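(* Let $V=\bigoplus_{n=0}^\infty V(n)$ with $V(0)=\mathbb{C}\mathbf 1$ be a quasi-primary generated, $C_2$-finite vertex operator algebra such that $V$ is a sum of highest weight modules for the Virasoro algebra. Let $\widetilde\Sigma=(\Sigma;Q_1,\ldots,Q_N;z_1,\ldots,z_N;W^1,\ldots,W^N)$ be a projective $N$-labeled Riemann surface. If all the $V$-modules $W^i$ $(1\le i\le N)$ are $B_1$-finite, then the conformal block $\mathcal V^\dagger(\widetilde\Sigma)$ is finite dimensional over $\mathbb C$.
   Context: Vertex operator algebras: $V$ is a vertex operator algebra over $\mathbb C$ with vacuum $\mathbf 1$, Virasoro element $\omega$, vertex operators $Y(a,x)=\sum_{n\in\mathbb Z}a(n)x^{-n-1}$, $L_n=\omega(n+1)$, graded by $L_0$: $V=\bigoplus_{n\ge0}V(n)$, $L_0|_{V(n)}=n\,\mathrm{id}$. For homogeneous $a\in V(n)$ write $|a|=n$. A vector $a\in V$ is quasi-primary if $L_1a=0$, and primary if $L_1a=L_2a=0$. $V$ is quasi-primary generated if $V=\sum_{k\ge0}L_{-1}^k\mathcal Q(V)$, where $\mathcal Q(V)$ is the space of quasi-primary vectors. Modules: a weak $V$-module is a vector space $W$ with a linear map $a\mapsto Y_W(a,x)=\sum_{n}a(n)x^{-n-1}\in(\mathrm{End}\,W)[[x,x^{-1}]]$ such that $Y_W(a,x)w\in W((x))$, $Y_W(\mathbf 1,x)=\mathrm{id}_W$, and the Borcherds (Jacobi) identity holds (no grading is assumed). A $V$-module is a weak $V$-module $W=\bigoplus_{\lambda\in\mathbb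 C}W(\lambda)$ with $L_0|_{W(\lambda)}=\lambda\,\mathrm{id}$, such that for each fixed $\lambda$, $W(\lambda-n)=0$ for all sufficiently large integers $n$. Finiteness: for a weak $V$-module $W$, $C_2(W)$ is the linear span of all $a(-2)w$ $(a\in V,w\in W)$, and $W$ is $C_2$-finite if $\dim W/C_2(W)<\infty$ ($V$ is $C_2$-finite if it is so as a module over itself). $B_1(W)$ is the linear span of all $a(-1)w$ with $a\in V$ homogeneous of weight $|a|>0$ and $w\in W$; $W$ is $B_1$-finite if $\dim W/B_1(W)<\infty$. Riemann surfaces: an $N$-labeled Riemann surface $\widetilde\Sigma=(\Sigma;Q_1,\ldots,Q_N;z_1,\ldots,z_N;W^1,\ldots,W^N)$ consists of a compact Riemann surface $\Sigma$, distinct points $Q_i\in\Sigma$, local coordinates $z_i$ around $Q_i$ with $z_i(Q_i)=0$, and $V$-modules $W^i$. A projective structure on $\Sigma$ is a system of local coordinates $\{(U_\alpha,z_\alpha)\}$ covering $\Sigma$ whose transition functions $z_\beta\circ z_\alpha^{-1}$ are Möbius transformations. $\widetilde\Sigma$ is projective if for some projective structure on $\Sigma$ each $z_i$ has the form $z_\alpha-z_\alpha(Q_i)$ for some $\alpha$ with $Q_i\in U_\alpha$. Let $\kappa$ be the canonical line bundle of $\Sigma$, and for $n\in\mathbb Z$ let $\Gamma(\Sigma;Q_1,\ldots,Q_N;\kappa^n)$ be the space of global meromorphic sections of $\kappa^n$ whose poles lie in $\{Q_1,\ldots,Q_N\}$. Conformal block: put $W_A=W^1\otimes\cdots\otimes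 W^N$. For homogeneous $a\in V(d)$ and $f\in\Gamma(\Sigma;Q_1,\ldots,Q_N;\kappa^{1-d})$, write $f=f(z_i)(dz_i)^{1-d}$ near $Q_i$, and let $f_i(t)=\sum_n c^{(i)}_nt^n\in\mathbb C((t))$ be the Laurent expansion of $f(z_i)$ at $z_i=0$ with $z_i$ replaced by $t$. Define $a(f,\widetilde\Sigma)\in\mathrm{End}(W_A)$ by $$a(f,\widetilde\Sigma)(w_1\otimes\cdots\otimes w_N)=\sum_{i=1}^N w_1\otimes\cdots\otimes\Big(\sum_n c^{(i)}_n a(n)w_i\Big)\otimes\cdots\otimes w_N .$$ Let $\mathcal G(\widetilde\Sigma)\subset\mathrm{End}(W_A)$ be the linear span of all $a(f,\widetilde\Sigma)$ with $a$ a homogeneous primary vector and $f\in\Gamma(\Sigma;Q_1,\ldots,Q_N;\kappa^{1-|a|})$, together with all $\omega(f,\widetilde\Sigma)$ with $f\in\Gamma(\Sigma;Q_1,\ldots,Q_N;\kappa^{-1})$. Let $\mathcal G(\widetilde\Sigma)W_A$ be the linear span of all $Tw$, $T\in\mathcal G(\widetilde\Sigma)$, $w\in W_A$. The conformal block is $\mathcal V^\dagger(\widetilde\Sigma)=\mathrm{Hom}_{\mathbb C}(W_A/\mathcal G(\widetilde\Sigma)W_A,\mathbb C)$. *)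

(* Defs.v *)
From HB Require Import structures.
From mathcomp Require Import all_boot all_order all_algebra.
From mathcomp Require Import complex zify.
From mathcomp Require Import all_classical all_reals all_analysis.

Set Implicit Arguments.
Unset Strict Implicit.
Unset Printing Implicit Defensive.

Import Order.TTheory GRing.Theory Num.Theory numFieldNormedType.Exports.
Local Open Scope classical_set_scope.
Local Open Scope ring_scope.

Section Span.
Variables (K : fieldType) (U : lmodType K).

Definition subspace (M : set U) : Prop :=
  M 0 /\ forall (k : K) (u v : U), M u -> M v -> M (k *: u + v).

Definition lspan (S : set U) : set U := smallest subspace S.

(* For a subspace M this says that M has finite dimension. *)
Definition fin_dim (M : set U) : Prop :=
  exists s : seq U, M `<=` lspan [set` s].

Lemma lspan_subspace (S : set U) : subspace (lspan S).
Proof.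
split=> [M [[]] //|k u v Su Sv M MS]; have [[_ MP] _] := MS.
by apply: MP; [exact: Su|exact: Sv].
Qed.

Lemma sub_lspan (S : set U) : S `<=` lspan S.
Proof. by move=> u Su M [_]; exact. Qed.

Definition lspan_mem (S : set U) : {pred U} := fun u => `[< lspan S u >].

Lemma lspan_mem_submod_closed (S : set U) : submod_closed (lspan_mem S).
Proof.
have [S0 SP] := lspan_subspace S.
split; first exact/asboolP.
by move=> k u v /asboolP Su /asboolP Sv; apply/asboolP; exact: SP.
Qed.

HB.instance Definition _ (S : set U) :=
  GRing.isSubmodClosed.Build K U (lspan_mem S) (lspan_mem_submod_closed S).

End Span.

(* [lquot S] is the quotient of U by the span of S, i.e. U / S when S is a
   subspace. The library quotient only has a zmodType structure, to which
   scaling is added here. *)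
Section Quotient.
Local Open Scope quotient_scope.
Variables (K : fieldType) (U : lmodType K) (S : set U).

Definition lquot : Type := @Quotient.quot U (lspan_mem S).

HB.instance Definition _ := GRing.Zmodule.on lquot.
HB.instance Definition _ := EqQuotient.on lquot.

Definition lclass (u : U) : lquot := \pi_lquot u.

Lemma lclassP (u v : U) : lclass u = lclass v <-> lspan S (u - v).
Proof.
split=> [/eqP|Suv]; first by rewrite -Quotient.idealrBE => /asboolP.
by apply/eqP; rewrite -Quotient.idealrBE; apply/asboolP.
Qed.

Lemma lclassD (u v : U) : lclass (u + v) = lclass u + lclass v.
Proof. by rewrite /lclass !piE. Qed.

Lemma lclass_repr (q : lquot) : lclass (repr q) = q.
Proof. exact: reprK. Qed.

Definition lquot_scale (k : K) (q : lquot) : lquot := lclass (k *: repr q).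

Lemma lclassZ (k : K) (u : U) : lclass (k *: u) = lquot_scale k (lclass u).
Proof.
apply/lclassP; rewrite -scalerBr.
have [S0 SP] := lspan_subspace S.
rewrite -[_ *: _]addr0; apply: SP => //.
by apply/lclassP; rewrite lclass_repr.
Qed.

Fact lquot_scaleA (k l : K) (q : lquot) :
  lquot_scale k (lquot_scale l q) = lquot_scale (k * l) q.
Proof. by rewrite -[q]lclass_repr -!lclassZ scalerA. Qed.

Fact lquot_scale1 : left_id 1 lquot_scale.
Proof. by move=> q; rewrite -[q]lclass_repr -lclassZ scale1r. Qed.

Fact lquot_scaleDr : right_distributive lquot_scale +%R.
Proof.
move=> k p q; rewrite -[p]lclass_repr -[q]lclass_repr -lclassD -!lclassZ.
by rewrite scalerDr lclassD.
Qed.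

Fact lquot_scaleDl (q : lquot) : {morph lquot_scale^~ q : k l / k + l}.
Proof.
by move=> k l; rewrite -[q]lclass_repr -!lclassZ scalerDl lclassD.
Qed.

HB.instance Definition _ := GRing.Zmodule_isLmodule.Build K lquot
  lquot_scaleA lquot_scale1 lquot_scaleDr lquot_scaleDl.

Lemma lclass_linear : linear lclass.
Proof. by move=> k u v; rewrite lclassD lclassZ. Qed.

End Quotient.

Section FreeModule.
Variables (K : fieldType) (X : choiceType).

Definition fin_supp : {pred X -> K^o} :=
  fun f => `[< finite_set [set x | f x != 0] >].

Lemma fin_supp_submod_closed : submod_closed fin_supp.
Proof.
split.
  apply/asboolP; rewrite (_ : [set _ | _] = set0) //.
  by apply/seteqP; split=> x //=; rewrite eqxx.
move=> k f g /asboolP fF /asboolP gF; apply/asboolP.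
have fgF : finite_set ([set x | f x != 0] `|` [set x | g x != 0]).
  by rewrite finite_setU.
apply: sub_finite_set fgF => x /= fgx.
apply/orP; apply: contraNT fgx; rewrite negb_or !negbK.
rewrite /GRing.add /= /GRing.scale /=.
by move=> /andP[/eqP -> /eqP ->]; rewrite scaler0 addr0.
Qed.

HB.instance Definition _ := GRing.isSubmodClosed.Build K (X -> K^o)
  fin_supp fin_supp_submod_closed.

Record free_mod := FreeMod {
  free_coef :> X -> K^o;
  free_coefP : fin_supp free_coef }.

HB.instance Definition _ := [isSub for free_coef].
HB.instance Definition _ := [Choice of free_mod by <:].
HB.instance Definition _ := [SubChoice_isSubLmodule of free_mod by <:].

End FreeModule.

(* [tensor W] is the tensor product of the family W: the free module on the
   families of vectors, modulo the multilinearity relations. *)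
Section Tensor.
Variables (K : fieldType) (I : finType) (W : I -> lmodType K).

Definition vecs : choiceType := (forall i, W i) : choiceType.

Definition multilinear (U : lmodType K) (m : vecs -> U) : Prop :=
  forall (w : vecs) (i : I) (k : K) (u v : W i),
    m (dfwith w i (k *: u + v)) = k *: m (dfwith w i u) + m (dfwith w i v).

Lemma free_delta_subproof (w : vecs) :
  ((fun w' => (w' == w)%:R) : vecs -> K^o) \in @fin_supp K vecs.
Proof.
apply/asboolP; apply: (@sub_finite_set _ _ [set w]) => [w' /=|].
  by have [//|_] := eqVneq w' w; rewrite eqxx.
exact: finite_set1.
Qed.

Definition free_delta (w : vecs) : free_mod K vecs :=
  FreeMod (free_delta_subproof w).

Definition tensor_rel : set (free_mod K vecs) :=
  [set r | exists (w : vecs) (i : I) (k : K) (u v : W i),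
    r = free_delta (dfwith w i (k *: u + v))
        - (k *: free_delta (dfwith w i u) + free_delta (dfwith w i v))].

Definition tensor : lmodType K := lquot tensor_rel.

Definition pure (w : vecs) : tensor := lclass tensor_rel (free_delta w).

Lemma pure_multilinear : multilinear pure.
Proof.
move=> w i k u v; rewrite /pure -lclass_linear.
by apply/lclassP; apply: sub_lspan; exists w, i, k, u, v.
Qed.

Section Lift.
Variables (U : lmodType K) (m : vecs -> U).

Definition free_lift (f : free_mod K vecs) : U :=
  \sum_(w \in [set: vecs]) f w *: m w.

(* the map tensor W -> U induced by m; linear when m is multilinear *)
Definition tensor_lift (t : tensor) : U := free_lift (repr t).

Lemma free_lift_linear : linear free_lift.
Proof.
move=> k f g; rewrite /free_lift.
pose A := [set w | f w != 0] `|` [set w | g w != 0].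
have fA : finite_set A.
  by rewrite finite_setU; split; apply/asboolP; exact: free_coefP.
have sumA (h : free_mod K vecs) : (forall w, ~ A w -> h w = 0) ->
    \sum_(w \in [set: vecs]) h w *: m w = \sum_(w \in A) h w *: m w.
  move=> hA; symmetry; apply: fsbig_widen => // w [_ /= Aw].
  by rewrite hA // scale0r.
have f0 w : ~ A w -> f w = 0.
  by move=> Aw; apply/eqP/negPn/negP => fw; apply: Aw; left.
have g0 w : ~ A w -> g w = 0.
  by move=> Aw; apply/eqP/negPn/negP => gw; apply: Aw; right.
have kfgE w : (k *: f + g) w = k * f w + g w by [].
rewrite !sumA //; last by move=> w Aw; rewrite kfgE f0 // g0 // mulr0 addr0.
rewrite !fsbig_finite // scaler_sumr -big_split /=.
by apply: eq_bigr => w _; rewrite -[LHS]/((k * f w + g w) *: m w)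
  scalerDl scalerA.
Qed.

Lemma free_lift_delta (w : vecs) : free_lift (free_delta w) = m w.
Proof.
rewrite /free_lift -(@fsbig_widen _ _ _ _ [set w]) //.
  by rewrite fsbig_set1 /= eqxx scale1r.
by move=> w' [_ /= /eqP w'w]; rewrite (negbTE w'w) scale0r.
Qed.

Hypothesis mP : multilinear m.

Lemma free_lift_eq (f g : free_mod K vecs) :
  lspan tensor_rel (f - g) -> free_lift f = free_lift g.
Proof.
have lift0 : free_lift 0 = 0.
  by rewrite -[X in free_lift X](scaler0 _ (-1)) -[X in free_lift X]addr0
    free_lift_linear scaleN1r addNr.
move=> fg; suff : free_lift (f - g) = 0.
  rewrite addrC -scaleN1r free_lift_linear scaleN1r => /eqP.
  by rewrite addrC subr_eq0 => /eqP.
apply: (fg [set h | free_lift h = 0]); split; first split=> //.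
  by move=> k u v /= u0 v0; rewrite free_lift_linear u0 v0 scaler0 addr0.
move=> _ /= [w [i [k [u [v ->]]]]].
rewrite addrC -scaleN1r !free_lift_linear !free_lift_delta scaleN1r.
by rewrite mP addNr.
Qed.

Lemma tensor_lift_pure (w : vecs) : tensor_lift (pure w) = m w.
Proof.
rewrite -free_lift_delta; apply: free_lift_eq.
by apply/lclassP; rewrite lclass_repr.
Qed.

Lemma tensor_lift_linear : linear tensor_lift.
Proof.
move=> k s t; rewrite /tensor_lift -free_lift_linear; apply: free_lift_eq.
by apply/lclassP; rewrite lclass_linear !lclass_repr.
Qed.

End Lift.
End Tensor.

(* Keeps the structures that are coerced to types explicit. *)
Set Strict Implicit.

Definition Cplx (R : realType) : numClosedFieldType := complex R.

Section VOA.
Variable R : realType.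
Local Notation C := (Cplx R).

Definition gbinom (p : int) (i : nat) : C :=
  (\prod_(j < i) (p - j%:Z)%:~R) / (i`!)%:R.

(* [Y a n w] is a(n)w. The sums over nat are sums over their supports, which
   are finite by [truncation]. *)
Record weak_module_axioms {V : lmodType C} (YV : V -> int -> V -> V) (vac : V)
    {W : lmodType C} (Y : V -> int -> W -> W) : Prop := WeakModuleAxioms {
  mode_linearl : forall n w, linear (fun a => Y a n w);
  mode_linearr : forall a n, linear (Y a n);
  truncation : forall a w, exists N : int, forall n, N <= n -> Y a n w = 0;
  mode_vacuum : forall n w, Y vac n w = if n == -1 then w else 0;
  borcherds : forall (a b : V) (p q r : int) (w : W),
    \sum_(i \in [set: nat])
      gbinom p i *: Y (YV a (r + i%:Z) b) (p + q - i%:Z) w =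
    \sum_(i \in [set: nat])
      ((-1) ^+ i * gbinom r i) *:
        (Y a (p + r - i%:Z) (Y b (q + i%:Z) w)
         - (-1) ^ r *: Y b (q + r - i%:Z) (Y a (p + i%:Z) w)) }.

Record voa := VOA {
  voa_space :> lmodType C;
  voa_Y : voa_space -> int -> voa_space -> voa_space;
  vacuum : voa_space;
  conformal : voa_space;
  central_charge : C;
  voa_adjoint : weak_module_axioms voa_Y vacuum voa_Y;
  voa_creation : forall a n, 0 <= n -> voa_Y a n vacuum = 0;
  voa_creation1 : forall a, voa_Y a (-1) vacuum = a;
  voa_virasoro : forall (m n : int) v,
    let L k := voa_Y conformal (k + 1) in
    L m (L n v) - L n (L m v) = (m - n)%:~R *: L (m + n) v
      + (if m + n == 0 then ((m ^+ 3 - m)%:~R / 12%:R * central_charge) *: v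
         else 0);
  voa_translation : forall a (n : int) v,
    voa_Y (voa_Y conformal 0 a) n v = (- n)%:~R *: voa_Y a (n - 1) v;
  voa_grading :
    lspan [set v | exists d : nat, voa_Y conformal 1 v = d%:R *: v] = setT;
  voa_fin_dim : forall d : nat,
    fin_dim [set v | voa_Y conformal 1 v = d%:R *: v] }.

Record weak_module (V : voa) := WeakModule {
  wm_space :> lmodType C;
  mode : V -> int -> wm_space -> wm_space;
  wm_axioms : weak_module_axioms (voa_Y V) (vacuum V) mode }.

Definition adjoint (V : voa) : weak_module V := @WeakModule V V (voa_Y V) (voa_adjoint V).

Definition vir (V : voa) (W : weak_module V) (n : int) : W -> W :=
  mode W (conformal V) (n + 1).

Definition weight_space (V : voa) (W : weak_module V) (l : C) : set W :=
  [set w | vir W 0 w = l *: w].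

Record voa_module (V : voa) := VOAModule {
  vm_weak :> weak_module V;
  vm_grading : lspan (\bigcup_(l in [set: C]) weight_space vm_weak l) = setT;
  vm_lower : forall l : C, exists n0 : int, forall n : int, n0 <= n ->
    weight_space vm_weak (l - n%:~R) = [set 0] }.

Definition homogeneous (V : voa) (d : nat) : set V :=
  weight_space (adjoint V) d%:R.

Definition quasi_primary (V : voa) : set V :=
  [set a | vir (adjoint V) 1 a = 0].

Definition primary (V : voa) : set V :=
  [set a | vir (adjoint V) 1 a = 0 /\ vir (adjoint V) 2 a = 0].

Definition quasi_primary_generated (V : voa) : Prop :=
  lspan [set v : V | exists (k : nat) (a : V),
    quasi_primary V a /\ v = iter k (vir (adjoint V) (-1)) a] = setT.

Definition vir_submodule (V : voa) (W : weak_module V) (M : set W) : Prop :=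
  subspace M /\ forall n w, M w -> M (vir W n w).

(* The central element of the Virasoro algebra acts by the scalar
   [central_charge V], so only the L_n matter. The zero module (w = 0) is
   allowed; it does not change sums of highest weight modules. *)
Definition highest_weight (V : voa) (W : weak_module V) (M : set W) : Prop :=
  exists (w : W) (h : C),
    [/\ forall n : int, 0 < n -> vir W n w = 0,
        vir W 0 w = h *: w
      & M = smallest (vir_submodule W) [set w]].

Definition sum_of_highest_weight (V : voa) : Prop :=
  exists F : set (set V),
    (forall M, F M -> highest_weight (adjoint V) M) /\
    lspan (\bigcup_(M in F) M) = setT.

Definition C2 (V : voa) (W : weak_module V) : set W :=
  lspan [set u | exists (a : V) (w : W), u = mode W a (-2) w].

Definition C2_finite (V : voa) (W : weak_module V) : Prop :=
  fin_dim [set: lquot (C2 W)].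

Definition B1 (V : voa) (W : weak_module V) : set W :=
  lspan [set u | exists (d : nat) (a : V) (w : W),
    [/\ (0 < d)%N, homogeneous V d a & u = mode W a (-1) w]].

Definition B1_finite (V : voa) (W : weak_module V) : Prop :=
  fin_dim [set: lquot (B1 W)].

(* The action of the Laurent series with coefficients c; the sum has finite
   support when c vanishes in low degrees. *)
Definition mode_series (V : voa) (W : weak_module V) (a : V) (c : int -> C)
    (w : W) : W :=
  \sum_(n \in [set: int]) c n *: mode W a n w.

Lemma mode_series_linear (V : voa) (W : weak_module V) (a : V) (c : int -> C) :
  (exists n0 : int, forall n, n < n0 -> c n = 0) -> linear (mode_series W a c).
Proof.
move=> [n0 c0] k u v.
have [Nu Nu0] := truncation (wm_axioms W) a u.
have [Nv Nv0] := truncation (wm_axioms W) a v.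
pose A := (fun m : nat => n0 + m%:Z) @` `I_(`|Num.max Nu Nv - n0|%N).
have fA : finite_set A by exact: finite_image.
have uv0 n : ~ A n -> c n = 0 \/ Nu <= n /\ Nv <= n.
  move=> An; have [/c0|n0n] := ltP n n0; [by left|right].
  apply/andP; rewrite -ge_max leNgt; apply/negP => nN.
  apply: An; exists `|n - n0|%N => /=; last by lia.
  by move: (Num.max Nu Nv) nN => M nM; lia.
have sumA w : (forall n, ~ A n -> c n *: mode W a n w = 0) ->
    mode_series W a c w = \sum_(n \in A) c n *: mode W a n w.
  by move=> wA; symmetry; apply: fsbig_widen => // n [_ /=]; exact: wA.
have u0 n : ~ A n -> c n *: mode W a n u = 0.
  by move=> /uv0[->|[/Nu0 -> _]]; rewrite ?scale0r ?scaler0.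
have v0 n : ~ A n -> c n *: mode W a n v = 0.
  by move=> /uv0[->|[_ /Nv0 ->]]; rewrite ?scale0r ?scaler0.
have kuvE n : c n *: mode W a n (k *: u + v) =
    k *: (c n *: mode W a n u) + c n *: mode W a n v.
  by rewrite (mode_linearr (wm_axioms W)) scalerDr !scalerA mulrC.
rewrite !sumA //; last by move=> n An; rewrite kuvE u0 // v0 // scaler0 addr0.
rewrite !fsbig_finite // scaler_sumr -big_split /=.
by apply: eq_bigr => n _; rewrite kuvE.
Qed.

End VOA.

Section RiemannSurface.
Variable R : realType.
Local Notation C := (Cplx R).

Definition holomorphic_at (f : C -> C) (z : C) : Prop :=
  derivable (f : C^o -> C^o) z 1.

Definition cderiv (f : C -> C) (z : C) : C := derive1 (f : C^o -> C^o) z.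

Definition laurent_expansion (c : int -> C) (f : C -> C) : Prop :=
  exists k : nat, (forall n : int, n < - k%:Z -> c n = 0) /\
    \forall t \near 0^',
      series (fun m : nat => c (m%:Z - k%:Z) * t ^ (m%:Z - k%:Z)) @ \oo --> f t.

Definition laurent_coef (f : C -> C) : int -> C :=
  xget (fun=> 0) [set c | laurent_expansion c f].

Lemma laurent_coef_lower (f : C -> C) :
  exists n0 : int, forall n, n < n0 -> laurent_coef f n = 0.
Proof.
rewrite /laurent_coef; case: xgetP => [c _ [k [c0 _]]|_]; last by exists 0.
by exists (- k%:Z).
Qed.

Definition meromorphic_at (f : C -> C) (z : C) : Prop :=
  exists c, laurent_expansion c (fun t => f (z + t)).

(* The values of [crd] outside [dom] are irrelevant. *)
Record coordinate (S : Type) := Coordinate {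
  dom : set S;
  crd :> S -> C }.

Definition chart {S : topologicalType} (x : coordinate S) : Prop :=
  [/\ open (dom x), {within dom x, continuous x}, set_inj (dom x) x
    & forall A, open A -> A `<=` dom x -> open (x @` A)].

(* [transition x y g]: g is y \o x^-1 on x (dom x `&` dom y). *)
Definition transition {S : Type} (x y : coordinate S) (g : C -> C) : Prop :=
  forall p, dom x p -> dom y p -> y p = g (x p).

Definition holomorphic_transition {S : Type} (x y : coordinate S) : Prop :=
  exists g, transition x y g /\
    forall p, dom x p -> dom y p -> holomorphic_at g (x p).

Definition mobius_transition {S : Type} (x y : coordinate S) : Prop :=
  exists a b c d : C, a * d - b * c != 0 /\
    forall p, dom x p -> dom y p ->
      c * x p + d != 0 /\ y p = (a * x p + b) / (c * x p + d).

Definition covering {S : Type} (A : set (coordinate S)) : Prop :=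
  forall p, exists2 x, A x & dom x p.

Record riemann_surface := RiemannSurface {
  rs_space :> topologicalType;
  rs_nonempty : [set: rs_space] !=set0;
  rs_hausdorff : hausdorff_space rs_space;
  rs_connected : connected [set: rs_space];
  atlas : set (coordinate rs_space);
  atlas_chart : forall x, atlas x -> chart x;
  atlas_cover : covering atlas;
  atlas_transition : forall x y, atlas x -> atlas y ->
    holomorphic_transition x y }.

Definition local_coordinate {S : riemann_surface} (x : coordinate S) : Prop :=
  chart x /\ forall y, atlas S y ->
    holomorphic_transition x y /\ holomorphic_transition y x.

Definition projective_structure {S : riemann_surface}
    (P : set (coordinate S)) : Prop :=
  [/\ forall x, P x -> local_coordinate x, covering P
    & forall x y, P x -> P y -> mobius_transition x y].

(* A section s of the n-th power of the canonical bundle is given by its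
   expressions s = (f x)(x) (dx)^n in all local coordinates x. The values of
   [f x] at the points of x (Q), where there may be a pole, are irrelevant. *)
Definition meromorphic_sections {S : riemann_surface} (Q : set S) (n : int) :
    set (coordinate S -> C -> C) :=
  [set f |
    [/\ forall x p, local_coordinate x -> dom x p -> ~ Q p ->
          holomorphic_at (f x) (x p),
        forall x p, local_coordinate x -> dom x p -> Q p ->
          meromorphic_at (f x) (x p)
      & forall x y g, local_coordinate x -> local_coordinate y ->
          transition x y g -> forall p, dom x p -> dom y p -> ~ Q p ->
          f x (x p) = cderiv g (x p) ^ n * f y (y p)]].

End RiemannSurface.

Section ConformalBlock.
Variables (R : realType) (V : voa R) (N : nat).
Local Notation C := (Cplx R).

Record labeled_surface := LabeledSurface {
  surface :> riemann_surface R;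
  surface_compact : compact [set: surface];
  point : 'I_N -> surface;
  point_inj : injective point;
  coord : 'I_N -> coordinate R surface;
  coord_local : forall i, local_coordinate (coord i);
  coord_dom : forall i, dom (coord i) (point i);
  coord_point : forall i, coord i (point i) = 0;
  label : 'I_N -> voa_module V }.

Definition projective (S : labeled_surface) : Prop :=
  exists P : set (coordinate R S), projective_structure P /\
    forall i, exists x, [/\ P x, dom x (point S i)
      & \forall p \near point S i, coord S i p = x p - x (point S i)].

Variable S : labeled_surface.

Definition label_space (i : 'I_N) : lmodType C := label S i.

Definition WA : lmodType C := tensor label_space.

Definition sections (n : int) : set (coordinate R S -> C -> C) :=
  meromorphic_sections (range (point S)) n.

Definition section_action (a : V) (f : coordinate R S -> C -> C)
    (w : vecs label_space) : WA :=
  \sum_(i < N)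
    pure (dfwith w i
      (mode_series (label S i) a (laurent_coef (f (coord S i))) (w i))).

Definition section_op (a : V) (f : coordinate R S -> C -> C) : WA -> WA :=
  tensor_lift (section_action a f).

Lemma section_action_multilinear (a : V) (f : coordinate R S -> C -> C) :
  multilinear (section_action a f).
Proof.
move=> w j k u v; rewrite /section_action scaler_sumr -big_split /=.
apply: eq_bigr => i _.
set c := laurent_coef _.
have Yl : linear (mode_series (label S i) a c).
  exact/mode_series_linear/laurent_coef_lower.
have [ij|ij] := eqVneq i j.
  subst j; have dd (x y : label_space i) :
      dfwith (dfwith w i x) i y = dfwith w i y.
    apply/functional_extensionality_dep => l; have [->|il] := eqVneq l i.
      by rewrite !dfwithin.
    by rewrite !dfwithout // eq_sym.
  by rewrite !dd !dfwithin Yl pure_multilinear.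
have ji : j != i by rewrite eq_sym.
have dd (x : label_space j) (y : label_space i) :
    dfwith (dfwith w j x) i y = dfwith (dfwith w i y) j x.
  apply/functional_extensionality_dep => l; have [->|li] := eqVneq l i.
    by rewrite dfwithin dfwithout // dfwithin.
  have [->|lj] := eqVneq l j; first by rewrite dfwithin dfwithout // dfwithin.
  by rewrite !dfwithout // eq_sym.
by rewrite !dd !(dfwithout _ _ ji) pure_multilinear.
Qed.

Lemma section_op_pure (a : V) (f : coordinate R S -> C -> C)
    (w : vecs label_space) :
  section_op a f (pure w) = section_action a f w.
Proof. exact/tensor_lift_pure/section_action_multilinear. Qed.

Definition GS : set (WA -> WA) :=
  lspan
    ([set T | exists (d : nat) (a : V) f,
        [/\ homogeneous V d a, primary V a, sections (1 - d%:Z) f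
          & T = section_op a f]]
     `|` [set T | exists2 f, sections (- 1) f
          & T = section_op (conformal V) f]).

Definition GWA : set WA :=
  lspan [set u | exists T w, GS T /\ u = T w].

Definition conformal_block : set (lquot GWA -> C^o) :=
  [set phi | linear phi].

End ConformalBlock.

Arguments GS {R V N} S T : rename.
Arguments GWA {R V N} S u : rename.
Arguments conformal_block {R V N} S phi : rename.

(* Main.v *)
(* Analysis. For every point Q_i and every d >= 1 there are, for all large n,
   sections of kappa^(1-d) with a pole of exact order n at Q_i and holomorphic
   elsewhere. For this one solves the Dirichlet problem outside a disc around Q
   by Perron's method and, with Schwarz's alternating method, finds harmonic
   functions with the singularity Re z^(-n), up to a constant. Their local
   holomorphic completions glue to a meromorphic function on the surface as
   soon as finitely many real linear conditions hold, so all but finitely many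
   pole orders at Q occur. If F has its only pole at Q and v runs over its
   critical values, then prod (F - v) / dF is a vector field holomorphic off Q,
   and multiplying its powers by meromorphic functions gives the sections.

   Algebra. Filter a B_1-finite module by the words a_1(-n_1)...a_k(-n_k)e, e in
   a finite set E, according to the sum of the weights of the a_i plus that of e.
   Modes commute modulo lower terms, and C_2-finiteness bounds the weights of the
   letters. Expanding (a_1(-1)...a_k)(-n), which is of lower order for large k,
   trades many letters with equal index for letters with a smaller one; hence
   long words lie in the span of the b(-n)w with n large, which thus has finite
   codimension. As V is a sum of highest weight modules, primary b and omega
   suffice. In the tensor product the sections above move such a leading term to
   terms of lower total weight, and an induction on this weight concludes. *)

From HB Require Import structures.
From mathcomp Require Import all_boot all_order all_algebra.
From mathcomp Require Import complex zify ring lra.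
From mathcomp Require Import all_classical all_reals all_analysis.
Require Import Defs.

Set Implicit Arguments.
Unset Strict Implicit.
Unset Printing Implicit Defensive.

Import Order.TTheory GRing.Theory Num.Theory numFieldNormedType.Exports.
Local Open Scope classical_set_scope.
Local Open Scope ring_scope.

(** * Complex numbers and derivatives *)

(** Weights of a module are complex, so no induction can run on them directly. Each weight l is
    paired with an integer m such that l - n is not a weight for n > m; modes shift l and m by the
    same integer, and a vector with m < 0 is zero, which starts the inductions. The total weight
    drops for a numerical reason. If a has weight d, then a(-n) raises the weight at Q_i by d + n -
    1, while the other modes of the operator are a(k) with k > -n at Q_i and k >= 0 at the other
    points, which raise it by at most d + n - 2 and d - 1. This is why the sections need an exact
    pole order n > 0 at one point and no pole elsewhere. How large n must be depends on a. This is
    harmless because C_2-finiteness bounds the weights of the letters before any bound on n is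
    chosen, so that only finitely many a have to be served. On the analytic side one functional, the
    mean over [0, 1], carries everything: composed with t -> e^(2 pi i t) it gives Cauchy and
    Poisson integrals, and composed with charts the mean value property. *)

Section ComplexPlane.
Variable R : realType.
Local Notation C := (Cplx R).
Implicit Types (z w : C) (x y : R).

Definition re z : R := complex.Re (z : complex R).
Definition im z : R := complex.Im (z : complex R).
Definition mkC x y : C := (Complex x y : complex R).
Definition rc x : C := mkC x 0.
(** Real-valued, unlike the norm of [Cplx R], whose values lie in [Cplx R] itself: estimates are
    left to linear arithmetic, which needs the total order of R. *)
Definition nm z : R := ComplexField.Normc.normc (z : complex R).
Definition imC : C := mkC 0 1.

Lemma re_mk x y : re (mkC x y) = x. Proof. by []. Qed.
Lemma im_mk x y : im (mkC x y) = y. Proof. by []. Qed.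
Lemma mkCE z : mkC (re z) (im z) = z. Proof. by case: z. Qed.
Lemma ceq z w : re z = re w -> im z = im w -> z = w.
Proof. by move=> rE iE; rewrite -(mkCE z) -(mkCE w) rE iE. Qed.
Lemma reD z w : re (z + w) = re z + re w. Proof. by case: z; case: w. Qed.
Lemma imD z w : im (z + w) = im z + im w. Proof. by case: z; case: w. Qed.
Lemma reN z : re (- z) = - re z. Proof. by case: z. Qed.
Lemma imN z : im (- z) = - im z. Proof. by case: z. Qed.
Lemma reB z w : re (z - w) = re z - re w. Proof. by rewrite reD reN. Qed.
Lemma imB z w : im (z - w) = im z - im w. Proof. by rewrite imD imN. Qed.
Lemma re0 : re 0 = 0. Proof. by []. Qed.
Lemma im0 : im 0 = 0. Proof. by []. Qed.
Lemma re1 : re 1 = 1. Proof. by []. Qed.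
Lemma im1 : im 1 = 0. Proof. by []. Qed.
Lemma reM z w : re (z * w) = re z * re w - im z * im w.
Proof. by case: z; case: w. Qed.
Lemma imM z w : im (z * w) = re z * im w + im z * re w.
Proof. by case: z; case: w. Qed.
Lemma re_rc x : re (rc x) = x. Proof. by []. Qed.
Lemma im_rc x : im (rc x) = 0. Proof. by []. Qed.
Definition reimE := (reD, imD, reN, imN, reM, imM, re_rc, im_rc, re_mk, im_mk,
  re0, im0, re1, im1).

Lemma rc0 : rc 0 = 0. Proof. by []. Qed.
Lemma rc1 : rc 1 = 1. Proof. by []. Qed.
Lemma rcD x y : rc (x + y) = rc x + rc y.
Proof. by apply: ceq; rewrite !reimE //=; ring. Qed.
Lemma rcM x y : rc (x * y) = rc x * rc y.
Proof. by apply: ceq; rewrite !reimE //=; ring. Qed.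
Lemma rcN x : rc (- x) = - rc x.
Proof. by apply: ceq; rewrite !reimE //= oppr0. Qed.
Lemma rcB x y : rc (x - y) = rc x - rc y. Proof. by rewrite rcD rcN. Qed.
Lemma rc_inj : injective rc. Proof. by move=> x y []. Qed.

HB.instance Definition _ := GRing.isZmodMorphism.Build R C rc rcB.
HB.instance Definition _ := GRing.isMonoidMorphism.Build R C rc (conj rc1 rcM).
HB.instance Definition _ := GRing.isZmodMorphism.Build C R re reB.
HB.instance Definition _ := GRing.isZmodMorphism.Build C R im imB.

Lemma re_rcM x z : re (rc x * z) = x * re z.
Proof. by rewrite !reimE mul0r subr0. Qed.
Lemma im_rcM x z : im (rc x * z) = x * im z.
Proof. by rewrite !reimE mul0r addr0. Qed.

Lemma normE z : `|z| = rc (nm z). Proof. by []. Qed.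
Lemma nm_def z : nm z = Num.sqrt (re z ^+ 2 + im z ^+ 2).
Proof. by case: z. Qed.
Lemma nm_ge0 z : 0 <= nm z. Proof. by rewrite nm_def sqrtr_ge0. Qed.
Lemma nm_sqr z : nm z ^+ 2 = re z ^+ 2 + im z ^+ 2.
Proof. by rewrite nm_def sqr_sqrtr // addr_ge0 ?sqr_ge0. Qed.
Lemma nm0 : nm 0 = 0. Proof. exact: ComplexField.Normc.normc0. Qed.
Lemma nm1 : nm 1 = 1. Proof. exact: ComplexField.Normc.normc1. Qed.
Lemma nmM z w : nm (z * w) = nm z * nm w.
Proof. exact: ComplexField.Normc.normcM. Qed.
Lemma nmV z : nm z^-1 = (nm z)^-1.
Proof. exact: ComplexField.Normc.normcV. Qed.
Lemma nmX z n : nm (z ^+ n) = nm z ^+ n.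
Proof. by elim: n => [|n IHn]; rewrite ?expr0 ?nm1 // !exprS nmM IHn. Qed.
Lemma nm_div z w : nm (z / w) = nm z / nm w. Proof. by rewrite nmM nmV. Qed.
Lemma nm_eq0 z : (nm z == 0) = (z == 0).
Proof.
apply/eqP/eqP => [|->]; last exact: nm0.
exact: ComplexField.Normc.eq0_normc.
Qed.
Lemma nm_gt0 z : (0 < nm z) = (z != 0).
Proof. by rewrite lt_def nm_ge0 andbT nm_eq0. Qed.
Lemma nmD z w : nm (z + w) <= nm z + nm w. Proof. exact: le_normcD. Qed.
Lemma nmN z : nm (- z) = nm z. Proof. by rewrite -mulN1r nmM !nm_def /= sqrrN expr1n
  oppr0 expr0n addr0 sqrtr1 mul1r. Qed.
Lemma nmB z w : nm (z - w) <= nm z + nm w.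
Proof. by rewrite -(nmN w) nmD. Qed.
Lemma nmC z w : nm (z - w) = nm (w - z). Proof. by rewrite -nmN opprB. Qed.
Lemma nm_rc x : nm (rc x) = `|x|.
Proof. by rewrite nm_def /= expr0n addr0 sqrtr_sqr. Qed.
Lemma nm_tri (u z w : C) : nm (z - w) <= nm (z - u) + nm (u - w).
Proof. by have := nmD (z - u) (u - w); rewrite addrA subrK. Qed.
Lemma nm_triB z w : nm z - nm w <= nm (z - w).
Proof. by rewrite lerBlDr; have := nmD (z - w) w; rewrite subrK. Qed.
Lemma le_re z : `|re z| <= nm z.
Proof.
rewrite nm_def -sqrtr_sqr ler_sqrt ?lerDl ?sqr_ge0 //.
by rewrite addr_ge0 ?sqr_ge0.
Qed.
Lemma le_im z : `|im z| <= nm z.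
Proof.
rewrite nm_def -sqrtr_sqr ler_sqrt ?lerDr ?sqr_ge0 //.
by rewrite addr_ge0 ?sqr_ge0.
Qed.
Lemma nm_reim z : nm z <= `|re z| + `|im z|.
Proof.
have {1}-> : z = rc (re z) + imC * rc (im z).
  by apply: ceq; rewrite !reimE; ring.
apply: le_trans (nmD _ _) _.
by rewrite nmM !nm_rc {1}/imC nm_def /= expr0n expr1n add0r sqrtr1 mul1r.
Qed.
Lemma nm_sum (I : Type) (r : seq I) (P : pred I) (F : I -> C) :
  nm (\sum_(i <- r | P i) F i) <= \sum_(i <- r | P i) nm (F i).
Proof.
elim/big_ind2 : _ => [|a b c d ab cd|//]; first by rewrite nm0.
by apply: le_trans (nmD _ _) _; exact: lerD.
Qed.

Lemma nearC (z : C) (P : set C) :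
  (\forall w \near z, P w) <->
  exists2 d : R, 0 < d & forall w, nm (w - z) < d -> P w.
Proof.
split=> [/nbhs_ballP[e /= e0 eP]|[d d0 dP]].
  move: e0; rewrite ltcE => /andP[/eqP ime ree].
  exists (re e) => // w wz; apply: eP; rewrite -ball_normE /=.
  by rewrite normE nmC ltcE /= wz ime eqxx.
apply/nbhs_ballP; exists (rc d) => /=; first by rewrite ltcE /= eqxx.
move=> w; rewrite -ball_normE /= normE nmC ltcE /= eqxx /=; exact: dP.
Qed.

(** The complex derivative without division and with a non-strict bound, so that w = z is no
    exception. *)
Definition cdiff (f : C -> C) (z d : C) := forall e : R, 0 < e ->
  exists2 k : R, 0 < k & forall w, nm (w - z) < k ->
    nm (f w - f z - d * (w - z)) <= e * nm (w - z).

Lemma dnearC (z : C) (P : set C) :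
  (\forall w \near z^', P w) <->
  exists2 d : R, 0 < d & forall w, w != z -> nm (w - z) < d -> P w.
Proof.
rewrite -[X in X <-> _]/(\forall w \near z, w != z -> P w) nearC.
by split=> -[d d0 dP]; exists d => // w; [move=> wz /dP|move=> /dP + wz]; exact.
Qed.

Lemma cdiffP (f : C -> C) (z d : C) :
  is_derive (z : C^o) 1 (f : C^o -> C^o) d <-> cdiff f z d.
Proof.
pose q := fun h : C => h^-1 *: (((f : C^o -> C^o) \o shift z) (h *: 1) - f z).
have qE h : q h = h^-1 * (f (h + z) - f z) by rewrite /q /= /GRing.scale /= mulr1.
have qdE h : h != 0 -> f (h + z) - f z - d * h = - (h * (d - q h)).
  by move=> h0; rewrite qE mulrBr mulVKf // opprB (mulrC h).
have qP : (q @ 0^' --> (d : C^o)) <-> cdiff f z d.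
  split=> [/cvgrPdist_le qd e e0|fz].
    have /qd /dnearC[k k0 kP] : 0 < rc e by rewrite ltcE /= eqxx.
    exists k => // w wk; have [->|wz] := eqVneq w z.
      by rewrite !subrr mulr0 subrr nm0 mulr0.
    have h0 : w - z != 0 by rewrite subr_eq0.
    have := kP (w - z) h0; rewrite subr0 => /(_ wk).
    rewrite normE lecE /= eqxx /= => qe.
    have := qdE _ h0; rewrite subrK => ->.
    by rewrite nmN nmM mulrC ler_wpM2r ?nm_ge0.
  apply/cvgrPdist_le => e; rewrite ltcE /= => /andP[/eqP ime ree].
  have [k k0 kP] := fz _ ree; apply/dnearC; exists k => // h h0.
  rewrite subr0 => hk; have := kP (h + z); rewrite addrK => /(_ hk).
  rewrite qdE // nmN nmM mulrC ler_pM2r ?nm_gt0 // => qe.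
  by rewrite normE lecE /= ime eqxx.
split=> [[fz fd]|/qP qd].
  apply/qP; rewrite -fd; exact: fz.
have ql : lim (q @ 0^') = d by exact: (cvg_lim (@norm_hausdorff _ _) qd).
by split; [apply/cvg_ex; exists d|].
Qed.

Lemma holomorphic_atP (f : C -> C) (z : C) :
  holomorphic_at f z <-> cdiff f z (cderiv f z).
Proof.
rewrite /cderiv derive1E -cdiffP; split=> [fz|[]//].
by split.
Qed.

Lemma cdiff_cderiv (f : C -> C) (z d : C) : cdiff f z d -> cderiv f z = d.
Proof. by move=> /cdiffP[_ <-]; rewrite /cderiv derive1E. Qed.

Lemma cdiff_holomorphic (f : C -> C) (z d : C) :
  cdiff f z d -> holomorphic_at f z.
Proof. by move=> /cdiffP[]. Qed.

Lemma cdiff_near (f g : C -> C) (z d : C) (k : R) : 0 < k ->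
  (forall w, nm (w - z) < k -> f w = g w) -> cdiff f z d -> cdiff g z d.
Proof.
move=> k0 fg fz e e0; have [l l0 lP] := fz _ e0.
exists (Num.min k l); first by rewrite lt_min k0.
move=> w; rewrite lt_min => /andP[wk wl].
by rewrite -!fg ?subrr ?nm0 //; exact: lP.
Qed.

Lemma cdiff_cst (a z : C) : cdiff (fun=> a) z 0.
Proof.
move=> e e0; exists 1 => // w _.
by rewrite subrr mul0r subrr nm0 mulr_ge0 ?nm_ge0 // ltW.
Qed.

Lemma cdiff_id (z : C) : cdiff (fun w => w) z 1.
Proof.
move=> e e0; exists 1 => // w _.
by rewrite mul1r subrr nm0 mulr_ge0 ?nm_ge0 // ltW.
Qed.

Lemma cdiff_continuous (f : C -> C) (z d : C) : cdiff f z d ->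
  forall e, 0 < e -> exists2 k : R, 0 < k &
    forall w, nm (w - z) < k -> nm (f w - f z) < e.
Proof.
move=> fz e e0; have [k k0 kP] := fz 1 ltr01.
have L0 : 0 < 1 + nm d by rewrite ltr_pwDl ?nm_ge0.
exists (Num.min k (e / (1 + nm d))).
  by rewrite lt_min k0 divr_gt0.
move=> w; rewrite lt_min => /andP[wk we].
have -> : f w - f z = (f w - f z - d * (w - z)) + d * (w - z).
  by rewrite subrK.
apply: le_lt_trans (nmD _ _) _; rewrite nmM.
apply: (@le_lt_trans _ _ ((1 + nm d) * nm (w - z))).
  by rewrite mulrDl lerD2r kP.
by rewrite mulrC -ltr_pdivlMr.
Qed.

Lemma cdiffD (f g : C -> C) (z a b : C) :
  cdiff f z a -> cdiff g z b -> cdiff (fun w => f w + g w) z (a + b).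
Proof. by move=> /cdiffP fa /cdiffP gb; apply/cdiffP; exact: is_deriveD. Qed.

Lemma cdiffM (f g : C -> C) (z a b : C) : cdiff f z a -> cdiff g z b ->
  cdiff (fun w => f w * g w) z (a * g z + f z * b).
Proof.
move=> /cdiffP fa /cdiffP gb; apply/cdiffP.
have -> : a * g z + f z * b = f z *: (b : C^o) + g z *: (a : C^o).
  by rewrite /GRing.scale /= addrC (mulrC a).
exact: is_deriveM.
Qed.

Lemma cdiffZ (f : C -> C) (k z a : C) :
  cdiff f z a -> cdiff (fun w => k * f w) z (k * a).
Proof.
by move=> fa; have := cdiffM (cdiff_cst k z) fa; rewrite mul0r add0r.
Qed.

Lemma cdiffN (f : C -> C) (z a : C) :
  cdiff f z a -> cdiff (fun w => - f w) z (- a).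
Proof. by move=> /cdiffP fa; apply/cdiffP; exact: is_deriveN. Qed.

Lemma cdiffX (f : C -> C) (z a : C) n : cdiff f z a ->
  cdiff (fun w => f w ^+ n) z (n%:R * f z ^+ n.-1 * a).
Proof.
move=> fa; elim: n => [|n IHn]; first by rewrite !mul0r; exact: cdiff_cst.
have := cdiffM fa IHn; rewrite -[X in _ -> cdiff _ _ X]/(n.+1%:R * f z ^+ n * a).
have -> : a * f z ^+ n + f z * (n%:R * f z ^+ n.-1 * a) = n.+1%:R * f z ^+ n * a.
  case: n {IHn} => [|n] /=; first by rewrite expr0; ring.
  by rewrite exprS -[n.+2%:R]natr1 ; ring.
by congr (cdiff _ _ _); apply/funext => w; rewrite exprS.
Qed.

Lemma cdiff_comp (f g : C -> C) (z a b : C) :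
  cdiff g z a -> cdiff f (g z) b -> cdiff (fun w => f (g w)) z (b * a).
Proof.
move=> ga fb e e0.
(* [1 + nm a] is a Lipschitz constant of g near z. Half of e pays for the error of f along g, the
   other half for b times the error of g. *)
have L0 : 0 < 1 + nm a by rewrite ltr_pwDl ?nm_ge0.
have B0 : 0 < 2 * (1 + nm b) by rewrite mulr_gt0 // ltr_pwDl ?nm_ge0.
have [k k0 kP] := fb _ (divr_gt0 e0 (mulr_gt0 (ltr0n _ 2) L0)).
have [l l0 lP] := cdiff_continuous ga k0.
have [m m0 mP] := ga _ ltr01.
have [p p0 pP] := ga _ (divr_gt0 e0 B0).
exists (Num.min l (Num.min m p)); first by rewrite !lt_min l0 m0.
move=> w; rewrite !lt_min => /and3P[wl wm wp].
have -> : f (g w) - f (g z) - b * a * (w - z) =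
    (f (g w) - f (g z) - b * (g w - g z)) + b * (g w - g z - a * (w - z)).
  by ring.
have gLip : nm (g w - g z) <= (1 + nm a) * nm (w - z).
  have -> : g w - g z = (g w - g z - a * (w - z)) + a * (w - z) by rewrite subrK.
  by apply: le_trans (nmD _ _) _; rewrite nmM mulrDl lerD2r mP.
apply: le_trans (nmD _ _) _; rewrite (splitr e) mulrDl lerD //.
  apply: le_trans (kP _ (lP _ wl)) _.
  apply: le_trans (ler_wpM2l _ gLip) _.
    by rewrite divr_ge0 ?mulr_ge0 ?ltW // ltr0n.
  by rewrite mulrA ler_wpM2r ?nm_ge0 // invfM mulrA mulfVK // gt_eqF.
rewrite nmM; apply: le_trans (ler_wpM2l (nm_ge0 _) (pP _ wp)) _.
rewrite mulrA ler_wpM2r ?nm_ge0 // invfM.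
rewrite (_ : _ * _ = e / 2 * (nm b / (1 + nm b))); last by ring.
rewrite ler_piMr ?divr_ge0 ?ltW // ltr_pdivrMr ?ltr_pwDl ?nm_ge0 //.
by rewrite mul1r ltrDr.
Qed.

Lemma cdiff_inv (z : C) : z != 0 -> cdiff (fun w => w^-1) z (- z ^- 2).
Proof.
move=> z0 e e0; have nz : 0 < nm z by rewrite nm_gt0.
(* The remainder is exactly (w - z)^2 / (z^2 w), and the first bound keeps the modulus of w above
   [nm z / 2]. *)
exists (Num.min (nm z / 2) (e * nm z ^+ 3 / 2)).
  by rewrite lt_min !divr_gt0 // mulr_gt0 // exprn_gt0.
move=> w; rewrite lt_min => /andP[wz we].
have nw : nm z / 2 <= nm w by have := nm_triB z w; rewrite nmC; lra.
have w0 : w != 0 by rewrite -nm_gt0; lra.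
have -> : w^-1 - z^-1 - - z ^- 2 * (w - z) = (w - z) ^+ 2 / (z ^+ 2 * w).
  by field; rewrite z0 w0.
rewrite nm_div nmX nmM nmX expr2 -mulrA mulrC ler_wpM2r ?nm_ge0 //.
have nw0 : 0 < nm w by lra.
rewrite ler_pdivrMr ?mulr_gt0 ?exprn_gt0 //; apply: le_trans (ltW we) _.
have -> : e * nm z ^+ 3 / 2 = (e * nm z ^+ 2) * (nm z / 2) by ring.
by rewrite [leRHS]mulrA ler_wpM2l // mulr_ge0 ?exprn_ge0 ?nm_ge0 // ltW.
Qed.

Lemma cdiffV (f : C -> C) (z a : C) : f z != 0 -> cdiff f z a ->
  cdiff (fun w => (f w)^-1) z (- (f z) ^- 2 * a).
Proof. by move=> fz0 fa; apply: cdiff_comp fa (cdiff_inv fz0). Qed.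

End ComplexPlane.

(** * Means of real functions on the unit interval *)

Section Mean.
Variable R : realType.
Local Notation C := (Cplx R).
Implicit Types (f g : R -> R) (x y e : R).

Definition ucont f := forall e, 0 < e -> exists2 d : R, 0 < d &
  forall x y, 0 <= x <= 1 -> 0 <= y <= 1 -> `|y - x| < d -> `|f y - f x| <= e.

(** A left Riemann sum. With 2^n intervals, bisecting [0, 1] expresses level n + 1 by level n of the
    two halves ([dyadic_sumS]), so that estimates become inductions on n. *)
Definition dyadic_sum (n : nat) f : R :=
  (2 ^- n) * \sum_(0 <= j < 2 ^ n) f (j%:R * 2 ^- n).

Definition mean f : R := lim (dyadic_sum ^~ f @ \oo).

Lemma dyadic_sum0 f : dyadic_sum 0 f = f 0.
Proof. by rewrite /dyadic_sum expr0 invr1 mul1r big_nat1 mul0r. Qed.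

Lemma dyadic_sumS n f : dyadic_sum n.+1 f =
  (dyadic_sum n (fun t => f (t / 2)) + dyadic_sum n (fun t => f ((t + 1) / 2))) / 2.
Proof.
rewrite /dyadic_sum -mulrDr expnS mul2n -addnn.
rewrite (@big_cat_nat _ _ _ (2 ^ n)) ?leq_addr //=.
rewrite -{2}(add0n (2 ^ n)%N) big_addn addnK.
have E : (2 ^- n.+1 : R) = 2 ^- n / 2 by rewrite exprSr invfM.
rewrite E [RHS]mulrAC; congr (_ * _ * (_ + _)); apply: eq_bigr => j _.
  by rewrite mulrA.
congr f; rewrite natrD mulrDl natrX mulrA mulrDl.
by rewrite (mulrA (2 ^+ n)) mulfV ?expf_neq0 // mul1r.
Qed.

Lemma dyadic_sum_le n f g : (forall x, 0 <= x <= 1 -> f x <= g x) ->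
  dyadic_sum n f <= dyadic_sum n g.
Proof.
elim: n f g => [|n IHn] f g fg; first by rewrite !dyadic_sum0 fg ?lexx ?ler01.
rewrite !dyadic_sumS ler_pM2r ?invr_gt0 // lerD // IHn // => x x01; apply: fg; lra.
Qed.

Lemma dyadic_sum_cst n (c : R) : dyadic_sum n (fun=> c) = c.
Proof.
elim: n => [|n IHn]; first by rewrite dyadic_sum0.
by rewrite dyadic_sumS IHn; lra.
Qed.

(** On each of the 2^n intervals the finer sum averages values that differ from the one at the left
    end by at most e. Bisection reduces this to n = 0, where an average of f is compared with
    [f 0]. *)
Lemma dyadic_sum_near n m f e :
  (forall x y, 0 <= x <= 1 -> 0 <= y <= 1 -> `|y - x| <= 2 ^- n ->
     `|f y - f x| <= e) ->
  `|dyadic_sum (n + m) f - dyadic_sum n f| <= e.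
Proof.
elim: n f => [|n IHn] f fe.
  rewrite add0n dyadic_sum0 ler_distl.
  have fx x : 0 <= x <= 1 -> `|f x - f 0| <= e.
    move=> x01; apply: fe; rewrite ?lexx ?ler01 // expr0 invr1 subr0.
    by rewrite ger0_norm; lra.
  rewrite -[X in X <= _ <= _](dyadic_sum_cst m) -[X in _ <= _ <= X](dyadic_sum_cst m).
  by rewrite !dyadic_sum_le // => x /fx; rewrite ler_distl => /andP[].
rewrite addSn !dyadic_sumS -mulrBl normrM [`|2^-1|]gtr0_norm ?invr_gt0 //.
rewrite ler_pdivrMr // opprD addrACA (_ : e * 2 = e + e); last by ring.
apply: le_trans (ler_normD _ _) _.
apply: lerD; apply: IHn => x y x01 y01 xy; apply: fe; try lra.
  rewrite -mulrBl normrM [`|2^-1|]gtr0_norm ?invr_gt0 // exprSr invfM.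
  by rewrite ler_pM2r ?invr_gt0.
rewrite -mulrBl opprD addrACA subrr addr0 normrM [`|2^-1|]gtr0_norm ?invr_gt0 //.
by rewrite exprSr invfM ler_pM2r ?invr_gt0.
Qed.

Lemma exists_half_pow e : 0 < e -> exists n : nat, 2 ^- n < e.
Proof.
move=> e0; have /cvgrPdist_lt/(_ e e0)[n _ /(_ n (leqnn n))] :
    (fun n : nat => (2^-1 : R) ^+ n) @ \oo --> 0.
  by apply: cvg_expr; rewrite ger0_norm ?invr_ge0 // invf_lt1 // ltr1n.
by rewrite /= sub0r normrN ger0_norm ?exprn_ge0 ?invr_ge0 // exprVn; exists n.
Qed.

Lemma cauchy_cvgn (u : nat -> R) :
  (forall e, 0 < e -> exists n, forall m, (n <= m)%N -> `|u m - u n| <= e) ->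
  cvgn u.
Proof.
move=> uC; apply/cauchy_cvgP/cauchy_exP => e e0.
have [n nP] := uC (e / 2) ltac:(exact: divr_gt0).
exists (u n); exists n => // m /nP; rewrite /ball /= distrC => mn.
by apply: le_lt_trans mn _; rewrite ltr_pdivrMr // ltr_pMr // ltr1n.
Qed.

Lemma mean_cvg f : ucont f -> dyadic_sum ^~ f @ \oo --> mean f.
Proof.
move=> fu; apply: cauchy_cvgn => e e0.
have [d d0 dP] := fu _ e0; have [n nd] := exists_half_pow d0.
exists n => m nm; rewrite -(subnKC nm); apply: dyadic_sum_near => x y x01 y01 xy.
by apply: dP => //; exact: le_lt_trans nd.
Qed.

Lemma mean_eq f a : dyadic_sum ^~ f @ \oo --> a -> mean f = a.
Proof. exact: cvg_lim. Qed.

Lemma mean_cst (c : R) : mean (fun=> c) = c.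
Proof.
apply: mean_eq; rewrite (_ : dyadic_sum ^~ _ = fun=> c); first exact: cvg_cst.
by apply/funext => n; rewrite dyadic_sum_cst.
Qed.

Lemma mean_ext f g : (forall x, 0 <= x <= 1 -> f x = g x) -> mean f = mean g.
Proof.
move=> fg; rewrite /mean (_ : dyadic_sum ^~ f = dyadic_sum ^~ g) //.
by apply/funext => n; apply/le_anti; rewrite !dyadic_sum_le // => x /fg ->.
Qed.

Lemma ucontD f g : ucont f -> ucont g -> ucont (fun x => f x + g x).
Proof.
move=> fu gu e e0; have e20 : 0 < e / 2 by exact: divr_gt0.
have [d d0 dP] := fu _ e20; have [k k0 kP] := gu _ e20.
exists (Num.min d k); first by rewrite lt_min d0.
move=> x y x01 y01; rewrite lt_min => /andP[xd xk].
rewrite opprD addrACA (splitr e); apply: le_trans (ler_normD _ _) _.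
by apply: lerD; [exact: dP|exact: kP].
Qed.

Lemma ucontZ f (c : R) : ucont f -> ucont (fun x => c * f x).
Proof.
move=> fu e e0; have c0 : 0 < 1 + `|c| by rewrite ltr_pwDl.
have [d d0 dP] := fu _ (divr_gt0 e0 c0).
exists d => // x y x01 y01 xy; rewrite -mulrBr normrM.
apply: le_trans (ler_wpM2l (normr_ge0 c) (dP _ _ x01 y01 xy)) _.
by rewrite mulrCA ler_piMr ?ltW // ltr_pdivrMr // mul1r ltrDr.
Qed.

Lemma meanD f g : ucont f -> ucont g ->
  mean (fun x => f x + g x) = mean f + mean g.
Proof.
move=> fu gu; apply: mean_eq.
rewrite (_ : dyadic_sum ^~ _ = fun n => dyadic_sum n f + dyadic_sum n g).
  by apply: cvgD; exact: mean_cvg.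
by apply/funext => n; rewrite /dyadic_sum big_split mulrDr.
Qed.

Lemma meanZ f (c : R) : ucont f -> mean (fun x => c * f x) = c * mean f.
Proof.
move=> fu; apply: mean_eq.
rewrite (_ : dyadic_sum ^~ _ = fun n => c * dyadic_sum n f).
  by apply: cvgMr; exact: mean_cvg.
by apply/funext => n; rewrite /dyadic_sum -mulr_sumr mulrCA.
Qed.

Lemma mean_le f g : ucont f -> ucont g ->
  (forall x, 0 <= x <= 1 -> f x <= g x) -> mean f <= mean g.
Proof.
move=> /mean_cvg fu /mean_cvg gu fg; apply: ler_cvg_to fu gu _.
by apply: nearW => n; exact: dyadic_sum_le.
Qed.

Lemma ucont_half0 f : ucont f -> ucont (fun t => f (t / 2)).
Proof.
move=> fu e e0; have [d d0 dP] := fu _ e0; exists d => // x y x01 y01 xy.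
apply: dP; try lra.
rewrite -mulrBl normrM [`|2^-1|]gtr0_norm ?invr_gt0 //.
by have := normr_ge0 (y - x); lra.
Qed.

Lemma ucont_half1 f : ucont f -> ucont (fun t => f ((t + 1) / 2)).
Proof.
move=> fu e e0; have [d d0 dP] := fu _ e0; exists d => // x y x01 y01 xy.
apply: dP; try lra.
rewrite -mulrBl opprD addrACA subrr addr0 normrM [`|2^-1|]gtr0_norm ?invr_gt0 //.
by have := normr_ge0 (y - x); lra.
Qed.

Lemma mean_half f : ucont f -> mean f =
  (mean (fun t => f (t / 2)) + mean (fun t => f ((t + 1) / 2))) / 2.
Proof.
move=> fu; apply: mean_eq; rewrite -cvg_shiftS /=.
rewrite (_ : (fun n : nat => dyadic_sum n.+1 f) = fun n => (dyadic_sum n (fun t => f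
  (t / 2))
  + dyadic_sum n (fun t => f ((t + 1) / 2))) / 2); last first.
  by apply/funext => n; rewrite dyadic_sumS.
apply: cvgMl; apply: cvgD; apply: mean_cvg; [exact: ucont_half0|].
exact: ucont_half1.
Qed.

Lemma mean_near f e a : ucont f -> (forall x, 0 <= x <= 1 -> `|f x - a| <= e) ->
  `|mean f - a| <= e.
Proof.
have ucst (b : R) : ucont (fun=> b).
  by move=> k k0; exists 1 => // x y _ _ _; rewrite subrr normr0 ltW.
move=> fu fa; rewrite ler_distl -(mean_cst (a - e)) -(mean_cst (a + e)).
by apply/andP; split; apply: mean_le => // x /fa; rewrite ler_distl => /andP[].
Qed.

(** The sums use left end points, so reflection does not match them term by term. Instead [0, 1] is
    bisected until f varies by at most e on each piece, where both means are within e of each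
    other. *)
Lemma mean_rev f : ucont f -> mean (fun t => f (1 - t)) = mean f.
Proof.
move=> fu.
have ru g : ucont g -> ucont (fun t => g (1 - t)).
  move=> gu e e0; have [d d0 dP] := gu _ e0; exists d => // x y x01 y01 xy.
  apply: dP; try lra.
  by rewrite (_ : 1 - y - (1 - x) = - (y - x)) ?normrN //; ring.
apply/eqP; rewrite -subr_eq0 -normr_eq0 eq_le normr_ge0 andbT.
apply/ler_addgt0Pr => e e0; rewrite add0r.
have [d d0 dP] := fu _ e0; have [n nd] := exists_half_pow d0.
have : forall x y, 0 <= x <= 1 -> 0 <= y <= 1 -> `|y - x| <= 2 ^- n ->
     `|f y - f x| <= e.
  by move=> x y x01 y01 xy; apply: dP => //; exact: le_lt_trans nd.
elim: n f fu {d0 dP nd} => [|n IHn] f fu fe.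
  suff : `|mean (fun t => f (1 - t) - f t) - 0| <= e.
    rewrite subr0 (_ : mean _ = mean (fun t => f (1 - t)) - mean f) //.
    rewrite (meanD (ru _ fu) (_ : ucont (fun t => - f t))); last first.
      by move: (ucontZ (-1) fu); congr ucont; apply/funext => t; rewrite mulN1r.
    congr (_ + _); rewrite -mulN1r -meanZ //; apply: mean_ext => t _.
    by rewrite mulN1r.
  apply: mean_near.
    apply: ucontD; first exact: ru.
    by move: (ucontZ (-1) fu); congr ucont; apply/funext => t; rewrite mulN1r.
  move=> x x01; rewrite subr0; apply: fe; rewrite ?expr0 ?invr1 ?ler_norml; lra.
have u0 := ucont_half0 fu; have u1 := ucont_half1 fu.
rewrite (mean_half fu) (mean_half (ru _ fu)).
rewrite (_ : mean (fun t => f (1 - t / 2)) = mean (fun t => f (((1 - t) + 1) / 2)));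
  last first.
  by apply: mean_ext => t _; congr f; lra.
rewrite (_ : mean (fun t => f (1 - (t + 1) / 2)) = mean (fun t => f ((1 - t) / 2)));
  last first.
  by apply: mean_ext => t _; congr f; lra.
have h0 := IHn _ u0 _; have h1 := IHn _ u1 _.
rewrite -mulrBl normrM [`|2^-1|]gtr0_norm ?invr_gt0 // ler_pdivrMr //.
rewrite (_ : e * 2 = e + e); last by ring.
rewrite (addrC (mean _) (mean _)) opprD addrACA addrC; apply: le_trans (ler_normD _
  _) _; apply: lerD.
  apply: h1 => x y x01 y01 xy; apply: fe; try lra.
  rewrite -mulrBl opprD addrACA subrr addr0 normrM [`|2^-1|]gtr0_norm ?invr_gt0 //.
  by rewrite exprSr invfM ler_pM2r ?invr_gt0.
apply: h0 => x y x01 y01 xy; apply: fe; try lra.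
rewrite -mulrBl normrM [`|2^-1|]gtr0_norm ?invr_gt0 // exprSr invfM.
by rewrite ler_pM2r ?invr_gt0.
Qed.

(** Bisection towards [t0] until f is bounded by a negative constant on the piece containing it; all
    other pieces contribute at most 0. The strictness is what drives the maximum principle. *)
Lemma mean_lt0 f t0 : ucont f -> (forall x, 0 <= x <= 1 -> f x <= 0) ->
  0 <= t0 <= 1 -> f t0 < 0 -> mean f < 0.
Proof.
move=> fu f0 t01 ft0.
have [d d0 dP] := fu (- f t0 / 2) ltac:(lra); have [n nd] := exists_half_pow d0.
have : exists2 c, c < 0 & forall x, 0 <= x <= 1 -> `|x - t0| <= 2 ^- n -> f x <= c.
  exists (f t0 / 2); first lra.
  move=> x x01 xt; have := dP _ _ t01 x01 (le_lt_trans xt nd).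
  by rewrite ler_norml => /andP[_]; lra.
elim: n f t0 fu f0 t01 {ft0 d d0 dP nd} => [|n IHn] f t0 fu f0 t01 [c c0 cP].
  apply: le_lt_trans c0; rewrite -(mean_cst c); apply: mean_le => //.
    by move=> k k0; exists 1 => // x y _ _ _; rewrite subrr normr0 ltW.
  by move=> x x01; apply: cP => //; rewrite expr0 invr1 ler_norml; lra.
have u0 := ucont_half0 fu; have u1 := ucont_half1 fu.
have m0 : mean (fun t => f (t / 2)) <= 0.
  rewrite -(mean_cst 0); apply: mean_le => // [|x x01]; last by apply: f0; lra.
  by move=> k k0; exists 1 => // x y _ _ _; rewrite subrr normr0 ltW.
have m1 : mean (fun t => f ((t + 1) / 2)) <= 0.
  rewrite -(mean_cst 0); apply: mean_le => // [|x x01]; last by apply: f0; lra.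
  by move=> k k0; exists 1 => // x y _ _ _; rewrite subrr normr0 ltW.
rewrite (mean_half fu); have [t0h|t0h] := leP t0 2^-1.
  suff : mean (fun t => f (t / 2)) < 0 by lra.
  apply: (IHn _ (2 * t0) u0) => [x x01| |]; [apply: f0|..]; try lra.
  exists c => // x x01 xt; apply: cP; first lra.
  rewrite (_ : x / 2 - t0 = (x - 2 * t0) / 2); last by lra.
  rewrite normrM [`|2^-1|]gtr0_norm ?invr_gt0 // exprSr invfM.
  by rewrite ler_pM2r ?invr_gt0.
suff : mean (fun t => f ((t + 1) / 2)) < 0 by lra.
apply: (IHn _ (2 * t0 - 1) u1) => [x x01| |]; [apply: f0|..]; try lra.
exists c => // x x01 xt; apply: cP; first lra.
rewrite (_ : (x + 1) / 2 - t0 = (x - (2 * t0 - 1)) / 2); last by lra.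
rewrite normrM [`|2^-1|]gtr0_norm ?invr_gt0 // exprSr invfM.
by rewrite ler_pM2r ?invr_gt0.
Qed.

End Mean.

(** * Continuity on a subset *)

Section ContinuousOn.

Definition cont_on (T U : topologicalType) (A : set T) (f : T -> U) :=
  forall x, A x -> f @ within A (nbhs x) --> f x.

Lemma cont_onP (T U : topologicalType) (A : set T) (f : T -> U) :
  {within A, continuous f} <-> cont_on A f.
Proof. exact: subspace_continuousP. Qed.

Lemma cont_on_nbhs (T U : topologicalType) (A : set T) (f : T -> U) :
  cont_on A f <-> forall x, A x -> forall P, nbhs (f x) P ->
    nbhs x (fun y => A y -> P (f y)).
Proof. by split=> fA x Ax; exact: fA. Qed.

Lemma cont_on_sub (T U : topologicalType) (A B : set T) (f : T -> U) :
  A `<=` B -> cont_on B f -> cont_on A f.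
Proof.
move=> AB /cont_on_nbhs fB; apply/cont_on_nbhs => x Ax P /(fB x (AB _ Ax)).
by apply: filterS => y + /AB.
Qed.

Lemma cont_on_comp (T U W : topologicalType) (A : set T) (B : set U)
    (f : U -> W) (g : T -> U) :
  (forall x, A x -> B (g x)) -> cont_on A g -> cont_on B f ->
  cont_on A (f \o g).
Proof.
move=> AB /cont_on_nbhs gA /cont_on_nbhs fB; apply/cont_on_nbhs => x Ax P.
move=> /(fB _ (AB _ Ax))/(gA x Ax); apply: filterS => y + Ay.
by move=> /(_ Ay); apply; exact: AB.
Qed.

Lemma cont_on_ext (T U : topologicalType) (A : set T) (f g : T -> U) :
  (forall x, A x -> f x = g x) -> cont_on A f -> cont_on A g.
Proof.
move=> fg /cont_on_nbhs fA; apply/cont_on_nbhs => x Ax P; rewrite -fg //.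
by move=> /(fA x Ax); apply: filterS => y + Ay => /(_ Ay); rewrite fg.
Qed.

Lemma cont_on_cst (T U : topologicalType) (A : set T) (c : U) :
  cont_on A (fun=> c).
Proof. by move=> x _; exact: cvg_cst. Qed.

Lemma cont_on_id (T : topologicalType) (A : set T) : cont_on A (fun x => x).
Proof. by move=> x Ax; exact: cvg_within. Qed.

Lemma cont_on_near (T U : topologicalType) (A : set T) (f : T -> U) :
  (forall x, A x -> f y @[y --> x] --> f x) -> cont_on A f.
Proof.
move=> fA x Ax; apply: cvg_trans (fA x Ax).
by apply: cvg_app; exact: cvg_within.
Qed.

Section Field.
Variables (K : numFieldType) (T : topologicalType) (A : set T).
Implicit Types f g : T -> K.

Lemma cont_onD f g :
  cont_on A f -> cont_on A g -> cont_on A (fun x => f x + g x).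
Proof. by move=> fA gA x Ax; exact: cvgD (fA x Ax) (gA x Ax). Qed.

Lemma cont_onN f : cont_on A f -> cont_on A (fun x => - f x).
Proof. by move=> fA x Ax; exact: cvgN (fA x Ax). Qed.

Lemma cont_onB f g :
  cont_on A f -> cont_on A g -> cont_on A (fun x => f x - g x).
Proof. by move=> fA gA; exact: cont_onD fA (cont_onN gA). Qed.

Lemma cont_onM f g :
  cont_on A f -> cont_on A g -> cont_on A (fun x => f x * g x).
Proof. by move=> fA gA x Ax; exact: cvgM (fA x Ax) (gA x Ax). Qed.

Lemma cont_onV f : (forall x, A x -> f x != 0) ->
  cont_on A f -> cont_on A (fun x => (f x)^-1).
Proof. by move=> f0 fA x Ax; exact: cvgV (f0 x Ax) (fA x Ax). Qed.

Lemma cont_onX f n : cont_on A f -> cont_on A (fun x => f x ^+ n).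
Proof.
move=> fA; elim: n => [|n IHn].
  by apply: (@cont_on_ext T K A (fun=> 1)) => [x _|]; [rewrite expr0|exact:
    cont_on_cst].
apply: (@cont_on_ext T K A (fun x => f x * f x ^+ n)) => [x _|].
  by rewrite exprS.
exact: cont_onM.
Qed.

End Field.
End ContinuousOn.

(** * Means of complex functions, and the unit circle *)

Section ComplexMean.
Variable R : realType.
Local Notation C := (Cplx R).
Local Notation I := (`[0, 1]%classic : set R).

Lemma cvgC (T : Type) (F : set_system T) (FF : Filter F) (f : T -> C) (a : C) :
  f @ F --> a <-> forall e : R, 0 < e -> \forall x \near F, nm (f x - a) < e.
Proof.
split=> [fa e e0|fe P].
  by apply: (fa [set w | nm (w - a) < e]); apply/nearC; exists e.
move=> /nearC[d /fe + dP]; rewrite nbhs_simpl /=.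
by apply: filterS => x /dP.
Qed.

Lemma cont_onCP (T : topologicalType) (A : set T) (f : T -> C) :
  cont_on A f <-> forall x, A x -> forall e : R, 0 < e ->
    \forall y \near x, A y -> nm (f y - f x) < e.
Proof. split=> fA x Ax.
  by have /(@cvgC _ (within A (nbhs x)) (within_filter A _)) := fA x Ax.
by apply/(@cvgC _ (within A (nbhs x)) (within_filter A _)); exact: fA. Qed.

Lemma cont_onRP (T : topologicalType) (A : set T) (f : T -> R) :
  cont_on A f <-> forall x, A x -> forall e : R, 0 < e ->
    \forall y \near x, A y -> `|f y - f x| < e.
Proof.
split=> fA x Ax.
  move=> e e0; have /cvgrPdist_lt/(_ e e0) := fA x Ax.
  by apply: (@filterS _ (nbhs x)) => y + Ay; rewrite distrC => /(_ Ay).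
apply/cvgrPdist_lt => e /(fA x Ax e).
by apply: (@filterS _ (nbhs x)) => y + Ay; rewrite distrC => /(_ Ay).
Qed.

Lemma cont_on_nonexp (T : topologicalType) (A : set T) (f : T -> C) (g : C -> R) :
  (forall z w, `|g z - g w| <= nm (z - w)) -> cont_on A f ->
  cont_on A (fun x => g (f x)).
Proof.
move=> gL /cont_onCP fA; apply/cont_onRP => x Ax e e0.
by apply: filterS (fA x Ax e e0) => y + Ay => /(_ Ay); exact: le_lt_trans.
Qed.

Lemma cont_on_re (T : topologicalType) (A : set T) (f : T -> C) :
  cont_on A f -> cont_on A (fun x => re (f x)).
Proof. by apply: cont_on_nonexp => z w; rewrite -reB le_re. Qed.

Lemma cont_on_nm (T : topologicalType) (A : set T) (f : T -> C) :
  cont_on A f -> cont_on A (fun x => nm (f x)).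
Proof.
apply: cont_on_nonexp => z w; rewrite ler_norml lerNl opprB nm_triB nmC.
by rewrite nm_triB.
Qed.

Lemma cont_on_rc (T : topologicalType) (A : set T) (f : T -> R) :
  cont_on A f -> cont_on A (fun x => rc (f x)).
Proof.
move=> /cont_onRP fA; apply/cont_onCP => x Ax e e0.
by apply: filterS (fA x Ax e e0) => y + Ay => /(_ Ay); rewrite -rcB nm_rc.
Qed.

Lemma mk_rc (x y : R) : mkC x y = rc x + imC R * rc y.
Proof. by apply: ceq; rewrite !reimE; ring. Qed.

Lemma cont_on_mk (T : topologicalType) (A : set T) (f g : T -> R) :
  cont_on A f -> cont_on A g -> cont_on A (fun x => mkC (f x) (g x)).
Proof.
move=> fA gA; apply: (@cont_on_ext _ _ _ (fun x => rc (f x) + imC R * rc (g x))).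
  by move=> x _; rewrite mk_rc.
apply: cont_onD; first exact: cont_on_rc.
by apply: cont_onM; [exact: cont_on_cst|exact: cont_on_rc].
Qed.

(** Heine-Cantor. The field K of radii stays general because balls in the complex plane have radii
    in [Cplx R], those in the interval radii in R. *)
Lemma compact_ucont (K : numFieldType) (T : pseudoMetricType K) (A : set T)
    (f : T -> C) : compact A -> cont_on A f -> forall e : R, 0 < e ->
  exists2 d : K, 0 < d & forall x y, A x -> A y -> ball x d y ->
    nm (f y - f x) <= e.
Proof.
move=> /compact_near_coveringP Ac /cont_onCP fA e e0.
have /Ac : forall x, A x -> \forall x' \near x & d \near (0 : K)^'+,
    A x' -> forall y, A y -> ball x' d y -> nm (f y - f x') <= e.
  move=> x Ax; have e20 : 0 < e / 2 by rewrite divr_gt0.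
  have /nbhs_ballP[r r0 rP] := fA x Ax _ e20.
  exists (ball x (r / 2), [set d | d < r / 2]) => /=.
    split; first by apply: nbhsx_ballx; rewrite divr_gt0.
    by apply: nbhs_right_lt; rewrite divr_gt0.
  move=> [x' d] /= [xx' dr] Ax' y Ay x'y.
  have fx' : nm (f x' - f x) < e / 2.
    by apply: rP => //; apply: le_ball xx'; rewrite ler_pdivrMr // ler_peMr ?ler1n ?ltW.
  have fy : nm (f y - f x) < e / 2.
    apply: rP => //; rewrite [r]splitr; apply: ball_triangle xx' _.
    by apply: le_ball x'y; exact: ltW.
  by apply: le_trans (nm_tri (f x) _ _) _; rewrite (nmC (f x)); lra.
rewrite /at_right near_withinE => /nbhs_ballP[r /= r0 rP].
exists (r / 2); first by rewrite divr_gt0.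
move=> x y Ax Ay xy; apply: rP xy => //; last by rewrite divr_gt0.
rewrite -ball_normE /= sub0r normrN gtr0_norm ?divr_gt0 //.
by rewrite ltr_pdivrMr // ltr_pMr // ltr1n.
Qed.

Lemma compact_bound (T : topologicalType) (A : set T) (f : T -> R) :
  compact A -> cont_on A f -> exists M, forall x, A x -> `|f x| <= M.
Proof.
move=> cA /cont_onP fA.
have [M [_ MP]] := compact_bounded (continuous_compact fA cA).
exists (M + 1) => x Ax; apply: (MP (M + 1)); first by rewrite ltrDl.
by exists x.
Qed.

Definition cucont (f : R -> C) := forall e : R, 0 < e -> exists2 d : R, 0 < d &
  forall x y, 0 <= x <= 1 -> 0 <= y <= 1 -> `|y - x| < d -> nm (f y - f x) <= e.

Lemma cont_cucont (f : R -> C) : cont_on I f -> cucont f.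
Proof.
move=> fI e e0; have [d d0 dP] := compact_ucont (@segment_compact _ 0 1) fI e0.
exists d => // x y x01 y01 xy; apply: dP; rewrite /= ?in_itv //=.
by rewrite -ball_normE /= distrC.
Qed.

Lemma cucont_re (f : R -> C) : cucont f -> ucont (fun x => re (f x)).
Proof.
move=> fu e e0; have [d d0 dP] := fu _ e0; exists d => // x y x01 y01 xy.
by rewrite -reB; apply: le_trans (le_re _) _; exact: dP.
Qed.

Lemma cucont_im (f : R -> C) : cucont f -> ucont (fun x => im (f x)).
Proof.
move=> fu e e0; have [d d0 dP] := fu _ e0; exists d => // x y x01 y01 xy.
by rewrite -imB; apply: le_trans (le_im _) _; exact: dP.
Qed.

Lemma cont_ucont (f : R -> R) : cont_on I f -> ucont f.
Proof. by move=> /cont_on_rc/cont_cucont/cucont_re. Qed.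

Definition cmean (f : R -> C) : C :=
  mkC (mean (fun x => re (f x))) (mean (fun x => im (f x))).

Lemma cmean_ext (f g : R -> C) :
  (forall x, 0 <= x <= 1 -> f x = g x) -> cmean f = cmean g.
Proof. by move=> fg; congr mkC; apply: mean_ext => x /fg ->. Qed.

Lemma cmean_cst (c : C) : cmean (fun=> c) = c.
Proof. by rewrite /cmean !mean_cst mkCE. Qed.

Lemma cmeanD (f g : R -> C) : cont_on I f -> cont_on I g ->
  cmean (fun x => f x + g x) = cmean f + cmean g.
Proof.
move=> /cont_cucont fu /cont_cucont gu; apply: ceq; rewrite !reimE.
  rewrite -meanD; [|exact: cucont_re..].
  by apply: mean_ext => x _; rewrite reD.
rewrite -meanD; [|exact: cucont_im..].
by apply: mean_ext => x _; rewrite imD.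
Qed.

Lemma cmeanZ (c : C) (f : R -> C) : cont_on I f ->
  cmean (fun x => c * f x) = c * cmean f.
Proof.
move=> /cont_cucont fu; have ru := cucont_re fu; have iu := cucont_im fu.
apply: ceq; rewrite !reimE.
  rewrite -meanZ // -mulNr -meanZ // -meanD; [|exact: ucontZ..].
  by apply: mean_ext => x _; rewrite !reimE mulNr.
rewrite -meanZ // -meanZ // -meanD; [|exact: ucontZ..].
by apply: mean_ext => x _; rewrite !reimE.
Qed.

Lemma cmeanN (f : R -> C) : cont_on I f -> cmean (fun x => - f x) = - cmean f.
Proof.
move=> fI; rewrite -mulN1r -cmeanZ //.
by apply: cmean_ext => x _; rewrite mulN1r.
Qed.

Lemma cmeanB (f g : R -> C) : cont_on I f -> cont_on I g ->
  cmean (fun x => f x - g x) = cmean f - cmean g.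
Proof. by move=> fI gI; rewrite (cmeanD fI (cont_onN gI)) (cmeanN gI). Qed.

Lemma cmean_rc (f : R -> R) : cmean (fun x => rc (f x)) = rc (mean f).
Proof. by rewrite /cmean /= mean_cst. Qed.

(** A factor u of modulus one turns the mean into its modulus; the mean of the real part of u f is
    then bounded by M. *)
Lemma cmean_bound (f : R -> C) (M : R) : cont_on I f ->
  (forall x, 0 <= x <= 1 -> nm (f x) <= M) -> nm (cmean f) <= M.
Proof.
move=> fI fM; have [m0|m0] := eqVneq (cmean f) 0.
  by rewrite m0 nm0; apply: le_trans (nm_ge0 _) (fM 0 _); rewrite lexx ler01.
pose m := cmean f; pose u := mkC (re m) (- im m) / rc (nm m).
have nm0' : nm m != 0 by rewrite nm_eq0.
have mJ : mkC (re m) (- im m) * m = rc (nm m) * rc (nm m).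
  by rewrite -rcM -expr2 nm_sqr; apply: ceq; rewrite !reimE; ring.
have um : u * m = rc (nm m).
  by rewrite /u mulrAC mJ mulfK // -(rmorph0 (@rc R)) (inj_eq (@rc_inj R)).
have nu : nm u = 1.
  have := congr1 (@nm R) um; rewrite nmM nm_rc ger0_norm ?nm_ge0 //.
  by move/(congr1 (fun x => x / nm m)); rewrite mulfK // mulfV.
have uI : cont_on I (fun x => u * f x) := cont_onM (@cont_on_cst _ _ I u) fI.
have -> : nm (cmean f) = mean (fun x => re (u * f x)).
  by rewrite -[LHS]/(re (rc (nm m))) -um -cmeanZ.
rewrite -(mean_cst M); apply: mean_le.
- exact/cont_ucont/cont_on_re.
- exact/cont_ucont/cont_on_cst.
move=> x x01; apply: le_trans (fM x x01); rewrite -[leRHS]mul1r -nu -nmM.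
exact: le_trans (ler_norm _) (le_re _).
Qed.

Lemma cmean_half (f : R -> C) : cont_on I f -> cmean f =
  (cmean (fun t => f (t / 2)) + cmean (fun t => f ((t + 1) / 2))) / 2.
Proof.
move=> /cont_cucont fu; rewrite -(rmorph_nat (@rc R)) -fmorphV mulrC.
apply: ceq; rewrite ?re_rcM ?im_rcM !reimE mulrC.
  by rewrite (mean_half (cucont_re fu)).
by rewrite (mean_half (cucont_im fu)).
Qed.

Lemma cmean_rev (f : R -> C) : cont_on I f ->
  cmean (fun t => f (1 - t)) = cmean f.
Proof.
move=> /cont_cucont fu; apply: ceq; rewrite !reimE.
  exact: (mean_rev (cucont_re fu)).
exact: (mean_rev (cucont_im fu)).
Qed.

Lemma cmean_dyadic (f : R -> C) : cont_on I f -> forall e : R, 0 < e ->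
  exists N, forall n, (N <= n)%N ->
   nm (cmean f - rc (2 ^- n) * \sum_(0 <= j < 2 ^ n) f (j%:R * 2 ^- n)) <= e.
Proof.
move=> /cont_cucont fu e e0; have e20 : 0 < e / 2 by rewrite divr_gt0.
have /cvgrPdist_le/(_ _ e20)[N _ NP] := mean_cvg (cucont_re fu).
have /cvgrPdist_le/(_ _ e20)[M _ MP] := mean_cvg (cucont_im fu).
exists (maxn N M) => n; rewrite geq_max => /andP[/NP nr /MP ni].
apply: le_trans (nm_reim _) _; rewrite reB imB re_rcM im_rcM.
by rewrite (splitr e) lerD // raddf_sum.
Qed.

Lemma compact_cball (a : C) (r : R) : compact [set z : C | nm (z - a) <= r].
Proof.
pose F (p : R * R) : C := mkC p.1 p.2 + a.
pose Q := (`[- `|r|, `|r|]%classic `*` `[- `|r|, `|r|]%classic) : set (R * R).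
have cQ : compact Q by apply: compact_setX; exact: segment_compact.
have cF : {within Q, continuous F}.
  apply/cont_onP/cont_onD; last exact: cont_on_cst.
  apply: cont_on_mk; apply: cont_on_near => p _; [exact: cvg_fst|exact: cvg_snd].
apply: subclosed_compact (continuous_compact cF cQ) _.
  rewrite -[X in closed X]setCK; apply: open_closedC; rewrite openE => z /= /negP.
  rewrite -ltNge => zr; apply/nearC; exists (nm (z - a) - r); first by rewrite subr_gt0.
  by move=> w wz; apply/negP; rewrite -ltNge; have := nm_tri w z a; rewrite (nmC z
    w); lra.
move=> z /= zr; exists (re (z - a), im (z - a)); last first.
  by rewrite /F mkCE subrK.
split; rewrite /= in_itv /= -ler_norml.
  by apply: le_trans (le_re _) (le_trans zr (ler_norm _)).
by apply: le_trans (le_im _) (le_trans zr (ler_norm _)).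
Qed.

(** This is e^(2 pi i t). The mean of g(circ t) over [0, 1] is the integral of g(w) dw / (2 pi i w)
    over the unit circle. *)
Definition circ (t : R) : C := mkC (cos (pi *+ 2 * t)) (sin (pi *+ 2 * t)).

Lemma circ0 : circ 0 = 1.
Proof. by rewrite /circ mulr0 cos0 sin0. Qed.

Lemma circ1 : circ 1 = 1.
Proof. by rewrite /circ mulr1 cos2pi sin2pi. Qed.

Lemma circD s t : circ (s + t) = circ s * circ t.
Proof.
by apply: ceq; rewrite !reimE mulrDr ?cosD ?sinD // addrC mulrC.
Qed.

Lemma circX t n : circ t ^+ n = circ (n%:R * t).
Proof.
elim: n => [|n IHn]; first by rewrite mul0r circ0.
by rewrite exprS IHn -circD -[n.+1%:R]nat1r mulrDl mul1r.
Qed.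

Lemma nm_circ t : nm (circ t) = 1.
Proof.
apply/eqP; rewrite -(@eqrXn2 _ 2) ?nm_ge0 // nm_sqr !reimE.
by rewrite cos2Dsin2 expr1n.
Qed.

Lemma circ_neq0 t : circ t != 0.
Proof. by rewrite -nm_gt0 nm_circ. Qed.

Lemma circ_neq1 t : 0 < t < 1 -> circ t != 1.
Proof.
move=> t01; apply/eqP => /(congr1 (@re R)); rewrite !reimE.
have [t0 t1] := andP t01; have pi0 := pi_gt0 R.
have s0 : 0 < sin (pi * t).
  apply: sin_gt0_pi; rewrite mulr_gt0 //=.
  by rewrite -[ltRHS]mulr1 ltr_pM2l.
rewrite (_ : pi *+ 2 * t = (pi * t) *+ 2); last by rewrite mulrnAl.
have := cos2Dsin2 (pi * t); rewrite cos_mulr2n.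
have : 0 < sin (pi * t) ^+ 2 by rewrite exprn_gt0.
by rewrite mulr2n; lra.
Qed.

Lemma circ_surj (z : C) : nm z = 1 -> exists2 t, 0 <= t <= 1 & circ t = z.
Proof.
move=> z1; have pi0 := pi_gt0 R.
have sqr1 : re z ^+ 2 + im z ^+ 2 = 1 by rewrite -nm_sqr z1 expr1n.
have re1 : -1 <= re z <= 1 by rewrite -ler_norml -z1 le_re.
have [ac0 acE] := acos_def re1.
pose a := acos (re z); have sa : 0 <= sin a by exact: sin_ge0_pi.
have sE : sin a = `|im z|.
  apply/eqP; rewrite -(@eqrXn2 _ 2) // real_normK ?num_real //.
  have := cos2Dsin2 a; rewrite acE; lra.
have p20 : 0 < (pi : R) *+ 2 by rewrite pmulrn_rgt0.
have [i0|i0] := leP 0 (im z).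
  exists (a / (pi *+ 2)).
    rewrite ler_pdivrMr // ler_pdivlMr // mul0r mul1r mulr2n /a.
    by have /andP[ac00 acpi] := ac0; lra.
  apply: ceq; rewrite !reimE mulrC divfK ?gt_eqF //.
  by rewrite sE ger0_norm.
exists (1 - a / (pi *+ 2)).
  have /andP[ac00 acpi] := ac0.
  have : 0 <= a / (pi *+ 2) <= 1.
    by rewrite ler_pdivrMr // ler_pdivlMr // mul0r mul1r mulr2n /a; lra.
  by lra.
apply: ceq; rewrite !reimE mulrBr mulr1 (mulrC (pi *+ 2)) divfK ?gt_eqF //.
  by rewrite addrC cosD2pi cosN.
by rewrite addrC sinD2pi sinN sE ltr0_norm // opprK.
Qed.

Lemma cont_on_circ (A : set R) : cont_on A circ.
Proof.
apply: cont_on_mk; apply: cont_on_near => t _.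
  apply: (@continuous_comp _ _ _ (fun t => pi *+ 2 * t) (@cos R)).
    exact: mulrl_continuous.
  exact: continuous_cos.
apply: (@continuous_comp _ _ _ (fun t => pi *+ 2 * t) (@sin R)).
  exact: mulrl_continuous.
exact: continuous_sin.
Qed.

End ComplexMean.

(** * Goursat's lemma and the Cauchy formula *)

Section CauchyFormula.
Variable R : realType.
Local Notation C := (Cplx R).
Local Notation I := (`[0, 1]%classic : set R).
Local Notation circ := (@circ R).
Implicit Types (f F : C -> C) (a b c z w : C).

Lemma I01 (t : R) : I t -> 0 <= t <= 1. Proof. by rewrite /= in_itv. Qed.

Lemma nm_small z : (forall e : R, 0 < e -> nm z <= e) -> z = 0.
Proof.
move=> ze; apply/eqP; rewrite -nm_eq0 eq_le nm_ge0 andbT.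
by apply/ler_addgt0Pr => e /ze; rewrite add0r.
Qed.

Definition cball0 (r : R) : set C := [set z | nm z <= r].

Definition seg a b (t : R) : C := a + rc t * (b - a).

Lemma seg_cball0 r a b t : cball0 r a -> cball0 r b -> 0 <= t <= 1 ->
  cball0 r (seg a b t).
Proof.
rewrite /cball0 /= => ar br /andP[t0 t1].
have -> : seg a b t = rc (1 - t) * a + rc t * b.
  by rewrite /seg rcB rc1; ring.
apply: le_trans (nmD _ _) _; rewrite !nmM !nm_rc (ger0_norm t0).
rewrite ger0_norm ?subr_ge0 //.
have -> : r = (1 - t) * r + t * r by ring.
by rewrite lerD // ler_wpM2l // subr_ge0.
Qed.

Lemma cont_on_seg (A : set R) a b : cont_on A (seg a b).
Proof.
apply: cont_onD; first exact: cont_on_cst.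
apply: cont_onM; last exact: cont_on_cst.
exact/cont_on_rc/cont_on_id.
Qed.

Definition seg_integral f a b : C := (b - a) * cmean (fun t => f (seg a b t)).

Section Goursat.
Variables (r : R) (f : C -> C).
Let A := cball0 r.
Hypothesis fA : cont_on A f.

Lemma cont_seg a b : A a -> A b -> cont_on I (fun t => f (seg a b t)).
Proof.
move=> Aa Ab; apply: (@cont_on_comp _ _ _ I A f (seg a b)) fA.
  by move=> t /I01 t01; exact: seg_cball0.
exact: cont_on_seg.
Qed.

Definition midpoint a b : C := seg a b 2^-1.

Lemma rc_half : rc 2^-1 = 2^-1 :> C.
Proof. by rewrite fmorphV rmorph_nat. Qed.

Lemma midpointE a b : midpoint a b = (a + b) / 2.
Proof. by rewrite /midpoint /seg rc_half; field. Qed.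

Lemma midpointA a b : A a -> A b -> A (midpoint a b).
Proof. by move=> Aa Ab; apply: seg_cball0 => //; lra. Qed.

Lemma seg_integral_split a b : A a -> A b -> seg_integral f a b =
  seg_integral f a (midpoint a b) + seg_integral f (midpoint a b) b.
Proof.
move=> Aa Ab; rewrite /seg_integral (cmean_half (cont_seg Aa Ab)).
rewrite (_ : cmean (fun t => f (seg a b (t / 2))) =
    cmean (fun t => f (seg a (midpoint a b) t))); last first.
  apply: cmean_ext => t _; congr f; rewrite midpointE /seg rcM rc_half.
  by field.
rewrite (_ : cmean (fun t => f (seg a b ((t + 1) / 2))) =
    cmean (fun t => f (seg (midpoint a b) b t))); last first.
  apply: cmean_ext => t _; congr f; rewrite midpointE /seg rcM rcD rc1 rc_half.
  by field.
by rewrite midpointE; field.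
Qed.

Lemma seg_integral_rev a b : A a -> A b ->
  seg_integral f b a = - seg_integral f a b.
Proof.
move=> Aa Ab; rewrite /seg_integral -(cmean_rev (cont_seg Aa Ab)) -mulNr opprB.
congr (_ * _); apply: cmean_ext => t _; congr f.
by rewrite /seg rcB rc1; ring.
Qed.

Definition tri_integral (g : C -> C) (T : C * C * C) : C :=
  seg_integral g T.1.1 T.1.2 + seg_integral g T.1.2 T.2 + seg_integral g T.2 T.1.1.

Lemma tri_integral_split a b c : A a -> A b -> A c ->
  let x := midpoint a b in let y := midpoint b c in let z := midpoint c a in
  tri_integral f (a, b, c) = tri_integral f (a, x, z) + tri_integral f (x, b, y)
    + tri_integral f (y, c, z) + tri_integral f (x, y, z).
Proof.
move=> Aa Ab Ac x y z; rewrite /tri_integral /=.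
rewrite (seg_integral_split Aa Ab) (seg_integral_split Ab Ac).
rewrite (seg_integral_split Ac Aa) -/x -/y -/z.
have [Ax Ay Az] : [/\ A x, A y & A z] by split; exact: midpointA.
rewrite (seg_integral_rev Ax Ay) (seg_integral_rev Ay Az) (seg_integral_rev Az Ax).
by ring.
Qed.

Definition small_triangle (d : R) (T : C * C * C) :=
  [/\ A T.1.1, A T.1.2 & A T.2] /\
  [/\ nm (T.1.2 - T.1.1) <= d, nm (T.2 - T.1.2) <= d & nm (T.1.1 - T.2) <= d].

Lemma nm_half z (d : R) : nm z <= d -> nm (z / 2) <= d / 2.
Proof.
by move=> zd; rewrite nm_div -(rmorph_nat (@rc R)) nm_rc normr_nat ler_pM2r ?invr_gt0.
Qed.

(** Of the four triangles cut out by the midpoints one carries at least a quarter of the integral.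
    The displacement of the first vertex is recorded so that the first vertices of iterated choices
    converge. *)
Lemma tri_integral_step d T : small_triangle d T -> exists T',
  [/\ small_triangle (d / 2) T', nm (T'.1.1 - T.1.1) <= d
    & nm (tri_integral f T) <= 4 * nm (tri_integral f T')].
Proof.
case: T => -[a b] c [/= [Aa Ab Ac] [ab bc ca]].
pose x := midpoint a b; pose y := midpoint b c; pose z := midpoint c a.
have [Ax Ay Az] : [/\ A x, A y & A z] by split; exact: midpointA.
have d0 : 0 <= d by apply: le_trans ab; exact: nm_ge0.
have hd : d / 2 <= d by lra.
have H : [/\ nm ((b - a) / 2) <= d / 2, nm ((c - b) / 2) <= d / 2
  & nm ((a - c) / 2) <= d / 2] by split; exact: nm_half.
have [h1 h2 h3] := H.
have S u v (w : C) : (u - v = w \/ u - v = - w) -> nm w <= d / 2 -> nm (u - v) <= d / 2.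
  by move=> [->|->]; rewrite ?nmN.
have sx : [/\ nm (x - a) <= d / 2, nm (b - x) <= d / 2 & nm (y - x) <= d / 2].
  rewrite /x /y !midpointE; split.
  - by apply: (S _ _ ((b - a) / 2)) => //; left; field.
  - by apply: (S _ _ ((b - a) / 2)) => //; left; field.
  - by apply: (S _ _ ((a - c) / 2)) => //; right; field.
have sy : [/\ nm (y - b) <= d / 2, nm (c - y) <= d / 2 & nm (z - y) <= d / 2].
  rewrite /y /z !midpointE; split.
  - by apply: (S _ _ ((c - b) / 2)) => //; left; field.
  - by apply: (S _ _ ((c - b) / 2)) => //; left; field.
  - by apply: (S _ _ ((b - a) / 2)) => //; right; field.
have sz : [/\ nm (z - c) <= d / 2, nm (a - z) <= d / 2 & nm (x - z) <= d / 2].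
  rewrite /x /z !midpointE; split.
  - by apply: (S _ _ ((a - c) / 2)) => //; left; field.
  - by apply: (S _ _ ((a - c) / 2)) => //; left; field.
  - by apply: (S _ _ ((c - b) / 2)) => //; right; field.
have [xa bx yx] := sx; have [yb cy zy] := sy; have [zc az xz] := sz.
have st1 : small_triangle (d / 2) (a, x, z) by split; split; rewrite //= nmC.
have st2 : small_triangle (d / 2) (x, b, y) by split; split; rewrite //= nmC.
have st3 : small_triangle (d / 2) (y, c, z) by split; split; rewrite //= nmC.
have st4 : small_triangle (d / 2) (x, y, z) by split; split; rewrite //= nmC.
have ya : nm (y - a) <= d.
  by apply: le_trans (nm_tri x _ _) _; lra.
have := tri_integral_split Aa Ab Ac; rewrite -/x -/y -/z => TE.
have TN : nm (tri_integral f (a, b, c)) <= nm (tri_integral f (a, x, z)) +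
    nm (tri_integral f (x, b, y)) + nm (tri_integral f (y, c, z)) +
    nm (tri_integral f (x, y, z)).
  rewrite TE; apply: le_trans (nmD _ _) _; rewrite lerD2r.
  apply: le_trans (nmD _ _) _; rewrite lerD2r; exact: nmD.
pose n0 := nm (tri_integral f (a, b, c)).
have [q1|q1] := leP n0 (4 * nm (tri_integral f (a, x, z))).
  by exists (a, x, z); split => //=; rewrite subrr nm0.
have [q2|q2] := leP n0 (4 * nm (tri_integral f (x, b, y))).
  by exists (x, b, y); split => //=; exact: le_trans hd.
have [q3|q3] := leP n0 (4 * nm (tri_integral f (y, c, z))).
  by exists (y, c, z); split.
exists (x, y, z); split => //=; first exact: le_trans hd.
by rewrite -/n0; rewrite -/n0 in TN; lra.
Qed.

End Goursat.

(** Real and imaginary parts converge separately, each with error at most [2 * d * 2 ^- n]; the two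
    together give the factor 4. *)
Lemma limit_geometric (u : nat -> C) (d : R) :
  (forall n, nm (u n.+1 - u n) <= d * 2 ^- n) ->
  exists q, forall n, nm (u n - q) <= 4 * d * 2 ^- n.
Proof.
move=> ud; have d0 : 0 <= d.
  by have := ud 0; rewrite expr0 invr1 mulr1; apply: le_trans; exact: nm_ge0.
have um n m : nm (u (n + m)%N - u n) <= 2 * d * 2 ^- n - 2 * d * 2 ^- (n + m).
  elim: m => [|m IHm]; first by rewrite addn0 !subrr nm0.
  rewrite addnS; apply: le_trans (nm_tri (u (n + m)%N) _ _) _.
  apply: le_trans (lerD (ud _) IHm) _.
  by rewrite exprSr invfM; move: (2 ^- n) (2 ^- (n + m)) => x y; lra.
have um' n m : nm (u (n + m)%N - u n) <= 2 * d * 2 ^- n.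
  apply: le_trans (um n m) _; rewrite gerBl.
  by rewrite !mulr_ge0 // invr_ge0 exprn_ge0.
have cv (p : C -> R) : (forall z w, `|p z - p w| <= nm (z - w)) ->
    exists l : R, forall n, `|p (u n) - l| <= 2 * d * 2 ^- n.
  move=> pL; have pC : cvgn (fun n => p (u n)).
    apply: cauchy_cvgn => e e0.
    have D0 : 0 < 2 * d + 1 by rewrite ltr_wpDl // mulr_ge0.
    have [n] := exists_half_pow (divr_gt0 e0 D0).
    rewrite ltr_pdivlMr // => ne; exists n => m nm; rewrite -(subnKC nm).
    apply: le_trans (pL _ _) _; apply: le_trans (um' _ _) _.
    apply: le_trans (ltW ne); rewrite mulrC ler_wpM2l ?invr_ge0 ?exprn_ge0 //.
    by rewrite lerDl.
  exists (lim (p (u n) @[n --> \oo])) => n.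
  have : (fun m => `|p (u n) - p (u m)|) @ \oo --> `|p (u n) - lim (p (u n) @[n -->
    \oo])|.
    by apply: cvg_norm; apply: cvgB pC; exact: cvg_cst.
  move=> /ler_cvg_to; apply; first exact: cvg_cst.
  exists n => // m /= nm; rewrite -(subnKC nm) distrC.
  exact: le_trans (pL _ _) (um' _ _).
have reL z w : `|re z - re w| <= nm (z - w) by rewrite -reB le_re.
have imL z w : `|im z - im w| <= nm (z - w) by rewrite -imB le_im.
have [x xP] := cv (@re R) reL.
have [y yP] := cv (@im R) imL.
exists (mkC x y) => n; apply: le_trans (nm_reim _) _; rewrite !reimE.
by have := lerD (xP n) (yP n); move: (2 ^- n) => t; lra.
Qed.

Section Primitive.
Variables (r : R) (f : C -> C).
Hypothesis r0 : 0 <= r.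
Let A := cball0 r.
Hypothesis fd : forall z, A z -> exists d, cdiff f z d.

Lemma cdiff_cball_cont : cont_on A f.
Proof.
have [d dP] := choice (fun z : {z | A z} => fd (projT2 z)).
apply/cont_onCP => z Az e e0.
have [k k0 kP] := cdiff_continuous (dP (exist _ z Az)) e0.
by apply/nearC; exists k => // w /kP.
Qed.

Let fA := cdiff_cball_cont.

(** Adding the mean to its reversal under t -> 1 - t makes the integrand constant, so an affine
    integrand is determined without a primitive. *)
Lemma seg_integral_affine a b (k l : C) :
  seg_integral (fun z => k + l * z) a b = (b - a) * (k + l * ((a + b) / 2)).
Proof.
have c1 : cont_on I (fun t => k + l * seg a b t).
  apply: cont_onD; first exact: cont_on_cst.
  by apply: cont_onM; [exact: cont_on_cst|exact: cont_on_seg].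
rewrite /seg_integral; congr (_ * _).
pose M := cmean (fun t => k + l * seg a b t).
have : M + M = (k + l * a) + (k + l * b).
  have c2 : cont_on I (fun t => k + l * seg a b (1 - t)).
    apply: (@cont_on_ext _ _ _ (fun t => k + l * seg b a t)).
      by move=> t _; rewrite /seg rcB rc1; congr (_ + _ * _); ring.
    apply: cont_onD; first exact: cont_on_cst.
    by apply: cont_onM; [exact: cont_on_cst|exact: cont_on_seg].
  rewrite {2}/M -(cmean_rev c1) -(cmeanD c1 c2).
  rewrite -[RHS]cmean_cst; apply: cmean_ext => t _.
  by rewrite /seg rcB rc1; ring.
rewrite -/M => ME; have -> : M = (M + M) / 2 by field.
by rewrite ME; field.
Qed.

Lemma goursat a b c : A a -> A b -> A c -> tri_integral f (a, b, c) = 0.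
Proof.
move=> Aa Ab Ac; apply/eqP; rewrite -nm_eq0 eq_le nm_ge0 andbT leNgt.
apply/negP => T0.
have [nxt nxtP] : exists nxt : R * (C * C * C) -> C * C * C,
    forall p, small_triangle r p.1 p.2 ->
      [/\ small_triangle r (p.1 / 2) (nxt p), nm ((nxt p).1.1 - p.2.1.1) <= p.1
        & nm (tri_integral f p.2) <= 4 * nm (tri_integral f (nxt p))].
  suff H : forall p : R * (C * C * C), exists T', small_triangle r p.1 p.2 ->
      [/\ small_triangle r (p.1 / 2) T', nm (T'.1.1 - p.2.1.1) <= p.1
        & nm (tri_integral f p.2) <= 4 * nm (tri_integral f T')].
    by have [nxt nxtP] := choice H; exists nxt.
  move=> p; have [sp|sp] := pselect (small_triangle r p.1 p.2); last by exists (0, 0,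
    0).
  by have [T' TP] := tri_integral_step fA sp; exists T'.
pose D := nm (b - a) + nm (c - b) + nm (a - c).
pose T := fix T n := if n is n'.+1 then nxt (D * 2 ^- n', T n') else (a, b, c).
have TP n : small_triangle r (D * 2 ^- n) (T n) /\
    nm (tri_integral f (a, b, c)) <= 4 ^+ n * nm (tri_integral f (T n)).
  elim: n => [|n [sT IHn]].
    split; last by rewrite expr0 mul1r.
    rewrite expr0 invr1 mulr1 /D; split; split => //=.
    - by rewrite -addrA lerDl addr_ge0 ?nm_ge0.
    - by rewrite addrAC lerDr addr_ge0 ?nm_ge0.
    - by rewrite lerDr addr_ge0 ?nm_ge0.
  have [st _ tt] := nxtP (D * 2 ^- n, T n) sT; split.
    by rewrite exprSr invfM mulrA.
  apply: le_trans IHn _; rewrite exprSr -mulrA ler_pM2l ?exprn_gt0 //.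
have [q qP] : exists q, forall n, nm ((T n).1.1 - q) <= 4 * D * 2 ^- n.
  apply: (@limit_geometric (fun n => (T n).1.1)) => n.
  by have [sT _] := TP n; have [_ + _] := nxtP (D * 2 ^- n, T n) sT.
have D0 : 0 <= D by rewrite !addr_ge0 ?nm_ge0.
have Aq : A q.
  rewrite /A /cball0 /=; apply/ler_addgt0Pr => e e0.
  have D4 : 0 < 4 * D + 1 by rewrite ltr_wpDl // mulr_ge0.
  have [n] := exists_half_pow (divr_gt0 e0 D4); rewrite ltr_pdivlMr // => ne.
  have [[[+ _ _] _] _] := TP n; rewrite /cball0 /= => Tr.
  have := nm_triB q (T n).1.1; rewrite nmC => /le_trans/(_ (qP n)).
  have h0 : 0 <= 2 ^- n :> R by rewrite invr_ge0 exprn_ge0.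
  by move: h0 ne; move: (2 ^- n) => t; nra.
have [m mP] := fd Aq.
(* Each of the three sides will contribute at most [5 * e * (D * h) ^+ 2]. The added 1 makes the
   final inequality contradictory and also covers D = 0. *)
pose e := nm (tri_integral f (a, b, c)) / (15 * D ^+ 2 + 1).
have E0 : 0 < 15 * D ^+ 2 + 1 by rewrite ltr_wpDl // mulr_ge0 // sqr_ge0.
have e0 : 0 < e by rewrite divr_gt0.
have [k k0 kP] := mP _ e0.
have D5 : 0 < 5 * D + 1 by rewrite ltr_wpDl // mulr_ge0.
have [n] := exists_half_pow (divr_gt0 k0 D5); rewrite ltr_pdivlMr // => nk.
have [[[A1 A2 A3] [s1 s2 s3]] Tn] := TP n.
pose h := 2 ^- n : R; rewrite -/h in nk s1 s2 s3.
have h0 : 0 < h by rewrite invr_gt0 exprn_gt0.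
have := qP n; rewrite -/h => q1.
(* The first vertex lies within [4 * D * h] of q, and a side adds at most [D * h]. *)
have near z w t : A z -> A w -> nm (z - q) <= 5 * D * h -> nm (w - q) <= 5 * D * h ->
    0 <= t <= 1 -> nm (seg z w t - q) <= 5 * D * h.
  move=> Az Aw zq wq t01.
  have := @seg_cball0 (5 * D * h) (z - q) (w - q) t zq wq t01.
  by rewrite /cball0 /seg /= => H; rewrite (_ : _ - q = z - q + rc t * (w - q - (z -
    q))) //; ring.
have v1 : nm ((T n).1.1 - q) <= 5 * D * h by nra.
have v2 : nm ((T n).1.2 - q) <= 5 * D * h.
  by apply: le_trans (nm_tri (T n).1.1 _ _) _; nra.
have v3 : nm ((T n).2 - q) <= 5 * D * h.
  by apply: le_trans (nm_tri (T n).1.1 _ _) _; rewrite nmC; nra.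
(* f is compared with its affine approximation at q, whose integrals over the three sides add up to
   zero. *)
have side z w : A z -> A w -> nm (z - q) <= 5 * D * h -> nm (w - q) <= 5 * D * h ->
    nm (w - z) <= D * h ->
    nm (seg_integral f z w - (w - z) * ((f q - m * q) + m * ((z + w) / 2)))
      <= 5 * e * (D * h) ^+ 2.
  move=> Az Aw zq wq zw; rewrite -seg_integral_affine /seg_integral -mulrBr nmM.
  have cf := cont_seg fA Az Aw.
  have ca : cont_on I (fun t => (f q - m * q) + m * seg z w t).
    apply: cont_onD; first exact: cont_on_cst.
    by apply: cont_onM; [exact: cont_on_cst|exact: cont_on_seg].
  have B : nm (cmean (fun t => f (seg z w t)) -
      cmean (fun t => (f q - m * q) + m * seg z w t)) <= e * (5 * D * h).
    rewrite -(cmeanB cf ca); apply: cmean_bound; first exact: cont_onB cf ca.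
    move=> t t01; have nq := near z w t Az Aw zq wq t01.
    have -> : f (seg z w t) - (f q - m * q + m * seg z w t) =
      f (seg z w t) - f q - m * (seg z w t - q) by ring.
    apply: le_trans (kP _ _) _; last by rewrite ler_pM2l.
    by apply: le_lt_trans nq _; nra.
  apply: le_trans (ler_pM (nm_ge0 _) (nm_ge0 _) zw B) _.
  by rewrite le_eqVlt; apply/orP; left; apply/eqP; ring.
have B1 := side _ _ A1 A2 v1 v2 s1.
have B2 := side _ _ A2 A3 v2 v3 s2.
have B3 := side _ _ A3 A1 v3 v1 s3.
have BT : nm (tri_integral f (T n)) <= 15 * e * (D * h) ^+ 2.
  move: B1 B2 B3; rewrite /tri_integral.
  set j1 := seg_integral _ _ _; set j2 := seg_integral _ _ _.
  set j3 := seg_integral _ _ _; set l1 := _ * (_ + m * ((_ + (T n).1.2) / 2)).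
  set l2 := _ * (_ + m * ((_ + (T n).2) / 2)).
  set l3 := _ * (_ + m * ((_ + (T n).1.1) / 2)) => B1 B2 B3.
  have -> : j1 + j2 + j3 = (j1 - l1) + (j2 - l2) + (j3 - l3).
    by rewrite /l1 /l2 /l3; field.
  apply: le_trans (nmD _ _) _.
  have := nmD (j1 - l1) (j2 - l2); lra.
(* The loss of a factor 4 per bisection is exactly compensated by the square of the scale. *)
have h4 : 4 ^+ n * h ^+ 2 = 1.
  have -> : h = 2^-1 ^+ n by rewrite exprVn.
  rewrite -exprM mulnC exprM -exprMn (_ : 4 * 2^-1 ^+ 2 = 1) ?expr1n //.
  by rewrite expr2; lra.
have : nm (tri_integral f (a, b, c)) <= 15 * e * D ^+ 2.
  apply: le_trans Tn _.
  have -> : 15 * e * D ^+ 2 = 4 ^+ n * (15 * e * (D * h) ^+ 2).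
    have -> : 4 ^+ n * (15 * e * (D * h) ^+ 2) = 15 * e * D ^+ 2 * (4 ^+ n * h ^+ 2).
      by rewrite exprMn; move: (4 ^+ n) => u; ring.
    by rewrite h4 mulr1.
  by rewrite ler_pM2l ?exprn_gt0.
have -> : nm (tri_integral f (a, b, c)) = e * (15 * D ^+ 2 + 1).
  by rewrite /e divfK // gt_eqF.
lra.
Qed.

Definition primitive z : C := seg_integral f 0 z.

(** By [goursat] an increment of the primitive is the integral over one segment, and f is uniformly
    continuous on the closed disc. The radius d therefore does not depend on z, and points of the
    boundary circle are included. *)
Lemma primitive_udiff (e : R) : 0 < e -> exists2 d : R, 0 < d &
  forall z w, A z -> A w -> nm (w - z) < d ->
    nm (primitive w - primitive z - f z * (w - z)) <= e * nm (w - z).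
Proof.
move=> e0; have A0 : A 0 by rewrite /A /cball0 /mkset nm0.
have cA : compact A.
  have := @compact_cball R 0 r; congr compact; apply/seteqP.
  by split=> z /=; rewrite /A /cball0 /= subr0.
have [d d0 dP] := compact_ucont cA fA e0.
move: d0; rewrite ltcE /= => /andP[/eqP imd red]; exists (re d) => // z w Az Aw zw.
have := goursat A0 Az Aw; rewrite /tri_integral /= (seg_integral_rev fA A0 Aw).
rewrite -/(primitive z) -/(primitive w) => T0.
have -> : primitive w - primitive z = seg_integral f z w.
  by move: T0 => /eqP; rewrite subr_eq0 => /eqP <-; rewrite addrAC subrr add0r.
have cf := cont_seg fA Az Aw.
rewrite /seg_integral (mulrC (f z)) -mulrBr nmM mulrC ler_wpM2r ?nm_ge0 //.
rewrite -[X in _ - X](cmean_cst (f z)) -(cmeanB cf (@cont_on_cst _ _ _ (f z))).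
apply: cmean_bound; first exact: cont_onB cf (@cont_on_cst _ _ _ (f z)).
move=> t t01; apply: dP => //; first exact: seg_cball0.
rewrite -ball_normE /= normE ltcE /= imd eqxx /=.
have -> : z - seg z w t = - (rc t * (w - z)) by rewrite /seg; ring.
rewrite nmN nmM nm_rc; apply: le_lt_trans zw.
by rewrite ler_piMl ?nm_ge0 // ler_norml; lra.
Qed.

End Primitive.

(** * Cauchy integrals over the unit circle *)

Section CircleIntegral.
Implicit Types (g : R -> C).

Lemma cont_on_circV (A : set R) : cont_on A (fun t => (circ t)^-1).
Proof.
apply: cont_onV; last exact: cont_on_circ.
by move=> t _; exact: circ_neq0.
Qed.

Lemma circV t : (circ t)^-1 = circ (- t).
Proof.
apply: (mulfI (circ_neq0 t)); rewrite mulfV ?circ_neq0 // -circD subrr.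
by rewrite circ0.
Qed.

Lemma circ_nat n : circ n%:R = 1.
Proof. by rewrite -[n%:R]mulr1 -circX circ1 expr1n. Qed.

(** The dyadic sums are geometric sums over roots of unity, and they vanish exactly once 2^n exceeds
    k. *)
Lemma cmean_circX k : (0 < k)%N -> cmean (fun t => circ t ^+ k) = 0.
Proof.
move=> k0; apply: nm_small => e e0.
have cI : cont_on I (fun t => circ t ^+ k).
  by apply: cont_onX; exact: cont_on_circ.
have [N NP] := cmean_dyadic cI e0; have := NP (maxn N k) (leq_maxl _ _).
set n := maxn N k; have kn : (k < 2 ^ n)%N.
  by apply: leq_ltn_trans (leq_maxr N k) _; exact: ltn_expl.
rewrite (_ : \sum_(_ <= _ < _) _ = 0) ?mulr0 ?subr0 //.
pose q := circ (k%:R * 2 ^- n).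
have p2 : 0 < 2 ^+ n :> R by rewrite exprn_gt0.
have q1 : q - 1 != 0.
  rewrite subr_eq0; apply: circ_neq1; rewrite divr_gt0 ?ltr0n //=.
  by rewrite ltr_pdivrMr // mul1r -natrX ltr_nat.
apply: (mulfI q1); rewrite mulr0.
rewrite (eq_bigr (fun j => q ^+ j)); last first.
  by move=> j _; rewrite /q !circX mulrCA.
rewrite big_mkord -subrX1 /q circX natrX mulrCA mulfV ?gt_eqF // mulr1.
by rewrite circ_nat subrr.
Qed.

Lemma cmean_circV k : (0 < k)%N -> cmean (fun t => (circ t)^-1 ^+ k) = 0.
Proof.
move=> k0; rewrite -(cmean_circX k0) -[RHS]cmean_rev; last first.
  by apply: cont_onX; exact: cont_on_circ.
apply: cmean_ext => t _; rewrite circD -circV circ1 mul1r //.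
Qed.

Lemma circB_gt0 z t : nm z < 1 -> 0 < nm (circ t - z).
Proof. by move=> z1; have := nm_triB (circ t) z; rewrite nm_circ; lra. Qed.

Lemma circB_neq0 z t : nm z < 1 -> circ t - z != 0.
Proof. by move=> /(circB_gt0 t); rewrite nm_gt0. Qed.

Lemma cont_on_kernel z n : nm z < 1 ->
  cont_on I (fun t => circ t / (circ t - z) ^+ n).
Proof.
move=> z1; apply: cont_onM; first exact: cont_on_circ.
apply: cont_onV; first by move=> t _; rewrite expf_neq0 ?circB_neq0.
apply: cont_onX; apply: cont_onB; [exact: cont_on_circ|exact: cont_on_cst].
Qed.

(* n = 1 is the Cauchy integral of g over the unit circle. *)
Definition cauchy g n z : C :=
  cmean (fun t => g t * (circ t / (circ t - z) ^+ n)).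

Lemma cauchy_ext g g' n z : (forall t, 0 <= t <= 1 -> g t = g' t) ->
  cauchy g n z = cauchy g' n z.
Proof. by move=> gg'; apply: cmean_ext => t /gg' ->. Qed.

Lemma cont_cauchy g n z : cont_on I g -> nm z < 1 ->
  cont_on I (fun t => g t * (circ t / (circ t - z) ^+ n)).
Proof. by move=> gI z1; apply: cont_onM gI _; exact: cont_on_kernel. Qed.

(** The k-th Taylor coefficient at 0 of [cauchy g 1], see [cauchy_series]. *)
Definition ccoef g k : C := cmean (fun t => g t * (circ t)^-1 ^+ k).

Lemma cont_ccoef g k : cont_on I g -> cont_on I (fun t => g t * (circ t)^-1 ^+ k).
Proof. by move=> gI; apply: cont_onM gI _; apply: cont_onX; exact: cont_on_circV. Qed.

(** One step of the geometric series: the kernel is 1 / (1 - x) = 1 + x / (1 - x) with x = z / circ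
    t. *)
Lemma cauchy_step g z : cont_on I g -> nm z < 1 ->
  cauchy g 1 z = cmean g + z * cauchy (fun t => g t * (circ t)^-1) 1 z.
Proof.
move=> gI z1.
have gI' : cont_on I (fun t => g t * (circ t)^-1).
  by apply: cont_onM gI _; exact: cont_on_circV.
have c1 := @cont_cauchy _ 1 z gI' z1.
rewrite /cauchy -(cmeanZ z c1) -(cmeanD gI (cont_onM (@cont_on_cst _ _ I z) c1)).
apply: cmean_ext => t _; rewrite expr1; field.
by rewrite circ_neq0 circB_neq0.
Qed.

Lemma cauchy_expand g z K : cont_on I g -> nm z < 1 ->
  cauchy g 1 z = \sum_(0 <= k < K) ccoef g k * z ^+ k +
    z ^+ K * cauchy (fun t => g t * (circ t)^-1 ^+ K) 1 z.
Proof.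
move=> gI z1; elim: K => [|K IHK].
  rewrite big_geq // add0r expr0 mul1r; suff -> : (fun t => g t * (circ t)^-1 ^+ 0) =
    g by [].
  by apply/funext => t; rewrite expr0 mulr1.
rewrite IHK (cauchy_step (@cont_ccoef _ K gI) z1) big_nat_recr //= -addrA.
congr (_ + _); rewrite mulrDr mulrC; congr (_ + _).
rewrite mulrA -exprSr (@cauchy_ext _ (fun t => g t * (circ t)^-1 ^+ K.+1)) //.
by move=> t _; rewrite exprSr mulrA.
Qed.

Lemma cauchy_bound g z n M : cont_on I g -> nm z < 1 ->
  (forall t, 0 <= t <= 1 -> nm (g t) <= M) ->
  nm (cauchy g n z) <= M / (1 - nm z) ^+ n.
Proof.
move=> gI z1 gM; apply: cmean_bound; first exact: cont_cauchy.
move=> t t01; rewrite nmM nm_div nm_circ nmX mul1r.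
apply: ler_pM; rewrite ?nm_ge0 ?invr_ge0 ?exprn_ge0 ?nm_ge0 ?gM //.
rewrite lef_pV2 ?posrE ?exprn_gt0 ?circB_gt0 ?subr_gt0 //.
apply: lerXn2r; rewrite ?nnegrE ?nm_ge0 ?subr_ge0 //; first exact: ltW.
by have := nm_triB (circ t) z; rewrite nm_circ.
Qed.

Lemma cont_bound g : cont_on I g -> exists2 M, 0 <= M &
  forall t, 0 <= t <= 1 -> nm (g t) <= M.
Proof.
move=> gI; have [M MP] := compact_bound (@segment_compact R 0 1) (cont_on_nm gI).
have MP' t : 0 <= t <= 1 -> nm (g t) <= M.
  by move=> t01; apply: le_trans (ler_norm _) (MP _ _); rewrite /= in_itv.
exists M => //; apply: le_trans (nm_ge0 _) (MP' 0 _); lra.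
Qed.

Lemma exprn_small (x e M : R) : 0 <= x -> x < 1 -> 0 <= M -> 0 < e ->
  exists N, forall n, (N <= n)%N -> M * x ^+ n <= e.
Proof.
move=> x0 x1 M0 e0; have M1 : 0 < M + 1 by rewrite ltr_wpDl.
have /cvgrPdist_le/(_ _ (divr_gt0 e0 M1))[N _ NP] :
    (fun n : nat => x ^+ n) @ \oo --> 0 by apply: cvg_expr; rewrite ger0_norm.
exists N => n /NP; rewrite /= sub0r normrN ger0_norm ?exprn_ge0 //.
rewrite ler_pdivlMr // mulrC; apply: le_trans.
by rewrite ler_wpM2r ?exprn_ge0 // lerDl.
Qed.

Lemma cauchy_series g z : cont_on I g -> nm z < 1 -> forall e, 0 < e ->
  exists N, forall n, (N <= n)%N ->
    nm (cauchy g 1 z - \sum_(0 <= k < n) ccoef g k * z ^+ k) <= e.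
Proof.
move=> gI z1 e e0; have [M M0 MP] := cont_bound gI.
have z1' : 0 < 1 - nm z by rewrite subr_gt0.
have [N NP] := exprn_small (nm_ge0 z) z1 (divr_ge0 M0 (ltW z1')) e0.
exists N => n /NP; apply: le_trans.
rewrite (cauchy_expand n gI z1) addrAC subrr add0r nmM nmX mulrC.
rewrite ler_wpM2r ?exprn_ge0 ?nm_ge0 // -[1 - nm z]expr1.
apply: (@cauchy_bound _ z 1 M (@cont_ccoef _ n gI) z1).
by move=> t t01; rewrite nmM nmX nmV nm_circ invr1 expr1n mulr1; exact: MP.
Qed.

Lemma cauchy_cst1 z : nm z < 1 -> cauchy (fun=> 1) 1 z = 1.
Proof.
move=> z1; have I1 := @cont_on_cst R C I 1.
apply/eqP; rewrite -subr_eq0; apply/eqP/nm_small => e e0.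
have [N NP] := cauchy_series I1 z1 e0; have := NP N.+1 (leqnSn _).
rewrite big_nat_recl //= expr0 mulr1 big1 ?addr0; last first.
  move=> k _; rewrite /ccoef (_ : cmean _ = 0) ?mul0r // -(@cmean_circV k.+1) //.
  by apply: cmean_ext => t _; rewrite mul1r.
rewrite /ccoef (_ : cmean _ = 1) // -[RHS]cmean_cst.
by apply: cmean_ext => t _; rewrite expr0 mul1r.
Qed.

(** With u = circ t - z and h = w - z the remainder of the kernel is h^2 times u or 3 u - 2 h, for n
    = 0 or 1, divided by u^3 (u - h)^(n+1). Both u and h have modulus at most 2, hence the constant
    10. Orders 1 and 2 serve a primitive and its derivative. *)
Lemma cauchy_diff_bound g n (rho : R) : cont_on I g -> (n < 2)%N ->
  0 <= rho -> rho < 1 -> exists K : R, forall z w, nm z <= rho -> nm w <= rho ->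
  nm (cauchy g n.+1 w - cauchy g n.+1 z - n.+1%:R * cauchy g n.+2 z * (w - z))
    <= K * nm (w - z) ^+ 2.
Proof.
move=> gI n2 r0 r1; have [M M0 MP] := cont_bound gI.
pose s := 1 - rho; have s0 : 0 < s by rewrite subr_gt0.
exists (M * (10 / (s ^+ 3 * s ^+ n.+1))) => z w zr wr.
have z1 : nm z < 1 by exact: le_lt_trans r1.
have w1 : nm w < 1 by exact: le_lt_trans r1.
have cz := @cont_cauchy _ n.+1 z gI z1; have cz2 := @cont_cauchy _ n.+2 z gI z1.
have cw := @cont_cauchy _ n.+1 w gI w1.
have cz2' := cont_onM (@cont_on_cst _ _ I (n.+1%:R * (w - z))) cz2.
have -> : n.+1%:R * cauchy g n.+2 z * (w - z) =
    n.+1%:R * (w - z) * cauchy g n.+2 z by ring.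
rewrite /cauchy -(cmeanB cw cz) -(cmeanZ _ cz2) -(cmeanB (cont_onB cw cz) cz2').
apply: cmean_bound; first exact: cont_onB (cont_onB cw cz) cz2'.
move=> t t01; set u := circ t - z.
have uw : circ t - w = u - (w - z) by rewrite /u; ring.
have u0 : u != 0 by exact: circB_neq0.
have v0 : u - (w - z) != 0 by rewrite -uw; exact: circB_neq0.
have us : s <= nm u.
  by have := nm_triB (circ t) z; rewrite nm_circ /u /s; lra.
have vs : s <= nm (u - (w - z)).
  by rewrite -uw; have := nm_triB (circ t) w; rewrite nm_circ /s; lra.
have u2 : nm u <= 2.
  by apply: le_trans (nmB _ _) _; rewrite nm_circ; lra.
have h2 : nm (w - z) <= 2 by apply: le_trans (nmB _ _) _; lra.
set h := w - z in uw v0 vs h2 *.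
have -> : g t * (circ t / (circ t - w) ^+ n.+1) - g t * (circ t / u ^+ n.+1) -
   n.+1%:R * h * (g t * (circ t / u ^+ n.+2)) =
   g t * circ t * (h ^+ 2 *
     ((if n == 0%N then u else 3%:R * u - 2%:R * h) / (u ^+ 3 * (u - h) ^+ n.+1))).
  rewrite uw; case: n n2 {cz cz2 cw cz2'} => [|[|//]] _ /=; field;
    by rewrite u0 v0.
rewrite (nmM (g t * _)) (nmM (g t)) nm_circ mulr1 (nmM (h ^+ 2)) nmX -[leRHS]mulrA.
apply: ler_pM; rewrite ?mulr_ge0 ?sqr_ge0 ?nm_ge0 //; first exact: MP.
rewrite mulrC; apply: ler_wpM2r; rewrite ?sqr_ge0 //.
rewrite nm_div nmM !nmX.
apply: ler_pM; rewrite ?nm_ge0 ?invr_ge0 ?mulr_ge0 ?exprn_ge0 ?nm_ge0 //.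
  case: ifP => _; first by apply: le_trans u2 _; lra.
  apply: le_trans (nmB _ _) _; rewrite !nmM -!(rmorph_nat (@rc R)) !nm_rc !normr_nat.
  by lra.
rewrite lef_pV2 ?posrE ?mulr_gt0 ?exprn_gt0 ?nm_gt0 //.
have s0' := ltW s0.
by apply: ler_pM; rewrite ?exprn_ge0 //; apply: lerXn2r; rewrite ?nnegrE ?nm_ge0.
Qed.

(** Differentiability with a radius independent of the point: one k serves all sample points of a
    Riemann sum. *)
Definition udiff (A : set C) f d := forall e : R, 0 < e -> exists2 k : R, 0 < k &
  forall z w, A z -> A w -> nm (w - z) < k ->
    nm (f w - f z - d z * (w - z)) <= e * nm (w - z).

Lemma udiff_quadratic (A : set C) f d (K : R) :
  (forall z w, A z -> A w ->
     nm (f w - f z - d z * (w - z)) <= K * nm (w - z) ^+ 2) -> udiff A f d.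
Proof.
move=> fK e e0; have K1 : 0 < `|K| + 1 by rewrite ltr_wpDl.
exists (e / (`|K| + 1)); first by rewrite divr_gt0.
move=> z w Az Aw; rewrite ltr_pdivlMr // => zw; apply: le_trans (fK z w Az Aw) _.
rewrite expr2 mulrA ler_wpM2r ?nm_ge0 //; apply: le_trans (ltW zw).
rewrite mulrC ler_wpM2l ?nm_ge0 //; apply: le_trans (ler_norm K) _.
by rewrite lerDl.
Qed.

Lemma cauchy_udiff g n (rho : R) : cont_on I g -> (n < 2)%N -> 0 <= rho ->
  rho < 1 -> udiff (cball0 rho) (cauchy g n.+1)
    (fun z => n.+1%:R * cauchy g n.+2 z).
Proof.
move=> gI n2 r0 r1; have [K KP] := cauchy_diff_bound gI n2 r0 r1.
exact: udiff_quadratic KP.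
Qed.

Lemma udiff_cdiff (rho : R) f d z : udiff (cball0 rho) f d -> nm z < rho ->
  cdiff f z (d z).
Proof.
move=> fd zr e e0; have [k k0 kP] := fd _ e0.
exists (Num.min k (rho - nm z)); first by rewrite lt_min k0 subr_gt0.
move=> w; rewrite lt_min => /andP[wk wr]; apply: kP => //; rewrite /cball0 /=.
  exact: ltW.
by have := nm_triB w z; lra.
Qed.

Lemma cauchy_cdiff g n z : cont_on I g -> (n < 2)%N -> nm z < 1 ->
  cdiff (cauchy g n.+1) z (n.+1%:R * cauchy g n.+2 z).
Proof.
move=> gI n2 z1; pose rho := (nm z + 1) / 2; have := nm_ge0 z => z0.
apply: (@udiff_cdiff rho _ (fun z => n.+1%:R * cauchy g n.+2 z)).
  by apply: cauchy_udiff => //; rewrite /rho; lra.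
by rewrite /rho; lra.
Qed.

Lemma cdiff_unique f z a b : cdiff f z a -> cdiff f z b -> a = b.
Proof. by move=> /cdiff_cderiv <- /cdiff_cderiv <-. Qed.

(** The increment over [0, 1] telescopes into 2^n steps, each at most [e * 2 ^- n]. *)
Lemma const_of_small_increments (p : R -> C) :
  (forall e : R, 0 < e -> exists2 k : R, 0 < k & forall s t, 0 <= s <= 1 ->
     0 <= t <= 1 -> `|t - s| < k -> nm (p t - p s) <= e * `|t - s|) ->
  p 1 = p 0.
Proof.
move=> pe; apply/eqP; rewrite -subr_eq0; apply/eqP/nm_small => e e0.
have [k k0 kP] := pe _ e0; have [n nk] := exists_half_pow k0.
have p2 : 0 < 2 ^+ n :> R by rewrite exprn_gt0.
have -> : p 1 - p 0 = \sum_(0 <= j < 2 ^ n)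
    (p (j.+1%:R * 2 ^- n) - p (j%:R * 2 ^- n)).
  rewrite (telescope_sumr (fun j => p (j%:R * 2 ^- n))) // mul0r.
  by rewrite natrX mulfV ?gt_eqF.
apply: le_trans (nm_sum _ _ _) _.
apply: (@le_trans _ _ (\sum_(0 <= j < 2 ^ n) e * 2 ^- n)); last first.
  rewrite big_const_nat subn0 iter_addr_0 -[_ *+ (2 ^ n)]mulr_natr natrX.
  rewrite -mulrA mulVf ?gt_eqF //.
  by rewrite mulr1.
rewrite big_nat [leRHS]big_nat; apply: ler_sum => j /andP[_ jn].
have E : j.+1%:R * 2 ^- n - j%:R * 2 ^- n = 2 ^- n :> R.
  by rewrite -mulrBl -natr1 addrAC subrr add0r mul1r.
have := kP (j%:R * 2 ^- n) (j.+1%:R * 2 ^- n).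
rewrite E ger0_norm ?invr_ge0 ?exprn_ge0 //; apply => //.
  rewrite divr_ge0 ?exprn_ge0 //= ler_pdivrMr // mul1r -natrX ler_nat.
  exact: ltnW.
by rewrite divr_ge0 ?exprn_ge0 //= ler_pdivrMr // mul1r -natrX ler_nat.
Qed.

Section CauchyFormula1.
Variables (F f : C -> C).
Let A := cball0 (1 : R).
Hypotheses (Fd : udiff A F f) (fA : cont_on A f).

Lemma circle_seg z s t : nm z < 1 -> 0 <= s <= 1 -> A (seg z (circ t) s).
Proof.
by move=> z1 s01; apply: seg_cball0 => //; rewrite /cball0 /mkset ?nm_circ // ltW.
Qed.

Lemma cont_circle_seg (h : C -> C) z s : cont_on A h -> nm z < 1 -> 0 <= s <= 1 ->
  cont_on I (fun t => h (seg z (circ t) s)).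
Proof.
move=> hA z1 s01; apply: (@cont_on_comp _ _ _ I A h (fun t => seg z (circ t) s)) hA.
  by move=> t _; exact: circle_seg.
apply: cont_onD; first exact: cont_on_cst.
apply: cont_onM; first exact: cont_on_cst.
by apply: cont_onB; [exact: cont_on_circ|exact: cont_on_cst].
Qed.

(** Up to the factor 2 pi i s this is the integral of F' = f along the closed loop (1 - s) z + s
    e^(2 pi i t). Its Riemann sums are uniformly close to the telescoping sum of the increments of
    F, which is zero. *)
Lemma loop_integral z s : nm z < 1 -> 0 < s <= 1 ->
  cmean (fun t => f (seg z (circ t) s) * circ t) = 0.
Proof.
move=> z1 /andP[s0 s1]; have s01 : 0 <= s <= 1 by rewrite ltW.
apply: nm_small => e e0; have e20 : 0 < e / 2 by rewrite divr_gt0.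
have cI : cont_on I (fun t => f (seg z (circ t) s) * circ t).
  exact: cont_onM (cont_circle_seg fA z1 s01) (@cont_on_circ _ _).
have [N NP] := cmean_dyadic cI e20; have [k k0 kP] := Fd e20.
have [m m0 mP] : exists2 m : R, 0 < m & forall t, `|t| < m -> nm (circ t - 1) < k.
  have /cont_onCP/(_ 0 Logic.I _ k0) := @cont_on_circ R setT.
  move=> /nbhs_ballP[m m0 mP]; exists m => // t tm; rewrite -circ0; apply: mP => //.
  by rewrite -ball_normE /= sub0r normrN.
have [M mM] := exists_half_pow m0.
(* [M.+1] forces n > 0, so that [2 ^- n] is less than 1 and q differs from 1. *)
have := NP (maxn N M.+1) (leq_maxl _ _); set n := maxn N M.+1.
set S := \sum_(_ <= _ < _) _ => nS.
have p2 : 0 < 2 ^+ n :> R by rewrite exprn_gt0.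
have h0 : 0 < 2 ^- n :> R by rewrite invr_gt0.
pose q := circ (2 ^- n).
have q1 : q - 1 != 0.
  rewrite subr_eq0; apply: circ_neq1; rewrite h0 invf_lt1 // exprn_egt1 ?ltr1n //.
  by rewrite -lt0n (leq_trans _ (leq_maxr _ _)).
have qk : nm (q - 1) < k.
  apply: mP; rewrite ger0_norm ?ltW //; apply: le_lt_trans mM.
  rewrite lef_pV2 ?posrE ?exprn_gt0 // ler_eXn2l ?ltr1n //.
  by rewrite (leq_trans _ (leq_maxr _ _)).
pose p j := seg z (circ (j%:R * 2 ^- n)) s.
have pA j : A (p j) by exact: circle_seg.
have pS j : p j.+1 - p j = rc s * (q - 1) * circ (j%:R * 2 ^- n).
  rewrite /p /seg -natr1 mulrDl mul1r circD /q; ring.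
have tel : \sum_(0 <= j < 2 ^ n) (F (p j.+1) - F (p j)) = 0.
  rewrite (telescope_sumr (fun j => F (p j))) // /p natrX mulfV ?gt_eqF // mul0r.
  by rewrite circ0 circ1 subrr.
have SE : rc s * (q - 1) * S = - \sum_(0 <= j < 2 ^ n)
    (F (p j.+1) - F (p j) - f (p j) * (p j.+1 - p j)).
  rewrite sumrB tel sub0r opprK mulr_sumr; apply: eq_bigr => j _.
  by rewrite pS /p; ring.
have sq0 : 0 < s * nm (q - 1) by rewrite mulr_gt0 ?nm_gt0.
have Sb : nm S <= e / 2 * 2 ^+ n.
  rewrite -(ler_pM2l sq0) -{1}(ger0_norm (ltW s0)) -(nm_rc s) -!nmM SE nmN.
  apply: le_trans (nm_sum _ _ _) _.
  apply: (@le_trans _ _ (\sum_(0 <= j < 2 ^ n) e / 2 * (s * nm (q - 1)))).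
    apply: ler_sum => j _; have := kP _ _ (pA j) (pA j.+1).
    rewrite pS !nmM nm_circ mulr1 nm_rc (ger0_norm (ltW s0)); apply.
    by apply: le_lt_trans qk; rewrite ler_piMl ?nm_ge0.
  rewrite big_const_nat subn0 iter_addr_0 -[_ *+ (2 ^ n)]mulr_natr natrX.
  by rewrite le_eqVlt; apply/orP; left; apply/eqP; ring.
have : nm (rc (2 ^- n) * S) <= e / 2.
  by rewrite nmM nm_rc (ger0_norm (ltW h0)) mulrC ler_pdivrMr.
have := nm_tri (rc (2 ^- n) * S) (cmean (fun t => f (seg z (circ t) s) * circ t)) 0.
by rewrite !subr0 => H1 H2; apply: le_trans H1 _; lra.
Qed.

(** The circle is contracted to z along the loops (1 - s) z + s e^(2 pi i t). At s = 0 the Cauchy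
    integral is F z. Its derivative in s is the mean in [loop_integral], because the factor
    [circ t - z] of the velocity cancels the kernel, and so it vanishes. *)
Lemma cauchy_formula1 z : nm z < 1 -> F z = cauchy (fun t => F (circ t)) 1 z.
Proof.
move=> z1.
have FA : cont_on A F.
  apply/cont_onCP => w Aw e e0; have [k k0 kP] := Fd ltr01.
  have L0 : 0 < 1 + nm (f w) by rewrite ltr_pwDl ?nm_ge0.
  apply/nearC; exists (Num.min k (e / (1 + nm (f w)))).
    by rewrite lt_min k0 divr_gt0.
  move=> v; rewrite lt_min ltr_pdivlMr // => /andP[vk ve] Av.
  have := kP _ _ Aw Av vk; rewrite mul1r => H.
  have := nmD (F v - F w - f w * (v - w)) (f w * (v - w)); rewrite subrK nmM.
  by nra.
pose Phi s := cauchy (fun t => F (seg z (circ t) s)) 1 z.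
have P1 : Phi 1 = cauchy (fun t => F (circ t)) 1 z.
  by apply: cauchy_ext => t _; congr F; rewrite /seg rc1; ring.
have P0 : Phi 0 = F z.
  rewrite -[RHS]mulr1 -(cauchy_cst1 z1).
  have c1 := @cont_cauchy _ 1 z (@cont_on_cst R C I 1) z1.
  rewrite /cauchy -(cmeanZ (F z) c1); apply: cmean_ext => t _.
  by rewrite /seg rc0 mul0r addr0 mul1r.
rewrite -P0 -P1; apply/esym/const_of_small_increments => e e0.
have [k k0 kP] := Fd e0; have k2 : 0 < k / 2 by rewrite divr_gt0.
exists (k / 2) => // s t s01 t01 st.
have cs := cont_circle_seg FA z1 s01; have ct := cont_circle_seg FA z1 t01.
have cfs := cont_circle_seg fA z1 s01.
have ks := @cont_cauchy _ 1 z cs z1; have kt := @cont_cauchy _ 1 z ct z1.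
have L : cmean (fun u => f (seg z (circ u) s) * circ u) = 0.
  (* At s = 0 the loop is the point z, and the mean is f z times the mean of [circ]. *)
  have [s0|s0] := eqVneq s 0; last by apply: loop_integral => //; rewrite lt_def s0;
    lra.
  rewrite s0 -[RHS](mulr0 (f z)) -(@cmean_circX 1) // -cmeanZ; last first.
    by apply: cont_onX; exact: cont_on_circ.
  by apply: cmean_ext => u _; rewrite /seg rc0 mul0r addr0.
have cL : cont_on I (fun u => f (seg z (circ u) s) * circ u).
  exact: cont_onM cfs (@cont_on_circ _ _).
have cL' := cont_onM (@cont_on_cst _ _ I (rc (t - s))) cL.
rewrite -[X in nm X]subr0 -(mulr0 (rc (t - s))) -L -(cmeanZ _ cL).
rewrite -(cmeanB kt ks) -(cmeanB (cont_onB kt ks) cL').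
apply: cmean_bound; first exact: cont_onB (cont_onB kt ks) cL'.
move=> u _; have cu0 := circB_neq0 u z1; have cup := circB_gt0 u z1.
set P := seg z (circ u) s; set Q := seg z (circ u) t.
have QP : Q - P = rc (t - s) * (circ u - z).
  by rewrite /Q /P /seg rcB; ring.
have -> : F Q * (circ u / (circ u - z) ^+ 1) - F P * (circ u / (circ u - z) ^+ 1) -
    rc (t - s) * (f P * circ u) =
    (F Q - F P - f P * (Q - P)) * circ u / (circ u - z).
  by rewrite QP expr1; field.
rewrite nm_div nmM nm_circ mulr1 ler_pdivrMr //.
have -> : e * `|t - s| * nm (circ u - z) = e * nm (Q - P).
  by rewrite QP nmM nm_rc mulrA.
apply: kP; [exact: circle_seg..|].
rewrite QP nmM nm_rc.
have : nm (circ u - z) <= 2.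
  by apply: le_trans (nmB _ _) _; rewrite nm_circ; lra.
by have := normr_ge0 (t - s); nra.
Qed.

End CauchyFormula1.

End CircleIntegral.

End CauchyFormula.

(** * Holomorphic functions *)

Section Holomorphic.
Variable R : realType.
Local Notation C := (Cplx R).
Local Notation I := (`[0, 1]%classic : set R).
Local Notation circ := (@circ R).
Implicit Types (f F : C -> C) (a b c z w : C).

(** The difference quotient between z and w is close to d z and, read backwards, to d w. *)
Lemma udiff_cont (r : R) f d : 0 < r ->
  udiff (cball0 r) f d -> cont_on (cball0 r) d.
Proof.
move=> r0 fd; apply/cont_onCP => z Az e e0.
have [k k0 kP] := fd _ (divr_gt0 e0 (ltr0n R 4)).
apply/nearC; exists k => // w wz Aw.
have [->|zw] := eqVneq w z; first by rewrite subrr nm0.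
have h0 : 0 < nm (w - z) by rewrite nm_gt0 subr_eq0.
have H1 := kP _ _ Az Aw wz; have H2 := kP _ _ Aw Az; rewrite nmC in H2.
have {}H2 := H2 wz.
have E : (d w - d z) * (w - z) =
  (f w - f z - d z * (w - z)) + (f z - f w - d w * (z - w)) by ring.
rewrite -(ltr_pM2r h0) -nmM E; apply: le_lt_trans (nmD _ _) _.
by nra.
Qed.

Lemma cdiff_affine a b z : cdiff (fun w => a + b * w) z b.
Proof.
have := cdiffD (cdiff_cst a z) (cdiffZ b (cdiff_id z)).
by rewrite mulr1 add0r.
Qed.

Section CauchyFormulaDisc.
Variables (f : C -> C) (a : C) (r : R).
Hypothesis r0 : 0 < r.
Hypothesis fd : forall z, nm (z - a) <= r -> exists d, cdiff f z d.

(** [cauchy_formula1] needs a continuous derivative, which is not known for f. It is applied to a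
    primitive F, so that f = F' becomes a Cauchy integral of order 2; that integral is uniformly
    differentiable on the half disc, where [cauchy_formula1] applies to f itself. This is the origin
    of r / 2. *)
Lemma cauchy_formula : cont_on I (fun t => f (a + rc (r / 2) * circ t)) /\
  forall z, nm z < 1 ->
    f (a + rc (r / 2) * z) = cauchy (fun t => f (a + rc (r / 2) * circ t)) 1 z.
Proof.
pose f1 z := f (a + rc r * z); pose A := cball0 (1 : R).
have f1d z : A z -> exists d, cdiff f1 z d.
  move=> Az; have [|d dP] := fd (_ : nm (a + rc r * z - a) <= r).
    by rewrite addrAC subrr add0r nmM nm_rc gtr0_norm // ler_piMr // ltW.
  by exists (d * rc r); exact: (@cdiff_comp _ f (fun w => a + rc r * w) _ _ _
    (cdiff_affine _ _ _) dP).
have f1A := cdiff_cball_cont f1d.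
pose F := primitive f1; have Fd : udiff A F f1.
  by move=> e e0; exact: (primitive_udiff ler01 f1d).
have FA : cont_on I (fun t => F (circ t)).
  have -> : (fun t => F (circ t)) = fun t => F (seg 0 (circ t) 1).
    by apply/funext => t; congr F; rewrite /seg rc1; ring.
  apply: (@cont_circle_seg _ F 0 1); [|by rewrite nm0 ltr01|by rewrite lexx ler01].
  apply/cont_onCP => w Aw e e0; have [k k0 kP] := Fd _ ltr01.
  have L0 : 0 < 1 + nm (f1 w) by rewrite ltr_pwDl ?nm_ge0.
  apply/nearC; exists (Num.min k (e / (1 + nm (f1 w)))).
    by rewrite lt_min k0 divr_gt0.
  move=> v; rewrite lt_min ltr_pdivlMr // => /andP[vk ve] Av.
  have := kP _ _ Aw Av vk; rewrite mul1r => H.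
  have := nmD (F v - F w - f1 w * (v - w)) (f1 w * (v - w)); rewrite subrK nmM.
  by nra.
pose g := fun t => F (circ t).
have FE z : nm z < 1 -> F z = cauchy g 1 z := cauchy_formula1 Fd f1A (z:=z).
have f1E z : nm z < 1 -> f1 z = cauchy g 2 z.
  move=> z1; have := @cauchy_cdiff _ g 0 z FA isT z1; rewrite mul1r.
  apply: cdiff_unique; apply: (@cdiff_near _ F _ _ _ (1 - nm z)).
  - by rewrite subr_gt0.
  - by move=> w wz; apply: FE; have := nm_triB w z; lra.
  - exact: udiff_cdiff Fd z1.
pose f2 z := f1 (z / 2).
have h2 z : nm (z / 2) = nm z / 2.
  by rewrite nm_div -(rmorph_nat (@rc R)) nm_rc normr_nat.
have f2d : udiff A f2 (fun z => 2%:R * cauchy g 3 (z / 2) / 2).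
  move=> e e0; have h01 : 0 <= (2^-1 : R) by rewrite invr_ge0.
  have h1 : (2^-1 : R) < 1 by rewrite invf_lt1 // ltr1n.
  have [k k0 kP] := @cauchy_udiff _ g 1 _ FA isT h01 h1 e e0.
  exists k => // z w; rewrite /A /cball0 /mkset => Az Aw zw.
  have hB u v : u / 2 - v / 2 = (u - v) / 2 :> C by rewrite mulrBl.
  have := kP (z / 2) (w / 2); rewrite /cball0 /mkset !h2 hB h2 /f2.
  have zw0 := nm_ge0 (w - z).
  rewrite !f1E ?h2; [|lra..] => H; apply: le_trans (le_trans (H _ _ _) _); try lra.
    by rewrite le_eqVlt; apply/orP; left; apply/eqP; congr nm; ring.
  by rewrite ler_pM2l //; lra.
have f2A := udiff_cont ltr01 f2d.
have f2E z : f (a + rc (r / 2) * z) = f2 z.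
  by rewrite /f2 /f1 rcM rc_half; congr f; ring.
split.
  apply: (@cont_on_ext _ _ _ (fun t => f1 (seg 0 (circ t) 2^-1))).
    by move=> t _; rewrite f2E /f2; congr f1; rewrite /seg rc_half; ring.
  by apply: cont_circle_seg => //; rewrite ?nm0 //; lra.
move=> z z1; rewrite f2E (cauchy_formula1 f2d f2A z1).
by apply: cauchy_ext => t _; rewrite f2E.
Qed.

End CauchyFormulaDisc.

(** Differentiability on a whole neighbourhood of a, whereas [holomorphic_at] concerns the point
    alone. *)
Definition hol f a := exists2 r : R, 0 < r &
  forall z, nm (z - a) < r -> exists d, cdiff f z d.

Lemma hol_cdiff f a : hol f a -> exists d, cdiff f a d.
Proof. by move=> [r r0 rP]; apply: rP; rewrite subrr nm0. Qed.

Lemma hol_near f g a (k : R) : 0 < k ->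
  (forall w, nm (w - a) < k -> f w = g w) -> hol f a -> hol g a.
Proof.
move=> k0 fg [r r0 rP]; exists (Num.min k r); first by rewrite lt_min k0.
move=> z; rewrite lt_min => /andP[zk /rP[d dP]]; exists d.
apply: (@cdiff_near _ f _ _ _ (k - nm (z - a))) dP; first by rewrite subr_gt0.
by move=> w wz; apply: fg; apply: le_lt_trans (nm_tri z _ _) _; lra.
Qed.

Lemma hol_open f a : hol f a ->
  exists2 r : R, 0 < r & forall z, nm (z - a) < r -> hol f z.
Proof.
move=> [r r0 rP]; exists r => // z za; exists (r - nm (z - a)).
  by rewrite subr_gt0.
by move=> w wz; apply: rP; apply: le_lt_trans (nm_tri z _ _) _; lra.
Qed.

Lemma hol_cst b a : hol (fun=> b) a.
Proof. by exists 1 => // z _; exists 0; exact: cdiff_cst. Qed.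

Lemma hol_id a : hol (fun z => z) a.
Proof. by exists 1 => // z _; exists 1; exact: cdiff_id. Qed.

Lemma holD f g a : hol f a -> hol g a -> hol (fun z => f z + g z) a.
Proof.
move=> [r r0 rP] [s s0 sP]; exists (Num.min r s); first by rewrite lt_min r0.
move=> z; rewrite lt_min => /andP[/rP[d dP] /sP[e eP]].
by exists (d + e); exact: cdiffD.
Qed.

Lemma holN f a : hol f a -> hol (fun z => - f z) a.
Proof. by move=> [r r0 rP]; exists r => // z /rP[d dP]; exists (- d); exact: cdiffN.
  Qed.

Lemma holB f g a : hol f a -> hol g a -> hol (fun z => f z - g z) a.
Proof. by move=> fa ga; exact: holD fa (holN ga). Qed.

Lemma holM f g a : hol f a -> hol g a -> hol (fun z => f z * g z) a.
Proof.
move=> [r r0 rP] [s s0 sP]; exists (Num.min r s); first by rewrite lt_min r0.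
move=> z; rewrite lt_min => /andP[/rP[d dP] /sP[e eP]].
by eexists; exact: cdiffM dP eP.
Qed.

Lemma hol_continuous f a : hol f a -> forall e, 0 < e ->
  exists2 k : R, 0 < k & forall w, nm (w - a) < k -> nm (f w - f a) < e.
Proof. by move=> /hol_cdiff[d]; exact: cdiff_continuous. Qed.

Lemma hol_neq0 f a : hol f a -> f a != 0 ->
  exists2 k : R, 0 < k & forall w, nm (w - a) < k -> f w != 0.
Proof.
move=> fa fa0; have n0 : 0 < nm (f a) by rewrite nm_gt0.
have [k k0 kP] := hol_continuous fa n0; exists k => // w /kP.
by apply: contraTneq => ->; rewrite sub0r nmN ltxx.
Qed.

Lemma holV f a : hol f a -> f a != 0 -> hol (fun z => (f z)^-1) a.
Proof.
move=> fa fa0; have [k k0 kP] := hol_neq0 fa fa0; have [r r0 rP] := fa.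
exists (Num.min k r); first by rewrite lt_min k0.
move=> z; rewrite lt_min => /andP[/kP z0 /rP[d dP]].
by eexists; exact: cdiffV dP.
Qed.

Lemma holX f a n : hol f a -> hol (fun z => f z ^+ n) a.
Proof.
by move=> [r r0 rP]; exists r => // z /rP[d dP]; eexists; exact: cdiffX dP.
Qed.

Lemma hol_comp f g a : hol g a -> hol f (g a) -> hol (fun z => f (g z)) a.
Proof.
move=> ga [s s0 sP]; have [k k0 kP] := hol_continuous ga s0.
have [r r0 rP] := ga; exists (Num.min k r); first by rewrite lt_min k0.
move=> z; rewrite lt_min => /andP[/kP/sP[e eP] /rP[d dP]].
by eexists; exact: cdiff_comp dP eP.
Qed.

Lemma hol_cauchy f a : hol f a -> exists2 r : R, 0 < r &
  forall s : R, 0 < s <= r -> cont_on I (fun t => f (a + rc s * circ t)) /\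
    forall z, nm z < 1 ->
      f (a + rc s * z) = cauchy (fun t => f (a + rc s * circ t)) 1 z.
Proof.
(* The circle of radius s arises from [cauchy_formula] on the disc of radius 2 s, and 2 s <= 2 r / 3
   < r. *)
move=> [r r0 rP]; exists (r / 3); first by rewrite divr_gt0.
move=> s /andP[s0 sr]; have s2 : 0 < 2 * s by rewrite mulr_gt0.
have fd z : nm (z - a) <= 2 * s -> exists d, cdiff f z d.
  by move=> zs; apply: rP; lra.
by have := cauchy_formula s2 fd; rewrite (_ : 2 * s / 2 = s) //; field.
Qed.

Lemma hol_cauchy1 f a : hol f a -> exists s : R, exists2 g : R -> C,
  0 < s /\ cont_on I g &
  forall w, nm (w - a) < s -> f w = cauchy g 1 ((w - a) / rc s).
Proof.
move=> /hol_cauchy[s s0 /(_ s)]; rewrite s0 lexx => /(_ isT)[gI gE].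
exists s, (fun t => f (a + rc s * circ t)) => // w ws.
have sn : rc s != 0 by rewrite -nm_gt0 nm_rc gtr0_norm.
rewrite -gE; first by congr f; field.
by rewrite nm_div nm_rc gtr0_norm // ltr_pdivrMr // mul1r.
Qed.

Lemma hol_mean f a : hol f a -> exists2 r : R, 0 < r &
  forall s : R, 0 < s <= r -> cont_on I (fun t => f (a + rc s * circ t)) /\
    cmean (fun t => f (a + rc s * circ t)) = f a.
Proof.
move=> /hol_cauchy[r r0 rP]; exists r => // s /rP[fI fE]; split => //.
have := fE 0; rewrite nm0 mulr0 addr0 => ->; last exact: ltr01.
by apply: cmean_ext => t _; rewrite subr0 expr1 mulfV ?circ_neq0 ?mulr1.
Qed.

Lemma cauchy_hol (g : R -> C) z n : cont_on I g -> (n < 2)%N -> nm z < 1 ->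
  hol (cauchy g n.+1) z.
Proof.
move=> gI n2 z1; exists (1 - nm z); first by rewrite subr_gt0.
move=> w wz; eexists; apply: cauchy_cdiff => //.
by have := nm_triB w z; lra.
Qed.

Lemma hol_scaled f a (s : R) : hol f 0 -> hol (fun w => f ((w - a) / rc s)) a.
Proof.
move=> f0; apply: (@hol_comp f (fun w => (w - a) / rc s)).
  by apply: holM (hol_cst _ _); apply: holB (hol_id _) (hol_cst _ _).
by rewrite subrr mul0r.
Qed.

Lemma hol_deriv f a : hol f a -> hol (cderiv f) a.
Proof.
move=> /hol_cauchy1[s [g [s0 gI] gE]].
have sn : rc s != 0 by rewrite -nm_gt0 nm_rc gtr0_norm.
apply: (@hol_near (fun w => cauchy g 2 ((w - a) / rc s) / rc s) _ _ s) => //.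
  move=> w ws; apply/esym/cdiff_cderiv.
  apply: (@cdiff_near _ (fun w => cauchy g 1 ((w - a) / rc s)) _ _ _ (s - nm (w - a))).
  - by rewrite subr_gt0.
  - by move=> v vw; rewrite gE //; apply: le_lt_trans (nm_tri w _ _) _; lra.
  have w1 : nm ((w - a) / rc s) < 1.
    by rewrite nm_div nm_rc gtr0_norm // ltr_pdivrMr // mul1r.
  have := @cauchy_cdiff _ g 0 _ gI isT w1; rewrite mul1r.
  apply: (@cdiff_comp _ _ (fun w => (w - a) / rc s)).
  have -> : (fun w => (w - a) / rc s) = fun w => - a / rc s + (rc s)^-1 * w.
    by apply/funext => v; ring.
  exact: cdiff_affine.
apply: holM (hol_cst _ _); apply: hol_scaled; apply: cauchy_hol => //.
by rewrite nm0.
Qed.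

Lemma hol_cderiv f a : hol f a -> cdiff f a (cderiv f a).
Proof. by move=> /hol_cdiff[d dP]; rewrite (cdiff_cderiv dP). Qed.

Lemma cauchy_vanish (g : R -> C) k : cont_on I g ->
  (forall j, (j < k)%N -> ccoef g j = 0) -> forall z, nm z < 1 ->
  cauchy g 1 z = z ^+ k * cauchy (fun t => g t * (circ t)^-1 ^+ k) 1 z.
Proof.
move=> gI g0 z z1; rewrite (cauchy_expand k gI z1) big_nat big1 ?add0r //.
by move=> j /andP[_ jk]; rewrite g0 ?mul0r.
Qed.

Lemma cauchy0 (g : R -> C) : cauchy g 1 0 = cmean g.
Proof. by apply: cmean_ext => t _; rewrite subr0 expr1 mulfV ?circ_neq0 ?mulr1. Qed.

Lemma ccoef0 (g : R -> C) : ccoef g 0 = cmean g.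
Proof. by apply: cmean_ext => t _; rewrite expr0 mulr1. Qed.

(** k is the first index with a nonzero Taylor coefficient; if there is none, the Taylor series
    shows that f is zero near a. *)
Lemma hol_order f a : hol f a ->
  (exists2 r : R, 0 < r & forall w, nm (w - a) < r -> f w = 0) \/
  exists k g, [/\ hol g a, g a != 0 & exists2 r : R, 0 < r &
    forall w, nm (w - a) < r -> f w = (w - a) ^+ k * g w].
Proof.
move=> /hol_cauchy1[s [g [s0 gI] gE]].
have sn : rc s != 0 by rewrite -nm_gt0 nm_rc gtr0_norm.
have w1 w : nm (w - a) < s -> nm ((w - a) / rc s) < 1.
  by move=> ws; rewrite nm_div nm_rc gtr0_norm // ltr_pdivrMr // mul1r.
have [[k gk]|/forallNP g0] := pselect (exists k, ccoef g k != 0); last first.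
  left; exists s => // w ws; rewrite gE //; apply: nm_small => e e0.
  have [N NP] := cauchy_series gI (w1 w ws) e0; have := NP N (leqnn _).
  rewrite big1 ?subr0 // => j _; have /negP/negPn/eqP -> := g0 j.
  by rewrite mul0r.
right; case: (@ex_minnP (fun k => ccoef g k != 0)); first by exists k.
move=> {gk}k gk kmin; pose g' t := g t * (circ t)^-1 ^+ k.
have g'I : cont_on I g' by exact: cont_ccoef.
exists k, (fun w => (rc s) ^- k * cauchy g' 1 ((w - a) / rc s)); split.
- apply: holM (hol_cst _ _) _; apply: (@hol_scaled (cauchy g' 1)).
  by apply: cauchy_hol => //; rewrite nm0.
- rewrite subrr mul0r cauchy0 mulf_neq0 ?invr_eq0 ?expf_neq0 //.
exists s => // w ws; rewrite gE // (@cauchy_vanish g k gI) ?w1 //; last first.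
  move=> j; rewrite ltnNge; apply: contraNeq; exact: kmin.
by rewrite expr_div_n mulrA.
Qed.

Lemma hol_taylor g a : hol g a -> exists s : R, exists2 c : nat -> C,
  0 < s /\ c 0 = g a & forall t, nm t < s ->
    (fun n => \sum_(0 <= m < n) c m * t ^+ m) @ \oo --> g (a + t).
Proof.
move=> /hol_cauchy1[s [h [s0 hI] hE]].
have sn : rc s != 0 by rewrite -nm_gt0 nm_rc gtr0_norm.
exists s, (fun m => ccoef h m / rc s ^+ m).
  split=> //; rewrite expr0 divr1 ccoef0 -cauchy0 hE ?subrr ?mul0r //.
  by rewrite nm0.
move=> t ts; have t1 : nm (t / rc s) < 1.
  by rewrite nm_div nm_rc gtr0_norm // ltr_pdivrMr // mul1r.
have -> : g (a + t) = cauchy h 1 (t / rc s).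
  by rewrite hE addrAC subrr add0r.
apply/cvgC => e e0; have [N NP] := cauchy_series hI t1 (divr_gt0 e0 (ltr0n R 2)).
exists N => // n /= /NP nP.
rewrite (eq_bigr (fun k => ccoef h k * (t / rc s) ^+ k)); last first.
  by move=> k _; rewrite expr_div_n mulrAC mulrA.
by rewrite nmC; apply: le_lt_trans nP _; lra.
Qed.

Lemma hol_laurent f g a k (r : R) : hol g a -> 0 < r ->
  (forall t, t != 0 -> nm t < r -> f t = t ^- k * g (a + t)) ->
  exists c : int -> C, [/\ laurent_expansion c f, forall n : int, n < - k%:Z -> c n = 0
    & c (- k%:Z) = g a].
Proof.
move=> /hol_taylor[s [c [s0 c0] cP]] r0 fE.
pose c' (n : int) : C := if n < - k%:Z then 0 else c (absz (n + k%:Z)).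
exists c'; split; first last.
- by rewrite /c' ltxx addNr absz0.
- by move=> n nk; rewrite /c' nk.
exists k; split; first by move=> n nk; rewrite /c' nk.
apply/dnearC; exists (Num.min r s); first by rewrite lt_min r0.
move=> t t0; rewrite subr0 lt_min => /andP[tr ts]; rewrite fE //.
have : (fun n => t ^- k * \sum_(0 <= m < n) c m * t ^+ m) @ \oo -->
    t ^- k * g (a + t) by apply: cvgMr; exact: cP.
apply: cvg_trans.
apply: near_eq_cvg; apply: nearW => n; rewrite /series /= mulr_sumr.
apply: eq_bigr => m _; rewrite /c' ifN; last by rewrite -leNgt; lia.
rewrite subrK absz_nat expfzDr // mulrCA; congr (_ * _).
by rewrite mulrC -exprnP exprnN.
Qed.

Lemma geometric_le2 (x : R) n : 0 <= x <= 1 / 2 ->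
  \sum_(0 <= m < n) x ^+ m <= 2.
Proof.
move=> /andP[x0 x1]; have h : 0 < 1 - x by lra.
rewrite -(ler_pM2l h) big_mkord -[1 - x]opprB mulNr -subrX1 opprB.
by have := exprn_ge0 n x0; lra.
Qed.

(** Convergence at one radius s bounds all terms there by some B. At the smaller radius x s the
    first nonzero term then dominates the rest of the series. *)
Lemma pseries_eq0 (b : nat -> C) (r : R) : 0 < r ->
  (forall t, t != 0 -> nm t < r ->
     (fun n => \sum_(0 <= m < n) b m * t ^+ m) @ \oo --> (0 : C)) ->
  forall m, b m = 0.
Proof.
move=> r0 bP; pose s := r / 2; have s0 : 0 < s by rewrite divr_gt0.
have sn : rc s != 0 by rewrite -nm_gt0 nm_rc gtr0_norm.
have [N NP] : exists N, forall n, (N <= n)%N -> nm (b n * rc s ^+ n) <= 2.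
  have sr : nm (rc s) < r by rewrite nm_rc gtr0_norm // /s; lra.
  have /cvgC bs := bP (rc s) sn sr; have [N _ NP] := bs 1 ltr01.
  exists N => n Nn; have {1}-> : b n * rc s ^+ n =
      \sum_(0 <= m < n.+1) b m * rc s ^+ m - \sum_(0 <= m < n) b m * rc s ^+ m.
    by rewrite big_nat_recr //= addrAC subrr add0r.
  have := NP n Nn; have := NP n.+1 (leqW Nn); rewrite /= !subr0 => h1 h2.
  apply: le_trans (nmB _ _) _; lra.
have [B B0 BP] : exists2 B, 0 <= B & forall n, nm (b n * rc s ^+ n) <= B.
  exists (\sum_(0 <= m < N) nm (b m * rc s ^+ m) + 2).
    by rewrite addr_ge0 // sumr_ge0 // => m _; exact: nm_ge0.
  move=> n; have [Nn|nN] := leqP N n.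
    by apply: le_trans (NP n Nn) _; rewrite lerDr sumr_ge0 // => m _; exact: nm_ge0.
  rewrite big_mkord (bigD1 (Ordinal nN)) //= -addrA lerDl addr_ge0 //.
  by rewrite sumr_ge0 // => m _; exact: nm_ge0.
apply: contrapT => /existsNP[k0 bk0].
have exk : exists k, b k != 0 by exists k0; exact/eqP.
have [k bk kmin] := ex_minnP exk.
pose D := nm (b k) * s ^+ k; have D0 : 0 < D by rewrite mulr_gt0 ?nm_gt0 ?exprn_gt0.
(* x <= 1/2 bounds the geometric tail by 2, and the second bound makes that tail at most half of the
   leading term [D * x ^+ k]. A quarter of it is left for the distance between a partial sum and its
   limit. *)
pose x := Num.min (1 / 2) (D / (4 * (B + 1))).
have B1 : 0 < 4 * (B + 1) by rewrite mulr_gt0 // ltr_wpDl.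
have x0 : 0 < x by rewrite lt_min !divr_gt0.
have x1 : x <= 1 / 2 by rewrite ge_min lexx.
have xD : x * (4 * (B + 1)) <= D.
  by rewrite -ler_pdivlMr // ge_min lexx orbT.
pose t := rc (x * s); have nt : nm t = x * s by rewrite nm_rc gtr0_norm // mulr_gt0.
have t0 : t != 0 by rewrite -nm_gt0 nt mulr_gt0.
have tr : nm t < r by rewrite nt /s; nra.
have e0 : 0 < D * x ^+ k / 4 by rewrite divr_gt0 // mulr_gt0 ?exprn_gt0.
have /cvgC bt := bP t t0 tr; have [M _ MP] := bt _ e0.
have := MP (M + k.+1)%N (leq_addr _ _); rewrite /= subr0 addnC.
set n := (k.+1 + M)%N.
rewrite (@big_cat_nat _ _ _ k.+1) ?leq_addr //= big_nat_recr //=.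
rewrite big_nat big1 ?add0r; last first.
  move=> j /andP[_ jk]; have [->|bj] := eqVneq (b j) 0; first by rewrite mul0r.
  by have := kmin j bj; rewrite leqNgt jk.
set T := \sum_(_ <= _ < _) _; have TB : nm T <= B * x ^+ k.+1 * 2.
  rewrite /T -{1}[k.+1]add0n big_addn /n addKn.
  apply: le_trans (nm_sum _ _ _) _.
  apply: (@le_trans _ _ (\sum_(0 <= j < M) B * x ^+ k.+1 * x ^+ j)).
    apply: ler_sum => j _; rewrite nmM nmX nt exprMn.
    have := BP (j + k.+1)%N; rewrite nmM nmX nm_rc gtr0_norm // => BPj.
    have -> : B * x ^+ k.+1 * x ^+ j = x ^+ (j + k.+1) * B by rewrite exprD; ring.
    by rewrite mulrCA ler_wpM2l // exprn_ge0 // ltW.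
  rewrite -mulr_sumr ler_wpM2l ?mulr_ge0 ?exprn_ge0 ?(ltW x0) //.
  by apply: geometric_le2; rewrite (ltW x0).
have btk : nm (b k * t ^+ k) = D * x ^+ k by rewrite nmM nmX nt exprMn /D; ring.
have := nm_triB (b k * t ^+ k) (- T); rewrite opprK nmN btk => h1 h2.
have xk : 0 < x ^+ k by rewrite exprn_gt0.
have : B * x ^+ k.+1 * 2 <= D * x ^+ k / 2.
  rewrite exprS; have -> : B * (x * x ^+ k) * 2 = (B * x * 2) * x ^+ k by ring.
  by rewrite [leRHS]mulrAC ler_pM2r //; nra.
lra.
Qed.

(** Two expansions may start at different exponents -k and -l. After multiplication by t^(k+l) both
    are power series in t and can be subtracted. *)
Lemma laurent_shift (c : int -> C) f k : (forall n : int, n < - k%:Z -> c n = 0) ->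
  (\forall t \near 0^', series (fun m : nat => c (m%:Z - k%:Z) * t ^ (m%:Z - k%:Z))
     @ \oo --> f t) ->
  forall j, \forall t \near 0^', (fun n => \sum_(0 <= m < n)
    c (m%:Z - (k + j)%:Z) * t ^+ m) @ \oo --> t ^+ (k + j) * f t.
Proof.
move=> ck /dnearC[r r0 rP] j; apply/dnearC; exists r; first exact: r0.
move=> t t0 tr.
have tn : t ^+ (k + j) != 0 by rewrite expf_neq0.
rewrite -(cvg_shiftn j).
have : (fun n => t ^+ (k + j) * series (fun m : nat => c (m%:Z - k%:Z) *
    t ^ (m%:Z - k%:Z)) n) @ \oo --> t ^+ (k + j) * f t.
  by apply: cvgMr; exact: rP.
apply: cvg_trans.
apply: near_eq_cvg; apply: nearW => n; rewrite /series /= mulr_sumr.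
rewrite (addnC n) [RHS](@big_cat_nat _ _ _ j) ?leq_addr //=.
rewrite [X in _ = X + _]big_nat [X in _ = X + _]big1 ?add0r.
  rewrite -[X in _ = \sum_(X <= _ < _) _]add0n [RHS]big_addn addKn.
  apply: eq_bigr => m _.
  rewrite (_ : (m + j)%N%:Z - (k + j)%N%:Z = m%:Z - k%:Z); last by lia.
  rewrite mulrCA; congr (_ * _); rewrite exprnP [in RHS]exprnP -expfzDr //.
  by congr (_ ^ _); lia.
by move=> m /andP[_ mj]; rewrite ck ?mul0r //; lia.
Qed.

Lemma laurent_unique (c c' : int -> C) f :
  laurent_expansion c f -> laurent_expansion c' f -> c = c'.
Proof.
move=> [k [ck cP]] [l [cl lP]].
have := laurent_shift ck cP l; have := laurent_shift cl lP k.
rewrite addnC => /dnearC[r r0 rP] /dnearC[s s0 sP].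
have rs : 0 < Num.min r s by rewrite lt_min r0.
have b0 := @pseries_eq0 (fun m => c (m%:Z - (k + l)%:Z) - c' (m%:Z - (k + l)%:Z)) _ rs.
apply/funext => n; have [nk|nk] := ltP n (- (k + l)%:Z).
  by rewrite ck ?cl //; lia.
have {b0} := b0 _ (absz (n + (k + l)%:Z)).
rewrite (_ : _ - _ = n); last by lia.
move=> /(_ _)/eqP; rewrite subr_eq0 => H; apply/eqP/H => t t0.
rewrite lt_min => /andP[tr ts].
rewrite -(subr0 t) in ts tr.
have : (fun n => \sum_(0 <= m < n) c (m%:Z - (k + l)%:Z) * t ^+ m -
    \sum_(0 <= m < n) c' (m%:Z - (k + l)%:Z) * t ^+ m) @ \oo -->
    t ^+ (k + l) * f t - t ^+ (k + l) * f t.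
  by apply: cvgB; [exact: sP|exact: rP].
rewrite subrr.
apply: cvg_trans; apply: near_eq_cvg; apply: nearW => m /=.
by rewrite -sumrB; apply: eq_bigr => i _; rewrite mulrBl.
Qed.

Lemma laurent_coefE (c : int -> C) f : laurent_expansion c f -> laurent_coef f = c.
Proof.
move=> cf; rewrite /laurent_coef; case: xgetP => [d _ /laurent_unique|]; first exact.
by move=> /(_ c).
Qed.

End Holomorphic.

(** * Poisson integrals *)

Section Poisson.
Variable R : realType.
Local Notation C := (Cplx R).
Local Notation I := (`[0, 1]%classic : set R).
Local Notation circ := (@circ R).
Implicit Types (u v : R -> R) (z w : C).

(** The Schwarz integral with kernel (c + z) / (c - z) = 2 c / (c - z) - 1, where c = circ t. Taking
    the Poisson integral as its real part makes harmonicity immediate. *)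
Definition schwarz u z : C :=
  2%:R * cauchy (fun t => rc (u t)) 1 z - rc (mean u).

Definition poisson u z : R := re (schwarz u z).

Definition pker (t : R) z : R := (1 - nm z ^+ 2) / nm (circ t - z) ^+ 2.

Lemma schwarz_hol u z : cont_on I u -> nm z < 1 -> hol (schwarz u) z.
Proof.
move=> uI z1; apply: holB (hol_cst _ _); apply: holM (hol_cst _ _) _.
by apply: cauchy_hol => //; exact: cont_on_rc.
Qed.

Lemma pkerE t z : nm z < 1 -> pker t z = re (2%:R * (circ t / (circ t - z)) - 1).
Proof.
move=> z1; have c0 := circB_neq0 t z1.
have n0 : nm (circ t - z) ^+ 2 != 0 by rewrite expf_neq0 // nm_eq0.
set w := circ t - z in c0 n0 *.
have -> : 2%:R * (circ t / w) - 1 = rc (nm w ^- 2) * ((circ t + z) * mkC (re w) (- im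
  w)).
  have wJ : w * mkC (re w) (- im w) = rc (nm w ^+ 2).
    by rewrite nm_sqr; apply: ceq; rewrite !reimE; ring.
  have JE : mkC (re w) (- im w) = rc (nm w ^+ 2) / w by rewrite -wJ mulrC mulKf.
  rewrite JE [RHS](_ : _ = (rc (nm w ^- 2) * rc (nm w ^+ 2)) * ((circ t + z) / w)).
    rewrite -rcM mulVf // rc1 mul1r (_ : circ t + z = 2%:R * circ t - w).
      by rewrite mulrBl mulfV // mulrA.
    by rewrite /w; ring.
  by ring.
rewrite re_rcM /pker mulrC; congr (_ * _).
have : nm (circ t) ^+ 2 = 1 by rewrite nm_circ expr1n.
by rewrite !nm_sqr /w !reimE => <-; ring.
Qed.

Lemma pker_cont z : nm z < 1 -> cont_on I (pker^~ z).
Proof.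
move=> z1; apply: (@cont_on_ext _ _ _ (fun t => re (2%:R * (circ t / (circ t - z)) -
  1))).
  by move=> t _; rewrite pkerE.
apply: cont_on_re; apply: cont_onB (@cont_on_cst _ _ _ _).
apply: cont_onM (@cont_on_cst _ _ _ _) _.
by have := @cont_on_kernel R z 1 z1; apply: cont_on_ext => t _; rewrite expr1.
Qed.

Lemma poissonE u z : cont_on I u -> nm z < 1 ->
  poisson u z = mean (fun t => u t * pker t z).
Proof.
move=> uI z1; have ru := cont_on_rc uI.
have c1 := @cont_cauchy _ _ 1 z ru z1.
rewrite /poisson /schwarz -(cmean_rc u) /cauchy -(cmeanZ _ c1).
have c2 := cont_onM (@cont_on_cst _ _ I (2%:R : C)) c1.
rewrite -(cmeanB c2 ru).
transitivity (mean (fun t => re (2%:R * (rc (u t) * (circ t / (circ t - z) ^+ 1)) -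
  rc (u t)))); [by []|apply: mean_ext => t _].
rewrite pkerE // -re_rcM; congr re; rewrite expr1; ring.
Qed.

Lemma pker_gt0 t z : nm z < 1 -> 0 < pker t z.
Proof.
move=> z1; rewrite divr_gt0 ?exprn_gt0 ?circB_gt0 //.
by have := nm_ge0 z; nra.
Qed.

Lemma pker_bounds t z : nm z < 1 ->
  (1 - nm z) / (1 + nm z) <= pker t z <= (1 + nm z) / (1 - nm z).
Proof.
move=> z1; have z0 := nm_ge0 z; have c0 := circB_gt0 t z1.
have h1 : nm (circ t - z) <= 1 + nm z by have := nmB (circ t) z; rewrite nm_circ.
have h2 : 1 - nm z <= nm (circ t - z) by have := nm_triB (circ t) z; rewrite nm_circ.
have e1 : (1 - nm z) / (1 + nm z) * nm (circ t - z) ^+ 2 <= 1 - nm z ^+ 2.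
  rewrite mulrAC ler_pdivrMr; last by lra.
  have : nm (circ t - z) ^+ 2 <= (1 + nm z) ^+ 2.
    by rewrite ler_sqr ?nnegrE ?nm_ge0 //; lra.
  by move: (nm (circ t - z) ^+ 2) => q; nra.
have e2 : 1 - nm z ^+ 2 <= (1 + nm z) / (1 - nm z) * nm (circ t - z) ^+ 2.
  rewrite mulrAC ler_pdivlMr; last by lra.
  have : (1 - nm z) ^+ 2 <= nm (circ t - z) ^+ 2.
    by rewrite ler_sqr ?nnegrE ?nm_ge0 //; lra.
  by move: (nm (circ t - z) ^+ 2) => q; nra.
apply/andP; split; first by rewrite ler_pdivlMr ?exprn_gt0.
by rewrite ler_pdivrMr ?exprn_gt0.
Qed.

Lemma cont_onMpker u z : cont_on I u -> nm z < 1 ->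
  cont_on I (fun t => u t * pker t z).
Proof. by move=> uI z1; exact: cont_onM uI (pker_cont z1). Qed.

Lemma poisson_le u v z : cont_on I u -> cont_on I v -> nm z < 1 ->
  (forall t, 0 <= t <= 1 -> u t <= v t) -> poisson u z <= poisson v z.
Proof.
move=> uI vI z1 uv; rewrite !poissonE //; apply: mean_le.
- exact/cont_ucont/cont_onMpker.
- exact/cont_ucont/cont_onMpker.
by move=> t /uv; rewrite ler_pM2r ?pker_gt0.
Qed.

Lemma poisson_ext u v z : (forall t, 0 <= t <= 1 -> u t = v t) ->
  poisson u z = poisson v z.
Proof.
move=> uv; congr (re (_ * _ - rc _)); last exact: mean_ext.
by apply: cauchy_ext => t /uv ->.
Qed.

Lemma schwarzD u v z : cont_on I u -> cont_on I v -> nm z < 1 ->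
  schwarz (fun t => u t + v t) z = schwarz u z + schwarz v z.
Proof.
move=> uI vI z1; rewrite /schwarz (meanD (cont_ucont uI) (cont_ucont vI)).
have cu := @cont_cauchy _ _ 1 z (cont_on_rc uI) z1.
have cv := @cont_cauchy _ _ 1 z (cont_on_rc vI) z1.
have -> : cauchy (fun t => rc (u t + v t)) 1 z =
    cauchy (fun t => rc (u t)) 1 z + cauchy (fun t => rc (v t)) 1 z.
  rewrite /cauchy -(cmeanD cu cv); apply: cmean_ext => t _.
  by rewrite rcD mulrDl.
by rewrite rcD; ring.
Qed.

Lemma schwarzZ (k : R) u z : cont_on I u -> nm z < 1 ->
  schwarz (fun t => k * u t) z = rc k * schwarz u z.
Proof.
move=> uI z1; rewrite /schwarz (meanZ _ (cont_ucont uI)).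
have cu := @cont_cauchy _ _ 1 z (cont_on_rc uI) z1.
have -> : cauchy (fun t => rc (k * u t)) 1 z = rc k * cauchy (fun t => rc (u t)) 1 z.
  rewrite /cauchy -(cmeanZ _ cu); apply: cmean_ext => t _.
  by rewrite rcM -mulrA.
by rewrite rcM; ring.
Qed.

Lemma poissonD u v z : cont_on I u -> cont_on I v -> nm z < 1 ->
  poisson (fun t => u t + v t) z = poisson u z + poisson v z.
Proof. by move=> uI vI z1; rewrite /poisson (schwarzD uI vI z1) reD. Qed.

Lemma poissonZ (k : R) u z : cont_on I u -> nm z < 1 ->
  poisson (fun t => k * u t) z = k * poisson u z.
Proof. by move=> uI z1; rewrite /poisson (schwarzZ k uI z1) re_rcM. Qed.

Lemma poissonB u v z : cont_on I u -> cont_on I v -> nm z < 1 ->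
  poisson (fun t => u t - v t) z = poisson u z - poisson v z.
Proof.
move=> uI vI z1; have nI := cont_onN vI; rewrite (poissonD uI nI z1); congr (_ + _).
rewrite -mulN1r -(poissonZ (-1 : R) vI z1); apply: poisson_ext => t _.
by rewrite mulN1r.
Qed.

Lemma poisson_cst (k : R) z : nm z < 1 -> poisson (fun=> k) z = k.
Proof.
move=> z1; have c1 := @cont_cauchy _ _ 1 z (@cont_on_cst R C I 1) z1.
rewrite /poisson /schwarz mean_cst.
have -> : cauchy (fun=> rc k) 1 z = rc k.
  rewrite -[RHS]mulr1 -(cauchy_cst1 z1) /cauchy -(cmeanZ _ c1).
  by apply: cmean_ext => t _; rewrite mul1r.
by rewrite -(rmorph_nat (@rc R)) -rcM -rcB re_rc; ring.
Qed.

Lemma poisson0 u : cont_on I u -> poisson u 0 = mean u.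
Proof.
move=> uI; rewrite /poisson /schwarz cauchy0 cmean_rc.
by rewrite -(rmorph_nat (@rc R)) -rcM -rcB re_rc; ring.
Qed.

Lemma poisson_near u z (k e : R) : cont_on I u -> nm z < 1 ->
  (forall t, 0 <= t <= 1 -> `|u t - k| <= e) -> `|poisson u z - k| <= e.
Proof.
move=> uI z1 ue; rewrite ler_distl.
have cc (l : R) := @cont_on_cst R R I l.
rewrite -{1}(poisson_cst (k - e) z1) -(poisson_cst (k + e) z1).
by apply/andP; split; apply: poisson_le => // t /ue; rewrite ler_distl => /andP[].
Qed.

Lemma harnack u z : cont_on I u -> (forall t, 0 <= t <= 1 -> 0 <= u t) ->
  nm z <= 2^-1 -> 3^-1 * mean u <= poisson u z <= 3 * mean u.
Proof.
move=> uI u0 z2; have z0 := nm_ge0 z; have z1 : nm z < 1 by lra.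
have uu := cont_ucont uI; have up := cont_ucont (cont_onMpker uI z1).
rewrite poissonE // -!meanZ //.
have k1 : 3^-1 <= (1 - nm z) / (1 + nm z).
  by rewrite ler_pdivlMr; lra.
have k2 : (1 + nm z) / (1 - nm z) <= 3.
  by rewrite ler_pdivrMr; lra.
apply/andP; split; apply: mean_le => //; try exact: ucontZ.
  move=> t t01; have /andP[p1 _] := pker_bounds t z1.
  by rewrite mulrC ler_wpM2l ?u0 //; lra.
move=> t t01; have /andP[_ p1] := pker_bounds t z1.
by rewrite mulrC ler_wpM2r ?u0 //; lra.
Qed.

Lemma cauchy_circ z : nm z < 1 -> cauchy circ 1 z = z.
Proof.
move=> z1; have cc := @cont_on_circ R I; rewrite (cauchy_step cc z1).
rewrite (_ : cmean circ = 0); last first.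
  by rewrite -(@cmean_circX R 1) //; apply: cmean_ext => t _; rewrite expr1.
rewrite (@cauchy_ext _ _ (fun=> 1)) ?cauchy_cst1 ?mulr1 ?add0r //.
by move=> t _; rewrite mulfV ?circ_neq0.
Qed.

Lemma cauchy_circV z : nm z < 1 -> cauchy (fun t => (circ t)^-1) 1 z = 0.
Proof.
move=> z1; have cc := @cont_on_circV R I; apply: nm_small => e e0.
have [N NP] := cauchy_series cc z1 e0; have := NP N (leqnn _).
rewrite big1 ?subr0 // => k _; rewrite /ccoef (_ : cmean _ = 0) ?mul0r //.
rewrite -(@cmean_circV R k.+1) //; apply: cmean_ext => t _.
by rewrite exprS.
Qed.

(** On the unit circle the real part of c w is (c w + c' / w) / 2 with c' the conjugate of c. The
    Cauchy integral fixes w and annihilates 1 / w. *)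
Lemma poisson_re (c : C) z : nm z < 1 ->
  poisson (fun t => re (c * circ t)) z = re (c * z).
Proof.
move=> z1; pose cJ := mkC (re c) (- im c).
have cc := @cont_on_circ R I; have cV := @cont_on_circV R I.
have k1 := cont_onM (@cont_on_cst _ _ I c) cc.
have reE t : rc (re (c * circ t)) = 2^-1 * (c * circ t + cJ * (circ t)^-1).
  have -> : (circ t)^-1 = mkC (re (circ t)) (- im (circ t)).
    apply: (mulfI (circ_neq0 t)); rewrite mulfV ?circ_neq0 //.
    have : nm (circ t) ^+ 2 = 1 by rewrite nm_circ expr1n.
    rewrite nm_sqr => n1; apply: ceq; rewrite !(reM, imM, re_mk, im_mk, re1, im1).
      by rewrite -n1 /circ !(re_mk, im_mk); ring.
    by ring.
  rewrite -rc_half; apply: ceq; rewrite ?re_rcM ?im_rcM.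
    by rewrite !(reD, imD, reM, imM, re_mk, im_mk, re_rc); field.
  by rewrite !(reD, imD, reM, imM, re_mk, im_mk, im_rc); field.
have -> : poisson (fun t => re (c * circ t)) z =
    re (2%:R * (2^-1 * (c * cauchy circ 1 z + cJ * cauchy (fun t => (circ t)^-1) 1 z)))
     - mean (fun t => re (c * circ t)).
  rewrite /poisson /schwarz reB re_rc; congr (re (_ * _) - _).
  have a1 := @cont_cauchy _ _ 1 z cc z1; have a2 := @cont_cauchy _ _ 1 z cV z1.
  rewrite /cauchy -(cmeanZ c a1) -(cmeanZ cJ a2).
  have b1 := cont_onM (@cont_on_cst _ _ I c) a1.
  have b2 := cont_onM (@cont_on_cst _ _ I cJ) a2.
  rewrite -(cmeanD b1 b2) -(cmeanZ _ (cont_onD b1 b2)).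
  by apply: cmean_ext => t _; rewrite reE; ring.
rewrite cauchy_circ // cauchy_circV // mulr0 addr0 mulrA mulfV ?pnatr_eq0 // mul1r.
have -> : mean (fun t => re (c * circ t)) = re (cmean (fun t => c * circ t)) by [].
rewrite (cmeanZ _ cc) (_ : cmean circ = 0) ?mulr0 ?re0 ?subr0 //.
by rewrite -(@cmean_circX R 1) //; apply: cmean_ext => t _; rewrite expr1.
Qed.

Definition unit_circle : set C := [set z | nm z = 1].

Lemma cont_circle_comp (h : C -> R) : cont_on unit_circle h ->
  cont_on I (fun t => h (circ t)).
Proof.
move=> hc; apply: (@cont_on_comp _ _ _ I unit_circle h circ) hc.
  by move=> t _; exact: nm_circ.
exact: cont_on_circ.
Qed.

Lemma compact_unit_circle : compact unit_circle.
Proof.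
have cI : {within I, continuous circ} by apply/cont_onP; exact: cont_on_circ.
have := continuous_compact cI (@segment_compact R 0 1); congr compact.
apply/seteqP; split=> [_ [t _ <-]|z /circ_surj[t t01 <-]]; first exact: nm_circ.
by exists t => //=; rewrite in_itv.
Qed.

(** No estimate of the kernel is made. The distance of h from its value at circ t0 is at most e / 2
    + K |w - circ t0|^2 on the circle. There this majorant is affine in the real part of c w, so
    [poisson_re] gives its Poisson integral, which is at most e near circ t0. *)
Lemma poisson_boundary (h : C -> R) t0 : cont_on unit_circle h ->
  forall e : R, 0 < e -> exists2 d : R, 0 < d & forall z, nm z < 1 ->
    nm (z - circ t0) < d -> `|poisson (fun t => h (circ t)) z - h (circ t0)| <= e.
Proof.
move=> hc e e0; have hI := cont_circle_comp hc.
have [M MP] := compact_bound compact_unit_circle hc.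
have M0 : 0 <= M by apply: le_trans (MP (circ t0) (nm_circ t0)); exact: normr_ge0.
have e20 : 0 < e / 2 by rewrite divr_gt0.
have /cont_onRP/(_ (circ t0) (nm_circ t0) _ e20) := hc.
move=> /nearC[k k0 kP]; pose K := 2 * M / k ^+ 2.
have K0 : 0 <= K by rewrite divr_ge0 ?mulr_ge0 ?exprn_ge0 // ltW.
pose c := mkC (re (circ t0)) (- im (circ t0)).
have n2 t : nm (circ t - circ t0) ^+ 2 = 2 - 2 * re (c * circ t).
  have : nm (circ t) ^+ 2 = 1 by rewrite nm_circ expr1n.
  have : nm (circ t0) ^+ 2 = 1 by rewrite nm_circ expr1n.
  rewrite !nm_sqr !(reD, imD, reN, imN, reM, imM, re_mk, im_mk).
  by move: (re (circ t)) (im (circ t)) (re (circ t0)) (im (circ t0)) => x y x0 y0; nra.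
pose q t := e / 2 + K * (2 - 2 * re (c * circ t)).
have rI : cont_on I (fun t => re (c * circ t)).
  by apply: cont_on_re; exact: cont_onM (@cont_on_cst _ _ I c) (@cont_on_circ R I).
have r2I := cont_onM (@cont_on_cst _ _ I (- 2 * K)) rI.
have qE t : q t = (e / 2 + 2 * K) + - 2 * K * re (c * circ t) by rewrite /q; ring.
have cI : cont_on I (fun t => e / 2 + 2 * K + - 2 * K * re (c * circ t)).
  exact: cont_onD (@cont_on_cst _ _ I (e / 2 + 2 * K)) r2I.
have hq t : 0 <= t <= 1 -> `|h (circ t) - h (circ t0)| <= q t.
  move=> t01; rewrite /q -n2; have [tk|tk] := ltP (nm (circ t - circ t0)) k.
    have := kP _ tk (nm_circ t).
    have := mulr_ge0 K0 (sqr_ge0 (nm (circ t - circ t0))); lra.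
  apply: (@le_trans _ _ (2 * M)).
    apply: le_trans (ler_normB _ _) _.
    by have := MP _ (nm_circ t); have := MP _ (nm_circ t0); lra.
  apply: (@le_trans _ _ (K * nm (circ t - circ t0) ^+ 2)); last lra.
  have kk : k ^+ 2 <= nm (circ t - circ t0) ^+ 2.
    by rewrite ler_sqr ?nnegrE ?nm_ge0 // ltW.
  have -> : 2 * M = K * k ^+ 2 by rewrite /K divfK // expf_neq0 // gt_eqF.
  by rewrite ler_wpM2l.
have K1 : 0 < 4 * (K + 1) by rewrite mulr_gt0 // ltr_wpDl.
exists (e / (4 * (K + 1))); first by rewrite divr_gt0.
move=> z z1; rewrite ltr_pdivlMr // => zt.
have qz : poisson (fun t => e / 2 + 2 * K + - 2 * K * re (c * circ t)) z <= e.
  have := poissonD (@cont_on_cst _ _ I (e / 2 + 2 * K)) r2I z1.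
  rewrite (poissonZ (- 2 * K) rI z1) poisson_cst // poisson_re // => ->.
  have : re (c * circ t0) = 1.
    have : nm (circ t0) ^+ 2 = 1 by rewrite nm_circ expr1n.
    rewrite nm_sqr !(reM, re_mk, im_mk); lra.
  have := le_re (c * z - c * circ t0); rewrite {1}reB -mulrBr nmM.
  have -> : nm c = 1.
    apply/eqP; rewrite -(@eqrXn2 _ 2) ?nm_ge0 // nm_sqr re_mk im_mk sqrrN.
    by rewrite -nm_sqr nm_circ.
  rewrite mul1r => H1 H2.
  have H3 : 1 - re (c * z) <= nm (z - circ t0).
    by apply: le_trans H1; rewrite H2 distrC; exact: ler_norm.
  have H4 : 2 * K * (1 - re (c * z)) <= 2 * K * nm (z - circ t0).
    by apply: ler_wpM2l => //; lra.
  have := nm_ge0 (z - circ t0); nra.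
rewrite ler_distl; apply/andP; split.
  have lI := cont_onB (@cont_on_cst _ _ I (h (circ t0))) cI.
  have : poisson (fun t => h (circ t0) - (e / 2 + 2 * K + - 2 * K * re (c * circ t))) z
      <= poisson (fun t => h (circ t)) z.
    apply: poisson_le => // t /hq; rewrite qE ler_distl => /andP[]; lra.
  rewrite (poissonB (@cont_on_cst _ _ I (h (circ t0))) cI z1) poisson_cst //; lra.
have lI := cont_onD (@cont_on_cst _ _ I (h (circ t0))) cI.
have : poisson (fun t => h (circ t)) z <=
    poisson (fun t => h (circ t0) + (e / 2 + 2 * K + - 2 * K * re (c * circ t))) z.
  apply: poisson_le => // t /hq; rewrite qE ler_distl => /andP[]; lra.
rewrite (poissonD (@cont_on_cst _ _ I (h (circ t0))) cI z1) poisson_cst //; lra.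
Qed.

End Poisson.

(** * Harmonic and subharmonic functions on a Riemann surface *)

Section Surface.
Variables (R : realType) (S : riemann_surface R).
Local Notation C := (Cplx R).
Local Notation I := (`[0, 1]%classic : set R).
Local Notation circ := (@circ R).
Implicit Types (x y : coordinate R S) (p q : S) (F G : S -> C) (u v h : S -> R).

Definition base_point : S := sval (cid (rs_nonempty S)).

(** The inverse of the coordinate. Outside the image of [dom x] it takes the default value
    [base_point], so statements about it carry the conditions [dom x (cinv x z)] and
    [x (cinv x z) = z]. *)
Definition cinv x (z : C) : S := xget base_point [set p | dom x p /\ x p = z].

Lemma open_dom x : local_coordinate x -> open (dom x).
Proof. by case=> -[]. Qed.

Lemma cinvK x p : local_coordinate x -> dom x p -> cinv x (x p) = p.
Proof.
move=> [[_ _ xI _] _] xp; rewrite /cinv; case: xgetP => [q -> [xq qp]|/(_ p)].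
  by apply: xI => //; rewrite inE.
by move=> /(_ (conj xp erefl)).
Qed.

Lemma chart_inv x p (N : set S) : local_coordinate x -> dom x p -> nbhs p N ->
  exists2 d : R, 0 < d & forall z, nm (z - x p) < d ->
    [/\ dom x (cinv x z), x (cinv x z) = z & N (cinv x z)].
Proof.
move=> lx xp; rewrite nbhsE => -[A [oA Ap] AN].
have [[ox _ _ xO] _] := lx; pose B := A `&` dom x.
have oB : open (x @` B).
  apply: xO; first by apply: openI oA ox.
  by move=> q [].
have : nbhs (x p) (x @` B).
  by apply: open_nbhs_nbhs; split => //; exists p.
move=> /nearC[d d0 dP]; exists d => // z /dP[q [Aq xq] <-].
by rewrite cinvK //; split=> //; exact: AN.
Qed.

Lemma chart_near x p (e : R) : local_coordinate x -> dom x p -> 0 < e ->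
  \forall q \near p, dom x q /\ nm (x q - x p) < e.
Proof.
move=> [[ox /cont_onP/cont_onCP xc _ _] _] xp e0.
have : nbhs p (dom x) by exact: open_nbhs_nbhs.
by apply: filterS2 (xc p xp e e0) => q xq' xq; split => //; exact: xq'.
Qed.

Lemma atlas_local x : atlas S x -> local_coordinate x.
Proof.
move=> ax; split; first exact: atlas_chart.
by move=> y ay; split; exact: atlas_transition.
Qed.

Lemma local_coordinate_at p : exists2 x, local_coordinate x & dom x p.
Proof. by have [x /atlas_local] := @atlas_cover R S p; exists x. Qed.

(** A local coordinate is compatible by definition only with the charts of the atlas, so x and y are
    compared through such a chart at p. *)
Lemma transition_hol x y p : local_coordinate x -> local_coordinate y ->
  dom x p -> dom y p -> exists g, [/\ hol g (x p), g (x p) = y p &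
    exists2 d : R, 0 < d & forall z, nm (z - x p) < d ->
    [/\ dom x (cinv x z), x (cinv x z) = z, dom y (cinv x z)
      & y (cinv x z) = g z]].
Proof.
move=> lx ly xp yp; have [a aa ap] := @atlas_cover R S p.
have la := atlas_local aa.
have [g [gt gh]] := (lx.2 a aa).1; have [g' [gt' gh']] := (ly.2 a aa).2.
have Na : nbhs p (dom a) by apply: open_nbhs_nbhs; split => //; exact: open_dom.
have Ny : nbhs p (dom y) by apply: open_nbhs_nbhs; split => //; exact: open_dom.
have [d d0 dP] := chart_inv lx xp (filterI Na Ny).
have [d' d0' dP'] := chart_inv la ap Ny.
have H1 : hol g (x p).
  exists d => // z /dP[xz zE [az _]]; exists (cderiv g z); apply/holomorphic_atP.
  by rewrite -zE; exact: gh.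
have H2 : hol g' (g (x p)).
  rewrite -(gt p xp ap); exists d' => // z /dP'[az zE yz].
  exists (cderiv g' z); apply/holomorphic_atP.
  by rewrite -zE; exact: gh'.
exists (fun z => g' (g z)); split.
- exact: hol_comp H1 H2.
- by rewrite -(gt p xp ap) -gt'.
exists d => // z /dP[xz zE [az yz]]; split => //.
by rewrite (gt' _ az yz) (gt _ xz az) zE.
Qed.

Definition hol_at F p := exists x, [/\ local_coordinate x, dom x p &
  hol (fun z => F (cinv x z)) (x p)].

Lemma hol_atP F p x : hol_at F p -> local_coordinate x -> dom x p ->
  hol (fun z => F (cinv x z)) (x p).
Proof.
move=> [y [ly yp Fy]] lx xp.
have [g [gh gp [d d0 dP]]] := transition_hol lx ly xp yp.
apply: (@hol_near _ (fun z => F (cinv y (g z))) _ _ d) => //.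
  by move=> z /dP[_ _ yz zE]; rewrite -zE cinvK.
by apply: (@hol_comp _ (fun z => F (cinv y z)) g) => //; rewrite gp.
Qed.

Lemma hol_at_near F p : hol_at F p -> \forall q \near p, hol_at F q.
Proof.
move=> [x [lx xp /hol_open[r r0 rP]]].
apply: filterS (chart_near lx xp r0) => q [xq /rP Fq].
by exists x.
Qed.

Lemma hol_at_eq F G p : (\forall q \near p, F q = G q) -> hol_at F p -> hol_at G p.
Proof.
move=> FG [x [lx xp Fx]]; exists x; split=> //.
have [d d0 dP] := chart_inv lx xp FG.
by apply: (@hol_near _ (fun z => F (cinv x z)) _ _ d) => // z /dP[].
Qed.

Lemma hol_at_cst (c : C) p : hol_at (fun=> c) p.
Proof.
by have [x lx xp] := local_coordinate_at p; exists x; split=> //; exact: hol_cst.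
Qed.

Lemma hol_at_coord x p : local_coordinate x -> dom x p -> hol_at x p.
Proof.
move=> lx xp; exists x; split=> //.
have [d d0 dP] := chart_inv lx xp (filterT : nbhs p setT).
apply: (@hol_near _ (fun z => z) _ _ d) => //; last exact: hol_id.
by move=> z /dP[_ ->].
Qed.

Lemma hol_at_comp (f : C -> C) F p : hol_at F p -> hol f (F p) ->
  hol_at (fun q => f (F q)) p.
Proof.
move=> [x [lx xp Fx]] fF; exists x; split=> //.
by apply: (@hol_comp _ f (fun z => F (cinv x z))) => //; rewrite cinvK.
Qed.

Lemma hol_atD F G p : hol_at F p -> hol_at G p -> hol_at (fun q => F q + G q) p.
Proof.
move=> [x [lx xp Fx]] /hol_atP Gx; exists x; split=> //.
by apply: holD Fx (Gx _ _ _).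
Qed.

Lemma hol_atN F p : hol_at F p -> hol_at (fun q => - F q) p.
Proof. by move=> [x [lx xp Fx]]; exists x; split=> //; exact: holN. Qed.

Lemma hol_atB F G p : hol_at F p -> hol_at G p -> hol_at (fun q => F q - G q) p.
Proof. by move=> Fp Gp; exact: hol_atD Fp (hol_atN Gp). Qed.

Lemma hol_atM F G p : hol_at F p -> hol_at G p -> hol_at (fun q => F q * G q) p.
Proof.
move=> [x [lx xp Fx]] /hol_atP Gx; exists x; split=> //.
by apply: holM Fx (Gx _ _ _).
Qed.

Lemma hol_at_cvg F p : hol_at F p -> forall e : R, 0 < e ->
  \forall q \near p, nm (F q - F p) < e.
Proof.
move=> [x [lx xp /hol_continuous Fx]] e e0; have [k k0 kP] := Fx e e0.
apply: filterS (chart_near lx xp k0) => q [xq /kP].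
by rewrite !cinvK.
Qed.

(** Harmonicity as the local existence of a holomorphic completion: it is independent of
    coordinates, and the mean value property follows from Cauchy's formula. *)
Definition harm h p := exists F, \forall q \near p, hol_at F q /\ h q = re (F q).

Lemma harm_near h p : harm h p -> \forall q \near p, harm h q.
Proof.
move=> [F /near_join]; apply: filterS => q Fq.
by exists F.
Qed.

Lemma harm_eq h u p : (\forall q \near p, h q = u q) -> harm h p -> harm u p.
Proof.
move=> hu [F Fh]; exists F; apply: filterS2 hu Fh => q <-; exact.
Qed.

Lemma harm_re F p : hol_at F p -> harm (fun q => re (F q)) p.
Proof. by move=> /hol_at_near Fp; exists F; apply: filterS Fp. Qed.

Lemma harmD u v p : harm u p -> harm v p -> harm (fun q => u q + v q) p.
Proof.
move=> [F Fu] [G Gv]; exists (fun q => F q + G q).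
apply: filterS2 Fu Gv => q [Fq ->] [Gq ->]; rewrite reD; split=> //.
exact: hol_atD.
Qed.

Lemma harmZ (k : R) u p : harm u p -> harm (fun q => k * u q) p.
Proof.
move=> [F Fu]; exists (fun q => rc k * F q).
apply: filterS Fu => q [Fq ->]; rewrite re_rcM; split=> //.
exact: hol_atM (hol_at_cst _ _) Fq.
Qed.

Lemma harmB u v p : harm u p -> harm v p -> harm (fun q => u q - v q) p.
Proof.
move=> up /(harmZ (-1)) vp; apply: harm_eq (harmD up vp).
by apply: nearW => q; rewrite mulN1r.
Qed.

Lemma harm_cst (k : R) p : harm (fun=> k) p.
Proof. by apply: harm_eq (harm_re (hol_at_cst (rc k) p)); exact: nearW. Qed.

Definition cont_at u p := forall e : R, 0 < e ->
  \forall q \near p, `|u q - u p| < e.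

Lemma cont_at_on (A : set S) u : (forall p, A p -> cont_at u p) -> cont_on A u.
Proof.
by move=> uA; apply/cont_onRP => p Ap e e0; apply: filterS (uA p Ap e e0).
Qed.

Lemma cont_on_at (A : set S) u p : nbhs p A -> cont_on A u -> cont_at u p.
Proof.
move=> nA /cont_onRP uA e e0; apply: filterS2 nA (uA p (nbhs_singleton nA) e e0).
by move=> q Aq; exact.
Qed.

Lemma harm_cont h p : harm h p -> cont_at h p.
Proof.
move=> [F Fh] e e0; have [Fp hp] := nbhs_singleton Fh.
apply: filterS2 Fh (hol_at_cvg Fp e0) => q [_ ->]; rewrite hp -reB.
exact: le_lt_trans (le_re _).
Qed.

Definition circle x (s : R) (t : R) : S := cinv x (rc s * circ t).

Definition centred x p := [/\ local_coordinate x, dom x p & x p = 0].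

Lemma centred_inv x p (N : set S) : centred x p -> nbhs p N ->
  exists2 d : R, 0 < d & forall z, nm z < d ->
    [/\ dom x (cinv x z), x (cinv x z) = z & N (cinv x z)].
Proof.
move=> [lx xp x0] Np; have [d d0 dP] := chart_inv lx xp Np.
by exists d => // z zd; apply: dP; rewrite x0 subr0.
Qed.

Lemma nm_rcirc (s t : R) : 0 < s -> nm (rc s * circ t) = s.
Proof. by move=> s0; rewrite nmM nm_circ mulr1 nm_rc gtr0_norm. Qed.

Lemma cont_cinv x (B : set C) : local_coordinate x ->
  (forall z, B z -> dom x (cinv x z) /\ x (cinv x z) = z) -> cont_on B (cinv x).
Proof.
move=> lx Bx; apply/cont_on_nbhs => z Bz N Np; have [xp xz] := Bx z Bz.
have [d d0 dP] := chart_inv lx xp Np; apply/nearC; exists d => // w wz _.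
by have [] := dP w; rewrite ?xz.
Qed.

Lemma circle_cont x p u : centred x p -> (\forall q \near p, cont_at u q) ->
  exists2 d : R, 0 < d & forall s, 0 < s < d -> cont_on I (fun t => u (circle x s t)).
Proof.
move=> cx up; have [d d0 dP] := centred_inv cx up; have [lx _ _] := cx.
exists d => // s /andP[s0 sd].
apply: (@cont_on_comp _ _ _ I [set q | cont_at u q] u (circle x s)).
- by move=> t _; have [] := dP (rc s * circ t); rewrite ?nm_rcirc.
- apply: (@cont_on_comp _ _ _ I [set z | nm z < d] (cinv x) (fun t => rc s * circ t)).
  + by move=> t _; rewrite /mkset nm_rcirc.
  + by apply: cont_onM (@cont_on_cst _ _ _ _) (@cont_on_circ R I).
  + by apply: cont_cinv => // z /dP[].
- by apply: cont_at_on.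
Qed.

(** Subharmonicity, tested on all small circles in every coordinate centred at p. Continuity is kept
    as a separate hypothesis. *)
Definition submean u p := forall x, centred x p -> exists2 d : R, 0 < d &
  forall s, 0 < s < d -> u p <= mean (fun t => u (circle x s t)).

Lemma harm_mean h p x : harm h p -> centred x p -> exists2 d : R, 0 < d &
  forall s, 0 < s < d -> mean (fun t => h (circle x s t)) = h p.
Proof.
move=> [F Fh] cx; have [lx xp x0] := cx; have [Fp hp] := nbhs_singleton Fh.
have [d d0 dP] := centred_inv cx Fh.
have [r r0 rP] := hol_mean (hol_atP Fp lx xp).
exists (Num.min d r); first by rewrite lt_min d0.
move=> s /andP[s0]; rewrite lt_min => /andP[sd sr].
have [|_] := rP s; first by rewrite s0 ltW.
rewrite cinvK // x0 hp => <-; apply: mean_ext => t _.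
by rewrite /circle add0r; have [] := dP (rc s * circ t); rewrite ?nm_rcirc // => _ _ [].
Qed.

Lemma harm_submean h p : harm h p -> submean h p.
Proof.
move=> hp x cx; have [d d0 dP] := harm_mean hp cx.
by exists d => // s /dP ->.
Qed.

Lemma submean_max u v p : cont_at u p -> submean u p -> submean v p ->
  (\forall q \near p, cont_at u q /\ cont_at v q) ->
  submean (fun q => Num.max (u q) (v q)) p.
Proof.
move=> _ up vp uv x cx; have [d d0 dP] := up x cx; have [k k0 kP] := vp x cx.
have uc : \forall q \near p, cont_at u q by apply: filterS uv => q [].
have vc : \forall q \near p, cont_at v q by apply: filterS uv => q [].
have mc : \forall q \near p, cont_at (fun q => Num.max (u q) (v q)) q.
  apply: filterS2 uc vc => q uq vq e e0.
  apply: filterS2 (uq e e0) (vq e e0) => r; rewrite !ltr_norml.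
  move=> /andP[u1 u2] /andP[v1 v2].
  by case: (ltP (u r) (v r)) => h1; case: (ltP (u q) (v q)) => h2; lra.
have [a a0 aP] := circle_cont cx uc; have [b b0 bP] := circle_cont cx vc.
have [c c0 cP] := circle_cont cx mc.
exists (Num.min (Num.min d k) (Num.min a (Num.min b c))).
  by rewrite !lt_min d0 k0 a0 b0.
move=> s /andP[s0]; rewrite !lt_min => /andP[/andP[sd sk] /and3P[sa sb sc]].
have su : 0 < s < a by rewrite s0.
have sv : 0 < s < b by rewrite s0.
have sm : 0 < s < c by rewrite s0.
rewrite ge_max; apply/andP; split.
  apply: le_trans (dP s _) _; first by rewrite s0.
  apply: mean_le; [exact/cont_ucont/aP|exact/cont_ucont/cP|].
  by move=> t _; rewrite le_max lexx.
apply: le_trans (kP s _) _; first by rewrite s0.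
apply: mean_le; [exact/cont_ucont/bP|exact/cont_ucont/cP|].
by move=> t _; rewrite le_max lexx orbT.
Qed.

Lemma submeanB u h p : (\forall q \near p, cont_at u q) -> submean u p ->
  harm h p -> submean (fun q => u q - h q) p.
Proof.
move=> uc up hp x cx; have [d d0 dP] := up x cx; have [k k0 kP] := harm_mean hp cx.
have hc : \forall q \near p, cont_at h q.
  by apply: filterS (harm_near hp) => q; exact: harm_cont.
have [a a0 aP] := circle_cont cx uc; have [b b0 bP] := circle_cont cx hc.
exists (Num.min (Num.min d k) (Num.min a b)); first by rewrite !lt_min d0 k0 a0.
move=> s /andP[s0]; rewrite !lt_min => /andP[/andP[sd sk] /andP[sa sb]].
have H1 : cont_on I (fun t => u (circle x s t)) by apply: aP; rewrite s0.
have H2 : cont_on I (fun t => h (circle x s t)) by apply: bP; rewrite s0.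
have E : mean (fun t => u (circle x s t) - h (circle x s t)) =
    mean (fun t => u (circle x s t)) - mean (fun t => h (circle x s t)).
  rewrite (meanD (cont_ucont H1) (cont_ucont (cont_onN H2))); congr (_ + _).
  rewrite -mulN1r -(meanZ (-1 : R) (cont_ucont H2)); apply: mean_ext => t _.
  by rewrite mulN1r.
by rewrite E kP ?s0 // lerB // dP ?s0.
Qed.

Lemma submean_eq u v p : (\forall q \near p, u q = v q) -> submean u p -> submean v p.
Proof.
move=> uv up x cx; have [d d0 dP] := up x cx; have [k k0 kP] := centred_inv cx uv.
exists (Num.min d k); first by rewrite lt_min d0.
move=> s /andP[s0]; rewrite lt_min => /andP[sd sk].
rewrite -(nbhs_singleton uv) (@mean_ext _ _ (fun t => u (circle x s t))).
  by apply: dP; rewrite s0.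
move=> t _; have [] := kP (rc s * circ t); by rewrite ?nm_rcirc.
Qed.

Definition affine_coord x (a : C) (s : R) : coordinate R S :=
  Coordinate (dom x) (fun p => (x p - a) / rc s).

Lemma affine_coord_local x (a : C) (s : R) : local_coordinate x -> 0 < s ->
  local_coordinate (affine_coord x a s).
Proof.
move=> lx s0; have [[ox /cont_onP xc xI xO] xa] := lx.
have sn : rc s != 0 :> C by rewrite -nm_gt0 nm_rc gtr0_norm.
have aI z w : (z - a) / rc s = (w - a) / rc s -> z = w.
  by move=> /(mulIf (invr_neq0 sn)) /(congr1 (+%R^~ a)); rewrite !subrK.
have affh z : hol (fun w => (w - a) / rc s) z.
  by apply: holM (hol_cst _ _); apply: holB (hol_id _) (hol_cst _ _).
split; first split=> //=.
- apply/cont_onP; apply: cont_onM (@cont_on_cst _ _ _ _).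
  by apply: cont_onB xc (@cont_on_cst _ _ _ _).
- by move=> p q Ap Aq /aI; exact: xI.
- move=> A oA Ax; have /= oxA := xO A oA Ax.
  rewrite openE => _ [p Ap <-]; apply/nearC.
  have : nbhs (x p) (x @` A) by apply: open_nbhs_nbhs; split=> //; exists p.
  move=> /nearC[d d0 dP]; exists (d / s); first by rewrite divr_gt0.
  move=> w ws; have [|q Aq qE] := dP (w * rc s + a).
    have -> : w * rc s + a - x p = (w - (x p - a) / rc s) * rc s by field.
    by rewrite nmM nm_rc gtr0_norm // -ltr_pdivlMr.
  by exists q => //; rewrite qE; field.
move=> y ay; have [[g [gt gh]] [g' [gt' gh']]] := xa y ay; split.
  exists (fun z => g (z * rc s + a)); split=> [p /= xp yp|p /= xp yp].
    by rewrite (gt p xp yp); congr g; field.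
  apply: (@cdiff_holomorphic _ _ _ (cderiv g (x p) * rc s)).
  have E : (x p - a) / rc s * rc s + a = x p by field.
  apply: (@cdiff_comp _ g (fun z => z * rc s + a)); last first.
    by rewrite E; apply/holomorphic_atP; exact: gh.
  have := cdiffD (cdiffM (cdiff_id ((x p - a) / rc s)) (cdiff_cst (rc s) _))
    (cdiff_cst a ((x p - a) / rc s)).
  by rewrite mul1r mulr0 !addr0.
exists (fun z => (g' z - a) / rc s); split=> [p /= yp xp|p /= yp xp].
  by rewrite (gt' p yp xp).
have [d dP] := hol_cdiff (affh (g' (y p))).
apply: (@cdiff_holomorphic _ _ _ (d * cderiv g' (y p))).
apply: (@cdiff_comp _ (fun w => (w - a) / rc s) g') => //.
by apply/holomorphic_atP; exact: gh'.
Qed.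

Lemma centred_at p : exists x, centred x p.
Proof.
have [x lx xp] := local_coordinate_at p; exists (affine_coord x (x p) 1).
split=> //; first exact: affine_coord_local.
by rewrite /= subrr mul0r.
Qed.

Lemma clopen_full (E : set S) : E !=set0 -> open E -> closed E -> E = setT.
Proof.
by move=> E0 oE cE; apply: (@rs_connected R S E E0); exists E; rewrite ?setTI.
Qed.

Lemma closed_subset_near (K A : set S) : closed K -> A `<=` K ->
  (forall q, K q -> ~ A q -> \forall r \near q, K r -> ~ A r) -> closed A.
Proof.
move=> cK AK KA; rewrite -[A]setCK; apply: open_closedC; rewrite openE => q Aq.
have [Kq|nKq] := pselect (K q).
  by apply: filterS (KA q Kq Aq) => r + Ar; move=> /(_ (AK _ Ar)).
have : nbhs q (~` K) by apply: open_nbhs_nbhs; split => //; exact: closed_openC.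
by apply: filterS => r Kr /AK.
Qed.

(** If the maximum is positive, the set E where it is attained lies in O. It is closed, and it is
    open since a smaller value anywhere on a small circle would push the mean below the maximum
    ([mean_lt0]). As S is connected, E and hence O would be all of S. *)
Lemma max_principle (O K : set S) u : open O -> O != setT -> compact K ->
  O `<=` K -> cont_on K u -> (forall p, O p -> submean u p) ->
  (forall p, K p -> ~ O p -> u p <= 0) -> forall p, K p -> u p <= 0.
Proof.
move=> oO OT cK OK uK uO u0 p0 Kp0; rewrite leNgt; apply/negP => up0.
have /cont_onP uK' := uK.
have [m Km mP] := compact_EVT_max (ex_intro _ p0 Kp0) cK uK'.
rewrite inE in Km; have {}mP q : K q -> u q <= u m by move=> Kq; apply: mP; rewrite inE.
have um : 0 < u m by apply: lt_le_trans up0 (mP _ Kp0).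
pose E := [set q | K q /\ u q = u m].
have EO q : E q -> O q.
  move=> [Kq uq]; apply: contrapT => /u0 => /(_ Kq); rewrite uq; lra.
have uc q : O q -> \forall r \near q, cont_at u r.
  move=> Oq; have : nbhs q O by exact: open_nbhs_nbhs.
  apply: filterS => r Or; apply: cont_on_at uK.
  have : nbhs r O by exact: open_nbhs_nbhs.
  exact: filterS.
have oE : open E.
  rewrite openE => q Eq; have Oq := EO q Eq; have [Kq uq] := Eq.
  have [x cx] := centred_at q; have [lx xq x0] := cx.
  have [d d0 dP] := uO q Oq x cx; have [c c0 cP] := circle_cont cx (uc q Oq).
  have NO : nbhs q O by exact: open_nbhs_nbhs.
  have [k k0 kP] := centred_inv cx NO.
  pose r := Num.min d (Num.min c k); have r0 : 0 < r by rewrite !lt_min d0 c0.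
  suff H z : nm z < r -> E (cinv x z).
    apply: filterS (chart_near lx xq r0) => p [xp].
    by rewrite x0 subr0 => /H; rewrite cinvK.
  rewrite !lt_min => /and3P[zd zc zk]; have [_ _ Oz] := kP z zk.
  split; first exact: OK.
  have [->|z0] := eqVneq z 0; first by rewrite -x0 cinvK.
  pose s := nm z; have s0 : 0 < s by rewrite nm_gt0.
  have sn : rc s != 0 :> C by rewrite -nm_gt0 nm_rc gtr0_norm.
  have [|t t01 tE] := @circ_surj R (z / rc s).
    by rewrite nm_div nm_rc gtr0_norm // divff // gt_eqF.
  have zE : rc s * circ t = z by rewrite tE mulrC divfK.
  have cI : cont_on I (fun t => u (circle x s t)) by apply: cP; rewrite s0.
  have fI := cont_onB cI (@cont_on_cst _ _ I (u m)).
  apply/eqP; rewrite eq_le mP /=; last exact: OK.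
  rewrite leNgt; apply/negP => uz.
  have f0 t' : 0 <= t' <= 1 -> u (circle x s t') - u m <= 0.
    move=> _; rewrite subr_le0; apply: mP; apply: OK.
    by have [] := kP (rc s * circ t'); rewrite ?nm_rcirc.
  have ft : u (circle x s t) - u m < 0 by rewrite /circle zE subr_lt0.
  have := mean_lt0 (cont_ucont fI) f0 t01 ft.
  rewrite (meanD (cont_ucont cI) (cont_ucont (@cont_on_cst _ _ I (- u m)))).
  by rewrite mean_cst subr_lt0 ltNge -uq dP // s0.
have cE : closed E.
  apply: (@closed_subset_near K); first exact: compact_closed (@rs_hausdorff R S) cK.
    by move=> q [].
  move=> q Kq Eq; have uq : u q < u m.
    by rewrite lt_def mP // andbT; apply/eqP => uq; apply: Eq.
  have e0 : 0 < u m - u q by rewrite subr_gt0.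
  have /cont_onRP/(_ q Kq _ e0) := uK.
  apply: filterS => r H Kr [_ ur]; have := H Kr; rewrite ur => /ltr_normlW; lra.
have ET : E = setT by apply: clopen_full => //; exists m.
by move/eqP: OT; apply; rewrite eqEsubset; split => // q _; apply: EO; rewrite ET.
Qed.

End Surface.

(** * Coordinate discs and Poisson modification *)

Section Discs.
Variables (R : realType) (S : riemann_surface R).
Local Notation C := (Cplx R).
Local Notation I := (`[0, 1]%classic : set R).
Local Notation circ := (@circ R).
Implicit Types (x y : coordinate R S) (p q : S) (F G : S -> C) (u v h : S -> R).

(** Discs are normalised to radius one by rescaling the coordinate. The margin r > 1 places the
    closed disc and its boundary circle inside the chart. *)
Definition good_disc x := local_coordinate x /\ exists2 r : R, 1 < r &
  forall z : C, nm z < r -> dom x (cinv x z) /\ x (cinv x z) = z.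

Definition disc x (r : R) : set S := [set p | dom x p /\ nm (x p) < r].
Definition odisc x := disc x 1.
Definition cdisc x : set S := [set p | dom x p /\ nm (x p) <= 1].
Definition sphere x : set S := [set p | dom x p /\ nm (x p) = 1].

Lemma good_local x : good_disc x -> local_coordinate x. Proof. by case. Qed.

Lemma good_inv x (z : C) : good_disc x -> nm z <= 1 ->
  dom x (cinv x z) /\ x (cinv x z) = z.
Proof. by move=> [_ [r r1 rP]] z1; apply: rP; exact: le_lt_trans r1. Qed.

Lemma open_disc x r : local_coordinate x -> open (disc x r).
Proof.
move=> lx; rewrite openE => p [xp pr].
have e0 : 0 < r - nm (x p) by rewrite subr_gt0.
apply: filterS (chart_near lx xp e0) => q [xq qp]; split=> //.
by have := nm_triB (x q) (x p); lra.
Qed.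

Lemma cdisc_image x : good_disc x -> cdisc x = cinv x @` cball0 (1 : R).
Proof.
move=> gx; apply/seteqP; split=> [p [xp p1]|_ [z z1 <-]].
  by exists (x p) => //; rewrite cinvK //; exact: good_local.
by have [xz zE] := good_inv gx z1; split => //; rewrite zE.
Qed.

Lemma compact_cdisc x : good_disc x -> compact (cdisc x).
Proof.
move=> gx; rewrite cdisc_image //; apply: continuous_compact.
  apply/cont_onP/cont_cinv; first exact: good_local.
  by move=> z z1; exact: good_inv.
have := @compact_cball R 0 1; congr compact; apply/seteqP.
by split=> z /=; rewrite /cball0 /mkset subr0.
Qed.

Lemma closed_cdisc x : good_disc x -> closed (cdisc x).
Proof. by move=> gx; apply: compact_closed (@rs_hausdorff R S) (compact_cdisc gx). Qed.

Lemma odisc_cdisc x : odisc x `<=` cdisc x.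
Proof. by move=> p [xp p1]; split => //; exact: ltW. Qed.

Lemma sphere_cdisc x : sphere x `<=` cdisc x.
Proof. by move=> p [xp p1]; split => //; rewrite p1. Qed.

Lemma cdisc_split x p : cdisc x p -> odisc x p \/ sphere x p.
Proof. by move=> [xp]; rewrite le_eqVlt => /orP[/eqP|] p1; [right|left]. Qed.

Lemma sphere_circle x t : good_disc x -> sphere x (circle x 1 t).
Proof.
move=> gx; rewrite /circle rc1 mul1r.
have c1 : nm (circ t) <= 1 by rewrite nm_circ.
by have [xz zE] := good_inv gx c1; split => //; rewrite zE nm_circ.
Qed.

Lemma circle_sphere x p : good_disc x -> sphere x p ->
  exists2 t, 0 <= t <= 1 & p = circle x 1 t.
Proof.
move=> gx [xp p1]; have [t t01 tE] := circ_surj p1; exists t => //.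
by rewrite /circle rc1 mul1r tE cinvK //; exact: good_local.
Qed.

Lemma odisc_neqT x : good_disc x -> odisc x != setT.
Proof.
move=> gx; apply/eqP => oT; have := sphere_circle 0 gx.
have : odisc x (circle x 1 0) by rewrite oT.
by move=> [_ h1] [_ h2]; rewrite h2 ltxx in h1.
Qed.

Lemma good_affine x p (r : R) : local_coordinate x -> 0 < r ->
  (forall z : C, nm (z - x p) < 2 * r -> dom x (cinv x z) /\ x (cinv x z) = z) ->
  good_disc (affine_coord x (x p) r).
Proof.
move=> lx r0 xr; split; first exact: affine_coord_local.
have rn : rc r != 0 :> C by rewrite -nm_gt0 nm_rc gtr0_norm.
exists 2; first by rewrite ltr1n.
move=> z z2; have la := affine_coord_local (x p) lx r0.
have zr : nm (x p + rc r * z - x p) < 2 * r.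
  by rewrite addrAC subrr add0r nmM nm_rc gtr0_norm // mulrC ltr_pM2r.
have [dz zE] := xr _ zr; set q := cinv x _ in dz zE.
have E : affine_coord x (x p) r q = z by rewrite /= zE; field.
have -> : cinv (affine_coord x (x p) r) z = q by rewrite -E cinvK.
by split.
Qed.

Lemma disc_exists p (N : set S) : nbhs p N -> exists x, [/\ good_disc x,
  cdisc x `<=` N, dom x p & x p = 0].
Proof.
move=> Np; have [x lx xp] := local_coordinate_at p.
have [d d0 dP] := chart_inv lx xp Np; pose r := d / 2.
have r0 : 0 < r by rewrite divr_gt0.
exists (affine_coord x (x p) r); split => //; last by rewrite /= subrr mul0r.
  apply: good_affine => // z zr; have [] := dP z => //.
  by move: zr; rewrite /r; lra.
move=> q [/= xq]; rewrite nm_div nm_rc gtr0_norm // ler_pdivrMr // mul1r => qr.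
have [] := dP (x q); first by move: qr; rewrite /r; lra.
by rewrite cinvK.
Qed.

(** The Poisson modification: h is replaced on the open unit disc of x by the Poisson integral of
    its boundary values. *)
Definition pmod x h p : R :=
  if `[< odisc x p >] then poisson (fun t => h (circle x 1 t)) (x p) else h p.

Lemma pmod_in x h p : odisc x p ->
  pmod x h p = poisson (fun t => h (circle x 1 t)) (x p).
Proof. by move=> px; rewrite /pmod asboolT. Qed.

Lemma pmod_out x h p : ~ odisc x p -> pmod x h p = h p.
Proof. by move=> px; rewrite /pmod asboolF. Qed.

Lemma pmod_sphere x h p : sphere x p -> pmod x h p = h p.
Proof. by move=> [_ p1]; apply: pmod_out => -[_]; rewrite p1 ltxx. Qed.

Lemma cont_circle1 x h : good_disc x -> cont_on (sphere x) h ->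
  cont_on I (fun t => h (circle x 1 t)).
Proof.
move=> gx hx; apply: (@cont_on_comp _ _ _ I (sphere x) h (circle x 1)) hx.
  by move=> t _; exact: sphere_circle.
apply: (@cont_on_comp _ _ _ I (cball0 (1 : R)) (cinv x) (fun t => rc 1 * circ t)).
- by move=> t _; rewrite /cball0 /mkset nm_rcirc.
- by apply: cont_onM (@cont_on_cst _ _ _ _) (@cont_on_circ R I).
- apply: cont_cinv; first exact: good_local.
  by move=> z z1; exact: good_inv.
Qed.

Lemma pmod_hol x h p : good_disc x -> cont_on (sphere x) h -> odisc x p ->
  hol_at (fun q => schwarz (fun t => h (circle x 1 t)) (x q)) p.
Proof.
move=> gx hx [xp p1]; apply: (@hol_at_comp _ _ (schwarz _) x).
  exact: hol_at_coord (good_local gx) xp.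
by apply: schwarz_hol => //; exact: cont_circle1.
Qed.

Lemma pmod_harm x h p : good_disc x -> cont_on (sphere x) h -> odisc x p ->
  harm (pmod x h) p.
Proof.
move=> gx hx px; exists (fun q => schwarz (fun t => h (circle x 1 t)) (x q)).
have : nbhs p (odisc x).
  by apply: open_nbhs_nbhs; split => //; apply: open_disc; exact: good_local.
by apply: filterS => q qx; split; [exact: pmod_hol|rewrite pmod_in].
Qed.

Lemma pmod_cont x h : good_disc x -> cont_on (sphere x) h ->
  cont_on (cdisc x) (pmod x h).
Proof.
move=> gx hx; have lx := good_local gx.
apply/cont_onRP => p /cdisc_split[px|px] e e0.
  by apply: filterS (harm_cont (pmod_harm gx hx px) e0).
have [t t01 pE] := circle_sphere gx px.
pose k (z : C) := h (cinv x z).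
have kc : cont_on (@unit_circle R) k.
  apply: (@cont_on_comp _ _ _ (@unit_circle R) (sphere x) h (cinv x)) hx.
    move=> z z1; have [|xz zE] := @good_inv x z gx; first by rewrite z1.
    by split=> //; rewrite zE.
  by apply: cont_cinv => // z z1; apply: good_inv => //; rewrite z1.
have e20 : 0 < e / 2 by rewrite divr_gt0.
have [d d0 dP] := poisson_boundary t kc e20.
have [xp p1] := px; have xpE : x p = circ t.
  rewrite pE /circle rc1 mul1r; have [] := @good_inv x (circ t) gx; rewrite ?nm_circ //.
have hp : h p = k (circ t) by rewrite /k -xpE cinvK.
have /cont_onRP/(_ p px e e0) hp' := hx.
apply: filterS2 (chart_near lx xp d0) hp' => q [xq qd] hq /cdisc_split[qx|qx].
  rewrite (pmod_in _ qx) (pmod_sphere _ px) hp.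
  rewrite (@poisson_ext _ _ (fun t => k (circ t))); last first.
    by move=> s _; rewrite /circle rc1 mul1r.
  by apply: le_lt_trans (dP _ qx.2 _) _; [rewrite -xpE|lra].
by rewrite !pmod_sphere //; exact: hq.
Qed.

Lemma pmod_le x u v p : good_disc x -> cont_on (sphere x) u -> cont_on (sphere x) v ->
  (forall q, sphere x q -> u q <= v q) -> cdisc x p -> pmod x u p <= pmod x v p.
Proof.
move=> gx ux vx uv /cdisc_split[px|px]; last by rewrite !pmod_sphere //; exact: uv.
rewrite !pmod_in //; apply: poisson_le px.2 _; try exact: cont_circle1.
by move=> t _; apply: uv; exact: sphere_circle.
Qed.

Lemma pmod_cst x (k : R) p : pmod x (fun=> k) p = k.
Proof.
by rewrite /pmod; case: asboolP => // px; rewrite poisson_cst //; case: px.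
Qed.

Lemma pmodB x u v p : good_disc x -> cont_on (sphere x) u -> cont_on (sphere x) v ->
  pmod x (fun q => u q - v q) p = pmod x u p - pmod x v p.
Proof.
move=> gx ux vx; rewrite /pmod; case: asboolP => // px.
by apply: poissonB px.2; exact: cont_circle1.
Qed.

Lemma pmodD x u v p : good_disc x -> cont_on (sphere x) u -> cont_on (sphere x) v ->
  pmod x (fun q => u q + v q) p = pmod x u p + pmod x v p.
Proof.
move=> gx ux vx; rewrite /pmod; case: asboolP => // px.
by apply: poissonD px.2; exact: cont_circle1.
Qed.

Lemma pmodZ x (k : R) u p : good_disc x -> cont_on (sphere x) u ->
  pmod x (fun q => k * u q) p = k * pmod x u p.
Proof.
move=> gx ux; rewrite /pmod; case: asboolP => // px.
by apply: poissonZ px.2; exact: cont_circle1.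
Qed.

Lemma pmod_near x u v p (e : R) : good_disc x -> cont_on (sphere x) u ->
  cont_on (sphere x) v -> (forall q, sphere x q -> `|u q - v q| <= e) ->
  cdisc x p -> `|pmod x u p - pmod x v p| <= e.
Proof.
move=> gx ux vx uv px; rewrite -pmodB //.
have uvx := cont_onB ux vx.
have cc (k : R) := @cont_on_cst S R (sphere x) k.
have L : pmod x (fun=> - e) p <= pmod x (fun q => u q - v q) p.
  by apply: pmod_le gx (cc _) uvx _ px => q /uv; rewrite ler_norml => /andP[].
have U : pmod x (fun q => u q - v q) p <= pmod x (fun=> e) p.
  by apply: pmod_le gx uvx (cc _) _ px => q /uv; rewrite ler_norml => /andP[].
by rewrite !pmod_cst in L U; rewrite ler_norml L.
Qed.

(** The maximum principle for [u - pmod x u], which is zero on the boundary circle. *)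
Lemma submean_le_pmod x u p : good_disc x -> cont_on (cdisc x) u ->
  (forall q, odisc x q -> submean u q) -> cdisc x p -> u p <= pmod x u p.
Proof.
move=> gx ux us px; have usx := cont_on_sub (@sphere_cdisc x) ux.
have ox : open (odisc x) by apply: open_disc; exact: good_local.
rewrite -subr_le0.
apply: (@max_principle R S (odisc x) (cdisc x) (fun q => u q - pmod x u q)) px.
- exact: ox.
- exact: odisc_neqT.
- exact: compact_cdisc.
- exact: odisc_cdisc.
- exact: cont_onB ux (pmod_cont gx usx).
- move=> q qx; apply: submeanB (us q qx) (pmod_harm gx usx qx).
  have : nbhs q (odisc x) by exact: open_nbhs_nbhs.
  apply: filterS => r rx; apply: cont_on_at ux.
  have : nbhs r (odisc x) by exact: open_nbhs_nbhs.
  by apply: filterS; exact: odisc_cdisc.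
- move=> q /cdisc_split[//|qx] _.
  by rewrite pmod_sphere // subrr.
Qed.

Lemma harmN h p : harm h p -> harm (fun q => - h q) p.
Proof.
move=> /(harmZ (-1)); apply: harm_eq; apply: nearW => q; by rewrite mulN1r.
Qed.

Lemma pmod_id x h p : good_disc x -> cont_on (cdisc x) h ->
  (forall q, odisc x q -> harm h q) -> cdisc x p -> pmod x h p = h p.
Proof.
move=> gx hx hh px; have hsx := cont_on_sub (@sphere_cdisc x) hx.
apply/le_anti/andP; split; last first.
  by apply: submean_le_pmod => // q /hh; exact: harm_submean.
have := @submean_le_pmod x (fun q => - h q) p gx (cont_onN hx) _ px.
have -> : pmod x (fun q => - h q) p = - pmod x h p.
  rewrite -mulN1r -(pmodZ (-1) p gx hsx) /pmod; case: ifP => _; last by rewrite mulN1r.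
  by apply: poisson_ext => t _; rewrite mulN1r.
rewrite lerN2; apply => q /hh/harmN; exact: harm_submean.
Qed.

Lemma submeanD u v p : (\forall q \near p, cont_at u q) ->
  (\forall q \near p, cont_at v q) -> submean u p -> submean v p ->
  submean (fun q => u q + v q) p.
Proof.
move=> uc vc up vp x cx; have [d d0 dP] := up x cx; have [k k0 kP] := vp x cx.
have [a a0 aP] := circle_cont cx uc; have [b b0 bP] := circle_cont cx vc.
exists (Num.min (Num.min d k) (Num.min a b)); first by rewrite !lt_min d0 k0 a0.
move=> s /andP[s0]; rewrite !lt_min => /andP[/andP[sd sk] /andP[sa sb]].
have H1 : cont_on I (fun t => u (circle x s t)) by apply: aP; rewrite s0.
have H2 : cont_on I (fun t => v (circle x s t)) by apply: bP; rewrite s0.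
rewrite (meanD (cont_ucont H1) (cont_ucont H2)).
by rewrite lerD ?dP ?kP ?s0.
Qed.

Section PoissonModification.
Variables (Y : set S) (x : coordinate R S) (u : S -> R).
Hypotheses (oY : open Y) (gx : good_disc x) (xY : cdisc x `<=` Y).
Hypotheses (uc : forall p, Y p -> cont_at u p) (us : forall p, Y p -> submean u p).

Lemma cont_cdisc : cont_on (cdisc x) u.
Proof. by apply: cont_at_on => p /xY; exact: uc. Qed.

Lemma le_pmod p : u p <= pmod x u p.
Proof.
have [px|px] := pselect (odisc x p); last by rewrite pmod_out.
apply: submean_le_pmod cont_cdisc _ (odisc_cdisc px) => // q /odisc_cdisc/xY.
exact: us.
Qed.

Lemma pmod_cont_at p : Y p -> cont_at (pmod x u) p.
Proof.
move=> Yp; have usx := cont_on_sub (@sphere_cdisc x) cont_cdisc.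
have [px|npx] := pselect (cdisc x p); last first.
  have : nbhs p (~` cdisc x).
    by apply: open_nbhs_nbhs; split => //; apply: closed_openC; exact: closed_cdisc.
  move=> Np e e0; apply: filterS2 Np (uc Yp e0) => q qx.
  by rewrite !pmod_out // => /odisc_cdisc.
have [px'|px'] := cdisc_split px; first exact/harm_cont/pmod_harm.
move=> e e0; have /cont_onRP/(_ p px e e0) := pmod_cont gx usx.
apply: filterS2 (uc Yp e0) => q uq H; have [|qx] := pselect (cdisc x q); first exact: H.
rewrite (pmod_sphere _ px') pmod_out // => /odisc_cdisc //.
Qed.

(** Inside the disc the modification is harmonic. Elsewhere, including the boundary circle, it
    equals u at the centre, and passing from u to the larger modification only increases the
    mean. *)
Lemma pmod_submean p : Y p -> submean (pmod x u) p.
Proof.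
move=> Yp; have usx := cont_on_sub (@sphere_cdisc x) cont_cdisc.
have [px|npx] := pselect (odisc x p); first exact/harm_submean/pmod_harm.
have NY : nbhs p Y by exact: open_nbhs_nbhs.
move=> y cy; have [d d0 dP] := us Yp cy.
have uN : \forall q \near p, cont_at u q by apply: filterS NY => q /uc.
have mN : \forall q \near p, cont_at (pmod x u) q.
  by apply: filterS NY => q; exact: pmod_cont_at.
have [a a0 aP] := circle_cont cy uN; have [b b0 bP] := circle_cont cy mN.
exists (Num.min d (Num.min a b)); first by rewrite !lt_min d0 a0.
move=> s /andP[s0]; rewrite !lt_min => /and3P[sd sa sb].
have sa' : 0 < s < a by rewrite s0.
have sb' : 0 < s < b by rewrite s0.
rewrite pmod_out //; apply: le_trans (dP s _) _; first by rewrite s0.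
apply: mean_le; [exact/cont_ucont/aP|exact/cont_ucont/bP|].
by move=> t _; exact: le_pmod.
Qed.

End PoissonModification.

End Discs.

(** * The Dirichlet problem outside a disc *)

Section Dirichlet.
Variables (R : realType) (S : riemann_surface R) (z : coordinate R S).
Local Notation C := (Cplx R).
Local Notation I := (`[0, 1]%classic : set R).
Local Notation circ := (@circ R).
Implicit Types (p q : S) (u v h b : S -> R).
Hypothesis lz : local_coordinate z.
(** Room for the circles in use: |z| = 1 bounds the outer region, |z| = 2 is the unit circle of
    [outer_coord], and as a good disc the latter needs a margin beyond radius 2. *)
Hypothesis z5 : forall w : C, nm w < 5 -> dom z (cinv z w) /\ z (cinv z w) = w.
Hypothesis Scompact : compact [set: S].

Let gz : good_disc z.
Proof.
by split=> //; exists 5; rewrite ?ltr1n.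
Qed.

Definition outer : set S := ~` cdisc z.
Definition couter : set S := ~` odisc z.

Lemma open_outer : open outer.
Proof. by apply: closed_openC; exact: closed_cdisc. Qed.

Lemma outer_neqT : outer != setT.
Proof.
apply/eqP => oT; have := sphere_circle 0 gz; move=> /sphere_cdisc.
by have : outer (circle z 1 0) by rewrite oT.
Qed.

Lemma compact_couter : compact couter.
Proof.
apply: subclosed_compact _ Scompact _ => //.
by apply: open_closedC; exact: open_disc.
Qed.

Lemma outer_couter : outer `<=` couter.
Proof. by move=> p np /odisc_cdisc. Qed.

Lemma couter_split p : couter p -> outer p \/ sphere z p.
Proof.
move=> np; have [pz|] := pselect (cdisc z p); last by left.
by have [|] := cdisc_split pz; [|right].
Qed.

Lemma sphere_couter : sphere z `<=` couter.
Proof. by move=> p [_ p1] [_]; rewrite p1 ltxx. Qed.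

Lemma sphere_not_outer p : sphere z p -> ~ outer p.
Proof. by move=> /sphere_cdisc zp /(_ zp). Qed.

Lemma outer_cont u p : cont_on couter u -> outer p -> cont_at u p.
Proof.
move=> uc op; apply: cont_on_at uc; have : nbhs p outer.
  by apply: open_nbhs_nbhs; split => //; exact: open_outer.
by apply: filterS; exact: outer_couter.
Qed.

Lemma outer_max u : cont_on couter u -> (forall p, outer p -> submean u p) ->
  (forall p, sphere z p -> u p <= 0) -> forall p, couter p -> u p <= 0.
Proof.
move=> uc us u0; apply: (max_principle open_outer outer_neqT compact_couter
  outer_couter uc us) => p /couter_split[//|pz] _; exact: u0.
Qed.

(* The modulus 1/|z| of a point of the outer region is at most one, so the
   Poisson integral of b in the reflected variable 1/z extends b outwards. *)
Definition reflected b (w : C) : R := b (cinv z w^-1).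

Lemma reflected_cont b : cont_on (sphere z) b -> cont_on (@unit_circle R) (reflected b).
Proof.
move=> bc; apply: (@cont_on_comp _ _ _ (@unit_circle R) (sphere z) b (fun w => cinv z
  w^-1)) bc.
  move=> w w1; have [|zw zE] := @good_inv _ _ z w^-1 gz.
    by rewrite nmV w1 invr1.
  by split; rewrite // zE nmV w1 invr1.
apply: (@cont_on_comp _ _ _ (@unit_circle R) (@unit_circle R) (cinv z) (fun w => w^-1)).
- by move=> w; rewrite /unit_circle /mkset nmV => ->; rewrite invr1.
- apply: cont_onV; last exact: cont_on_id.
  by move=> w w1; rewrite -nm_gt0 w1.
- by apply: cont_cinv => // w w1; apply: good_inv => //; rewrite w1.
Qed.

Definition reflected_poisson b p : R :=
  poisson (fun t => reflected b (circ t)) (z p)^-1.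

Lemma nm_inv_lt1 (w : C) : 1 < nm w -> nm w^-1 < 1.
Proof. by move=> w1; rewrite nmV invf_lt1 // (lt_trans ltr01). Qed.

Lemma hol_inv p : dom z p -> z p != 0 -> hol_at (fun q => (z q)^-1) p.
Proof.
move=> zp z0; apply: (@hol_at_comp _ _ (fun w => w^-1) z); first exact: hol_at_coord.
by apply: holV => //; exact: hol_id.
Qed.

Lemma reflected_harm b p : cont_on (sphere z) b -> dom z p -> 1 < nm (z p) ->
  harm (reflected_poisson b) p.
Proof.
move=> bc zp p1; have z0 : z p != 0 by rewrite -nm_gt0 (lt_trans ltr01).
apply: (@harm_re _ _ (fun q => schwarz (fun t => reflected b (circ t)) (z q)^-1)).
apply: (@hol_at_comp _ _ (schwarz _) (fun q => (z q)^-1)); first exact: hol_inv.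
apply: schwarz_hol; last exact: nm_inv_lt1.
exact/cont_circle_comp/reflected_cont.
Qed.

Lemma reflected_boundary b p : cont_on (sphere z) b -> sphere z p ->
  forall e : R, 0 < e -> \forall q \near p, dom z q -> 1 < nm (z q) ->
    `|reflected_poisson b q - b p| < e.
Proof.
move=> bc pz e e0; have [t t01 pE] := circle_sphere gz pz.
have e20 : 0 < e / 2 by rewrite divr_gt0.
have [d d0 dP] := poisson_boundary (- t) (reflected_cont bc) e20.
have [zp p1] := pz; have z0 : z p != 0 by rewrite -nm_gt0 p1.
have zE : z p = circ t.
  rewrite pE /circle rc1 mul1r; have [] := @good_inv _ _ z (circ t) gz; rewrite
    ?nm_circ //.
have bE : reflected b (circ (- t)) = b p.
  by rewrite /reflected -circV invrK -zE cinvK.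
apply: filterS (hol_at_cvg (hol_inv zp z0) d0) => q qd zq q1.
have := dP _ (nm_inv_lt1 q1); rewrite bE -circV -zE => /(_ qd).
by move=> H; apply: le_lt_trans H _; lra.
Qed.

Lemma reflected_bound b (M : R) p : cont_on (sphere z) b ->
  (forall q, sphere z q -> `|b q| <= M) -> 1 < nm (z p) ->
  `|reflected_poisson b p| <= M.
Proof.
move=> bc bM p1; rewrite -[X in `|X|]subr0; apply: poisson_near.
- exact/cont_circle_comp/reflected_cont.
- exact: nm_inv_lt1.
move=> t _; rewrite subr0 /reflected circV; apply: bM.
by have := sphere_circle (- t) gz; rewrite /circle rc1 mul1r.
Qed.

Lemma cont_at_sqr (F : S -> C) p : hol_at F p ->
  cont_at (fun q => nm (F q) ^+ 2) p.
Proof.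
move=> Fp; pose N : set S := [set q | hol_at F q].
have FN : cont_on N F.
  by apply/cont_onCP => q Fq e e0; apply: filterS (hol_at_cvg Fq e0).
have Np : nbhs p N by exact: hol_at_near Fp.
have c2 : cont_on N (fun q => nm (F q) ^+ 2) by exact: cont_onX (cont_on_nm FN).
exact: cont_on_at Np c2.
Qed.

(** |F|^2 is at least 2 Re (conj (F p) F) - |F p|^2, a harmonic function, with equality at p. *)
Lemma submean_sqr (F : S -> C) p : hol_at F p ->
  submean (fun q => nm (F q) ^+ 2) p.
Proof.
move=> Fp x cx.
pose cF := mkC (re (F p)) (- im (F p)).
have hF : harm (fun q => 2 * re (cF * F q) - nm (F p) ^+ 2) p.
  apply: harmB (harmZ _ (harm_re _)) (harm_cst _ _).
  exact: hol_atM (hol_at_cst _ _) Fp.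
have FN := hol_at_near Fp.
have sqc : \forall q \near p, cont_at (fun q => nm (F q) ^+ 2) q.
  by apply: filterS FN => q; exact: cont_at_sqr.
have hc : \forall q \near p, cont_at (fun q => 2 * re (cF * F q) - nm (F p) ^+ 2) q.
  by apply: filterS (harm_near hF) => q; exact: harm_cont.
have [d d0 dP] := harm_mean hF cx.
have [a a0 aP] := circle_cont cx sqc; have [c c0 cP] := circle_cont cx hc.
exists (Num.min d (Num.min a c)); first by rewrite !lt_min d0 a0.
move=> s /andP[s0]; rewrite !lt_min => /and3P[sd sa sc].
have E : 2 * re (cF * F p) - nm (F p) ^+ 2 = nm (F p) ^+ 2.
  by rewrite nm_sqr /cF !(reM, re_mk, im_mk); ring.
rewrite -E -(dP s); last by rewrite s0.
apply: mean_le; [apply/cont_ucont/cP; by rewrite s0|apply/cont_ucont/aP; by rewrite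
  s0|].
move=> t _; rewrite !nm_sqr /cF !(reM, re_mk, im_mk).
have := sqr_ge0 (re (F p) - re (F (circle x s t))).
have := sqr_ge0 (im (F p) - im (F (circle x s t))).
by move: (re (F p)) (im (F p)) (re _) (im _) => k l m n; nra.
Qed.

Lemma cont_atD u v p : cont_at u p -> cont_at v p -> cont_at (fun q => u q + v q) p.
Proof.
move=> up vp e e0; have e20 : 0 < e / 2 by rewrite divr_gt0.
apply: filterS2 (up _ e20) (vp _ e20) => q h1 h2.
rewrite opprD addrACA; apply: le_lt_trans (ler_normD _ _) _; lra.
Qed.

Lemma cont_at_cst (k : R) p : cont_at (fun=> k : R) p.
Proof. by move=> e e0; apply: nearW => q; rewrite subrr normr0. Qed.

Lemma max_near (a c d e : R) : `|a - c| < e -> d <= c -> `|Num.max a d - c| < e.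
Proof. by rewrite !ltr_norml => /andP[h1 h2] dc; case: (ltP a d) => h; lra. Qed.

Lemma cont_at_max u v p : cont_at u p -> cont_at v p ->
  cont_at (fun q => Num.max (u q) (v q)) p.
Proof.
move=> up vp e e0; apply: filterS2 (up e e0) (vp e e0) => q; rewrite !ltr_norml.
move=> /andP[u1 u2] /andP[v1 v2].
by case: (ltP (u q) (v q)) => h1; case: (ltP (u p) (v p)) => h2; lra.
Qed.

Lemma cont_at_eq u v p : (\forall q \near p, u q = v q) -> cont_at u p -> cont_at v p.
Proof.
move=> uv up e e0; rewrite -(nbhs_singleton uv).
by apply: filterS2 uv (up e e0) => q ->.
Qed.

Definition outer_coord : coordinate R S := affine_coord z 0 2.

Lemma nm_outer p : nm (outer_coord p) = nm (z p) / 2.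
Proof. by rewrite /outer_coord /= subr0 nm_div nm_rc ger0_norm. Qed.

Lemma good_outer : good_disc outer_coord.
Proof.
split; first exact: affine_coord_local.
have r2 : rc 2 != 0 :> C by rewrite -nm_gt0 nm_rc gtr0_norm.
exists 2; first by rewrite ltr1n.
move=> w w2; have w5 : nm (rc 2 * w) < 5 by rewrite nmM nm_rc ger0_norm //; lra.
have [zw zE] := z5 w5; have lo := affine_coord_local 0 lz (ltr0n R 2).
have E : outer_coord (cinv z (rc 2 * w)) = w by rewrite /= zE subr0 mulrC mulKf.
have -> : cinv outer_coord w = cinv z (rc 2 * w) by rewrite -{1}E cinvK.
by split.
Qed.

Section Barrier.
Variables (b : S -> R) (M : R).
Hypothesis bc : cont_on (sphere z) b.
Hypothesis bM : forall p, sphere z p -> `|b p| <= M.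

Let M0 : 0 <= M.
Proof. by apply: le_trans (bM (sphere_circle 0 gz)); exact: normr_ge0. Qed.

(** For |z| > 2 the penalty k^2 (1 / |z|^2 - 1) is below -3 (M + 1)^2, which brings every value up
    to M below -M. *)
Let k : R := 2 * (M + 1).

(** The outward extension of b is harmonic only inside the chart. The added term k^2 (1 / |z|^2 - 1)
    is subharmonic, vanishes on |z| = 1 and drops far enough for the function to be cut off before
    the chart ends. *)
Definition barrier_in p : R :=
  reflected_poisson b p + (nm (rc k * (z p)^-1) ^+ 2 - k ^+ 2).

(** A subharmonic function on the whole outer region with boundary values b. Between |z| = 2 and |z|
    = 3 the maximum with -M is -M already, so the two branches match. *)
Definition barrier p : R :=
  if `[< sphere z p >] then b p else
  if `[< dom z p /\ nm (z p) < 3 >] then Num.max (barrier_in p) (- M) else - M.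

Lemma kappaE (w : C) : nm (rc k * w^-1) ^+ 2 - k ^+ 2 = k ^+ 2 * ((nm w)^-1 ^+ 2 - 1).
Proof.
rewrite nmM nmV nm_rc exprMn real_normK ?num_real //; ring.
Qed.

Lemma barrier_in_far p : 2 < nm (z p) -> barrier_in p <= - M.
Proof.
move=> p2; have p1 : 1 < nm (z p) by lra.
have := reflected_bound bc bM p1; rewrite ler_norml => /andP[_ rM].
rewrite /barrier_in kappaE.
have i2 : (nm (z p))^-1 <= 2^-1 by rewrite lef_pV2 ?posrE //; lra.
have i0 : 0 <= (nm (z p))^-1 by rewrite invr_ge0 nm_ge0.
have : (nm (z p))^-1 ^+ 2 <= 4^-1 by move: i2 i0; move: (nm _)^-1 => a; nra.
move: (_ ^+ 2) => a a4.
have : k ^+ 2 * (a - 1) <= k ^+ 2 * (- (3 / 4)).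
  by rewrite ler_wpM2l ?sqr_ge0 //; lra.
rewrite /k; have := sqr_ge0 M; nra.
Qed.

Lemma barrier_sphere p : sphere z p -> barrier p = b p.
Proof. by move=> pz; rewrite /barrier asboolT. Qed.

Lemma barrier_outer p : outer p -> barrier p =
  if `[< dom z p /\ nm (z p) < 3 >] then Num.max (barrier_in p) (- M) else - M.
Proof. by move=> po; rewrite /barrier asboolF // => /sphere_not_outer. Qed.

Lemma barrier_local p : outer p ->
  (exists2 v, (\forall q \near p, v q = barrier q) &
    submean v p /\ \forall q \near p, cont_at v q).
Proof.
move=> po; have No : nbhs p outer by apply: open_nbhs_nbhs; split => //; exact:
  open_outer.
have [[zp p3]|np] := pselect (dom z p /\ nm (z p) < 3).
  exists (fun q => Num.max (barrier_in q) (- M)).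
    have : nbhs p (disc z 3) by apply: open_nbhs_nbhs; split => //; exact: open_disc.
    by apply: filterS2 No => q qo qz; rewrite barrier_outer // asboolT.
  have p1 : 1 < nm (z p) by rewrite ltNge; apply/negP => p1; exact: po.
  have H q : dom z q -> 1 < nm (z q) -> submean barrier_in q /\ cont_at barrier_in q.
    move=> zq q1; have z0 : z q != 0 by rewrite -nm_gt0 (lt_trans ltr01).
    have hF : hol_at (fun q => rc k * (z q)^-1) q.
      exact: hol_atM (hol_at_cst _ _) (hol_inv zq z0).
    have rh := reflected_harm bc zq q1.
    have rc' : \forall r \near q, cont_at (reflected_poisson b) r.
      by apply: filterS (harm_near rh) => r; exact: harm_cont.
    have sc : \forall r \near q, cont_at (fun q => nm (rc k * (z q)^-1) ^+ 2 - k ^+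
      2) r.
      apply: filterS (hol_at_near hF) => r Fr.
      exact: cont_atD (cont_at_sqr Fr) (@cont_at_cst (- k ^+ 2) r).
    split; last exact: cont_atD (nbhs_singleton rc') (nbhs_singleton sc).
    apply: submeanD rc' sc (harm_submean rh) _.
    apply: submeanD (submean_sqr hF) _; last exact: harm_submean (harm_cst _ _).
      by apply: filterS (hol_at_near hF) => r; exact: cont_at_sqr.
    by apply: nearW => r; exact: cont_at_cst.
  have [bs bcont] := H p zp p1.
  have N1 : \forall q \near p, dom z q /\ 1 < nm (z q).
    have e0 : 0 < nm (z p) - 1 by rewrite subr_gt0.
    apply: filterS (chart_near lz zp e0) => q [zq]; split=> //.
    by have := nm_triB (z p) (z q); rewrite nmC; lra.
  have NC : \forall q \near p, cont_at barrier_in q.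
    by apply: filterS N1 => q [zq q1]; have [] := H q zq q1.
  split; last first.
    by apply: filterS NC => q qc; apply: cont_at_max qc (@cont_at_cst (- M) q).
  apply: (@submean_max R S barrier_in (fun=> - M)) bcont bs (harm_submean (harm_cst _
    _)) _.
  by apply: filterS NC => q; split=> //; exact: cont_at_cst.
(* Near such a point one is either off the chart or at |z| > 2, where both branches of [barrier]
   give -M. *)
exists (fun=> - M); last first.
  by split; [exact/harm_submean/harm_cst|apply: nearW => q; exact: cont_at_cst].
have : nbhs p (~` cdisc outer_coord).
  apply: open_nbhs_nbhs; split.
    by apply: closed_openC; apply: closed_cdisc good_outer.
  move=> [zp]; rewrite nm_outer => p2; apply: np; split=> //; lra.
apply: filterS2 No => q qo q2; rewrite barrier_outer //.
case: asboolP => // -[zq q3]; rewrite (max_idPr _) //.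
apply: barrier_in_far; rewrite ltNge; apply/negP => q2'; apply: q2; split=> //.
by rewrite nm_outer; lra.
Qed.

Lemma barrier_submean p : outer p -> submean barrier p.
Proof. by move=> /barrier_local[v vb [vs _]]; exact: submean_eq vb vs. Qed.

Lemma barrier_cont : cont_on couter barrier.
Proof.
apply/cont_onRP => p /couter_split[po|pz] e e0.
  have [v vb [_ vc]] := barrier_local po.
  by apply: filterS (cont_at_eq vb (nbhs_singleton vc) e0).
have e20 : 0 < e / 2 by rewrite divr_gt0.
have [zp p1] := pz; have z0 : z p != 0 by rewrite -nm_gt0 p1.
have k0 : 0 < k by rewrite /k; move: M0; lra.
have hF : hol_at (fun q => rc k * (z q)^-1) p.
  exact: hol_atM (hol_at_cst _ _) (hol_inv zp z0).
have sqE : nm (rc k * (z p)^-1) ^+ 2 = k ^+ 2.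
  by rewrite nmM nmV p1 invr1 mulr1 nm_rc real_normK ?num_real.
have N1 := reflected_boundary bc pz e20.
have N2 := cont_at_sqr hF e20; rewrite sqE in N2.
have /cont_onRP/(_ p pz e e0) N3 := bc.
have N4 := chart_near lz zp ltr01.
rewrite (barrier_sphere pz).
apply: filterS2 (filterI N1 N2) (filterI N3 N4) => q [h1 h2] [h3 [zq h4]].
move=> /couter_split[qo|qz]; last by rewrite barrier_sphere //; exact: h3.
have q1 : 1 < nm (z q) by rewrite ltNge; apply/negP => q1; exact: qo.
rewrite barrier_outer // asboolT; last first.
  by split=> //; have := nm_triB (z q) (z p); lra.
apply: max_near; last by have := bM pz; rewrite ler_norml => /andP[].
have {}h1 := h1 zq q1; rewrite /barrier_in.
rewrite addrAC; apply: le_lt_trans (ler_normD _ _) _; lra.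
Qed.

End Barrier.

Definition perron b v := [/\ cont_on couter v, forall p, outer p -> submean v p
  & forall p, sphere z p -> v p <= b p].

Lemma perron_max b u v : perron b u -> perron b v ->
  perron b (fun p => Num.max (u p) (v p)).
Proof.
move=> [uc us ub] [vc vs vb]; split.
- apply/cont_onRP => p pc e e0.
  have /cont_onRP/(_ p pc e e0) h1 := uc; have /cont_onRP/(_ p pc e e0) h2 := vc.
  apply: filterS2 h1 h2 => q h1 h2 qc; move: (h1 qc) (h2 qc); rewrite !ltr_norml.
  move=> /andP[u1 u2] /andP[v1 v2].
  by case: (ltP (u q) (v q)) => l1; case: (ltP (u p) (v p)) => l2; lra.
- move=> p po; apply: submean_max (us p po) (vs p po) _; first exact: outer_cont.
  have : nbhs p outer by apply: open_nbhs_nbhs; split => //; exact: open_outer.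
  by apply: filterS => q qo; split; exact: outer_cont.
- by move=> p pz; rewrite ge_max ub ?vb.
Qed.

Lemma perron_pmod b v x : good_disc x -> cdisc x `<=` outer -> perron b v ->
  perron b (pmod x v).
Proof.
move=> gx xo [vc vs vb].
have vca p : outer p -> cont_at v p by exact: outer_cont.
split.
- apply/cont_onRP => p /couter_split[po|pz] e e0.
    by apply: filterS (pmod_cont_at gx xo vca po e0).
  have npx : ~ cdisc x p by move=> /xo; exact: sphere_not_outer.
  have : nbhs p (~` cdisc x).
    by apply: open_nbhs_nbhs; split => //; apply: closed_openC; exact: closed_cdisc.
  have /cont_onRP/(_ p (sphere_couter pz) e e0) := vc.
  apply: filterS2 => q h qx qc; rewrite !pmod_out //; first exact: h.
    by move=> /odisc_cdisc.
  by move=> /odisc_cdisc.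
- by move=> p po; apply: pmod_submean po => //; exact: open_outer.
- move=> p pz; rewrite pmod_out; first exact: vb.
  by move=> /odisc_cdisc/xo; exact: sphere_not_outer.
Qed.

(** Poisson modification does not increase uniform distances and fixes functions that are harmonic
    in the disc and continuous up to its boundary. Hence it fixes a uniform limit h of such
    functions, which is therefore harmonic. *)
Lemma harm_unif x h p : good_disc x -> odisc x p ->
  (forall e : R, 0 < e -> exists u, [/\ cont_on (cdisc x) u,
     forall q, odisc x q -> harm u q & forall q, cdisc x q -> `|h q - u q| <= e]) ->
  harm h p.
Proof.
move=> gx px hu.
have hc : cont_on (cdisc x) h.
  apply/cont_onRP => q qx e e0; have e30 : 0 < e / 4 by rewrite divr_gt0.
  have [u [uc _ uh]] := hu _ e30; have /cont_onRP/(_ q qx _ e30) := uc.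
  apply: filterS => r H rx; have := H rx; have := uh q qx; have := uh r rx.
  by rewrite !ler_norml !ltr_norml => /andP[a1 a2] /andP[b1 b2] /andP[c1 c2]; lra.
have hsc := cont_on_sub (@sphere_cdisc _ _ x) hc.
have E q : odisc x q -> pmod x h q = h q.
  move=> qx; apply/eqP; rewrite -subr_eq0 -normr_eq0 eq_le normr_ge0 andbT.
  apply/ler_addgt0Pr => e e0; rewrite add0r.
  have [u [uc uh hu']] := hu (e / 2) ltac:(by rewrite divr_gt0).
  have usc := cont_on_sub (@sphere_cdisc _ _ x) uc.
  have := pmod_near gx hsc usc (fun r rx => hu' r (sphere_cdisc rx)) (odisc_cdisc qx).
  rewrite (pmod_id gx uc uh (odisc_cdisc qx)) => h1.
  have := hu' q (odisc_cdisc qx); move: h1; rewrite !ler_norml.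
  by move=> /andP[a1 a2] /andP[b1 b2]; lra.
apply: harm_eq (pmod_harm gx hsc px).
have : nbhs p (odisc x) by apply: open_nbhs_nbhs; split => //; apply: open_disc gx.1.
exact: filterS.
Qed.

Lemma compact_sphere : compact (sphere z).
Proof.
have -> : sphere z = cinv z @` (@unit_circle R).
  apply/seteqP; split=> [p [zp p1]|_ [w w1 <-]].
    by exists (z p) => //; exact: cinvK.
  by have [|zw zE] := @good_inv _ _ z w gz; rewrite ?w1 //; split; rewrite // zE.
apply: continuous_compact; last exact: compact_unit_circle.
apply/cont_onP/cont_cinv => // w w1; apply: good_inv => //; by rewrite w1.
Qed.

Lemma perron_barrier b (M : R) : cont_on (sphere z) b ->
  (forall p, sphere z p -> `|b p| <= M) -> perron b (barrier b M).
Proof.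
move=> bc bM; split; [exact: barrier_cont|exact: barrier_submean|].
by move=> p pz; rewrite barrier_sphere.
Qed.

(** The negated barrier of -b majorises the whole Perron family, by the maximum principle for its
    difference with v. It bounds the supremum and later squeezes it at the boundary. *)
Lemma perron_le_barrier b (M : R) v p : cont_on (sphere z) b ->
  (forall p, sphere z p -> `|b p| <= M) -> perron b v -> couter p ->
  v p <= - barrier (fun q => - b q) M p.
Proof.
move=> bc bM [vc vs vb] pc.
have nbc : cont_on (sphere z) (fun q => - b q) by exact: cont_onN.
have nbM q : sphere z q -> `|- b q| <= M by rewrite normrN; exact: bM.
have [uc us ub] := perron_barrier nbc nbM.
rewrite -subr_le0 opprK.
have uvc := cont_onD vc uc.
apply: (@outer_max (fun q => v q + barrier (fun q => - b q) M q)) pc; first exact: uvc.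
  move=> q qo; apply: submeanD (vs q qo) (us q qo).
    have : nbhs q outer by apply: open_nbhs_nbhs; split => //; exact: open_outer.
    by apply: filterS => r; exact: outer_cont.
  have : nbhs q outer by apply: open_nbhs_nbhs; split => //; exact: open_outer.
  by apply: filterS => r; exact: outer_cont.
by move=> q qz; rewrite (barrier_sphere _ _ qz) subr_le0; exact: vb.
Qed.

Definition perron_sup b p : R := sup [set v p | v in perron b].

Section PerronSup.
Variables (b : S -> R) (M : R).
Hypothesis bc : cont_on (sphere z) b.
Hypothesis bM : forall p, sphere z p -> `|b p| <= M.
Let w := perron_sup b.

Lemma perron_has_sup p : couter p -> has_sup [set v p | v in perron b].
Proof.
move=> pc; split; first by exists (barrier b M p); exists (barrier b M) => //; exact:
  perron_barrier.
by exists (- barrier (fun q => - b q) M p) => _ [v pv <-]; exact: perron_le_barrier.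
Qed.

Lemma perron_sup_ge v p : perron b v -> couter p -> v p <= w p.
Proof.
move=> pv pc; have [_ ub] := perron_has_sup pc.
by apply: (ub_le_sup ub); exists v.
Qed.

Lemma perron_sup_le (k : R) p : couter p ->
  (forall v, perron b v -> v p <= k) -> w p <= k.
Proof.
move=> pc vk; have [ne _] := perron_has_sup pc.
by apply: ge_sup => // _ [v pv <-]; exact: vk.
Qed.

Lemma perron_sup_sphere p : sphere z p -> w p = b p.
Proof.
move=> pz; have pc := sphere_couter pz; apply/eqP; rewrite eq_le; apply/andP; split.
  by apply: perron_sup_le => // v [_ _ vb]; exact: vb.
have := perron_sup_ge (perron_barrier bc bM) pc.
by rewrite barrier_sphere.
Qed.

(** Instead of a monotone sequence, one modified member u with u p > w p - e / 3 is used. For any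
    competitor v' the modification of max (v, v') exceeds u by a nonnegative Poisson integral whose
    value at p is below e / 3; Harnack's inequality bounds it by e on the half disc y. So w is a
    uniform limit of harmonic functions there. *)
Lemma perron_sup_harm p : outer p -> harm w p.
Proof.
move=> po; have No : nbhs p outer by apply: open_nbhs_nbhs; split => //; exact:
  open_outer.
have [x [gx xo xp x0]] := disc_exists No.
have lx := good_local gx.
have half0 : 0 < 2^-1 :> R by rewrite invr_gt0.
have xpd : odisc x p by split=> //; rewrite x0 nm0.
pose y := affine_coord x (x p) 2^-1.
have gy : good_disc y.
  by apply: good_affine => // v; rewrite mulfV ?pnatr_eq0 // x0 subr0 => v1; apply:
    good_inv => //; exact: ltW.
have yx q : cdisc y q -> dom x q /\ nm (x q) <= 2^-1.
  have -> : cdisc y q = (dom x q /\ nm (x q / rc 2^-1) <= 1) by rewrite /cdisc /mkset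
    /y /= x0 subr0.
  rewrite nm_div nm_rc ger0_norm ?invr_ge0 // invrK => -[yq q1].
  by split=> //; lra.
have yo q : cdisc y q -> odisc x q.
  by move=> /yx[xq q2]; split=> //; apply: le_lt_trans q2 _; lra.
apply: (@harm_unif y w p gy); first by split=> //; rewrite /y /= subrr mul0r nm0.
move=> e e0; have e30 : 0 < e / 3 by rewrite divr_gt0.
have [_ [v pv <-] vp] := @sup_adherent _ _ _ e30 (perron_has_sup (outer_couter po)).
have pu := perron_pmod gx xo pv; set u := pmod x v in pu.
have [vc vs _] := pv.
have sc (v' : S -> R) : cont_on couter v' -> cont_on (sphere x) v'.
  by apply: cont_on_sub => q /sphere_cdisc/xo; exact: outer_couter.
exists u; split.
- apply: cont_on_sub (pmod_cont gx (sc _ vc)) => q /yo; exact: odisc_cdisc.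
- by move=> q /odisc_cdisc/yo; exact: pmod_harm (sc _ vc).
move=> q qy; have qx := yo q qy; have qo := xo _ (odisc_cdisc qx).
have qc := outer_couter qo.
rewrite ger0_norm; last by rewrite subr_ge0; exact: perron_sup_ge.
rewrite lerBlDr; apply: perron_sup_le => // v' pv'.
have pm := perron_max pv pv'; set m := (fun q => _) in pm.
have [mc ms _] := pm; have pum := perron_pmod gx xo pm.
have mle : v' q <= pmod x m q.
  apply: le_trans (le_pmod gx xo _ ms q); last by move=> r; exact: outer_cont.
  by rewrite le_max lexx orbT.
apply: le_trans mle _; rewrite -lerBlDr.
have dc : cont_on I (fun t => m (circle x 1 t) - v (circle x 1 t)).
  by apply: cont_onB; apply: cont_circle1 => //; exact: sc.
have d0 t : 0 <= t <= 1 -> 0 <= m (circle x 1 t) - v (circle x 1 t).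
  by move=> _; rewrite subr_ge0 le_max lexx.
have pE r : odisc x r -> pmod x m r - u r =
    poisson (fun t => m (circle x 1 t) - v (circle x 1 t)) (x r).
  move=> rx; rewrite /u !pmod_in // poissonB //; [..|by case: rx].
    by apply: cont_circle1 => //; exact: sc.
  by apply: cont_circle1 => //; exact: sc.
have [_ h2] := andP (harnack dc d0 (yx q qy).2).
rewrite pE //; apply: le_trans h2 _.
have := pE p xpd; rewrite x0 poisson0 // => <-.
have h3 := perron_sup_ge pum (outer_couter po).
have h4 : v p <= u p.
  by apply: (le_pmod gx xo _ vs) => r; exact: outer_cont.
have : w p - e / 3 < v p := vp.
lra.
Qed.

(** At the boundary circle w is squeezed between the barrier of b and the negated barrier of -b,
    both continuous with value b. *)
Lemma perron_sup_cont : cont_on couter w.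
Proof.
apply/cont_onRP => p /couter_split[po|pz] e e0.
  by apply: filterS (harm_cont (perron_sup_harm po) e0).
have nbc : cont_on (sphere z) (fun q => - b q) by exact: cont_onN.
have nbM q : sphere z q -> `|- b q| <= M by rewrite normrN; exact: bM.
have [lc _ _] := perron_barrier bc bM; have [hc _ _] := perron_barrier nbc nbM.
have pc := sphere_couter pz.
have /cont_onRP/(_ p pc e e0) h1 := lc; have /cont_onRP/(_ p pc e e0) h2 := hc.
apply: filterS2 h1 h2 => q h1 h2 qc; move: (h1 qc) (h2 qc).
rewrite !(barrier_sphere _ _ pz) (perron_sup_sphere pz).
rewrite !ltr_norml.
have := perron_sup_ge (perron_barrier bc bM) qc.
have : w q <= - barrier (fun q => - b q) M q.
  by apply: perron_sup_le => // v pv; exact: perron_le_barrier.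
move=> a1 a2 /andP[b1 b2] /andP[c1 c2]; lra.
Qed.

End PerronSup.

End Dirichlet.

(** * Schwarz's alternating method *)

Section Alternating.
Variables (R : realType) (S : riemann_surface R) (z : coordinate R S).
Local Notation C := (Cplx R).
Local Notation I := (`[0, 1]%classic : set R).
Local Notation circ := (@circ R).
Implicit Types (p q : S) (u v h b : S -> R).
Hypothesis lz : local_coordinate z.
Hypothesis z5 : forall w : C, nm w < 5 -> dom z (cinv z w) /\ z (cinv z w) = w.
Hypothesis Scompact : compact [set: S].

Let gz : good_disc z.
Proof. by split=> //; exists 5; rewrite ?ltr1n. Qed.

Local Notation outer := (outer z).
Local Notation couter := (couter z).
Local Notation D := (outer_coord z).
Local Notation H := (perron_sup z).

Let gD : good_disc D. Proof. exact: good_outer. Qed.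

Lemma dirichlet_cont b : cont_on (sphere z) b -> cont_on couter (H b).
Proof.
move=> bc; have [M bM] := compact_bound (compact_sphere lz z5) bc.
exact: perron_sup_cont bM.
Qed.

Lemma dirichlet_harm b p : cont_on (sphere z) b -> outer p -> harm (H b) p.
Proof.
move=> bc; have [M bM] := compact_bound (compact_sphere lz z5) bc.
exact: perron_sup_harm bM p.
Qed.

Lemma dirichlet_sphere b p : cont_on (sphere z) b -> sphere z p -> H b p = b p.
Proof.
move=> bc; have [M bM] := compact_bound (compact_sphere lz z5) bc.
exact: perron_sup_sphere bM p.
Qed.

Lemma dirichlet_ge b (m : R) p : cont_on (sphere z) b ->
  (forall q, sphere z q -> m <= b q) -> couter p -> m <= H b p.
Proof.
move=> bc mb pc; rewrite -subr_le0.
have uc : cont_on couter (fun q => m - H b q).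
  exact: cont_onB (@cont_on_cst _ _ couter m) (dirichlet_cont bc).
apply: (outer_max lz z5 Scompact uc) pc.
  move=> q qo; apply: harm_submean.
  exact: harmB (harm_cst m q) (dirichlet_harm bc qo).
by move=> q qz; rewrite dirichlet_sphere // subr_le0; exact: mb.
Qed.

Lemma dirichlet_le b (m : R) p : cont_on (sphere z) b ->
  (forall q, sphere z q -> b q <= m) -> couter p -> H b p <= m.
Proof.
move=> bc mb pc; rewrite -subr_le0.
have uc : cont_on couter (fun q => H b q - m).
  exact: cont_onB (dirichlet_cont bc) (@cont_on_cst _ _ couter m).
apply: (outer_max lz z5 Scompact uc) pc.
  move=> q qo; apply: harm_submean.
  exact: harmB (dirichlet_harm bc qo) (harm_cst m q).
by move=> q qz; rewrite dirichlet_sphere // subr_le0; exact: mb.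
Qed.

Lemma sphereD_outer p : sphere D p -> outer p.
Proof.
move=> [zp]; rewrite nm_outer => p2 [_ p1]; move: p2 p1.
by move: (nm _) => a; lra.
Qed.

Lemma sphere_odiscD p : sphere z p -> odisc D p.
Proof. by move=> [zp p1]; split=> //; rewrite nm_outer p1; lra. Qed.

Lemma couter_sphereD u : cont_on couter u -> cont_on (sphere D) u.
Proof. by apply: cont_on_sub => p /sphereD_outer/outer_couter. Qed.

Lemma pmodD_sphere u : cont_on couter u -> cont_on (sphere z) (pmod D u).
Proof.
move=> uc; apply: cont_on_sub (pmod_cont gD (couter_sphereD uc)) => p.
by move=> /sphere_odiscD/odisc_cdisc.
Qed.

Definition osc_le b (k : R) := exists m : R, forall p, sphere z p -> m <= b p <= m + k.

(* Harnack's inequality on |z| = 1 inside |z| < 2, applied to the distances to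
   both extreme values. *)
Lemma alternate_osc b (k : R) : cont_on (sphere z) b -> osc_le b k ->
  osc_le (pmod D (H b)) (2 / 3 * k).
Proof.
move=> bc [m mk].
have Hc := dirichlet_cont bc; have HDc := couter_sphereD Hc.
have cI := cont_circle1 gD HDc.
have ge q : couter q -> m <= H b q by apply: dirichlet_ge => // r /mk/andP[].
have le q : couter q -> H b q <= m + k by apply: dirichlet_le => // r /mk/andP[].
have co t : couter (circle D 1 t) by exact/outer_couter/sphereD_outer/sphere_circle.
pose a := mean (fun t => H b (circle D 1 t)).
have cm : cont_on I (fun=> m : R) by exact: cont_on_cst.
have cmk : cont_on I (fun=> m + k) by exact: cont_on_cst.
exists (m + (a - m) / 3) => p pz.
have [zp p1] := pz.
have pD := sphere_odiscD pz.
have p2 : nm (D p) <= 2^-1 by rewrite nm_outer p1 mul1r.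
have plt : nm (D p) < 1 by case: pD.
rewrite pmod_in //.
have c1 := cont_onB cI cm; have c2 := cont_onB cmk cI.
have pge t : 0 <= H b (circle D 1 t) - m by rewrite subr_ge0; exact: ge.
have ple t : 0 <= m + k - H b (circle D 1 t) by rewrite subr_ge0; exact: le.
have [h1 _] := andP (harnack c1 (fun t _ => pge t) p2).
have [h2 _] := andP (harnack c2 (fun t _ => ple t) p2).
have E1 : mean (fun t => H b (circle D 1 t) - m) = a - m.
  by rewrite -poisson0 // poissonB ?nm0 // poisson_cst ?nm0 // poisson0.
have E2 : mean (fun t => m + k - H b (circle D 1 t)) = m + k - a.
  by rewrite -poisson0 // poissonB ?nm0 // poisson_cst ?nm0 // poisson0.
move: h1 h2; rewrite E1 E2 !poissonB // !poisson_cst //.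
by move: (poisson _ _) => y h1 h2; lra.
Qed.

Section Iteration.
Variables (s : S -> R) (k : R) (p0 : S).
Hypothesis sc : cont_on (sphere z) s.
Hypothesis sk : osc_le s k.
Hypothesis p0z : sphere z p0.

Fixpoint alternate n : S -> R :=
  if n is n'.+1 then pmod D (H (alternate n')) else s.

Lemma alternate_cont n : cont_on (sphere z) (alternate n).
Proof. by elim: n => [|n IH] //=; exact/pmodD_sphere/dirichlet_cont. Qed.

Let r n : R := (2 / 3) ^+ n * k.

Lemma osc_alternate n : osc_le (alternate n) (r n).
Proof.
elim: n => [|n IH]; first by rewrite /r expr0 mul1r.
by rewrite /r exprS -mulrA; apply: alternate_osc; [exact: alternate_cont|].
Qed.

Lemma alternate_near n p : sphere z p -> `|alternate n p - alternate n p0| <= r n.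
Proof.
move=> pz; have [m mk] := osc_alternate n.
have /andP[h1 h2] := mk p pz; have /andP[h3 h4] := mk p0 p0z.
by rewrite ler_norml; apply/andP; split; lra.
Qed.

Lemma r_ge0 n : 0 <= r n.
Proof. by apply: le_trans (alternate_near n p0z); exact: normr_ge0. Qed.

(** The alternating step contracts oscillations but fixes constants. Subtracting the value at [p0]
    leaves terms of size (2/3)^n and changes each of them only by a constant. *)
Let t n p : R := H (alternate n) p - alternate n p0.

Definition alternate_sum n p : R := \sum_(j < n) t j p.

Lemma alternate_term n p : couter p -> `|t n p| <= r n.
Proof.
move=> pc; rewrite /t ler_norml lerBlDr lerBrDr; apply/andP; split.
  apply: (dirichlet_ge (@alternate_cont n)) pc => q qz.
  have := alternate_near n qz; rewrite ler_norml => /andP[]; lra.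
apply: (dirichlet_le (@alternate_cont n)) pc => q qz.
have := alternate_near n qz; rewrite ler_norml => /andP[]; lra.
Qed.

Lemma alternate_sumS n p : alternate_sum n.+1 p = alternate_sum n p + t n p.
Proof. by rewrite /alternate_sum big_ord_recr. Qed.

Lemma alternate_sum_near n m p : couter p ->
  `|alternate_sum (n + m) p - alternate_sum n p| <= 3 * r n - 3 * r (n + m).
Proof.
move=> pc; elim: m => [|m IH]; first by rewrite addn0 !subrr normr0.
rewrite addnS alternate_sumS.
have h := alternate_term (n + m) pc.
have E : r (n + m).+1 = 2 / 3 * r (n + m) by rewrite /r exprS -mulrA.
rewrite E addrAC; apply: le_trans (ler_normD _ _) _.
by move: IH h; move: (`|_|) (`|_|) => a b; lra.
Qed.

Lemma r_small (e : R) : 0 < e -> exists n, r n < e.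
Proof.
move=> e0; have rl : (fun n => r n) @ \oo --> (0 : R).
  rewrite -(mul0r k); apply: cvgM; last exact: cvg_cst.
  by apply: cvg_expr; rewrite ger0_norm ?divr_ge0 //; lra.
move/cvgrPdist_lt : rl => /(_ e e0) [n _ /(_ n (leqnn n))] /=.
rewrite sub0r normrN => h; exists n; exact: le_lt_trans (ler_norm _) h.
Qed.

Definition alternate_lim p : R := lim (alternate_sum ^~ p @ \oo).

Lemma alternate_lim_near n p : couter p ->
  `|alternate_lim p - alternate_sum n p| <= 3 * r n.
Proof.
move=> pc.
have near3 i j : (i <= j)%N -> `|alternate_sum j p - alternate_sum i p| <= 3 * r i.
  move=> /subnKC <-; apply: le_trans (alternate_sum_near _ _ pc) _.
  by have := r_ge0 (i + (j - i)); lra.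
have cv : cvgn (alternate_sum ^~ p).
  apply: cauchy_cvgn => e e0; have e30 : 0 < e / 3 by rewrite divr_gt0.
  have [i ri] := r_small e30; exists i => j ij.
  by apply: le_trans (near3 i j ij) _; lra.
apply/ler_addgt0Pr => e e0.
move/cvgrPdist_lt : (cv) => /(_ e e0) [N _ NP].
have := NP (maxn N n) (leq_maxl _ _); rewrite /= -/(alternate_lim p) => h1.
have h2 := near3 n (maxn N n) (leq_maxr _ _).
have -> : alternate_lim p - alternate_sum n p =
  (alternate_lim p - alternate_sum (maxn N n) p) +
  (alternate_sum (maxn N n) p - alternate_sum n p) by ring.
by apply: le_trans (ler_normD _ _) _; move: h1 h2; move: (`|_|) (`|_|) => a b; lra.
Qed.

Lemma alternate_sum_cont n : cont_on couter (alternate_sum n).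
Proof.
elim: n => [|n IH].
  apply: (cont_on_ext _ (@cont_on_cst _ _ couter (0 : R))) => p _.
  by rewrite /alternate_sum big_ord0.
have tc : cont_on couter (t n).
  exact: cont_onB (dirichlet_cont (@alternate_cont n)) (@cont_on_cst _ _ couter _).
apply: (cont_on_ext _ (cont_onD IH tc)) => p _; by rewrite alternate_sumS.
Qed.

Lemma alternate_sum_harm n p : outer p -> harm (alternate_sum n) p.
Proof.
move=> po; elim: n => [|n IH].
  apply: (harm_eq _ (harm_cst 0 p)); apply: nearW => q.
  by rewrite /alternate_sum big_ord0.
have th : harm (t n) p.
  exact: harmB (dirichlet_harm (@alternate_cont n) po) (harm_cst _ p).
apply: (harm_eq _ (harmD IH th)); apply: nearW => q; by rewrite alternate_sumS.
Qed.

(** The telescoping of a Neumann series: if T is the alternating step, 1 - T applied to the sum of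
    the T^j s is s - T^n s. The subtracted constants drop out since [pmod] preserves them. *)
Lemma pmod_alternate n p : sphere z p ->
  alternate_sum n p - pmod D (alternate_sum n) p = s p - alternate n p.
Proof.
move=> pz; have pD := sphere_odiscD pz.
elim: n => [|n IH].
  have -> : alternate_sum 0 = (fun=> 0) by apply/funext => q; rewrite /alternate_sum
    big_ord0.
  by rewrite pmod_cst subrr subrr.
have -> : alternate_sum n.+1 = (fun q => alternate_sum n q + t n q).
  by apply/funext => q; rewrite alternate_sumS.
have Hc := couter_sphereD (dirichlet_cont (@alternate_cont n)).
have cc : cont_on (sphere D) (fun=> alternate n p0) by exact: cont_on_cst.
rewrite pmodD //; last exact: cont_onB Hc cc.
  rewrite /t pmodB // pmod_cst /= -/(alternate n) (dirichlet_sphere (@alternate_cont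
    n) pz).
  by move: IH; move: (pmod _ _ _) (pmod _ _ _) => a b; lra.
exact/couter_sphereD/alternate_sum_cont.
Qed.

Lemma alternate_lim_cont : cont_on couter alternate_lim.
Proof.
apply/cont_onRP => p pc e e0; have e10 : 0 < e / 9 by rewrite divr_gt0.
have [n rn] := r_small e10.
have /cont_onRP/(_ p pc _ e10) := @alternate_sum_cont n.
apply: filterS => q h qc; have := h qc.
have := alternate_lim_near n qc; have := alternate_lim_near n pc.
rewrite !ler_norml !ltr_norml => /andP[a1 a2] /andP[b1 b2] /andP[c1 c2].
by apply/andP; split; lra.
Qed.

Lemma alternate_lim_harm p : outer p -> harm alternate_lim p.
Proof.
move=> po; have No : nbhs p outer.
  by apply: open_nbhs_nbhs; split=> //; exact: open_outer.
have [x [gx xo xp x0]] := disc_exists No.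
apply: (harm_unif gx); first by split; rewrite // x0 nm0.
move=> e e0; have e30 : 0 < e / 3 by rewrite divr_gt0.
have [n rn] := r_small e30; exists (alternate_sum n); split.
- by apply: cont_on_sub (@alternate_sum_cont n) => q /xo/outer_couter.
- by move=> q /odisc_cdisc/xo; exact: alternate_sum_harm.
- move=> q /xo/outer_couter qc; apply: le_trans (alternate_lim_near n qc) _; lra.
Qed.

Lemma alternate_lim_jump p : sphere z p ->
  alternate_lim p - pmod D alternate_lim p - s p =
  alternate_lim p0 - pmod D alternate_lim p0 - s p0.
Proof.
move=> pz; apply/eqP; rewrite -subr_eq0 -normr_eq0 eq_le normr_ge0 andbT.
(* 13 = 6 + 6 + 1: the error of the jump at p and at [p0], and the oscillation of [alternate n]. *)
apply/ler_addgt0Pr => e e0; rewrite add0r; have e10 : 0 < e / 13 by rewrite divr_gt0.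
have [n rn] := r_small e10.
have L q : sphere z q -> `|alternate_lim q - pmod D alternate_lim q - s q + alternate
  n q| <= 6 * r n.
  move=> qz; have h1 := alternate_lim_near n (sphere_couter qz).
  have h2 : `|pmod D alternate_lim q - pmod D (alternate_sum n) q| <= 3 * r n.
    apply: (pmod_near gD _ _ _ (odisc_cdisc (sphere_odiscD qz))).
    - exact/couter_sphereD/alternate_lim_cont.
    - exact/couter_sphereD/alternate_sum_cont.
    - by move=> q' /sphereD_outer/outer_couter; exact: alternate_lim_near.
  have := pmod_alternate n qz; move: h1 h2.
  move: (pmod D alternate_lim q) (pmod _ _ q) => a b.
  rewrite !ler_norml => /andP[a1 a2] /andP[b1 b2] h; apply/andP; split; lra.
have := L p pz; have := L p0 p0z; have := alternate_near n pz.
move: (pmod D alternate_lim p) (pmod D alternate_lim p0) => a b.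
rewrite !ler_norml => /andP[a1 a2] /andP[b1 b2] /andP[c1 c2]; apply/andP; split; lra.
Qed.

End Iteration.

(** This makes h, defined for |z| >= 1, and s + [pmod D h], defined for |z| <= 2, agree on |z| = 1
    up to the constant c. If s vanishes on |z| = 2 they also agree there, so on the annulus both
    represent one harmonic function once the constant is removed. *)
Lemma alternating s : cont_on (sphere z) s -> exists (h : S -> R) (c : R),
  [/\ cont_on couter h, forall p, outer p -> harm h p
    & forall p, sphere z p -> h p = s p + pmod D h p + c].
Proof.
move=> sc; have [M bM] := compact_bound (compact_sphere lz z5) sc.
have sk : osc_le s (2 * M).
  by exists (- M) => p /bM; rewrite ler_norml => /andP[]; move=> *; apply/andP;
    split; lra.
have p0z := sphere_circle 0 gz.
exists (alternate_lim s (circle z 1 0)).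
eexists; split; [exact: alternate_lim_cont sc sk p0z|exact: alternate_lim_harm sc sk
  p0z|].
move=> p pz; have E := alternate_lim_jump sc sk p0z pz.
set X := alternate_lim _ _ p in E *; set Y := pmod _ _ p in E *.
have -> : X = s p + Y + (X - Y - s p) by ring.
rewrite E; reflexivity.
Qed.

End Alternating.

(** * Meromorphic functions with a single pole *)

Lemma compact_finite (T : topologicalType) (K : set T) (U : T -> set T) :
  compact K -> (forall p, K p -> open (U p) /\ U p p) ->
  exists s : seq T, (forall p, p \in s -> K p) /\
    forall q, K q -> exists2 p, p \in s & U p q.
Proof.
move=> cK KU.
(* The filter generated by the sets of all lists containing a given finite list of points of K.
   Near-covering compactness along it is the finite subcover property. *)
pose F (A : set (seq T)) := exists s0 : seq T, (forall p, p \in s0 -> K p) /\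
  forall s, {subset s0 <= s} -> A s.
have FF : Filter F.
  split; first by exists [::].
    move=> A B [s [sK sA]] [t [tK tB]]; exists (s ++ t); split.
      by move=> p; rewrite mem_cat => /orP[/sK|/tK].
    by move=> u stu; split; [apply: sA|apply: tB] => p ps; apply: stu;
      rewrite mem_cat ps ?orbT.
  by move=> A B AB [s [sK sA]]; exists s; split=> // t /sA /AB.
have [] := iffLR (compact_near_coveringP K) cK _ F
  (fun s q => exists2 p, p \in s & U p q) FF.
  move=> p Kp; have [oU Up] := KU p Kp.
  exists (U p, [set s : seq T | p \in s]); first split=> /=.
  - by apply: open_nbhs_nbhs; split.
  - exists [:: p]; split=> [q|t]; first by rewrite inE => /eqP ->.
    by apply; rewrite mem_head.
  by move=> [q s] /= [Uq ps]; exists p.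
by move=> s [sK sP]; exists s; split=> //; exact: sP.
Qed.

Section Meromorphic.
Variables (R : realType) (S : riemann_surface R).
Local Notation C := (Cplx R).
Local Notation I := (`[0, 1]%classic : set R).
Local Notation circ := (@circ R).
Implicit Types (p q : S) (F G : S -> C).

(** Increments in the directions 1 and i see the real and the imaginary part of the derivative. *)
Lemma cdiff_re0 (f : C -> C) (a d : C) (r : R) : cdiff f a d -> 0 < r ->
  (forall w, nm (w - a) < r -> re (f w) = 0) -> d = 0.
Proof.
move=> fd r0 f0; apply: nm_small => e e0; have e20 : 0 < e / 2 by rewrite divr_gt0.
have [k k0 kP] := fd _ e20.
pose t := Num.min k r / 2.
have t0 : 0 < t by rewrite divr_gt0 // lt_min k0.
have [tk tr] : t < k /\ t < r.
  have := ge_min k k r; have := ge_min r k r; rewrite !lexx orbT /= => h1 h2.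
  by move: t0 h1 h2; rewrite /t; move: (Num.min k r) => m; lra.
have ra : re (f a) = 0 by apply: f0; rewrite subrr nm0.
have H (u : C) : nm u = 1 -> `|re (d * u)| <= e / 2.
  move=> u1; have wE : a + rc t * u - a = rc t * u by ring.
  have nE : nm (rc t * u) = t by rewrite nmM nm_rc u1 mulr1 gtr0_norm.
  have := kP (a + rc t * u); rewrite wE nE => /(_ tk) h.
  have := le_trans (le_re _) h.
  rewrite !reB ra f0 ?wE ?nE // subrr sub0r normrN mulrCA re_rcM normrM gtr0_norm //.
  by rewrite mulrC ler_pM2r.
have h1 := H 1 (nm1 R); rewrite mulr1 in h1.
have h2 := H (imC R); rewrite /imC reM re_mk im_mk mulr0 sub0r mulr1 normrN in h2.
have {}h2 := h2 _; apply: le_trans (nm_reim d) _.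
have -> : e = e / 2 + e / 2 by lra.
apply: lerD h1 (h2 _); rewrite nm_def re_mk im_mk expr0n expr1n add0r sqrtr1 //.
Qed.

(** By [cdiff_re0] the derivative vanishes, so f does not change along a segment from 0. Cauchy's
    formula holds on the disc of radius 1/2 and its uniform derivative on half of that, which gives
    the radius 1/4. *)
Lemma hol_re0_const (f : C -> C) : (forall w, nm w <= 1 -> hol f w) ->
  (forall w, nm w <= 1 -> re (f w) = 0) -> forall w, nm w <= 4^-1 -> f w = f 0.
Proof.
move=> fh f0 w w4.
have fd z : nm (z - 0) <= 1 -> exists d, cdiff f z d.
  by rewrite subr0 => /fh/hol_cdiff.
pose g : R -> C := fun t => f (0 + rc (1 / 2) * circ t).
have [gc gE] : cont_on I g /\ forall z, nm z < 1 ->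
  f (0 + rc (1 / 2) * z) = cauchy g 1 z := cauchy_formula (@ltr01 R) fd.
have half1 : 2^-1 < 1 :> R by rewrite invf_lt1 ?ltr1n.
have half0 : 0 <= 2^-1 :> R by rewrite invr_ge0.
have gU := cauchy_udiff gc (isT : (0 < 2)%N) half0 half1.
have g2 z : nm z <= 2^-1 -> 1%:R * cauchy g 2 z = 0.
  move=> z2; have z1 : nm z < 1 by apply: le_lt_trans z2 _.
  apply: (@cdiff_re0 (cauchy g 1) z _ (1 - nm z)); first exact: cauchy_cdiff.
    by rewrite subr_gt0.
  move=> v vz; have v1 : nm v < 1 by have := nm_triB v z; lra.
  rewrite -gE // f0 // add0r nmM nm_rc ger0_norm ?divr_ge0 //.
  by move: v1 (nm_ge0 v) => ? ?; nra.
pose v := rc 2 * w.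
have v2 : nm v <= 2^-1 by rewrite nmM nm_rc ger0_norm //; lra.
have E z : nm z < 1 -> f (rc (1 / 2) * z) = cauchy g 1 z by move=> z1; rewrite -gE
  ?add0r.
have -> : w = rc (1 / 2) * v by rewrite mulrA -rcM mul1r mulVf ?pnatr_eq0 // rc1 mul1r.
have -> : f 0 = cauchy g 1 0 by rewrite -E ?nm0 // mulr0.
rewrite E; last exact: le_lt_trans v2 half1.
have := @const_of_small_increments R (fun t => cauchy g 1 (rc t * v)).
rewrite rc0 rc1 mul0r mul1r; apply=> e e0.
have [k k0 kP] := gU e e0; exists k => // s t s01 t01 st.
have B t' : 0 <= t' <= 1 -> nm (rc t' * v) <= 2^-1.
  move=> /andP[t0 t1]; rewrite nmM nm_rc ger0_norm //.
  by move: v2 (nm_ge0 v) => ? ?; nra.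
have D : nm (rc t * v - rc s * v) <= `|t - s|.
  rewrite -mulrBl -rcB nmM nm_rc; have := normr_ge0 (t - s).
  by move: v2 (nm_ge0 v) => ? ? ?; nra.
have := kP _ _ (B s s01) (B t t01) (le_lt_trans D st).
rewrite g2; last exact: B.
rewrite mul0r subr0 => h; apply: le_trans h _; rewrite ler_wpM2l //; exact: ltW.
Qed.

(** A holomorphic function with vanishing real part is constant on small discs. K is covered by
    finitely many of them, and the imaginary parts at their centres determine the function on K.
    This makes gluing a matter of finitely many real linear conditions. *)
Lemma finite_test (K O : set S) : compact K -> open O -> K `<=` O ->
  exists s : seq S, (forall p, p \in s -> O p) /\
    forall G, (forall p, O p -> hol_at G p /\ re (G p) = 0) ->
      (forall p, p \in s -> im (G p) = 0) -> forall p, K p -> G p = 0.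
Proof.
move=> cK oO KO.
pose P p x := [/\ good_disc x, cdisc x `<=` O, dom x p & x p = 0].
have /choice[X XP] : forall p, exists x, K p -> P p x.
  move=> p; have [Kp|nKp] := pselect (K p); last by exists (Coordinate set0 (fun=>
    0)) => /nKp.
  have Np : nbhs p O by apply: open_nbhs_nbhs; split=> //; exact: KO.
  by have [x xP] := disc_exists Np; exists x.
have [|s [sK Ks]] := compact_finite (U := fun p => disc (X p) 4^-1) cK.
  move=> p /XP[gx _ xp x0]; split; first by apply: open_disc; exact: good_local.
  by split=> //; rewrite x0 nm0 invr_gt0.
exists s; split=> [p /sK/KO //|G GO G0 q /Ks[p ps [xq q4]]].
have [gx xO xp x0] := XP p (sK p ps); have lx := good_local gx.
have inv w : nm w <= 1 -> O (cinv (X p) w) /\ dom (X p) (cinv (X p) w) /\ (X p) (cinv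
  (X p) w) = w.
  move=> w1; have [iw wE] := good_inv gx w1; split=> //; apply: xO; split=> //.
  by rewrite wE.
have := @hol_re0_const (fun w => G (cinv (X p) w)) _ _ ((X p) q) (ltW q4).
have i0 : cinv (X p) 0 = p by rewrite -x0 cinvK.
rewrite cinvK // i0 => ->.
- by apply: ceq; [have [_ ->] := GO p (KO _ (sK _ ps))|rewrite G0].
- move=> w w1; have [ow [dw wE]] := inv w w1.
  by have := hol_atP (GO _ ow).1 lx dw; rewrite wE.
- by move=> w w1; have [ow _] := inv w w1; have [] := GO _ ow.
Qed.

Lemma hol_at_sum m (f : 'I_m -> S -> C) p : (forall i, hol_at (f i) p) ->
  hol_at (fun q => \sum_i f i q) p.
Proof.
elim: m f => [|m IH] f fp.
  by apply: (hol_at_eq _ (hol_at_cst 0 p)); apply: nearW => q; rewrite big_ord0.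
apply: (hol_at_eq _ (hol_atD (IH _ (fun i => fp (widen_ord (leqnSn m) i))) (fp
  ord_max))).
by apply: nearW => q; rewrite big_ord_recr.
Qed.

Lemma harm_sum m (f : 'I_m -> S -> R) p : (forall i, harm (f i) p) ->
  harm (fun q => \sum_i f i q) p.
Proof.
elim: m f => [|m IH] f fp.
  by apply: (harm_eq _ (harm_cst 0 p)); apply: nearW => q; rewrite big_ord0.
apply: (harm_eq _ (harmD (IH _ (fun i => fp (widen_ord (leqnSn m) i))) (fp ord_max))).
by apply: nearW => q; rewrite big_ord_recr.
Qed.

Lemma cont_on_sum (A : set S) m (f : 'I_m -> S -> R) : (forall i, cont_on A (f i)) ->
  cont_on A (fun q => \sum_i f i q).
Proof.
elim: m f => [|m IH] f fp.
  by apply: (cont_on_ext _ (@cont_on_cst _ _ A (0 : R))) => q _; rewrite big_ord0.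
have h1 : cont_on A (fun q => \sum_i f (widen_ord (leqnSn m) i) q).
  by apply: IH => i; exact: fp.
apply: (cont_on_ext _ (cont_onD h1 (fp ord_max))) => q _.
by rewrite big_ord_recr.
Qed.

Lemma re_sum m (f : 'I_m -> C) : re (\sum_i f i) = \sum_i re (f i).
Proof.
by elim: m f => [|m IH] f; rewrite ?big_ord0 // !big_ord_recr /= reD IH.
Qed.

Lemma im_sum m (f : 'I_m -> C) : im (\sum_i f i) = \sum_i im (f i).
Proof.
by elim: m f => [|m IH] f; rewrite ?big_ord0 // !big_ord_recr /= imD IH.
Qed.

Lemma re_inv_circle (w : C) : nm w = 1 -> re w^-1 = re w.
Proof.
by move=> /circ_surj[t _ <-]; rewrite circV /circ !re_mk mulrN cosN.
Qed.

Section Existence.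
Variables (z : coordinate R S) (Q : S).
Hypothesis lz : local_coordinate z.
Hypothesis z5 : forall w : C, nm w < 5 -> dom z (cinv z w) /\ z (cinv z w) = w.
Hypothesis Scompact : compact [set: S].
Hypothesis zQ : dom z Q.
Hypothesis zQ0 : z Q = 0.

Local Notation outer := (outer z).
Local Notation couter := (couter z).
Local Notation D := (outer_coord z).

Let gz : good_disc z.
Proof. by split=> //; exists 5; rewrite ?ltr1n. Qed.

Let gD : good_disc D. Proof. exact: good_outer. Qed.

(** On |z| = 2 the conjugate of 1 / z is z / 4, so the subtracted power makes the real part vanish
    on the unit circle of D. *)
Definition principal n p : C := (z p)^-1 ^+ n - (z p / rc 4) ^+ n.

Lemma coord_neq0 p : dom z p -> p <> Q -> z p != 0.
Proof.
move=> zp pQ; apply/eqP => p0; apply: pQ.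
by rewrite -(cinvK lz zp) p0 -zQ0 cinvK.
Qed.

Lemma hol_atX F p n : hol_at F p -> hol_at (fun q => F q ^+ n) p.
Proof.
by move=> Fp; apply: (@hol_at_comp _ _ (fun w => w ^+ n) F) => //; exact: holX
  (hol_id _).
Qed.

Lemma hol_scaled_coord p n : dom z p -> hol_at (fun q => (z q / rc 4) ^+ n) p.
Proof.
move=> zp; apply: hol_atX; exact: hol_atM (hol_at_coord lz zp) (hol_at_cst _ p).
Qed.

Lemma hol_principal n p : dom z p -> p <> Q -> hol_at (principal n) p.
Proof.
move=> zp pQ; apply: hol_atB (hol_scaled_coord n zp).
by apply: hol_atX; apply: hol_inv => //; exact: coord_neq0.
Qed.

Lemma principal_sphereD n p : sphere D p -> re (principal n p) = 0.
Proof.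
move=> [zp p1]; rewrite /principal reB.
have -> : (z p)^-1 = rc 2^-1 * (D p)^-1.
  rewrite /= subr0 invfM invrK mulrCA -rcM mulVf ?pnatr_eq0 //.
  by rewrite rc1 mulr1.
have -> : z p / rc 4 = rc 2^-1 * D p.
  rewrite /= subr0; have -> : rc 4 = rc 2 * rc 2 :> C by rewrite -rcM; congr rc; ring.
  have -> : rc 2^-1 = (rc 2)^-1 :> C by rewrite fmorphV.
  by rewrite invfM mulrCA.
have cX (y : R) k : rc y ^+ k = rc (y ^+ k) :> C.
  by elim: k => [|k IH]; rewrite ?expr0 ?rc1 // !exprS IH rcM.
move: (D p) p1 => w w1.
rewrite !exprMn cX !re_rcM [w^-1 ^+ n]exprVn re_inv_circle ?subrr //.
by rewrite nmX w1 expr1n.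
Qed.

Lemma sphere_neqQ p : outer p -> p <> Q.
Proof. by move=> po pQ; apply: po; rewrite pQ; split; rewrite // zQ0 nm0. Qed.

Lemma sphere_Q p : sphere z p -> p <> Q.
Proof. by move=> [_ p1] pQ; move: p1; rewrite pQ zQ0 nm0 => /eqP; rewrite eq_sym
  oner_eq0. Qed.

Lemma principal_cont n (A : set S) : (forall p, A p -> dom z p /\ p <> Q) ->
  cont_on A (fun p => re (principal n p)).
Proof.
move=> AP; apply: cont_at_on => p /AP[zp pQ].
exact: harm_cont (harm_re (hol_principal n zp pQ)).
Qed.

Lemma half_exists : exists h : nat -> S -> R, exists c : nat -> R, forall n,
  [/\ cont_on couter (h n), forall p, outer p -> harm (h n) p
    & forall p, sphere z p -> h n p = re (principal n p) + pmod D (h n) p + c n].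
Proof.
have E n : exists hc : (S -> R) * R, [/\ cont_on couter hc.1,
    forall p, outer p -> harm hc.1 p
  & forall p, sphere z p -> hc.1 p = re (principal n p) + pmod D hc.1 p + hc.2].
  have sc : cont_on (sphere z) (fun p => re (principal n p)).
    by apply: principal_cont => p pz; split; [case: pz|exact: sphere_Q].
  by have [h [c hc]] := alternating lz z5 Scompact sc; exists (h, c).
have [f fP] := choice E; exists (fun n => (f n).1), (fun n => (f n).2) => n.
exact: fP.
Qed.

(** Radius 3/2 lies strictly between the circles |z| = 1 and |z| = 2: the disc of Z lies in that of
    D, and its complement in the outer region. *)
Let Z := affine_coord z (z Q) (3 / 2).

Let gZ : good_disc Z.
Proof.
apply: good_affine => // w; rewrite zQ0 subr0 => w3; apply: z5.
by apply: lt_le_trans w3 _; lra.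
Qed.

Lemma odiscZ p : odisc Z p <-> disc z (3 / 2) p.
Proof.
rewrite /odisc /disc /mkset /= zQ0 subr0 nm_div nm_rc ger0_norm //.
by rewrite ltr_pdivrMr ?mul1r.
Qed.

Lemma cdiscZ p : cdisc Z p <-> dom z p /\ nm (z p) <= 3 / 2.
Proof.
rewrite /cdisc /mkset /= zQ0 subr0 nm_div nm_rc ger0_norm //.
by rewrite ler_pdivrMr ?mul1r.
Qed.

Section Combination.
Variables (h : nat -> S -> R) (c : nat -> R).
Hypothesis hP : forall n, [/\ cont_on couter (h n), forall p, outer p -> harm (h n) p
    & forall p, sphere z p -> h n p = re (principal n p) + pmod D (h n) p + c n].

Definition inner_part n p : C := schwarz (fun t => h n (circle D 1 t)) (D p).
Definition local_part x n p : C := schwarz (fun t => h n (circle x 1 t)) (x p).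

Let hD n : cont_on (sphere D) (h n).
Proof. by have [hc _ _] := hP n; exact: couter_sphereD hc. Qed.

Lemma inner_hol n p : odisc D p -> hol_at (inner_part n) p.
Proof. exact: pmod_hol. Qed.

Lemma inner_re n p : odisc D p -> re (inner_part n p) = pmod D (h n) p.
Proof. by move=> pD; rewrite pmod_in. Qed.

Lemma local_hol x n p : good_disc x -> cdisc x `<=` outer -> odisc x p ->
  hol_at (local_part x n) p.
Proof.
move=> gx xo xp; apply: pmod_hol => //; have [hc _ _] := hP n.
by apply: cont_on_sub hc => q /sphere_cdisc/xo/outer_couter.
Qed.

Lemma local_re x n p : good_disc x -> cdisc x `<=` outer -> odisc x p ->
  re (local_part x n p) = h n p.
Proof.
move=> gx xo xp; have [hc hh _] := hP n.
have hxc : cont_on (cdisc x) (h n) by apply: cont_on_sub hc => q /xo/outer_couter.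
have := pmod_id gx hxc (fun q xq => hh q (xo q (odisc_cdisc xq))) (odisc_cdisc xp).
by rewrite pmod_in.
Qed.

Section Coefficients.
Variables (m : nat) (nn : 'I_m -> nat) (a : 'I_m -> R).
Hypothesis ac : \sum_i a i * c (nn i) = 0.

(** Both sides are harmonic on 1 < |z| < 2. On |z| = 2 they agree since the principal parts vanish,
    and on |z| = 1 they differ by the sum of the [a i * c (nn i)], which is zero by [ac]. *)
Lemma annulus_eq p : outer p -> odisc D p ->
  \sum_i a i * h (nn i) p =
  \sum_i a i * (re (principal (nn i) p) + pmod D (h (nn i)) p).
Proof.
move=> po pD.
pose K : set S := couter `&` cdisc D.
pose O : set S := outer `&` odisc D.
(* The factor k will be 1 and -1, so that the one-sided maximum principle yields an equality. *)
pose u (k : R) i q := k * (a i * (h (nn i) q - (re (principal (nn i) q) + pmod D (h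
  (nn i)) q))).
have KQ q : K q -> dom z q /\ q <> Q.
  move=> [qc [zq _]]; split=> //; have [/sphere_neqQ//|/sphere_Q//] := couter_split qc.
have uc k i : cont_on K (u k i).
  have [hc _ _] := hP (nn i).
  have h1 := cont_on_sub (@subIsetl _ couter (cdisc D)) hc.
  have h2 := cont_on_sub (@subIsetr _ couter (cdisc D)) (pmod_cont gD (@hD (nn i))).
  have h3 := @principal_cont (nn i) K KQ.
  have h4 := cont_onB h1 (cont_onD h3 h2).
  exact: cont_onM (@cont_on_cst _ _ K k) (cont_onM (@cont_on_cst _ _ K (a i)) h4).
have uh k i q : O q -> harm (u k i) q.
  move=> [qo qD]; have [_ hh _] := hP (nn i).
  apply: harmZ; apply: harmZ; apply: harmB (hh q qo) _.
  apply: harmD (harm_re (hol_principal _ _ (sphere_neqQ qo))) _; first by case: qD.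
  by apply: pmod_harm.
have main k : \sum_i u k i p <= 0.
  have := @max_principle R S O K (fun q => \sum_i u k i q); apply.
  - apply: openI; first exact: open_outer.
    exact: open_disc (good_local gD).
  - apply/eqP => OT; have : O Q by rewrite OT.
    by move=> [/sphere_neqQ].
  - apply: compact_closedI; first exact: compact_couter.
    exact: closed_cdisc.
  - by move=> q [qo qD]; split; [exact: outer_couter|exact: odisc_cdisc].
  - by apply: cont_on_sum => i; exact: uc.
  - by move=> q qO; apply: harm_submean; apply: harm_sum => i; exact: uh.
  - move=> q [qc qD] nO.
    have [qo|qz] := couter_split qc.
      have [qD'|qs] := cdisc_split qD; first by case: nO.
      rewrite big1 // => i _; rewrite /u principal_sphereD // add0r.
      by rewrite pmod_sphere // subrr !mulr0.
    rewrite -mulr_sumr; have -> : \sum_i a i * (h (nn i) q - (re (principal (nn i) q)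
      + pmod D (h (nn i)) q)) = 0.
      rewrite -[RHS]ac; apply: eq_bigr => i _; have [_ _ hs] := hP (nn i).
      congr (_ * _); rewrite hs //.
      move: (re _) (c _) => x y; move: (pmod D (h (nn i)) q) => w; ring.
    by rewrite mulr0.
  - by split; [exact: outer_couter|exact: odisc_cdisc].
have := main 1; have := main (- 1); rewrite /u -!mulr_sumr mul1r mulN1r oppr_le0 =>
  h1 h2.
apply/eqP; rewrite -subr_eq0 -sumrB.
have -> : \sum_i (a i * h (nn i) p - a i * (re (principal (nn i) p) + pmod D (h (nn
  i)) p)) =
   \sum_i a i * (h (nn i) p - (re (principal (nn i) p) + pmod D (h (nn i)) p)).
  by apply: eq_bigr => i _; rewrite mulrBr.
by rewrite eq_le h1 h2.
Qed.

End Coefficients.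
End Combination.

Definition combination m (nn : 'I_m -> nat) (a : 'I_m -> R) (F : nat -> S -> C) p : C :=
  \sum_i rc (a i) * F (nn i) p.

Lemma hol_combination m (nn : 'I_m -> nat) (a : 'I_m -> R) (F : nat -> S -> C) p :
  (forall n, hol_at (F n) p) -> hol_at (combination nn a F) p.
Proof.
by move=> Fp; apply: hol_at_sum => i; exact: hol_atM (hol_at_cst _ p) (Fp _).
Qed.

Lemma re_combination m (nn : 'I_m -> nat) (a : 'I_m -> R) (F : nat -> S -> C) p :
  re (combination nn a F p) = \sum_i a i * re (F (nn i) p).
Proof. by rewrite re_sum; apply: eq_bigr => i _; rewrite re_rcM. Qed.

Lemma im_combinationB m (nn : 'I_m -> nat) (a : 'I_m -> R) (F G : nat -> S -> C) p :
  im (combination nn a F p - combination nn a G p) =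
  \sum_i a i * im (F (nn i) p - G (nn i) p).
Proof.
rewrite -sumrB im_sum; apply: eq_bigr => i _.
by rewrite -mulrBr im_rcM.
Qed.

(** On the disc of Z and on each of finitely many small outer discs there is a holomorphic candidate
    whose real part is the sum of the [a i * h (nn i)]. On overlaps the candidates differ by locally
    constant imaginary functions, and the conditions in [Phi] force these to vanish. *)
Lemma meromorphic_combination : exists Phi : seq (nat -> R),
  forall m (nn : 'I_m -> nat) (a : 'I_m -> R),
  all (fun phi => \sum_i a i * phi (nn i) == 0) Phi ->
  exists F, (forall p, p <> Q -> hol_at F p) /\ exists2 G, hol_at G Q &
    forall p, disc z (3 / 2) p -> F p = \sum_i rc (a i) * (z p)^-1 ^+ nn i + G p.
Proof.
have [h [c hP]] := half_exists.
have coZ : compact (~` odisc Z).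
  apply: subclosed_compact _ Scompact _ => //; apply: open_closedC.
  exact: open_disc (good_local gZ).
have Zo p : ~ odisc Z p -> outer p.
  by move=> nZ [zp p1]; apply: nZ; apply/odiscZ; split=> //; lra.
have /choice[X XP] : forall p, exists x, ~ odisc Z p ->
    [/\ good_disc x, cdisc x `<=` outer, dom x p & x p = 0].
  move=> p; have [Zp|nZ] := pselect (odisc Z p); first by exists z => /(_ Zp).
  have No : nbhs p outer by apply: open_nbhs_nbhs; split; [exact: open_outer|exact: Zo].
  by have [x xP] := disc_exists No; exists x.
(* Concentric discs of half the radius: the overlaps of the closed discs are compact subsets of the
   open overlaps of the X p, as [finite_test] requires. *)
pose Y p := affine_coord (X p) (X p p) 2^-1.
have gY p : ~ odisc Z p -> good_disc (Y p).
  move=> /XP[gx _ _ x0]; apply: good_affine; [exact: good_local|by rewrite invr_gt0|].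
  by move=> w; rewrite x0 subr0 mulfV ?pnatr_eq0 // => w1; apply: good_inv => //;
    exact: ltW.
have YX p q : ~ odisc Z p -> cdisc (Y p) q -> odisc (X p) q.
  move=> /XP[gx _ _ x0].
  have -> : cdisc (Y p) q = (dom (X p) q /\ nm (X p q / rc 2^-1) <= 1) by rewrite
    /cdisc /mkset /Y /= x0 subr0.
  rewrite nm_div nm_rc ger0_norm ?invr_ge0 // invrK => -[yq q1].
  by split=> //; lra.
have [|s [sK Ks]] := compact_finite (U := fun p => odisc (Y p)) coZ.
  move=> p pZ; split; first by apply: open_disc; apply: good_local; exact: gY.
  have [_ _ xp x0] := XP p pZ; split=> //.
  by rewrite /= subrr mul0r nm0.
have T1 k : exists t : seq S, ~ odisc Z k ->
   forall G, (forall p, odisc D p /\ odisc (X k) p -> hol_at G p /\ re (G p) = 0) ->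
     (forall p, p \in t -> im (G p) = 0) -> forall p, cdisc Z p /\ cdisc (Y k) p -> G
       p = 0.
  have [Zk|kZ] := pselect (odisc Z k); first by exists [::] => /(_ Zk).
  have gk := gY k kZ; have [gx xo xk x0] := XP k kZ.
  have cK : compact (cdisc Z `&` cdisc (Y k)).
    by apply: compact_closedI; [exact: compact_cdisc|exact: closed_cdisc].
  have oO : open (odisc D `&` odisc (X k)).
    by apply: openI; apply: open_disc; exact: good_local.
  have [|t [_ tP]] := finite_test cK oO; last by exists t => _.
  move=> p [/cdiscZ[zp p2] /(YX k p kZ)]; split=> //; split=> //.
  by rewrite nm_outer; lra.
have T2 kl : exists t : seq S, ~ odisc Z kl.1 -> ~ odisc Z kl.2 ->
   forall G, (forall p, odisc (X kl.1) p /\ odisc (X kl.2) p -> hol_at G p /\ re (G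
     p) = 0) ->
     (forall p, p \in t -> im (G p) = 0) -> forall p, cdisc (Y kl.1) p /\ cdisc (Y
       kl.2) p -> G p = 0.
  case: kl => k l /=.
  have [Zk|kZ] := pselect (odisc Z k); first by exists [::] => /(_ Zk).
  have [Zl|lZ] := pselect (odisc Z l); first by exists [::] => _ /(_ Zl).
  have [gx xo xk x0] := XP k kZ; have [gx' xo' xk' x0'] := XP l lZ.
  have cK : compact (cdisc (Y k) `&` cdisc (Y l)).
    by apply: compact_closedI; [apply/compact_cdisc/gY|apply/closed_cdisc/gY].
  have oO : open (odisc (X k) `&` odisc (X l)).
    by apply: openI; apply: open_disc; exact: good_local.
  have [|t [_ tP]] := finite_test cK oO; last by exists t => _ _.
  by move=> p [/(YX k p kZ) ? /(YX l p lZ)].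
have [t1 t1P] := choice T1; have [t2 t2P] := choice T2.
pose F0 n p := principal n p + inner_part h n p.
pose F1 k := local_part h (X k).
(* One condition for the constants, and one for every test point of an overlap of the central disc
   with a small one or of two small ones. *)
exists (c :: [seq (fun n => im (F1 k n p - F0 n p)) | k <- s, p <- t1 k] ++
  [seq (fun n => im (F1 kl.1 n p - F1 kl.2 n p)) | kl <- allpairs pair s s, p <- t2
    kl]).
move=> m nn a; rewrite /= all_cat => /and3P[/eqP ac /all_allpairsP a1 /all_allpairsP
  a2].
pose cF := combination nn a.
have reF0 p : outer p -> odisc D p -> re (cF F0 p) = \sum_i a i * h (nn i) p.
  move=> po pD; rewrite (annulus_eq hP ac po pD) re_combination; apply: eq_bigr => i _.
  by rewrite reD inner_re.
have holF0 p : odisc D p -> p <> Q -> hol_at (cF F0) p.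
  move=> pD pQ; apply: hol_combination => n; apply: hol_atD; last exact: inner_hol.
  by apply: hol_principal => //; case: pD.
have sZ k : k \in s -> ~ odisc Z k by move=> /sK.
have reF1 k p : k \in s -> odisc (X k) p -> re (cF (F1 k) p) = \sum_i a i * h (nn i) p.
  move=> /sZ/XP[gx xo _ _] pX; rewrite re_combination; apply: eq_bigr => i _.
  by rewrite (local_re hP).
have holF1 k p : k \in s -> odisc (X k) p -> hol_at (cF (F1 k)) p.
  move=> /sZ/XP[gx xo _ _] pX; apply: hol_combination => n; exact: (local_hol hP n gx
    xo pX).
have E1 k p : k \in s -> cdisc Z p -> cdisc (Y k) p -> cF (F1 k) p = cF F0 p.
  move=> ks pZ pY; apply/eqP; rewrite -subr_eq0; apply/eqP.
  apply: (t1P k (sZ k ks) (fun p => cF (F1 k) p - cF F0 p)) => // q.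
    move=> [qD qX]; have [gx xo _ _] := XP k (sZ k ks).
    have qo := xo _ (odisc_cdisc qX).
    split; last by rewrite reB reF1 // reF0 // subrr.
    apply: hol_atB; [exact: holF1|apply: holF0 => //; exact: sphere_neqQ].
  move=> qt; rewrite im_combinationB; exact/eqP/a1.
have E2 k l p : k \in s -> l \in s -> cdisc (Y k) p -> cdisc (Y l) p -> cF (F1 k) p =
  cF (F1 l) p.
  move=> ks ls pk pl; apply/eqP; rewrite -subr_eq0; apply/eqP.
  apply: (t2P (k, l) (sZ k ks) (sZ l ls) (fun p => cF (F1 k) p - cF (F1 l) p)) => // q.
    move=> [qk ql]; split; last by rewrite reB (reF1 k) // (reF1 l) // subrr.
    by apply: hol_atB; exact: holF1.
  move=> qt; rewrite im_combinationB; apply/eqP/(a2 (k, l)) => //.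
  by apply/allpairsP; exists (k, l).
(* Any small disc around p may be chosen, since the candidates agree on overlaps; Q is a default
   value. *)
pose ch p := xget Q [set k | k \in s /\ odisc (Y k) p].
have chP p : ~ odisc Z p -> ch p \in s /\ odisc (Y (ch p)) p.
  by move=> /Ks[k ks kp]; rewrite /ch; case: xgetP => [k' _ //|/(_ k)[]].
pose F p := if `[< odisc Z p >] then cF F0 p else cF (F1 (ch p)) p.
exists F; split.
  move=> p pQ; have [pZ|pZ] := pselect (odisc Z p).
    have pD : odisc D p by move/odiscZ: pZ => [zp p1]; split; rewrite // nm_outer; lra.
    apply: hol_at_eq (holF0 p pD pQ).
    have : nbhs p (odisc Z).
      by apply: open_nbhs_nbhs; split=> //; apply: open_disc; exact: good_local.
    by apply: filterS => q qZ; rewrite /F asboolT.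
  have [ks kp] := chP p pZ; set k := ch p in ks kp.
  apply: hol_at_eq (holF1 k p ks (YX _ _ (sZ k ks) (odisc_cdisc kp))).
  have : nbhs p (odisc (Y k)).
    by apply: open_nbhs_nbhs; split=> //; apply: open_disc; apply: good_local;
      exact/gY/sZ.
  apply: filterS => q qY; rewrite /F; case: asboolP => qZ.
    by apply: E1 => //; exact: odisc_cdisc.
  by have [ls lq] := chP q qZ; apply: E2 => //; exact: odisc_cdisc.
have QD : odisc D Q by split; rewrite // nm_outer zQ0 nm0 mul0r.
exists (fun p => \sum_i rc (a i) * (inner_part h (nn i) p - (z p / rc 4) ^+ nn i)).
  apply: hol_at_sum => i; apply: hol_atM (hol_at_cst _ Q) _.
  by apply: hol_atB; [exact: inner_hol|exact: hol_scaled_coord].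
move=> p /odiscZ pZ; rewrite /F asboolT // -big_split; apply: eq_bigr => i _ /=.
rewrite /F0 /principal -mulrDr; congr (_ * _).
by rewrite addrAC -addrA.
Qed.
Definition has_pole (F : S -> C) n := (forall p, p <> Q -> hol_at F p) /\
  exists G, [/\ hol_at G Q, G Q != 0 &
    \forall p \near Q, p <> Q -> F p = (z p)^-1 ^+ n * G p].

Lemma left_kernel (K : fieldType) n (A : 'M[K]_(n.+1, n)) :
  exists2 u : 'rV[K]_n.+1, u != 0 & u *m A = 0.
Proof.
have : kermx A != 0.
  rewrite -mxrank_eq0 mxrank_ker subn_eq0 -ltnNge ltnS; exact: rank_leq_col.
by move=> /rowV0Pn[u /sub_kermxP uA u0]; exists u.
Qed.

(* Among any [size Phi + 1] pole orders a nontrivial real combination satisfies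
   the finitely many conditions [Phi], and its pole order is one of them. *)
Lemma pole_orders : exists n0, forall n, (n0 <= n)%N -> exists F, has_pole F n.
Proof.
have [Phi PhiP] := meromorphic_combination.
apply: contrapT => /forallNP no.
have /choice[f fP] : forall N, exists n, (N <= n)%N /\ ~ exists F, has_pole F n.
  by move=> N; apply: contrapT => /forallNP fN; apply: (no N) => n Nn;
    apply: contrapT => nF; exact: (fN n).
pose e := fix e i := if i is i'.+1 then f (e i').+1 else f 1%N.
have eS i : (e i < e i.+1)%N by have [] := fP (e i).+1.
have e_lt i j : (i < j)%N -> (e i < e j)%N.
  elim: j => // j IH; rewrite ltnS leq_eqVlt => /orP[/eqP -> //|/IH ij].
  exact: ltn_trans ij (eS j).
have e0 i : (0 < e i)%N.
  case: i => [|i]; first by have [] := fP 1%N.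
  by apply: leq_ltn_trans (eS i).
have ebad i : ~ exists F, has_pole F (e i) by case: i => [|i]; [have [] := fP
  1%N|have [] := fP (e i).+1].
pose K := size Phi.
pose A : 'M[R]_(K.+1, K) := \matrix_(i, j) nth (fun=> 0) Phi j (e i).
have [u u0 uA] := left_kernel A.
pose a i := u 0 i.
have [|F [Fh [G GQ FE]]] := PhiP K.+1 (fun i => e i) a.
  apply/(all_nthP (fun=> 0)) => j jK; apply/eqP.
  have := congr1 (fun M : 'rV[R]_K => M 0 (Ordinal jK)) uA; rewrite !mxE => h.
  by rewrite -[RHS]h; apply: eq_bigr => i _; rewrite mxE.
have [i0 ai0] : exists i, a i != 0.
  apply: contrapT => /forallNP a0; move/eqP: u0; apply.
  apply/rowP => i; rewrite mxE; apply/eqP/negPn/negP => ui; exact: (a0 i ui).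
pose M := [arg max_(i > i0 | a i != 0) (i : nat)].
have [aM Mmax] : a M != 0 /\ forall i, a i != 0 -> (i <= M)%N.
  by rewrite /M; case: arg_maxnP => // i ai iM; split.
apply: (ebad M); exists F; split=> //.
exists (fun p => \sum_(i < K.+1) rc (a i) * (z p) ^+ (e M - e i) + z p ^+ e M * G p);
  split.
- apply: hol_atD; last first.
    by apply: hol_atM GQ; apply: hol_atX; exact: hol_at_coord.
  apply: hol_at_sum => i; apply: hol_atM (hol_at_cst _ Q) _.
  by apply: hol_atX; exact: hol_at_coord.
- rewrite zQ0 expr0n gtn_eqF // mul0r addr0 (bigD1 M) //= subnn expr0 mulr1 big1.
    by rewrite addr0 -nm_gt0 nm_rc normr_gt0.
  move=> i iM; have [->|ai] := eqVneq (a i) 0; first by rewrite mul0r.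
  have := Mmax i ai; rewrite leq_eqVlt (inj_eq val_inj) (negPf iM) /= => /e_lt iM'.
  by rewrite expr0n subn_eq0 leqNgt iM' mulr0.
- have : nbhs Q (disc z (3 / 2)).
    apply: open_nbhs_nbhs; split; first exact: open_disc.
    by split; rewrite // zQ0 nm0.
  apply: filterS => p pz pQ; have z0 : z p != 0 by apply: coord_neq0 => //; case: pz.
  rewrite FE // mulrDr mulrA -exprMn mulVf // expr1n mul1r; congr (_ + _).
  rewrite mulr_sumr; apply: eq_bigr => i _.
  have [->|ai] := eqVneq (a i) 0; first by rewrite !mul0r mulr0.
  have eiM : (e i <= e M)%N.
    by have := Mmax i ai; rewrite leq_eqVlt => /orP[/eqP ->//|/e_lt/ltnW].
  have -> : (z p)^-1 ^+ e M = (z p)^-1 ^+ (e M - e i) * (z p)^-1 ^+ e i by rewrite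
    -exprD subnK.
  by rewrite mulrCA mulrAC -exprMn mulVf // expr1n mul1r.
Qed.

End Existence.

End Meromorphic.

(** * Orders of meromorphic functions and sections *)

Section Order.
Variable R : realType.
Local Notation C := (Cplx R).
Implicit Types (f g : C -> C) (a w : C).

Definition mer f a (k : int) := exists g, [/\ hol g a, g a != 0 &
  exists2 r : R, 0 < r & forall w, w != a -> nm (w - a) < r ->
    f w = (w - a) ^ k * g w].

Lemma mer_near f f' a k (r : R) : 0 < r ->
  (forall w, w != a -> nm (w - a) < r -> f w = f' w) -> mer f a k -> mer f' a k.
Proof.
move=> r0 ff [g [gh ga [s s0 sP]]]; exists g; split=> //.
exists (Num.min r s); first by rewrite lt_min r0.
by move=> w wa; rewrite lt_min => /andP[wr ws]; rewrite -ff // sP.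
Qed.

Lemma hol_mer f a : hol f a -> f a != 0 -> mer f a 0.
Proof.
move=> fh fa; exists f; split=> //; exists 1 => // w _ _.
by rewrite expr0z mul1r.
Qed.

Lemma mer_id a : mer (fun w => w - a) a 1.
Proof.
exists (fun=> 1); split; [exact: hol_cst|exact: oner_neq0|].
by exists 1 => // w _ _; rewrite expr1z mulr1.
Qed.

Lemma merM f f' a k l : mer f a k -> mer f' a l -> mer (fun w => f w * f' w) a (k + l).
Proof.
move=> [g [gh ga [r r0 rP]]] [g' [gh' ga' [s s0 sP]]].
exists (fun w => g w * g' w); split; [exact: holM|by rewrite mulf_neq0|].
exists (Num.min r s); first by rewrite lt_min r0.
move=> w wa; rewrite lt_min => /andP[wr ws]; rewrite rP // sP //.
by rewrite expfzDr ?subr_eq0 // mulrACA.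
Qed.

Lemma merV f a k : mer f a k -> mer (fun w => (f w)^-1) a (- k).
Proof.
move=> [g [gh ga [r r0 rP]]].
exists (fun w => (g w)^-1); split; [exact: holV|by rewrite invr_eq0|].
by exists r => // w wa wr; rewrite rP // invfM invr_expz.
Qed.

Lemma merX f a k n : mer f a k -> mer (fun w => f w ^+ n) a (k * n%:Z).
Proof.
move=> fk; elim: n => [|n IH].
  rewrite mulr0; apply: (mer_near ltr01 _ (hol_mer (hol_cst 1 a) (oner_neq0 _))).
  by move=> w _ _; rewrite expr0.
have -> : k * n.+1%:Z = k + k * n%:Z by rewrite -addn1 PoszD mulrDr mulr1 addrC.
by apply: (mer_near ltr01 _ (merM fk IH)) => w _ _; rewrite exprS.
Qed.

Lemma mer_neq0 f a k : mer f a k -> exists2 r : R, 0 < r &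
  forall w, w != a -> nm (w - a) < r -> f w != 0.
Proof.
move=> [g [gh ga [r r0 rP]]]; have [s s0 sP] := hol_neq0 gh ga.
exists (Num.min r s); first by rewrite lt_min r0.
move=> w wa; rewrite lt_min => /andP[wr ws]; rewrite rP // mulf_neq0 ?sP //.
by rewrite expfz_neq0 // subr_eq0.
Qed.

Lemma mer_subC f a n c : (0 < n)%N -> mer f a (- n%:Z) ->
  mer (fun w => f w - c) a (- n%:Z).
Proof.
move=> n0 [g [gh ga [r r0 rP]]].
exists (fun w => g w - (w - a) ^+ n * c); split.
- apply: holB gh _; apply: holM (hol_cst c a); apply: holX.
  by apply: holB; [exact: hol_id|exact: hol_cst].
- by rewrite subrr expr0n gtn_eqF // mul0r subr0.
- exists r => // w wa wr; rewrite rP // mulrBr; congr (_ - _).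
  by rewrite mulrA -exprnN mulVf ?mul1r // expf_neq0 // subr_eq0.
Qed.

Lemma mer_prod f a n (vs : seq C) : (0 < n)%N -> mer f a (- n%:Z) ->
  mer (fun w => \prod_(v <- vs) (f w - v)) a (- n%:Z * (size vs)%:Z).
Proof.
move=> n0 fn; elim: vs => [|v vs IH].
  rewrite mulr0; apply: (mer_near ltr01 _ (hol_mer (hol_cst 1 a) (oner_neq0 _))).
  by move=> w _ _; rewrite big_nil.
have -> : - n%:Z * (size (v :: vs))%:Z = - n%:Z + - n%:Z * (size vs)%:Z.
  by rewrite /= -addn1 PoszD mulrDr mulr1 addrC.
by apply: (mer_near ltr01 _ (merM (mer_subC v n0 fn) IH)) => w _ _; rewrite big_cons.
Qed.

(** The product rule is applied to (w - a)^n f = g rather than to a negative power. The new factor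
    takes the value -n g(a) at a, which is nonzero because n > 0. *)
Lemma mer_deriv f a n : (0 < n)%N -> mer f a (- n%:Z) ->
  mer (cderiv f) a (- n.+1%:Z).
Proof.
move=> n0 [g [gh ga [r r0 rP]]]; have [s s0 sP] := hol_open gh.
exists (fun w => (w - a) * cderiv g w - n%:R * g w); split.
- apply: holB; last exact: holM (hol_cst _ a) gh.
  by apply: holM (hol_deriv gh); apply: holB; [exact: hol_id|exact: hol_cst].
- by rewrite subrr mul0r sub0r oppr_eq0 mulf_neq0 // pnatr_eq0 -lt0n.
- exists (Num.min r s); first by rewrite lt_min r0.
  move=> w wa; rewrite lt_min => /andP[wr ws].
  have t0 : w - a != 0 by rewrite subr_eq0.
  have tn : (w - a) ^+ n != 0 by rewrite expf_neq0.
  have tS : (w - a) ^+ n.+1 != 0 by rewrite expf_neq0.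
  pose k := Num.min (nm (w - a)) (r - nm (w - a)).
  have k0 : 0 < k by rewrite lt_min nm_gt0 t0 subr_gt0.
  have kP v : nm (v - w) < k -> v != a /\ nm (v - a) < r.
    rewrite lt_min => /andP[v1 v2]; split.
      by apply/eqP => va; move: v1; rewrite va nmC ltxx.
    by have := nm_tri w v a; lra.
  have fE v : nm (v - w) < k -> f v = (v - a) ^- n * g v.
    by move=> /kP[va vr]; rewrite rP // exprnN.
  have cX : cdiff (fun v => (v - a) ^+ n) w (n%:R * (w - a) ^+ n.-1 * 1).
    by apply: cdiffX; have := cdiffD (cdiff_id w) (cdiff_cst (- a) w); rewrite addr0.
  have fh : hol f w.
    apply: (hol_near k0 (f := fun v => ((v - a) ^+ n)^-1 * g v)).
      by move=> v /fE.
    apply: holM (sP w ws); apply: holV => //; apply: holX.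
    by apply: holB; [exact: hol_id|exact: hol_cst].
  have := cdiffM cX (hol_cderiv fh).
  move=> /(cdiff_near k0 (g := g)) H.
  have {H} := H _; rewrite mulr1 => H.
  have {}H : cdiff g w (n%:R * (w - a) ^+ n.-1 * f w + (w - a) ^+ n * cderiv f w).
    apply: H => v vk; rewrite fE // mulrA mulfV ?mul1r // expf_neq0 // subr_eq0.
    by have [] := kP v vk.
  have E := cdiff_unique (hol_cderiv (sP w ws)) H.
  apply: (mulfI tS); rewrite mulrA -exprnN mulfV // mul1r E rP // -exprnN.
  rewrite mulrDr; have -> : (w - a) * (n%:R * (w - a) ^+ n.-1 * ((w - a) ^- n * g w))
    = n%:R * g w.
    have -> : (w - a) ^+ n = (w - a) ^+ n.-1 * (w - a) by rewrite -exprSr prednK.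
    move: (w - a) t0 (g w) (n%:R) => t t0 y m; have tn' : t ^+ n.-1 != 0 by rewrite
      expf_neq0.
    by field; rewrite tn' t0.
  by rewrite mulrA -exprS addrAC subrr add0r.
Qed.

Lemma mer_laurent f a n : mer f a (- n%:Z) -> exists c,
  [/\ laurent_expansion c (fun t => f (a + t)), forall k : int, k < - n%:Z -> c k = 0
    & c (- n%:Z) != 0].
Proof.
move=> [g [gh ga [r r0 rP]]].
have [|c [cl c0 cn]] := hol_laurent (f := fun t => f (a + t)) (k := n) gh r0.
  move=> t t0 tr; rewrite rP; last by rewrite addrC addKr.
    by rewrite addrAC subrr add0r exprnN.
  by rewrite -subr_eq0 addrAC subrr add0r.
by exists c; split=> //; rewrite cn.
Qed.

Lemma hol_laurent0 f a : hol f a -> exists c,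
  laurent_expansion c (fun t => f (a + t)) /\ forall k : int, k < 0 -> c k = 0.
Proof.
move=> fh; have [|c [cl c0 cn]] := hol_laurent (f := fun t => f (a + t)) (k := 0) fh
  ltr01.
  by move=> t t0 tr; rewrite expr0 invr1 mul1r.
by exists c; split=> //; rewrite oppr0 in c0.
Qed.

Lemma mer_meromorphic f a k : mer f a k -> meromorphic_at f a.
Proof.
case: k => n; last first.
  by rewrite NegzE => /mer_laurent[c [cl _ _]]; exists c.
move=> [g [gh ga [r r0 rP]]].
have hh : hol (fun w => (w - a) ^+ n * g w) a.
  apply: holM gh; apply: holX; by apply: holB; [exact: hol_id|exact: hol_cst].
have [|c [cl _ _]] := hol_laurent (f := fun t => f (a + t)) (k := 0) hh r0.
  move=> t t0 tr; rewrite rP ?expr0 ?invr1 ?mul1r //; last by rewrite addrC addKr.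
  by rewrite -subr_eq0 addrAC subrr add0r.
by exists c.
Qed.

Lemma hol_holomorphic f a : hol f a -> holomorphic_at f a.
Proof. by move=> /hol_cderiv/cdiff_holomorphic. Qed.

End Order.

(** * Sections of powers of the canonical bundle *)

Section Sections.
Variables (R : realType) (S : riemann_surface R).
Local Notation C := (Cplx R).
Implicit Types (p q : S) (F G : S -> C) (x y : coordinate R S).
Hypothesis Scompact : compact [set: S].

Definition in_coord x F : C -> C := fun w => F (cinv x w).
Definition diff_in x F : C -> C := cderiv (in_coord x F).

Lemma near_transition x y (g : C -> C) p : local_coordinate x -> local_coordinate y ->
  transition x y g -> dom x p -> dom y p ->
  exists2 r : R, 0 < r & hol g (x p) /\ forall F w, nm (w - x p) < r ->
    in_coord x F w = in_coord y F (g w).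
Proof.
move=> lx ly xy xp yp; have [g' [gh gE [d d0 dP]]] := transition_hol lx ly xp yp.
have gg w : nm (w - x p) < d -> g' w = g w.
  by move=> /dP[dx xw dy yw]; rewrite -yw xy // xw.
exists d => //; split; first exact: hol_near d0 gg gh.
move=> F w wd; have [dx xw dy yw] := dP w wd.
by rewrite /in_coord -gg // -yw cinvK.
Qed.

Lemma diff_transition x y (g : C -> C) F p : local_coordinate x -> local_coordinate y ->
  transition x y g -> dom x p -> dom y p -> hol_at F p ->
  diff_in x F (x p) = diff_in y F (y p) * cderiv g (x p).
Proof.
move=> lx ly xy xp yp Fp; have [r r0 [gh E]] := near_transition lx ly xy xp yp.
apply: cdiff_cderiv; apply: (cdiff_near r0 (f := fun w => in_coord y F (g w))).
  by move=> w wr; rewrite (E F w wr).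
apply: cdiff_comp (hol_cderiv gh) _; rewrite -xy //.
exact: hol_cderiv (hol_atP Fp ly yp).
Qed.

Lemma transition_exists x y : local_coordinate x -> local_coordinate y ->
  exists g : C -> C, transition x y g.
Proof.
move=> lx ly; exists (fun w => y (cinv x w)) => p xp yp; by rewrite cinvK.
Qed.

Section PoleAt.
Variables (z : coordinate R S) (Q : S).
Hypothesis lz : local_coordinate z.
Hypothesis zQ : dom z Q.
Hypothesis zQ0 : z Q = 0.

(** The alternative, z vanishing identically near Q, would send points other than Q to Q under the
    inverse coordinate. *)
Lemma coord_mer x : local_coordinate x -> dom x Q ->
  exists2 k : nat, (0 < k)%N & mer (in_coord x z) (x Q) k%:Z.
Proof.
move=> lx xQ; have zh := hol_atP (hol_at_coord lz zQ) lx xQ.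
have [d d0 dP] := chart_inv lx xQ (open_nbhs_nbhs (conj (open_dom lz) zQ)).
case: (hol_order zh) => [[r r0 rP]|[k [g [gh g0 [r r0 rP]]]]].
  have e0 : 0 < Num.min r d by rewrite lt_min r0.
  pose w := x Q + rc (Num.min r d / 2).
  have wE : nm (w - x Q) = Num.min r d / 2.
    by rewrite /w addrAC subrr add0r nm_rc gtr0_norm // divr_gt0.
  have wl : nm (w - x Q) < Num.min r d by rewrite wE; lra.
  move: (wl); rewrite lt_min => /andP[wr wd].
  have [xw xE zw] := dP w wd.
  have := rP w wr; rewrite -zQ0 => zE.
  have : cinv x w = Q by rewrite -(cinvK lz zw) zE cinvK.
  by move=> cE; move: xE; rewrite cE => wx; move: wE; rewrite wx subrr nm0; lra.
exists k; last by exists g; split=> //; exists r => // w _ /rP.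
rewrite lt0n; apply/eqP => k0; move: g0; have := rP (x Q).
by rewrite subrr nm0 cinvK // zQ0 k0 expr0 mul1r => <- //; rewrite eqxx.
Qed.

Lemma pole_mer F n x : has_pole z Q F n -> local_coordinate x -> dom x Q ->
  exists2 k : nat, (0 < k)%N & mer (in_coord x F) (x Q) (- (k * n)%N%:Z).
Proof.
move=> [Fh [G [GQ G0 FG]]] lx xQ; have [k k0 kz] := coord_mer lx xQ; exists k => //.
have [d d0 dP] := chart_inv lx xQ FG.
have Gm : mer (in_coord x G) (x Q) 0.
  by apply: hol_mer; [exact: hol_atP GQ lx xQ|rewrite /in_coord cinvK].
have := merM (merX n (merV kz)) Gm; rewrite addr0 mulNr -PoszM.
apply: (mer_near d0) => w wQ wd; have [dx xw] := dP w wd.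
rewrite /in_coord => -> //; move=> cE; move: xw; rewrite cE => xw.
by move: wQ; rewrite xw eqxx.
Qed.

Lemma pole_mer_self F n : has_pole z Q F n -> mer (in_coord z F) 0 (- n%:Z).
Proof.
move=> [Fh [G [GQ G0 FG]]].
have [d d0 dP] := chart_inv lz zQ FG; rewrite zQ0 in dP.
have Gm : mer (in_coord z G) 0 0.
  rewrite -zQ0; by apply: hol_mer; [exact: hol_atP GQ lz zQ|rewrite /in_coord cinvK].
have := merM (merX n (merV (mer_id 0))) Gm; rewrite addr0 mulNr mul1r.
apply: (mer_near d0) => w wQ wd; have [dx xw] := dP w wd.
rewrite /in_coord => -> //; first by rewrite xw subr0.
by move=> cE; move: wQ; rewrite -xw cE zQ0 eqxx.
Qed.

Definition critical F p := exists x, [/\ local_coordinate x, dom x p & diff_in x F (x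
  p) = 0].

Lemma criticalP F p x : hol_at F p -> critical F p -> local_coordinate x -> dom x p ->
  diff_in x F (x p) = 0.
Proof.
move=> Fp [y [ly yp y0]] lx xp; have [g xy] := transition_exists lx ly.
by rewrite (diff_transition lx ly xy xp yp Fp) y0 mul0r.
Qed.

Section Function.
Variables (F : S -> C) (n : nat).
Hypothesis Fpole : has_pole z Q F n.
Hypothesis n0 : (0 < n)%N.

Let Fh p : p <> Q -> hol_at F p. Proof. by case: Fpole => + _; apply. Qed.

Lemma noncritical_near_pole : \forall q \near Q, q <> Q -> ~ critical F q.
Proof.
have [r r0 rP] := mer_neq0 (mer_deriv n0 (pole_mer_self Fpole)).
apply: filterS (chart_near lz zQ r0) => q [zq qr] qQ cq; rewrite zQ0 in qr.
have := criticalP (Fh qQ) cq lz zq.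
apply/eqP/rP => //; exact: coord_neq0 lz zQ zQ0 q zq qQ.
Qed.

Lemma noncritical_near p : p <> Q -> ~ (\forall q \near p, critical F q) ->
  \forall q \near p, q <> p -> ~ critical F q.
Proof.
move=> pQ np; have [x lx xp] := local_coordinate_at p.
have dh := hol_deriv (hol_atP (Fh pQ) lx xp).
case: (hol_order dh) => [[r r0 rP]|[k [g [gh g0 [r r0 rP]]]]].
  case: np; apply: filterS (chart_near lx xp r0) => q [xq qr].
  by exists x; split=> //; exact: rP.
have [s s0 sP] := hol_neq0 gh g0.
have e0 : 0 < Num.min r s by rewrite lt_min r0.
apply: filterS2 (chart_near lx xp e0) (hol_at_near (Fh pQ)) => q [xq].
rewrite lt_min => /andP[qr qs] Fq qp /criticalP cq.
have := cq _ Fq lx xq; rewrite /diff_in /in_coord rP //; apply/eqP.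
rewrite mulf_neq0 ?sP // expf_neq0 // subr_eq0; apply/eqP => xE; apply: qp.
by rewrite -(cinvK lx xq) xE cinvK.
Qed.

(** The set E of points other than Q near which F is critical throughout is open. It is closed
    because at any other point the critical points do not accumulate, Q included since dF has a pole
    there. As Q is not in E, connectedness makes E empty. *)
Lemma not_critical_open p : p <> Q -> ~ (\forall q \near p, critical F q).
Proof.
move=> pQ pc; pose E : set S := [set q | q <> Q /\ \forall r \near q, critical F r].
have notE q : (\forall r \near q, r <> q -> ~ critical F r) -> ~ E q ->
    \forall r \near q, ~ E r.
  move=> h nq; apply: filterS h => r hr [rQ rc]; have [rq|/hr] := pselect (r = q).
    by apply: nq; rewrite -rq.
  by apply; exact: nbhs_singleton rc.
have ET : E = setT.
  apply: (clopen_full (E := E)); first by exists p.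
    rewrite openE => q [qQ qc]; have qN : \forall r \near q, r <> Q.
      have : nbhs q (~` [set Q]).
        apply: open_nbhs_nbhs; split=> //; apply: closed_openC.
        exact: (accessible_closed_set1 (hausdorff_accessible (@rs_hausdorff R S))).
      exact: filterS.
    by apply: filterS2 qN (nbhs_interior qc) => r rQ rc; split.
  rewrite -openC openE => q nq; apply: notE => //.
  have [->|qQ] := pselect (q = Q); first exact: noncritical_near_pole.
  by apply: noncritical_near => // qc; apply: nq.
by have : E Q by [rewrite ET]; case.
Qed.

Lemma finite_critical : exists s : seq S, forall p, critical F p -> p \in s.
Proof.
pose U p : set S := interior [set q | q <> p -> ~ critical F q].
have [|s [_ sP]] := compact_finite (U := U) Scompact.
  move=> p _; split; first exact: open_interior.
  rewrite /U /interior /mkset; have [->|pQ] := pselect (p = Q).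
    exact: noncritical_near_pole.
  exact: noncritical_near (not_critical_open pQ).
exists s => q qc; have [p ps /interior_subset qp] := sP q Logic.I.
by have [->//|/qp /(_ qc)] := pselect (q = p).
Qed.

Section VectorField.
Variables (vs : seq C).
Hypothesis vsP : forall p, critical F p -> F p \in vs.

Definition vector_field x (w : C) : C :=
  (\prod_(v <- vs) (in_coord x F w - v)) / diff_in x F w.

Lemma hol_prod (f : C -> C) (us : seq C) a : hol f a ->
  hol (fun w => \prod_(v <- us) (f w - v)) a.
Proof.
move=> fa; elim: us => [|u us IH].
  by apply: (hol_near ltr01 _ (hol_cst 1 a)) => w _; rewrite big_nil.
by apply: (hol_near ltr01 _ (holM (holB fa (hol_cst u a)) IH)) => w _; rewrite big_cons.
Qed.

(* At a critical point the zero of F - v has higher order than that of dF. *)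
Lemma vector_field_hol x p : local_coordinate x -> dom x p -> p <> Q ->
  hol (vector_field x) (x p).
Proof.
move=> lx xp pQ; have fh := hol_atP (Fh pQ) lx xp; have dh := hol_deriv fh.
rewrite -/(in_coord x F) -/(diff_in x F) in fh dh.
have [d0|d0] := eqVneq (diff_in x F (x p)) 0; last first.
  by apply: holM (hol_prod vs fh) _; exact: holV.
have cp : critical F p by exists x.
have fE : in_coord x F (x p) = F p by rewrite /in_coord cinvK.
have perm : forall w, \prod_(v <- vs) (in_coord x F w - v) =
  (in_coord x F w - F p) * \prod_(v <- rem (F p) vs) (in_coord x F w - v).
  by move=> w; rewrite (perm_big _ (perm_to_rem (vsP cp))) big_cons.
suff [q qh [r r0 rP]] : exists2 q, hol q (x p) & exists2 r : R, 0 < r & forall w, nm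
  (w - x p) < r ->
    (in_coord x F w - F p) / diff_in x F w = q w.
  apply: (hol_near r0 _ (holM qh (hol_prod (rem (F p) vs) fh))) => w /rP <-.
  by rewrite /vector_field perm mulrAC.
case: (hol_order (holB fh (hol_cst (F p) (x p)))) => [[r r0 rP]|[k [g [gh g0 [r r0
  rP]]]]].
  by exists (fun=> 0); [exact: hol_cst|exists r => // w /rP ->; rewrite mul0r].
have k0 : (0 < k)%N.
  rewrite lt0n; apply/eqP => k0; move: g0; have := rP (x p).
  by rewrite subrr nm0 fE k0 expr0 mul1r subrr => <- //; rewrite eqxx.
have [s s0 sP] := hol_open gh; have [t t0 tP] := hol_open fh.
pose u w := k%:R * g w + (w - x p) * cderiv g w.
have uh : hol u (x p).
  apply: holD; first exact: holM (hol_cst _ _) gh.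
  apply: holM (hol_deriv gh); by apply: holB; [exact: hol_id|exact: hol_cst].
have u0 : u (x p) != 0 by rewrite /u subrr mul0r addr0 mulf_neq0 // pnatr_eq0 -lt0n.
have [l l0 lP] := hol_neq0 uh u0.
have dE w : nm (w - x p) < Num.min r (Num.min s t) -> diff_in x F w = (w - x p) ^+
  k.-1 * u w.
  rewrite !lt_min => /and3P[wr ws wt].
  have cX : cdiff (fun v => (v - x p) ^+ k) w (k%:R * (w - x p) ^+ k.-1 * 1).
    by apply: cdiffX; have := cdiffD (cdiff_id w) (cdiff_cst (- x p) w); rewrite addr0.
  have h1 := cdiffM cX (hol_cderiv (sP w ws)).
  have h2 := cdiffD (hol_cderiv (tP w wt)) (cdiff_cst (- F p) w).
  have e0 : 0 < r - nm (w - x p) by rewrite subr_gt0.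
  have h3 := cdiff_near e0 (g := fun v => (v - x p) ^+ k * g v) _ h2.
  have {}h3 := h3 _; rewrite addr0 in h3.
  have {}h3 : cdiff (fun v => (v - x p) ^+ k * g v) w (cderiv (in_coord x F) w).
    by apply: h3 => v vw; apply: rP; have := nm_tri w v (x p); lra.
  have kE : (w - x p) ^+ k = (w - x p) * (w - x p) ^+ k.-1 by rewrite -exprS prednK.
  rewrite /diff_in (cdiff_unique h3 h1) /u mulr1 kE.
  move: ((w - x p) ^+ k.-1) (w - x p) (g w) (cderiv g w) (k%:R : C) => a1 a2 a3 a4
    a5; ring.
exists (fun w => (w - x p) * (g w / u w)).
  apply: holM; first by apply: holB; [exact: hol_id|exact: hol_cst].
  by apply: holM gh _; exact: holV.
exists (Num.min l (Num.min r (Num.min s t))); first by rewrite !lt_min l0 r0 s0.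
move=> w; rewrite lt_min => /andP[wl wm]; rewrite dE //.
have uw := lP w wl; move: wm; rewrite lt_min => /andP[wr _].
rewrite (rP w wr) -{1}(prednK k0) exprSr.
have [-> |wx] := eqVneq w (x p).
  by rewrite subrr !(mulr0, mul0r).
have : w - x p != 0 by rewrite subr_eq0.
move: (w - x p) uw => a uw a0; have ak : a ^+ k.-1 != 0 by rewrite expf_neq0.
by field; rewrite uw ak.
Qed.

Lemma vector_field_mer x : local_coordinate x -> dom x Q ->
  exists k, mer (vector_field x) (x Q) k.
Proof.
move=> lx xQ; have [k k0 kF] := pole_mer Fpole lx xQ.
have kn : (0 < k * n)%N by rewrite muln_gt0 k0.
by eexists; exact: merM (mer_prod vs kn kF) (merV (mer_deriv kn kF)).
Qed.

Lemma vector_field_mer_self :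
  mer (vector_field z) 0 (n.+1%:Z - n%:Z * (size vs)%:Z).
Proof.
have zF := pole_mer_self Fpole.
have := merM (mer_prod vs n0 zF) (merV (mer_deriv n0 zF)).
by rewrite opprK addrC mulNr.
Qed.

Lemma vector_field_transition x y (g : C -> C) p : local_coordinate x ->
  local_coordinate y -> transition x y g -> dom x p -> dom y p -> p <> Q ->
  vector_field x (x p) = (cderiv g (x p))^-1 * vector_field y (y p).
Proof.
move=> lx ly xy xp yp pQ; rewrite /vector_field (diff_transition lx ly xy xp yp (Fh
  pQ)).
by rewrite /in_coord !cinvK // invfM mulrA mulrC.
Qed.

End VectorField.
End Function.

Hypothesis z_poles : exists n0, forall n, (n0 <= n)%N -> exists F, has_pole z Q F n.

Lemma section_exists (e : nat) : exists n0, forall n, (n0 <= n)%N ->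
  exists f : coordinate R S -> C -> C,
  [/\ forall x p, local_coordinate x -> dom x p -> p <> Q -> hol (f x) (x p),
      forall x, local_coordinate x -> dom x Q -> exists k, mer (f x) (x Q) k,
      mer (f z) 0 (- n%:Z)
    & forall x y g, local_coordinate x -> local_coordinate y ->
        transition x y g -> forall p, dom x p -> dom y p -> p <> Q ->
        f x (x p) = (cderiv g (x p)) ^ (- e%:Z) * f y (y p)].
Proof.
have [n0 n0P] := z_poles; pose n := maxn n0 1.
have [F Fp] := n0P n (leq_maxl _ _); have n1 : (0 < n)%N by rewrite leq_maxr.
have [s sP] := finite_critical Fp n1; pose vs := [seq F p | p <- s].
have vsP p : critical F p -> F p \in vs by move=> /sP ps; exact: map_f.
(* The order at Q of the e-th power of the vector field. A function G with a pole of order N = m + o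
   corrects it to a pole of order m, and m >= n0 + |o| ensures that G exists. *)
pose o : int := (n.+1%:Z - n%:Z * (size vs)%:Z) * e%:Z.
exists (n0 + absz o)%N => m nm.
have [N [N0 NE]] : exists N, (n0 <= N)%N /\ - N%:Z + o = - m%:Z.
  by exists (absz (m%:Z + o)); split; lia.
have [G Gp] := n0P N N0.
exists (fun x w => in_coord x G w * vector_field F vs x w ^+ e); split.
- move=> x p lx xp pQ; apply: holM; first by have [Gh _] := Gp; exact: hol_atP (Gh p
  pQ) lx xp.
  by have := vector_field_hol Fp vsP lx xp pQ; exact: holX.
- move=> x lx xQ; have [k _ kG] := pole_mer Gp lx xQ.
  have [l lv] := vector_field_mer Fp n1 vs lx xQ.
  by eexists; exact: merM kG (merX e lv).
- rewrite -NE; exact: merM (pole_mer_self Gp) (merX e (vector_field_mer_self Fp n1 vs)).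
- move=> x y g lx ly xy p xp yp pQ.
  rewrite (vector_field_transition Fp vs lx ly xy xp yp pQ) exprMn mulrCA.
  by rewrite -exprnN exprVn /in_coord !cinvK.
Qed.

End PoleAt.

End Sections.

Section PoleOrders.
Variables (R : realType) (S : riemann_surface R).
Local Notation C := (Cplx R).
Hypothesis Scompact : compact [set: S].

(** The coordinate is rescaled to contain the disc of radius 5; this multiplies the leading factor G
    by a nonzero constant and keeps the pole order. *)
Lemma pole_orders_at (y : coordinate R S) (Q : S) : local_coordinate y ->
  dom y Q -> y Q = 0 -> exists n0, forall n, (n0 <= n)%N -> exists F, has_pole y Q F n.
Proof.
move=> ly yQ yQ0.
have NT : nbhs Q [set: S] by exact: filterT.
have [d d0 dP] := chart_inv ly yQ NT; rewrite yQ0 in dP.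
pose r := d / 5; have r0 : 0 < r by rewrite divr_gt0.
have rc0 : rc r != 0 :> C by rewrite -nm_gt0 nm_rc gtr0_norm.
pose z := affine_coord y 0 r.
have lz : local_coordinate z by exact: affine_coord_local.
have z5 w : nm w < 5 -> dom z (cinv z w) /\ z (cinv z w) = w.
  move=> w5; have wd : nm (rc r * w - 0) < d.
    by rewrite subr0 nmM nm_rc gtr0_norm // /r mulrAC ltr_pdivrMr // ltr_pM2l.
  have [yw yE _] := dP _ wd.
  have E : z (cinv y (rc r * w)) = w by rewrite /= yE subr0 mulrC mulKf.
  have -> : cinv z w = cinv y (rc r * w) by rewrite -{1}E cinvK.
  by split.
have zQ0 : z Q = 0 by rewrite /= yQ0 subrr mul0r.
have [n0 n0P] := pole_orders lz z5 Scompact yQ zQ0.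
exists n0 => n /n0P[F [Fh [G [GQ G0 FG]]]]; exists F; split=> //.
exists (fun p => rc r ^+ n * G p); split.
- exact: hol_atM (hol_at_cst _ Q) GQ.
- by rewrite mulf_neq0 // expf_neq0.
- apply: filterS FG => p FG pQ; rewrite FG //= subr0 invfM invrK exprMn mulrA.
  by [].
Qed.

End PoleOrders.

Section LabeledSections.
Variables (R : realType) (V : voa R) (N : nat) (S : labeled_surface V N).
Local Notation C := (Cplx R).

Lemma laurent_coef_of (c : int -> C) (f : C -> C) :
  laurent_expansion c (fun t => f (0 + t)) -> laurent_coef f = c.
Proof.
move=> h; apply: laurent_coefE.
by have -> : f = (fun t => f (0 + t)) by apply/funext => t; rewrite add0r.
Qed.

(** With d = e + 1 the bundle is kappa^(-e), whose sections are functions times e-th powers of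
    vector fields. *)
Lemma sections_with_pole (i : 'I_N) (e : nat) : exists n0, forall n, (n0 <= n)%N ->
  exists f, [/\ @sections R V N S (1 - e.+1%:Z) f,
    forall k : int, k < - n%:Z -> laurent_coef (f (coord S i)) k = 0,
    laurent_coef (f (coord S i)) (- n%:Z) != 0
  & forall j, j != i -> forall k : int, k < 0 -> laurent_coef (f (coord S j)) k = 0].
Proof.
have Sc := surface_compact S; pose Q := point S i; pose z := coord S i.
have lz : local_coordinate z := coord_local S i.
have zQ : dom z Q := coord_dom S i.
have zQ0 : z Q = 0 := coord_point S i.
have [n0 n0P] := section_exists Sc lz zQ zQ0 (pole_orders_at Sc lz zQ zQ0) e.
exists n0 => n /n0P[f [fh fm fz ft]]; exists f.
have [c [cl c0 cn]] := mer_laurent fz.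
have nQ p : ~ range (point S) p -> p <> Q by move=> np pQ; apply: np; exists i.
split.
- split.
  + by move=> x p lx xp /nQ pQ; exact/hol_holomorphic/fh.
  + move=> x p lx xp _; have [pQ|pQ] := pselect (p = Q).
      by move: xp; rewrite pQ => /(fm x lx)[k]; exact: mer_meromorphic.
    by have [c' [cl' _]] := hol_laurent0 (fh x p lx xp pQ); exists c'.
  + move=> x y g lx ly xy p xp yp /nQ pQ; rewrite (ft x y g lx ly xy p xp yp pQ).
    by congr (_ ^ _ * _); lia.
- by rewrite (laurent_coef_of cl).
- by rewrite (laurent_coef_of cl).
- move=> j ji k k0.
  have pQ : point S j <> Q by move=> /(@point_inj _ _ _ S) ij; move: ji; rewrite ij
    eqxx.
  have := fh (coord S j) _ (coord_local S j) (coord_dom S j) pQ.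
  by rewrite coord_point => /hol_laurent0[c' [cl' c0']]; rewrite (laurent_coef_of
    cl') c0'.
Qed.

End LabeledSections.

(** * Modes of a vertex operator algebra *)

Section Subspaces.
Variables (K : fieldType) (U : lmodType K).
Implicit Types (S T M : set U) (u v : U).

Lemma subspace0 M : subspace M -> M 0. Proof. by case. Qed.

Lemma subspaceZ M (k : K) u : subspace M -> M u -> M (k *: u).
Proof. by move=> [M0 MP] Mu; rewrite -[_ *: _]addr0; exact: MP. Qed.

Lemma subspaceD M u v : subspace M -> M u -> M v -> M (u + v).
Proof. by move=> [M0 MP] Mu Mv; rewrite -[u]scale1r; exact: MP. Qed.

Lemma subspaceN M u : subspace M -> M u -> M (- u).
Proof. by move=> MP Mu; rewrite -scaleN1r; exact: subspaceZ. Qed.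

Lemma subspaceB M u v : subspace M -> M u -> M v -> M (u - v).
Proof. by move=> MP Mu Mv; apply: subspaceD => //; exact: subspaceN. Qed.

Lemma subspace_sum M (I : Type) (r : seq I) (P : pred I) (F : I -> U) :
  subspace M -> (forall i, P i -> M (F i)) -> M (\sum_(i <- r | P i) F i).
Proof.
move=> MP MF; apply: (big_ind M) => //; first exact: subspace0.
by move=> u v; exact: subspaceD.
Qed.

Lemma lspan_sub S M : subspace M -> S `<=` M -> lspan S `<=` M.
Proof. by move=> MP SM u; apply; split. Qed.

Lemma lspan_mono S T : S `<=` T -> lspan S `<=` lspan T.
Proof.
by move=> ST; apply: lspan_sub (lspan_subspace T) _ => u /ST; exact: sub_lspan.
Qed.

Lemma lspan_setT S : lspan S = setT -> forall M, subspace M -> S `<=` M -> forall u,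
  M u.
Proof. by move=> ST M MP SM u; apply: (lspan_sub MP SM); rewrite ST. Qed.

End Subspaces.

Section LinearImage.
Variables (K : fieldType) (U U' : lmodType K) (f : U -> U').
Hypothesis fl : linear f.

Lemma linear_0 : f 0 = 0.
Proof. by have := fl (-1) 0 0; rewrite scaler0 addr0 scaleN1r addNr. Qed.

Lemma linear_D u v : f (u + v) = f u + f v.
Proof. by have := fl 1 u v; rewrite !scale1r. Qed.

Lemma linear_Z k u : f (k *: u) = k *: f u.
Proof. by have := fl k u 0; rewrite !addr0 linear_0 addr0. Qed.

Lemma linear_N u : f (- u) = - f u.
Proof. by rewrite -scaleN1r linear_Z scaleN1r. Qed.

Lemma linear_B u v : f (u - v) = f u - f v.
Proof. by rewrite linear_D linear_N. Qed.

Lemma linear_big (I : Type) (r : seq I) (P : pred I) (F : I -> U) :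
  f (\sum_(i <- r | P i) F i) = \sum_(i <- r | P i) f (F i).
Proof. by apply: (big_morph f); [exact: linear_D|exact: linear_0]. Qed.

Lemma preim_subspace (M : set U') : subspace M -> subspace (f @^-1` M).
Proof.
move=> MP; split=> [|k u v Mu Mv]; rewrite /preimage /mkset; first by rewrite
  linear_0; exact: subspace0.
by rewrite fl; apply: MP.2.
Qed.

Lemma lspan_image (S : set U) (M : set U') : subspace M ->
  (forall u, S u -> M (f u)) -> forall u, lspan S u -> M (f u).
Proof. by move=> MP SM u; apply: lspan_sub (preim_subspace MP) _ u. Qed.

End LinearImage.

Lemma linear_subcst (K : fieldType) (U : lmodType K) (L : U -> U) (k : K) :
  linear L -> linear (fun u => L u - k *: u).
Proof.
move=> Ll a u v; rewrite Ll scalerDr !scalerA scalerBr scalerA mulrC -!addrA.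
by congr (_ + _); rewrite opprD addrCA.
Qed.

Lemma fsum_trunc (U : zmodType) (F : nat -> U) N :
  (forall i, (N <= i)%N -> F i = 0) -> \sum_(i \in [set: nat]) F i = \sum_(i < N) F i.
Proof.
move=> FN; rewrite -(@fsbig_widen _ _ _ _ `I_N) //; last first.
  by move=> i [_ /= /negP]; rewrite -leqNgt; exact: FN.
by rewrite -fsbig_ord.
Qed.

Section WeightVectors.
Variables (K : fieldType) (U : lmodType K) (L : U -> U).
Hypothesis Ll : linear L.

Definition annihilator (ls : seq K) (u : U) : U :=
  foldr (fun l v => L v - l *: v) u ls.

Lemma annihilator_linear ls : linear (annihilator ls).
Proof.
elim: ls => [|l ls IH] k u v //=; by rewrite IH (linear_subcst l Ll).
Qed.

Lemma annihilator_comm ls k u :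
  annihilator ls (L u - k *: u) = L (annihilator ls u) - k *: annihilator ls u.
Proof.
elim: ls => [//|l ls IH] /=; rewrite IH.
rewrite !(linear_B Ll) !(linear_Z Ll) !scalerBr !scalerA (mulrC l k).
by rewrite !opprB addrACA [RHS]addrACA; congr (_ + _); exact: addrC.
Qed.

Lemma annihilator_cat ls ls' u : annihilator ls' u = 0 -> annihilator (ls ++ ls') u = 0.
Proof. by rewrite /annihilator foldr_cat => ->; exact: linear_0 (annihilator_linear
  ls). Qed.

Lemma annihilator_catl ls ls' u : annihilator ls u = 0 -> annihilator (ls ++ ls') u = 0.
Proof.
move=> u0; rewrite /annihilator foldr_cat -/(annihilator ls' u) -/(annihilator ls _).
elim: ls' => [//|l ls' IH] /=.
by rewrite annihilator_comm IH (linear_0 Ll) scaler0 subrr.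
Qed.

Lemma annihilator_eigen ls u l : L u = l *: u -> l \notin ls ->
  annihilator ls u = 0 -> u = 0.
Proof.
move=> Lu; elim: ls u Lu => [//|k ls IH] u Lu; rewrite inE negb_or => /andP[lk lls].
have E : annihilator (k :: ls) u = (l - k) *: annihilator ls u.
  by rewrite /= -annihilator_comm Lu -scalerBl (linear_Z (annihilator_linear ls)).
rewrite E => /eqP; rewrite scaler_eq0 subr_eq0 (negPf lk) /= => /eqP.
exact: IH.
Qed.

(* Components of weight other than l are killed by a product of factors
   L - k with k != l, which is injective on the eigenspace of l. *)
Lemma weight_span (P : K -> U -> Prop) (l : K) (u : U) :
  (forall k v, P k v -> L v = k *: v) -> L u = l *: u ->
  lspan [set v | exists k, P k v] u -> lspan (P l) u.
Proof.
move=> PL Lu uP.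
pose M := [set v | exists2 v', lspan (P l) v' & exists2 ls, l \notin ls &
  annihilator ls (v - v') = 0].
have lP := lspan_subspace (P l).
have MP : subspace M.
  split; first by exists 0; [exact: subspace0|exists [::]; rewrite //= subrr].
  move=> k v w [v' v'P [ls lls v0]] [w' w'P [ls' lls' w0]].
  exists (k *: v' + w'); first exact: lP.2.
  exists (ls ++ ls'); first by rewrite mem_cat negb_or lls.
  have -> : k *: v + w - (k *: v' + w') = k *: (v - v') + (w - w').
    by rewrite scalerBr opprD addrACA.
  rewrite annihilator_linear annihilator_catl // annihilator_cat //.
  by rewrite scaler0 addr0.
have [u' u'P [ls lls u0]] : M u.
  apply: (lspan_sub MP _ uP) => v [k Pkv]; have [kl|kl] := eqVneq k l.
    exists v; first by apply: sub_lspan; rewrite -kl.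
    by exists [::]; rewrite //= subrr.
  exists 0; first exact: subspace0.
  exists [:: k]; first by rewrite inE eq_sym.
  by rewrite /= subr0 (PL k v Pkv) subrr.
suff -> : u = u' by [].
apply/eqP; rewrite -subr_eq0; apply/eqP; apply: (@annihilator_eigen ls _ l) => //.
have Lu' : L u' = l *: u'.
  have eP : subspace [set v | L v = l *: v].
    split=> [|k v w /= Lv Lw]; first by rewrite /mkset (linear_0 Ll) scaler0.
    by rewrite /mkset Ll Lv Lw scalerDr !scalerA mulrC.
  by apply: (lspan_sub eP _ u'P) => v; exact: PL.
by rewrite (linear_B Ll) Lu Lu' scalerBr.
Qed.

End WeightVectors.

Section Modes.
Variables (R : realType) (V : voa R).
Local Notation C := (Cplx R).
Local Notation YV := (voa_Y V).

Lemma gbinom0 (p : int) : gbinom R p 0 = 1.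
Proof. by rewrite /gbinom big_ord0 fact0 divr1. Qed.

Lemma gbinom0S i : gbinom R 0 i.+1 = 0.
Proof. by rewrite /gbinom big_ord_recl /= subrr mul0r mul0r. Qed.

Lemma gbinomS (p : int) i :
  gbinom R p i.+1 = gbinom R p i * (p - i%:Z)%:~R / i.+1%:R.
Proof.
by rewrite /gbinom big_ord_recr factS natrM invfM /=; ring.
Qed.

Lemma gbinomN1 i : (-1) ^+ i * gbinom R (-1) i = 1.
Proof.
elim: i => [|i IH]; first by rewrite gbinom0 mulr1.
rewrite gbinomS exprS; have -> : (-1 - i%:Z)%:~R = - i.+1%:R :> C.
  by rewrite -opprD rmorphN -PoszD add1n.
rewrite -[RHS]IH; have : i.+1%:R != 0 :> C by rewrite pnatr_eq0.
by move: ((-1) ^+ i) (gbinom _ _ _) (i.+1%:R : C) => x y t t0; field.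
Qed.

Lemma gbinomN2 i : (-1) ^+ i * gbinom R (-2) i = i.+1%:R.
Proof.
elim: i => [|i IH]; first by rewrite gbinom0 mulr1.
rewrite gbinomS exprS; have -> : (-2 - i%:Z)%:~R = - i.+2%:R :> C.
  by rewrite -opprD rmorphN -PoszD.
have : i.+1%:R != 0 :> C by rewrite pnatr_eq0.
move: IH; move: ((-1) ^+ i) (gbinom _ _ _) (i.+1%:R : C) (i.+2%:R : C) => x y t t' IH
  t0.
have -> : -1 * x * (y * - t' / t) = x * y * t' / t by ring.
by rewrite IH mulrAC mulfV // mul1r.
Qed.

Section Weak.
Variable W : weak_module V.
Local Notation Y := (mode W).
Let wW := wm_axioms W.

Lemma model n w : linear (fun a => Y a n w). Proof. exact: mode_linearl wW n w. Qed.
Lemma moder a n : linear (Y a n). Proof. exact: mode_linearr wW a n. Qed.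

Lemma truncN a w : exists N : nat, forall n : int, N%:Z <= n -> Y a n w = 0.
Proof.
have [N NP] := truncation wW a w; exists (absz N) => n nN; apply: NP; lia.
Qed.

(** The case r = 0, the commutator formula. The range of summation is any large N, so that a caller
    can make it contain the terms to be singled out. *)
Lemma borcherds_comm a b (p q : int) w : exists N0 : nat, forall N, (N0 <= N)%N ->
  Y a p (Y b q w) - Y b q (Y a p w) =
  \sum_(i < N) gbinom R p i *: Y (YV a i%:Z b) (p + q - i%:Z) w.
Proof.
have [N0 NP] := truncation (voa_adjoint V) a b; exists (absz N0) => N NN.
have := borcherds wW a b p q 0 w.
rewrite (@fsum_trunc _ _ N); last first.
  move=> i iN; rewrite add0r NP; last by lia.
  by rewrite (linear_0 (model _ w)) scaler0.
rewrite (@fsum_trunc _ _ 1); last first.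
  by case=> // i _; rewrite gbinom0S mulr0 scale0r.
rewrite big_ord1 /= gbinom0 expr0 mulr1 scale1r expr0z scale1r.
have -> : p + 0 - 0%:Z = p by lia.
have -> : q + 0 - 0%:Z = q by lia.
have -> : q + 0%:Z = q by lia.
have -> : p + 0%:Z = p by lia.
move=> <-; by apply: eq_bigr => i _; rewrite add0r.
Qed.

(** The case p = 0, which expresses the modes of an iterate a(r)b by products of modes. *)
Lemma borcherds_iter a b (r q : int) w : exists N0 : nat, forall N, (N0 <= N)%N ->
  Y (YV a r b) q w = \sum_(i < N) ((-1) ^+ i * gbinom R r i) *:
    (Y a (r - i%:Z) (Y b (q + i%:Z) w) - (-1) ^ r *: Y b (q + r - i%:Z) (Y a i%:Z w)).
Proof.
have [Na NaP] := truncN a w; have [Nb NbP] := truncN b w.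
exists (Na + (Nb + absz q))%N => N NN.
have := borcherds wW a b 0 q r w.
rewrite (@fsum_trunc _ _ 1); last first.
  by case=> // i _; rewrite gbinom0S scale0r.
rewrite big_ord1 gbinom0 scale1r addr0 add0r subr0 => ->.
rewrite (@fsum_trunc _ _ N); last first.
  move=> i iN; rewrite add0r NbP; last by lia.
  rewrite (NaP i%:Z); last by lia.
  by rewrite !(linear_0 (moder _ _)) scaler0 subrr scaler0.
by apply: eq_bigr => i _; rewrite !add0r.
Qed.

(** For filtrations and spans only membership of the terms matters; the coefficients are forgotten
    here once and for all. *)
Lemma comm_mem M a b (p q : int) w : subspace M ->
  (forall i : nat, M (Y (YV a i%:Z b) (p + q - i%:Z) w)) ->
  M (Y a p (Y b q w) - Y b q (Y a p w)).
Proof.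
move=> MP Mi; have [N NP] := borcherds_comm a b p q w; rewrite (NP N (leqnn N)).
by apply: subspace_sum => // i _; exact: subspaceZ.
Qed.

Lemma iter_mem M a b (r q : int) w : subspace M ->
  (forall i : nat, M (Y a (r - i%:Z) (Y b (q + i%:Z) w))) ->
  (forall i : nat, M (Y b (q + r - i%:Z) (Y a i%:Z w))) ->
  M (Y (YV a r b) q w).
Proof.
move=> MP M1 M2; have [N NP] := borcherds_iter a b r q w; rewrite (NP N (leqnn N)).
apply: subspace_sum => // i _; apply: subspaceZ => //.
by apply: subspaceB => //; exact: subspaceZ.
Qed.

Lemma L_1E a : YV (conformal V) 0 a = YV a (-2) (vacuum V).
Proof.
have := voa_translation V a (-1) (vacuum V).
by rewrite voa_creation1 opprK mulr1z scale1r => ->.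
Qed.

(** The axiom [voa_translation] concerns V alone. On a module one writes L_(-1) a = a(-2) 1 and
    expands; the modes of the vacuum select the single term i = n - 1 or i = - n - 1, according to
    the sign of n. *)
Lemma mode_translation a (n : int) w :
  Y (YV (conformal V) 0 a) n w = (- n)%:~R *: Y a (n - 1) w.
Proof.
rewrite L_1E; have [N NP] := borcherds_iter a (vacuum V) (-2) n w.
have vE (k : int) v : Y (vacuum V) k v = if k == -1 then v else 0 by exact:
  mode_vacuum wW k v.
pose M := (N + (absz n).+2)%N; rewrite (NP M); last by rewrite leq_addr.
have E1 : (-1) ^ (-2) = 1 :> C by rewrite -exprnN -signr_odd /= expr0 invr1.
have Y0 (b : V) (k : int) : Y b k 0 = 0 by exact: linear_0 (moder b k).
have [n0|n0|->] := ltgtP n 0; last first.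
- rewrite oppr0 mulr0z scale0r big1 // => i _; rewrite gbinomN2 !vE.
  have -> : (0 + i%:Z == -1) = false by apply/eqP; lia.
  have -> : (0 + -2 - i%:Z == -1) = false by apply/eqP; lia.
  by rewrite Y0 scaler0 subrr scaler0.
- have i0M : (absz (n - 1)%R < M)%N by rewrite /M; lia.
  rewrite (bigD1 (Ordinal i0M)) //= big1 => [|i ii]; last first.
    rewrite gbinomN2 !vE; have -> : (n + i%:Z == -1) = false by apply/eqP; lia.
    have -> : (n + -2 - i%:Z == -1) = false.
      apply/eqP => e; move/eqP: ii; apply; apply: val_inj => /=; lia.
    by rewrite Y0 scaler0 subrr scaler0.
  rewrite addr0 gbinomN2 !vE E1 scale1r.
  have -> : (n + (absz (n - 1))%:Z == -1) = false by apply/eqP; lia.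
  have -> : (n + -2 - (absz (n - 1))%:Z == -1) = true by apply/eqP; lia.
  rewrite Y0 sub0r scalerN -scaleNr; congr (_ *: Y _ _ _); last by lia.
  by rewrite rmorphN /= -[_.+1%:R]/(((absz (n - 1)).+1%:Z)%:~R); congr (- _%:~R); lia.
- have i0M : (absz (n + 1)%R < M)%N by rewrite /M; lia.
  rewrite (bigD1 (Ordinal i0M)) //= big1 => [|i ii]; last first.
    rewrite gbinomN2 !vE; have -> : (n + -2 - i%:Z == -1) = false by apply/eqP; lia.
    have -> : (n + i%:Z == -1) = false.
      apply/eqP => e; move/eqP: ii; apply; apply: val_inj => /=; lia.
    by rewrite Y0 scaler0 subrr scaler0.
  rewrite addr0 gbinomN2 !vE E1 scale1r.
  have -> : (n + (absz (n + 1))%:Z == -1) = true by apply/eqP; lia.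
  have -> : (n + -2 - (absz (n + 1))%:Z == -1) = false by apply/eqP; lia.
  rewrite subr0; congr (_ *: Y _ _ _); last by lia.
  by rewrite -[_.+1%:R]/(((absz (n + 1)).+1%:Z)%:~R); congr (_%:~R); lia.
Qed.

(** The commutator with L_0 = omega(1) has only the terms i = 0 and i = 1, namely the modes of
    L_(-1) a and L_0 a. *)
Lemma mode_weight d a (n : int) (l : C) w : homogeneous V d a ->
  weight_space W l w -> weight_space W (l + (d%:Z - n - 1)%:~R) (Y a n w).
Proof.
rewrite /homogeneous /weight_space /vir /mkset !add0r /= => ha hw.
have [N NP] := borcherds_comm (conformal V) a 1 n w.
have := NP N.+2 ltac:(lia); rewrite hw (linear_Z (moder a n)).
rewrite big_ord_recl big_ord_recl /= big1 => [|i _]; last first.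
  rewrite (_ : gbinom R 1 _ = 0) ?scale0r // /bump /= !add1n.
  by rewrite /gbinom big_ord_recl big_ord_recl /= /bump /= subrr mulr0z mul0r mulr0
    mul0r.
rewrite addr0 gbinom0 scale1r mode_translation /bump /= addn0.
have -> : gbinom R 1 1 = 1 by rewrite gbinomS gbinom0 mul1r subr0 mulr1z divr1.
rewrite scale1r ha (linear_Z (model _ w)) => /eqP; rewrite subr_eq => /eqP ->.
have -> : 1 + n - 1%:Z = n by lia.
rewrite addr0 -!scalerDl; congr (_ *: _).
by rewrite addrC; congr (_ + _); rewrite -[d%:R]/((d%:Z)%:~R) -rmorphD; congr
  (_%:~R); lia.
Qed.

End Weak.
End Modes.

Section Homogeneous.
Variables (R : realType) (V : voa R).
Local Notation C := (Cplx R).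
Local Notation YV := (voa_Y V).

Lemma vir_linear (W : weak_module V) n : linear (vir W n).
Proof. exact: moder. Qed.

Lemma homogeneous_subspace d : subspace (homogeneous V d).
Proof.
split=> [|k u v]; rewrite /homogeneous /weight_space /mkset.
  by rewrite (linear_0 (@vir_linear (adjoint V) 0)) scaler0.
move=> hu hv; rewrite (@vir_linear (adjoint V) 0) hu hv scalerDr !scalerA.
by rewrite mulrC.
Qed.

Lemma weight_neg (k : C) v : weight_space (adjoint V) k v ->
  (forall d : nat, k != d%:R) -> v = 0.
Proof.
move=> vk kd; pose P (l : C) (u : V) := exists2 d : nat, l = d%:R & homogeneous V d u.
have vP : lspan (P k) v.
  apply: (@weight_span _ _ _ (@vir_linear (adjoint V) 0) P k v _ vk).
    by move=> l u [d -> hu].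
  apply: (lspan_setT (voa_grading V) (lspan_subspace _)) => u [d hu].
  by apply: sub_lspan; exists d%:R, d.
apply: (lspan_sub (M := [set 0]) _ _ vP).
  by split=> // a x y -> ->; rewrite /= scaler0 addr0.
by move=> u [d kE _]; have := kd d; rewrite kE eqxx.
Qed.

Lemma homogeneous_mode d d' a b (n : int) : homogeneous V d a -> homogeneous V d' b ->
  YV a n b = 0 \/ exists2 e : nat, e%:Z = d%:Z + d'%:Z - n - 1 & homogeneous V e (YV
    a n b).
Proof.
move=> ha hb; have h := mode_weight n ha hb.
have wE : d'%:R + (d%:Z - n - 1)%:~R = (d%:Z + d'%:Z - n - 1)%:~R :> C.
  by rewrite -[d'%:R]/((d'%:Z)%:~R) -rmorphD; congr (_%:~R); lia.
rewrite wE in h; have [n0|n0] := leP 0 (d%:Z + d'%:Z - n - 1).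
  right; exists (absz (d%:Z + d'%:Z - n - 1)%R); first by lia.
  rewrite /homogeneous.
  by have -> : (absz (d%:Z + d'%:Z - n - 1)%R)%:R = (d%:Z + d'%:Z - n - 1)%:~R :> C
    by rewrite -[LHS]/(((absz (d%:Z + d'%:Z - n - 1)%R)%:Z)%:~R); congr (_%:~R); lia.
left; apply: weight_neg h _ => e; rewrite -[e%:R]/((e%:Z)%:~R) eqr_int.
by apply/eqP; lia.
Qed.

End Homogeneous.

Arguments vir_linear {R V} W n.

(** * The filtration of a B_1-finite module *)

Section Filtration.
Variables (R : realType) (V : voa R) (W : voa_module V).
Local Notation C := (Cplx R).
Local Notation YV := (voa_Y V).
Local Notation Y := (mode W).
Variable (E : C -> W -> Prop).
Hypothesis V0 : homogeneous V 0 = [set v : V | exists k : Cplx R, v = k *: vacuum V].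
Hypothesis EW : forall l e, E l e -> weight_space W l e.
Hypothesis B1E : forall w : W, lspan ([set u | exists (d : nat) (a : V) (w : W),
    [/\ (0 < d)%N, homogeneous V d a & u = Y a (-1) w]] `|` [set e | exists l, E l
      e]) w.

(** An integer height for a complex weight: m bounds how far l lies above the lowest weight of the
    form l - n. *)
Definition lower (m : int) (l : C) : Prop := forall n : int, m < n ->
  weight_space W (l - n%:~R) = [set 0].

(** A letter a(-n) counts with the weight d of a alone, whatever n is. The base vector counts with a
    height of its weight, so that the degree is an integer even though the weights are complex. *)
Inductive word : int -> W -> Prop :=
| word_base s l e : E l e -> lower s l -> word s e
| word_step s d a n u : homogeneous V d a -> (0 < d)%N -> word s u ->
    word (s + d%:Z) (Y a (- n.+1%:Z) u)
| word_mono s s' u : s <= s' -> word s u -> word s' u.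

Definition wfilt s := lspan (word s).

Lemma wfilt_subspace s : subspace (wfilt s).
Proof. exact: lspan_subspace. Qed.

Lemma wfilt_mono s s' : s <= s' -> wfilt s `<=` wfilt s'.
Proof. by move=> ss; apply: lspan_mono => u; exact: word_mono. Qed.

Lemma lowerD m l (k : int) : lower m l -> lower (m + k) (l + k%:~R).
Proof.
move=> ml n mn; have -> : l + k%:~R - n%:~R = l - (n - k)%:~R.
  by rewrite rmorphB /= opprB addrAC -addrA addrCA addrC addrA.
by apply: ml; lia.
Qed.

Lemma lower_neg m l w : lower m l -> m < 0 -> weight_space W l w -> w = 0.
Proof.
move=> ml m0; have := ml 0 m0; rewrite subr0 => -> //.
Qed.

Lemma wfilt_neg s d a (n : int) u : homogeneous V d a -> n < 0 ->
  wfilt s u -> wfilt (s + d%:Z) (Y a n u).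
Proof.
move=> ha n0; case: d ha => [|d] ha us.
  rewrite addr0; move: ha; rewrite V0 => -[k ->].
  rewrite (linear_Z (model n u)); apply: (subspaceZ k (wfilt_subspace s)).
  rewrite (mode_vacuum (wm_axioms W)).
  by case: eqP => // _; apply: subspace0; exact: wfilt_subspace.
have nE : n = - (absz n).-1.+1%:Z by lia.
move: u us; apply: (lspan_image (moder a n)); first exact: wfilt_subspace.
by move=> u us; apply: sub_lspan; rewrite nE; exact: word_step.
Qed.

(** Induction on the height: a(-1) raises weight and degree by the same d > 0, so a weight component
    of w is a combination of vectors a(-1) w' with w' of height m - d, and of elements of E. *)
Lemma lower_wfilt m l w : weight_space W l w -> lower m l -> wfilt m w.
Proof.
have [m0|] := ltP m 0.
  move=> lw ml; rewrite (lower_neg ml m0 lw); exact: subspace0 (wfilt_subspace m).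
case: m => // m _; elim/ltn_ind: m l w => m IH l w lw ml.
pose P (k : C) (v : W) := (exists (d : nat) (a : V) (w' : W),
  [/\ (0 < d)%N, homogeneous V d a, weight_space W (k - d%:R) w' & v = Y a (-1) w'])
    \/ E k v.
have Pw k v : P k v -> weight_space W k v.
  move=> [[d [a [w' [d0 ha hw ->]]]]|/EW//].
  have := mode_weight (-1) ha hw; rewrite opprK addrK.
  by rewrite -[d%:~R]/(d%:R : C) subrK.
have : lspan (P l) w.
  apply: (@weight_span _ _ _ (vir_linear W 0) P l w Pw lw).
  apply: (lspan_sub (lspan_subspace _) _ (B1E w)) => v [[d [a [w' [d0 ha ->]]]]|[k Ek]].
    move: w'; apply: (lspan_setT (vm_grading W)).
      by apply: (preim_subspace (moder a (-1))); exact: lspan_subspace.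
    move=> w' [k _ kw']; apply: sub_lspan; exists (k + d%:R); left.
    by exists d, a, w'; split=> //; rewrite addrK.
  by apply: sub_lspan; exists k; right.
apply: (lspan_sub (wfilt_subspace _)) => v [[d [a [w' [d0 ha hw ->]]]]|Ev]; last first.
  by apply: sub_lspan; exact: word_base Ev ml.
have ml' : lower (m%:Z - d%:Z) (l - d%:R).
  have -> : l - d%:R = l + (- d%:Z)%:~R by rewrite rmorphN.
  exact: lowerD.
have [dm|dm] := leqP d m; last first.
  rewrite (lower_neg ml' _ hw) ?(linear_0 (moder a (-1))); last by lia.
  exact: subspace0 (wfilt_subspace _).
have -> : Posz m = (m - d)%N%:Z + d%:Z by lia.
apply: wfilt_neg ha _ _ => //; apply: (IH (m - d)%N _ (l - d%:R)) => //; first by lia.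
by have -> : Posz (m - d) = m%:Z - d%:Z by lia.
Qed.

(** Nonnegative modes gain one degree. On a base vector the weight grows by d - n - 1 only, so
    [lower_wfilt] applies; past a letter the commutator consists of modes of a(i)b, whose weight is
    at most one less than the sum of the weights. *)
Lemma wfilt_nneg s u : wfilt s u -> forall d a (n : int), homogeneous V d a -> 0 <= n ->
  wfilt (s + d%:Z - 1) (Y a n u).
Proof.
move=> us d a n ha n0; move: u us.
apply: (lspan_image (moder a n)); first exact: wfilt_subspace.
move=> u us; elim: us d a n ha n0 => {s u} [s l e Ee sl|s d' b n' u hb d'0 us IH|s s'
  u ss us IH] d a n ha n0.
- have := mode_weight n ha (EW Ee) => h.
  have ll := @lowerD s l (d%:Z - n - 1) sl.
  by apply: wfilt_mono (lower_wfilt h ll); lia.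
- set N := - n'.+1%:Z; rewrite -[Y a n _](subrK (Y b N (Y a n u))).
  have ug : wfilt s u by exact: sub_lspan.
  apply: (subspaceD (wfilt_subspace _)).
    apply: comm_mem; first exact: wfilt_subspace.
    move=> i; have [->|[e eE hc]] := homogeneous_mode i ha hb.
      rewrite (linear_0 (model _ u)); exact: subspace0 (wfilt_subspace _).
    have [m0|m0] := ltP (n + N - i%:Z) 0.
      by apply: wfilt_mono (wfilt_neg hc m0 ug); lia.
    by apply: wfilt_mono (IH _ _ _ hc m0); lia.
  apply: (@wfilt_mono (s + d%:Z - 1 + d'%:Z)); first by lia.
  by apply: wfilt_neg hb _ (IH _ _ _ ha n0); rewrite /N; lia.
- by apply: wfilt_mono (IH _ _ _ ha n0); lia.
Qed.

Lemma wfilt_mode s u d a (n : int) : wfilt s u -> homogeneous V d a ->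
  wfilt (s + d%:Z) (Y a n u).
Proof.
move=> us ha; have [n0|n0] := ltP n 0; first exact: wfilt_neg.
by apply: wfilt_mono (wfilt_nneg us ha n0); lia.
Qed.

(** The commutator is made of modes of a(i)b with i >= 0, of weight d + d' - i - 1. Thus the
    associated graded action is commutative. *)
Lemma wfilt_comm s u d a d' b (p q : int) : wfilt s u -> homogeneous V d a ->
  homogeneous V d' b ->
  wfilt (s + d%:Z + d'%:Z - 1) (Y a p (Y b q u) - Y b q (Y a p u)).
Proof.
move=> us ha hb; apply: comm_mem; first exact: wfilt_subspace.
move=> i; have [->|[e eE hc]] := homogeneous_mode i ha hb.
  rewrite (linear_0 (model _ u)); exact: subspace0 (wfilt_subspace _).
by apply: wfilt_mono (wfilt_mode _ us hc); lia.
Qed.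

(** All other terms of the expansion contain a nonnegative mode, which costs one degree by
    [wfilt_nneg]. *)
Lemma wfilt_iter1 s u d a d' b n : wfilt s u -> homogeneous V d a ->
  homogeneous V d' b ->
  wfilt (s + d%:Z + d'%:Z - 1) (Y (YV a (-1) b) (- n.+1%:Z) u -
    \sum_(i < n.+1) Y a (- i.+1%:Z) (Y b (- (n.+1 - i)%N%:Z) u)).
Proof.
move=> us ha hb; have GP := wfilt_subspace (s + d%:Z + d'%:Z - 1).
have [N NP] := borcherds_iter a b (-1) (- n.+1%:Z) u.
rewrite (NP (n.+1 + N)%N) ?leq_addl // big_split_ord /= [X in wfilt _ X]addrAC -sumrB.
apply: (subspaceD GP); apply: (@subspace_sum _ _ _ _ _ _ _ GP) => i _.
  rewrite gbinomN1 scale1r; have -> : -1 - i%:Z = - i.+1%:Z by lia.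
  have -> : - n.+1%:Z + i%:Z = - (n.+1 - i)%N%:Z by have := ltn_ord i; lia.
  rewrite [X in wfilt _ X]addrAC subrr add0r; apply: (subspaceN GP); apply:
    (subspaceZ _ GP).
  apply: wfilt_mono (wfilt_mode _ (wfilt_nneg us ha _) hb); first by lia.
  by [].
rewrite gbinomN1 scale1r; apply: (subspaceB GP); last first.
  apply: (subspaceZ _ GP); apply: wfilt_mono (wfilt_mode _ (wfilt_nneg us ha _) hb);
    first by lia.
  by [].
by apply: wfilt_mono (wfilt_mode _ (wfilt_nneg us hb _) ha); rewrite /=; lia.
Qed.

(** a(-2)b has weight d + d' + 1, yet its modes raise the degree by d + d' only. This saving of one
    is how C_2-finiteness enters the filtration. *)
Lemma wfilt_iter2 s u d a d' b (q : int) : wfilt s u -> homogeneous V d a ->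
  homogeneous V d' b -> wfilt (s + d%:Z + d'%:Z) (Y (YV a (-2) b) q u).
Proof.
move=> us ha hb; apply: iter_mem; first exact: wfilt_subspace.
  by move=> i; apply: wfilt_mono (wfilt_mode _ (wfilt_mode _ us hb) ha); lia.
by move=> i; apply: wfilt_mono (wfilt_mode _ (wfilt_mode _ us ha) hb); lia.
Qed.

Lemma wfilt_C2 s u d a (q : int) : wfilt s u ->
  lspan [set c | exists d1 d2 x y, [/\ (d1 + d2).+1 = d, homogeneous V d1 x,
    homogeneous V d2 y & c = YV x (-2) y]] a ->
  wfilt (s + d%:Z - 1) (Y a q u).
Proof.
move=> us; move: a; apply: (lspan_image (model q u)); first exact: wfilt_subspace.
move=> _ [d1 [d2 [x [y [dE hx hy ->]]]]].
by apply: wfilt_mono (wfilt_iter2 q us hx hy); lia.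
Qed.

Lemma wfilt_exhaust w : lspan [set u | exists s, wfilt s u] w.
Proof.
apply: (lspan_setT (vm_grading W) (lspan_subspace _)) => u [l _ lu].
have [n0 n0P] := vm_lower W l; apply: sub_lspan; exists n0.
by apply: lower_wfilt lu _ => n n0n; apply: n0P; exact: ltW.
Qed.

End Filtration.

(** * Words in the modes *)

Section Letters.
Variables (R : realType) (V : voa R) (W : voa_module V).
Local Notation C := (Cplx R).
Local Notation YV := (voa_Y V).
Local Notation Y := (mode W).
Variable (E : C -> W -> Prop).
Hypothesis V0 : homogeneous V 0 = [set v : V | exists k : Cplx R, v = k *: vacuum V].
Hypothesis EW : forall l e, E l e -> weight_space W l e.
Hypothesis B1E : forall w : W, lspan ([set u | exists (d : nat) (a : V) (w : W),
    [/\ (0 < d)%N, homogeneous V d a & u = Y a (-1) w]] `|` [set e | exists l, E l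
      e]) w.
Variable D : nat.
Hypothesis C2D : forall d a, (D < d)%N -> homogeneous V d a ->
  lspan [set c | exists d1 d2 x y, [/\ (d1 + d2).+1 = d, homogeneous V d1 x,
    homogeneous V d2 y & c = YV x (-2) y]] a.
Variable H : nat.

Local Notation G := (wfilt E).

Let GP s : subspace (G s). Proof. exact: wfilt_subspace. Qed.

(* ((d, a), n) stands for the operator a(-n) with a in V(d). *)
Definition letter : eqType := (nat * V * nat)%type.
Implicit Types (ls : seq letter).

Definition act (l : letter) (v : W) : W := Y l.1.2 (- l.2%:Z) v.
Definition acts ls (v : W) : W := foldr act v ls.
Definition valid_letter (l : letter) : Prop :=
  [/\ homogeneous V l.1.1 l.1.2, (0 < l.1.1 <= D)%N & (0 < l.2)%N].
Definition valid ls : Prop := forall l, l \in ls -> valid_letter l.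
Definition deg ls : nat := sumn [seq l.1.1 | l <- ls].

Lemma act_linear l : linear (act l). Proof. exact: moder. Qed.

Lemma acts_cat ls ls' v : acts (ls ++ ls') v = acts ls (acts ls' v).
Proof. by rewrite /acts foldr_cat. Qed.

Lemma deg_cat ls ls' : deg (ls ++ ls') = (deg ls + deg ls')%N.
Proof. by rewrite /deg map_cat sumn_cat. Qed.

Lemma deg_perm ls ls' : perm_eq ls ls' -> deg ls = deg ls'.
Proof. by move=> p; apply: perm_sumn; exact: perm_map. Qed.

Lemma valid_cons l ls : valid (l :: ls) -> valid_letter l /\ valid ls.
Proof.
by move=> h; split; [apply: h; rewrite mem_head|move=> k kl; apply: h; rewrite inE kl
  orbT].
Qed.

Lemma valid_cat ls ls' : valid ls -> valid ls' -> valid (ls ++ ls').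
Proof. by move=> h h' l; rewrite mem_cat => /orP[/h|/h']. Qed.

Lemma valid_sub ls ls' : {subset ls <= ls'} -> valid ls' -> valid ls.
Proof. by move=> s h l /s/h. Qed.

Lemma act_wfilt t l v : valid_letter l -> G t v -> G (t + l.1.1%:Z) (act l v).
Proof. by move=> [ha _ _] tv; exact: wfilt_mode. Qed.

Lemma acts_wfilt t ls v : valid ls -> G t v -> G (t + (deg ls)%:Z) (acts ls v).
Proof.
elim: ls => [|l ls IH]; first by rewrite addr0.
move=> /valid_cons[hl hls] tv.
by apply: wfilt_mono (act_wfilt hl (IH hls tv)); rewrite /deg /=; lia.
Qed.

Lemma act_move t l ls v : valid_letter l -> valid ls -> G t v ->
  G (t + l.1.1%:Z + (deg ls)%:Z - 1) (act l (acts ls v) - acts ls (act l v)).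
Proof.
move=> hl; elim: ls => [|k ls IH]; first by rewrite subrr => _ _; exact: subspace0.
move=> /valid_cons[hk hls] tv.
rewrite -[X in G _ X](subrKA (act k (act l (acts ls v)))).
apply: (subspaceD (GP _)).
  have [ha _ _] := hl; have [hb _ _] := hk.
  apply: wfilt_mono (wfilt_comm V0 EW B1E _ _ (acts_wfilt hls tv) ha hb).
  by rewrite /deg /=; lia.
rewrite -(linear_B (act_linear k)).
by apply: wfilt_mono (act_wfilt hk (IH hls tv)); rewrite /deg /=; lia.
Qed.

Lemma acts_perm t ls ls' v : perm_eq ls ls' -> valid ls -> G t v ->
  G (t + (deg ls)%:Z - 1) (acts ls v - acts ls' v).
Proof.
elim: ls ls' => [|l ls IH] ls' pe.
  by move: pe; rewrite perm_sym => /perm_nilP -> _ _; rewrite subrr; exact: subspace0.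
move=> /valid_cons[hl hls] tv.
have ll : l \in ls' by rewrite -(perm_mem pe) mem_head.
case/splitPr: ll pe => s1 s2 pe.
have pe' : perm_eq ls (s1 ++ s2).
  by rewrite -(perm_cons l) (perm_trans pe) // perm_catC /= perm_cons perm_catC.
have vs : valid (s1 ++ s2) by apply: valid_sub hls => k; rewrite (perm_mem pe').
have vs1 : valid s1 by apply: valid_sub vs => k ks; rewrite mem_cat ks.
have vs2 : valid s2 by apply: valid_sub vs => k ks; rewrite mem_cat ks orbT.
rewrite -[X in G _ X](subrKA (act l (acts (s1 ++ s2) v))) /=.
apply: (subspaceD (GP _)).
  rewrite -(linear_B (act_linear l)).
  by apply: wfilt_mono (act_wfilt hl (IH _ pe' hls tv)); rewrite /deg /=; lia.
have dE := deg_perm pe'; rewrite !acts_cat /=.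
apply: wfilt_mono (act_move hl vs1 (acts_wfilt vs2 tv)).
by move: dE; rewrite deg_cat /deg /=; lia.
Qed.

(** What may be discarded in degree s: lower degrees, and vectors that start with a mode of index at
    least H. *)
Definition tail s : set W := lspan (G (s - 1) `|` [set u | exists d a n v,
  [/\ homogeneous V d a, (0 < d <= D)%N, (H <= n)%N, G (s - d%:Z) v & u = Y a (-
    n%:Z) v]]).

Lemma tail_subspace s : subspace (tail s).
Proof. exact: lspan_subspace. Qed.

Lemma wfilt_tail s : G (s - 1) `<=` tail s.
Proof. by move=> u us; apply: sub_lspan; left. Qed.

Lemma tail_act s l u : valid_letter l -> tail s u -> tail (s + l.1.1%:Z) (act l u).
Proof.
move=> hl; move: u; apply: (lspan_image (act_linear l)); first exact: tail_subspace.
move=> u [us|[d [a [n [v [ha dD nH vs ->]]]]]].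
  by apply: wfilt_tail; apply: wfilt_mono (act_wfilt hl us); lia.
have [hb _ _] := hl.
rewrite -[act l _](subrK (Y a (- n%:Z) (act l v))); apply: (subspaceD (tail_subspace
  _)).
  by apply: wfilt_tail; apply: wfilt_mono (wfilt_comm V0 EW B1E _ _ vs hb ha); lia.
apply: sub_lspan; right; exists d, a, n, (act l v); split=> //.
by apply: wfilt_mono (act_wfilt hl vs); lia.
Qed.

Lemma tail_large t ls v : valid ls -> G t v -> has (fun l => H <= l.2)%N ls ->
  tail (t + (deg ls)%:Z) (acts ls v).
Proof.
elim: ls => [//|l ls IH] /valid_cons[hl hls] tv /= /orP[lH|h].
  apply: sub_lspan; right; have [ha d0 _] := hl.
  exists l.1.1, l.1.2, l.2, (acts ls v); split=> //.
  by apply: wfilt_mono (acts_wfilt hls tv); rewrite /deg /=; lia.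
have := tail_act hl (IH hls tv h).
by rewrite /deg /= PoszD -addrA [X in t + X]addrC.
Qed.

Section Expansion.

Fixpoint iterated (x : nat * V) (xs : seq (nat * V)) : V :=
  if xs is y :: ys then YV x.2 (-1) (iterated y ys) else x.2.

Definition wt (xs : seq (nat * V)) : nat := sumn [seq x.1 | x <- xs].

Lemma iterated_homogeneous x xs : (forall y, y \in x :: xs -> homogeneous V y.1 y.2) ->
  homogeneous V (wt (x :: xs)) (iterated x xs).
Proof.
elim: xs x => [|y xs IH] x h; first by rewrite /wt /= addn0; apply: h; rewrite mem_head.
have hx := h x (mem_head _ _).
have hy : homogeneous V (wt (y :: xs)) (iterated y xs).
  by apply: IH => z zs; apply: h; rewrite inE zs orbT.
have [/= ->|[e eE he]] := homogeneous_mode (-1) hx hy.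
  by apply: subspace0; exact: homogeneous_subspace.
have -> : wt [:: x, y & xs] = e by move: eE; rewrite /wt /=; lia.
exact: he.
Qed.

Variable (t : int) (u : W) (j : nat).
Hypothesis tu : G t u.
Hypothesis j0 : (0 < j)%N.

Definition spread (xs : seq (nat * V)) (n : nat) : set W :=
  [set acts (zip xs ns) u | ns in [set ns : seq nat | [/\ size ns = size xs,
    all (leq 1) ns, sumn ns = n & ns <> nseq (size xs) j]]].

(* The product of the a_i(-j) is the only summand of the expansion of
   (a_1(-1)...a_k)(-n) in which all indices are equal to j. *)
Lemma iterated_expand x xs n : (forall y, y \in x :: xs -> homogeneous V y.1 y.2) ->
  lspan (G (t + (wt (x :: xs))%:Z - 1) `|` spread (x :: xs) (n.+1 + size xs)%N)
  (Y (iterated x xs) (- n.+1%:Z) u -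
   (if (n.+1 + size xs == (size xs).+1 * j)%N
    then acts (zip (x :: xs) (nseq (size xs).+1 j)) u else 0)).
Proof.
elim: xs x n => [|y xs IH] x n h.
  rewrite /= addn0 mul1n; case: eqP => [nj|nj].
    by rewrite /act /= -nj subrr; exact: subspace0 (lspan_subspace _).
  rewrite subr0; apply: sub_lspan; right; exists [:: n.+1] => //=.
  by split=> //; [rewrite addn0|case].
have hx := h x (mem_head _ _).
have hys : forall z, z \in y :: xs -> homogeneous V z.1 z.2.
  by move=> z zs; apply: h; rewrite inE zs orbT.
have hy := iterated_homogeneous hys.
set T := lspan _; have TP : subspace T by exact: lspan_subspace.
set b := iterated y xs; set K := (size xs).+1.
set main := acts (zip [:: x, y & xs] (nseq (size (y :: xs)).+1 j)) u.
set cond := (_ == _).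
pose F i := Y x.2 (- i.+1%:Z) (Y b (- (n.+1 - i)%N%:Z) u).
have iter : T (Y (iterated x (y :: xs)) (- n.+1%:Z) u - \sum_(i < n.+1) F i).
  apply: sub_lspan; left.
  apply: wfilt_mono (wfilt_iter1 V0 EW B1E _ tu hx hy).
  by rewrite /wt /=; lia.
(* The exceptional product is assigned to the summand in which x has index j, so that the two sums
   can be compared term by term. *)
have mainE : (if cond then main else 0) =
    \sum_(i < n.+1) (if cond && (i.+1 == j) then main else 0).
  case: ifP => c; last by rewrite big1 // => i _; rewrite c.
  have jn : (j.-1 < n.+1)%N by move/eqP: c; rewrite /=; nia.
  rewrite (bigD1 (Ordinal jn)) //= prednK // eqxx /= big1 ?addr0 // => i ij.
  case: eqP => // /eqP e; move: ij; rewrite -val_eqE /= -eqSS prednK //.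
  by rewrite e.
rewrite mainE -[X in T X](subrKA (\sum_(i < n.+1) F i)) -sumrB.
apply: (subspaceD TP) iter _; apply: (@subspace_sum _ _ _ _ _ _ _ TP) => i _.
have iN : (n.+1 - i)%N = (n - i).+1 by have := ltn_ord i; lia.
have sum_nseq k : sumn (nseq k j) = (k * j)%N by rewrite sumn_nseq mulnC.
have spreadc ns : size ns = K -> all (leq 1) ns ->
    sumn ns = ((n - i).+1 + size xs)%N -> (i.+1 == j) && (ns == nseq K j) = false ->
    T (Y x.2 (- i.+1%:Z) (acts (zip (y :: xs) ns) u)).
  move=> sn an su ne; apply: sub_lspan; right; exists (i.+1 :: ns) => //; split=> //=.
  - by rewrite sn.
  - by rewrite su /=; have := ltn_ord i; lia.
  - by move=> [ij nE]; move: ne; rewrite ij nE !eqxx.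
have := IH y (n - i)%N hys; rewrite -iN; set c' := (_ == _) => hI.
have {}hI : T (Y x.2 (- i.+1%:Z) (Y b (- (n.+1 - i)%N%:Z) u -
   (if c' then acts (zip (y :: xs) (nseq (size xs).+1 j)) u else 0))).
  apply: (lspan_image (moder x.2 _) TP _ hI) => v [vG|[ns [sn an su ne] <-]].
    apply: sub_lspan; left; apply: wfilt_mono (wfilt_mode V0 EW B1E _ vG hx).
    by rewrite /wt /=; lia.
  by apply: spreadc => //; [rewrite -iN|apply/andP => -[_ /eqP]].
move: hI; rewrite (linear_B (moder x.2 _)) => hI.
have [ij|ij] := eqVneq i.+1 j.
  have -> : cond && true = c'.
    have li := ltn_ord i.
    by rewrite andbT /cond /c' /= -ij; apply/idP/idP => /eqP ?; apply/eqP; nia.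
  move: hI; rewrite /F; case: c'; last by rewrite (linear_0 (moder x.2 _)).
  by rewrite /main /= /act /= -ij.
rewrite andbF subr0 /F -[X in T X](subrK (Y x.2 (- i.+1%:Z)
  (if c' then acts (zip (y :: xs) (nseq (size xs).+1 j)) u else 0))).
apply: (subspaceD TP) hI _; case: ifP => c; last first.
  by rewrite (linear_0 (moder x.2 _)); exact: subspace0.
apply: spreadc; rewrite ?size_nseq ?(negPf ij) //.
  by rewrite all_nseq j0 orbT.
by rewrite sum_nseq -iN (eqP c).
Qed.

Lemma sumn_large (ns : seq nat) : all (leq j) ns -> sumn ns = (size ns * j)%N ->
  ns = nseq (size ns) j.
Proof.
elim: ns => [//|n ns IH] /= /andP[jn h]; rewrite mulSn => e.
have le : (size ns * j <= sumn ns)%N.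
  by elim: ns h {IH e} => [//|m ns IH] /= /andP[jm /IH]; rewrite mulSn; lia.
have [nj se] : n = j /\ sumn ns = (size ns * j)%N by lia.
by rewrite nj -IH.
Qed.

(** D + 1 letters of positive weight give an iterated product of weight above D, which lies in C_2,
    so its modes have lower degree. In the expansion the product with all indices j is therefore a
    combination of the others; these have the same index sum, hence an index below j. *)
Lemma equal_indices xs : size xs = D.+1 ->
  (forall x, x \in xs -> homogeneous V x.1 x.2 /\ (0 < x.1)%N) ->
  lspan (G (t + (wt xs)%:Z - 1) `|` [set acts (zip xs ns) u | ns in
    [set ns : seq nat | [/\ size ns = size xs, all (leq 1) ns & has (fun n => n <
      j)%N ns]]])
  (acts (zip xs (nseq (size xs) j)) u).
Proof.
case: xs => [//|x xs] sx h.
have hh y : y \in x :: xs -> homogeneous V y.1 y.2 by move=> /h[].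
set T := lspan _; have TP : subspace T by exact: lspan_subspace.
(* Chosen so that the indices, one for each of the D + 1 letters, add up to (D + 1) j. *)
pose n := (D.+1 * j.-1)%N.
have c : (n.+1 + size xs == (size xs).+1 * j)%N.
  by move: sx => /= -[->]; apply/eqP; rewrite /n -[j in RHS](prednK j0) mulnS; lia.
have := @iterated_expand x xs n hh; rewrite c.
have cG : T (Y (iterated x xs) (- n.+1%:Z) u).
  apply: sub_lspan; left; apply: wfilt_C2 (tu) _ => //.
  apply: C2D (iterated_homogeneous hh); rewrite -sx.
  elim: (x :: xs) h {hh sx c} => [//|y ys IH] h /=.
  have [_ y0] := h y (mem_head _ _).
  have := IH (fun z zs => h z (mem_behead (s := y :: ys) zs)).
  have -> : wt (y :: ys) = (y.1 + wt ys)%N by [].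
  by move: (wt ys) (size ys) y.1 y0 => k m r; lia.
move=> hT; rewrite -[X in T X](subKr (Y (iterated x xs) (- n.+1%:Z) u)).
apply: (subspaceB TP) cG _.
apply: (lspan_sub TP _ hT) => v [vG|[ns [sn an su ne] <-]]; first by apply:
  sub_lspan; left.
apply: sub_lspan; right; exists ns => //; split=> //.
rewrite -[has _ _]negbK -all_predC; apply/negP => al; apply: ne; rewrite -sn.
apply: sumn_large; last by rewrite su (eqP c) sn.
by apply: sub_all al => m /=; rewrite -leqNgt.
Qed.

End Expansion.

(** Uniform in the word, its length, the degree and the vector; taken at j = H it leaves only
    finitely many words to consider. *)
Definition vanishing j L := forall ls t v, valid ls -> G t v ->
  (L <= count (fun l => l.2 < j) ls)%N -> tail (t + (deg ls)%:Z) (acts ls v).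

Lemma zip_letters ls j : all (fun l => l.2 == j) ls ->
  ls = zip [seq l.1 | l <- ls] (nseq (size ls) j).
Proof. by elim: ls => [//|[x n] ls IH] /= /andP[/eqP -> /IH <-]. Qed.

Lemma zip_valid (xs : seq (nat * V)) ns : size ns = size xs -> all (leq 1) ns ->
  (forall x, x \in xs -> homogeneous V x.1 x.2 /\ (0 < x.1 <= D)%N) -> valid (zip xs
    ns).
Proof.
elim: xs ns => [|x xs IH] [|n ns] //= [sn] /andP[n0 an] h l.
rewrite inE => /orP[/eqP -> /=|]; first by have [] := h x (mem_head _ _).
by apply: IH => // y ys; apply: h; rewrite inE ys orbT.
Qed.

Lemma zip_deg (xs : seq (nat * V)) ns : size ns = size xs -> deg (zip xs ns) = wt xs.
Proof.
by elim: xs ns => [|x xs IH] [|n ns] //= [sn]; rewrite /deg /wt /= -/(deg _) IH.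
Qed.

(* Trading D + 1 letters of index j for at least one letter of smaller index. *)
Lemma vanishing_trade j L : (0 < j)%N -> vanishing j L ->
  forall k ls t v, valid ls -> G t v ->
  (L <= count (fun l => l.2 < j) ls + k)%N ->
  (k * D.+1 <= count (fun l => l.2 == j) ls)%N -> tail (t + (deg ls)%:Z) (acts ls v).
Proof.
move=> j0 hL; elim=> [|k IH] ls t v hls tv c1 c2.
  by apply: hL => //; rewrite addn0 in c1.
(* B consists of the D + 1 letters to be traded. They may be moved to the front because permuting
   letters costs only lower terms. *)
pose F := [seq l <- ls | l.2 == j]; pose B := take D.+1 F.
pose rest := drop D.+1 F ++ [seq l <- ls | l.2 != j].
have pe : perm_eq ls (B ++ rest).
  by rewrite perm_sym catA cat_take_drop; apply/permPl/perm_filterC.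
have hBr : valid (B ++ rest) by apply: valid_sub hls => l; rewrite (perm_mem pe).
have hB : valid B by apply: valid_sub hBr => l lB; rewrite mem_cat lB.
have hr : valid rest by apply: valid_sub hBr => l lB; rewrite mem_cat lB orbT.
have sF : size F = count (fun l => l.2 == j) ls by rewrite size_filter.
have sB : size B = D.+1.
  by apply: size_takel; rewrite sF; apply: leq_trans c2; rewrite mulSn leq_addr.
have aB : all (fun l => l.2 == j) B.
  by apply/allP => l /mem_take; rewrite mem_filter => /andP[].
pose xs := [seq l.1 | l <- B].
have sx : size xs = D.+1 by rewrite size_map.
have BE : B = zip xs (nseq (size xs) j) by rewrite size_map; exact: zip_letters.
have hx x : x \in xs -> homogeneous V x.1 x.2 /\ (0 < x.1 <= D)%N.
  by move=> /mapP[l lB ->]; have [] := hB l lB.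
have TP := tail_subspace (t + (deg ls)%:Z).
have -> : acts ls v = (acts ls v - acts (B ++ rest) v) + acts (B ++ rest) v.
  by rewrite subrK.
apply: (subspaceD TP); first by apply: wfilt_tail; exact: acts_perm pe hls tv.
have dE : deg ls = (wt xs + deg rest)%N.
  by rewrite (deg_perm pe) deg_cat {1}BE zip_deg // size_nseq.
have ru := acts_wfilt hr tv.
have := equal_indices ru j0 sx (fun x xx => conj (hx x xx).1 (proj1 (andP (hx x
  xx).2))).
rewrite [acts (B ++ rest) v]acts_cat {1}BE => hT.
apply: (lspan_sub TP _ hT) => w [wG|[ns [sn an hn] <-]].
  by apply: wfilt_tail; apply: wfilt_mono wG; rewrite dE; lia.
rewrite -acts_cat; have hz := zip_valid sn an hx.
have -> : deg ls = deg (zip xs ns ++ rest) by rewrite deg_cat zip_deg.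
have cr : count (fun l => l.2 == j) rest = (count (fun l => l.2 == j) ls - D.+1)%N.
  have cB : count (fun l => l.2 == j) B = size B by apply/eqP; rewrite -all_count.
  by have /= -> := permP pe (fun l => l.2 == j); rewrite count_cat cB sB addKn.
have cr' : count (fun l => l.2 < j)%N rest = count (fun l => l.2 < j)%N ls.
  have cB : count (fun l => l.2 < j)%N B = 0%N.
    apply/eqP; rewrite -leqn0 leqNgt -has_count; apply/hasPn => l /(allP aB)/eqP ->.
    by rewrite ltnn.
  by have /= -> := permP pe (fun l => l.2 < j)%N; rewrite count_cat cB.
have cz : (0 < count (fun l => l.2 < j)%N (zip xs ns))%N.
  rewrite -has_count; have e : [seq l.2 | l <- zip xs ns] = ns by apply: unzip2_zip;
    rewrite sn.
  by move: hn; rewrite -{1}e has_map.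
apply: IH; first exact: valid_cat.
- exact: tv.
- by rewrite count_cat cr'; move: c1 cz; lia.
- by rewrite count_cat cr; move: c2; rewrite mulSn; lia.
Qed.

Lemma vanishing_exists j : exists L, vanishing j L.
Proof.
elim: j => [|j [L hL]].
  by exists 1%N => ls t v _ _; rewrite (eq_count (a2 := pred0)) ?count_pred0 // => l;
    rewrite ltn0.
have [j0|j0] := posnP j.
  exists 1%N => ls t v hls _; rewrite -has_count => /hasP[l /hls[_ _]]; rewrite j0.
  by case: l.2.
(* Either L letters have index below j, or at least L (D + 1) have index j; the latter can be traded
   L times, each time for at least one smaller letter. *)
exists (L + L * D.+1)%N => ls t v hls tv hc.
have cE : count (fun l => l.2 < j.+1)%N ls =
    (count (fun l => l.2 < j)%N ls + count (fun l => l.2 == j) ls)%N.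
  rewrite -count_predUI [X in (_ + X)%N](_ : _ = 0%N) ?addn0.
    by apply: eq_count => l /=; rewrite ltnS leq_eqVlt orbC.
  apply/eqP; rewrite -leqn0 leqNgt -has_count; apply/hasPn => l _ /=.
  by case: ltngtP.
have [Lc|Lc] := leqP L (count (fun l => l.2 < j)%N ls); first exact: hL.
apply: (vanishing_trade j0 hL (k := L)) => //; first by rewrite leq_addl.
by move: hc; rewrite cE; lia.
Qed.

(** A letter of weight above D lies in C_2 and lowers the degree, so modulo lower terms only valid
    letters remain. *)
Lemma word_split s u : word E s u -> lspan (G (s - 1) `|` [set w | exists ls t l e,
  [/\ valid ls, E l e, lower W t l, t + (deg ls)%:Z = s & w = acts ls e]]) u.
Proof.
elim=> {s u} [s l e Ee sl|s d a n u ha d0 us IH|s s' u ss us IH].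
- by apply: sub_lspan; right; exists [::], s, l, e; split=> //; rewrite addr0.
- have [dD|dD] := leqP d D; last first.
    apply: sub_lspan; left.
    by apply: wfilt_C2 (sub_lspan us) (C2D dD ha).
  move: IH; apply: (lspan_image (moder a _) (lspan_subspace _)) => w [wG|].
    apply: sub_lspan; left; apply: wfilt_mono (wfilt_mode V0 EW B1E _ wG ha); lia.
  move=> [ls [t [l [e [hls Ee tl tE ->]]]]]; apply: sub_lspan; right.
  exists (((d, a), n.+1) :: ls), t, l, e; split=> //; last by rewrite -tE /deg /=; lia.
  by move=> k; rewrite inE => /orP[/eqP ->|/hls//]; split; rewrite //= d0 dD.
- have [sE|ne] := eqVneq s s'; first by rewrite -sE.
  by apply: sub_lspan; left; apply: (@wfilt_mono _ _ _ E s); [lia|exact: sub_lspan].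
Qed.

Lemma word_negative s u : word E s u -> s < 0 -> u = 0.
Proof.
elim=> {s u} [s l e Ee sl|s d a n u ha d0 us IH|s s' u ss us IH] s0.
- exact: lower_neg sl s0 (EW Ee).
- by rewrite IH ?(linear_0 (moder a _)) //; lia.
- by apply: IH; lia.
Qed.

Variable es : seq W.
Hypothesis Ees : forall l e, E l e -> e \in es.

(** Induction on the degree. A word with an index at least H, or with L letters of index below H, is
    in the tail. The others have fewer than L letters with bounded weights and indices, and
    linearity in each letter reduces them to spanning vectors of the V(d) with d <= D. *)
Lemma finite_words : exists X : seq W, forall w, lspan ([set u | exists d a n v,
  [/\ homogeneous V d a, (0 < d <= D)%N, (H <= n)%N & u = Y a (- n%:Z) v]] `|` [set`
    X]) w.
Proof.
have [L hL] := vanishing_exists H.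
have /choice[bs bsP] : forall d : nat, exists s : seq V, homogeneous V d `<=` lspan
  [set` s].
  exact: voa_fin_dim.
pose Bs := flatten [seq bs d | d <- iota 1 D].
(* X k contains the words with at most k letters taken from the spanning lists, applied to elements
   of es. *)
pose X := fix X k := if k is k'.+1 then X k' ++
  [seq Y bn.1 (- bn.2%:Z) x | bn <- allpairs pair Bs (iota 0 H), x <- X k'] else es.
have XS k : {subset X k <= X k.+1} by move=> x xk; rewrite /= mem_cat xk.
have XP ls e : valid ls -> all (fun l => l.2 < H)%N ls -> e \in es ->
    lspan [set` X (size ls)] (acts ls e).
  elim: ls => [|l ls IH]; first by move=> _ _ ee; exact: sub_lspan.
  move=> /valid_cons[[ha /andP[d0 dD] _] hls] /= /andP[lH als] ee.
  have aB : lspan [set` Bs] l.1.2.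
    have := bsP _ _ ha; apply: lspan_mono => b /= bb.
    by apply/flattenP; exists (bs l.1.1) => //; apply: map_f; rewrite mem_iota add1n
      ltnS d0.
  apply: (lspan_image (moder l.1.2 _) (lspan_subspace _) _ (IH hls als ee)) => x xX.
  apply: (lspan_image (model _ x) (lspan_subspace _) _ aB) => b bB.
  apply: sub_lspan => /=; rewrite mem_cat; apply/orP; right.
  apply/allpairsPdep; exists (b, l.2), x; split=> //.
  by apply/allpairsP; exists (b, l.2); rewrite mem_iota.
exists (X L) => w.
set T := lspan _; have TP : subspace T by exact: lspan_subspace.
have Xmono k : (k <= L)%N -> lspan [set` X k] `<=` T.
  move=> kL; apply: lspan_mono => x /= xk; right; move: kL xk => /subnK <-.
  by elim: (L - k)%N => [//|m IH] /IH; exact: XS.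
have tailT s : G (s - 1) `<=` T -> tail s `<=` T.
  move=> GT; apply: (lspan_sub TP) => u [/GT//|[d [a [n [v [ha dD nH _ ->]]]]]].
  by apply: sub_lspan; left; exists d, a, n, v.
have GT (n : nat) : G n%:Z `<=` T.
  have step s : G (s - 1) `<=` T -> G s `<=` T.
    move=> GT; apply: (lspan_sub TP) => u /word_split; apply: (lspan_sub TP) => v
      [/GT//|].
    move=> [ls [t [l [e [hls Ee tl tE ->]]]]].
    have et : G t e by apply: sub_lspan; exact: word_base Ee tl.
    have [h|h] := boolP (has (fun l => H <= l.2)%N ls).
      by apply: (tailT s GT); rewrite -tE; exact: tail_large.
    have al : all (fun l => l.2 < H)%N ls.
      by move: h; rewrite -all_predC; apply: sub_all => k /=; rewrite -ltnNge.
    have [sL|sL] := leqP L (size ls).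
      by apply: (tailT s GT); rewrite -tE; apply: hL => //; move: al; rewrite
        all_count => /eqP ->.
    by apply: (Xmono _ (ltnW sL)); apply: XP => //; exact: Ees Ee.
  elim: n => [|n IH]; last by apply: step; rewrite intS addrC addKr.
  apply: step => u; apply: (lspan_sub TP) => v /word_negative -> //.
  exact: subspace0.
apply: (lspan_sub TP _ (wfilt_exhaust V0 EW B1E w)) => u [s us].
have [s0|s0] := leP 0 s; first by apply: (GT (absz s)); have -> : Posz (absz s) = s
  by lia.
by apply: (GT 0%N); apply: wfilt_mono us; lia.
Qed.

End Letters.

(** * Finite codimension *)

Section FiniteSpan.
Variables (K : fieldType) (U : lmodType K).
Implicit Types (S : set U) (s : seq U).

Lemma lspan_finite S (us : seq U) : (forall u, u \in us -> lspan S u) ->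
  exists s, (forall x, x \in s -> S x) /\ forall u, u \in us -> lspan [set` s] u.
Proof.
have one u : lspan S u -> exists s, (forall x, x \in s -> S x) /\ lspan [set` s] u.
  pose M := [set u | exists s, (forall x, x \in s -> S x) /\ lspan [set` s] u].
  apply: (lspan_sub (M := M)).
    split; first by exists [::]; split=> //; exact: subspace0 (lspan_subspace _).
    move=> k v w [s [sS sv]] [t [tS tw]]; exists (s ++ t); split.
      by move=> x; rewrite mem_cat => /orP[/sS|/tS].
    apply: (lspan_subspace _).2; [move: sv|move: tw]; apply: lspan_mono => x /= xs.
      by rewrite mem_cat xs.
    by rewrite mem_cat xs orbT.
  move=> v Sv; exists [:: v]; split=> [x|]; first by rewrite inE => /eqP ->.
  by apply: sub_lspan; rewrite /= inE.
elim: us => [|u us IH] h; first by exists [::].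
have [s [sS su]] := one u (h u (mem_head _ _)).
have [t [tS tu]] := IH (fun v vu => h v (mem_behead (s := u :: us) vu)).
exists (s ++ t); split=> [x|v]; first by rewrite mem_cat => /orP[/sS|/tS].
rewrite inE => /orP[/eqP ->|/tu]; [move: su|]; apply: lspan_mono => x /= xs.
  by rewrite mem_cat xs.
by rewrite mem_cat xs orbT.
Qed.

Lemma quotient_finite S : fin_dim [set: lquot S] ->
  exists s, forall u, lspan (S `|` [set` s]) u.
Proof.
move=> [qs qsP]; exists [seq repr q | q <- qs] => u.
set T := lspan _; have TP : subspace T by exact: lspan_subspace.
have ST v : lspan S v -> T v by apply: lspan_mono => x Sx; left.
pose M := [set q : lquot S | forall u, lclass S u = q -> T u].
have lcl k v w : lclass S (k *: v + w) = k *: lclass S v + lclass S w.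
  exact: lclass_linear.
suff : M (lclass S u) by apply.
apply: (lspan_sub (M := M) _ _ (qsP (lclass S u) Logic.I)).
  split.
    move=> v v0; apply: ST; rewrite -[v]subr0; apply/lclassP; rewrite v0.
    by apply: esym; exact: (linear_0 (@lclass_linear _ _ S)).
  move=> k p q Mp Mq v vE; have [u1 p1] : exists u1, lclass S u1 = p by exists (repr
    p); exact: lclass_repr.
  have [u2 q2] : exists u2, lclass S u2 = q by exists (repr q); exact: lclass_repr.
  rewrite -[v](subrK (k *: u1 + u2)); apply: (subspaceD TP).
    by apply: ST; apply/lclassP; rewrite lcl p1 q2.
  by apply: TP.2; [exact: Mp|exact: Mq].
move=> q /= qq v vq; rewrite -[v](subrK (repr q)); apply: (subspaceD TP).
  by apply: ST; apply/lclassP; rewrite lclass_repr.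
by apply: sub_lspan; right; apply: map_f.
Qed.

End FiniteSpan.

Section VOAFinite.
Variables (R : realType) (V : voa R).
Local Notation C := (Cplx R).
Local Notation YV := (voa_Y V).
Local Notation omega := (conformal V).

Lemma homogeneous_span v : lspan [set a : V | exists d, homogeneous V d a] v.
Proof. exact: (lspan_setT (voa_grading V) (lspan_subspace _) (@sub_lspan _ _ _)). Qed.

(** A finite complement of C_2 can be taken homogeneous, hence of bounded weight D. In weight d > D,
    [weight_span] leaves only the terms x(-2)y of weight exactly d. *)
Lemma C2_large : C2_finite (adjoint V) -> exists D : nat, forall d a, (D < d)%N ->
  homogeneous V d a ->
  lspan [set c | exists d1 d2 x y, [/\ (d1 + d2).+1 = d, homogeneous V d1 x,
    homogeneous V d2 y & c = YV x (-2) y]] a.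
Proof.
move=> /quotient_finite[s0 s0P].
have [s [sh ss]] := lspan_finite (us := s0) (fun u _ => homogeneous_span u).
have [D DP] : exists D, forall x, x \in s -> exists2 d, (d <= D)%N & homogeneous V d x.
  elim: s sh {ss} => [|x s IH] sh; first by exists 0%N.
  have [D DP] := IH (fun y ys => sh y (mem_behead (s := x :: s) ys)).
  have [d hd] := sh x (mem_head _ _); exists (maxn D d) => y.
  rewrite inE => /orP[/eqP ->|/DP[e eD he]]; first by exists d; rewrite ?leq_maxr.
  by exists e; rewrite // (leq_trans eD) ?leq_maxl.
exists D => d a Dd ha.
pose P (k : C) (v : V) := (exists d1 d2 x y, [/\ k = (d1 + d2).+1%:R, homogeneous V
  d1 x,
    homogeneous V d2 y & v = YV x (-2) y]) \/ exists e : nat, [/\ (e <= D)%N, k =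
      e%:R & homogeneous V e v].
have PW k v : P k v -> weight_space (adjoint V) k v.
  move=> [[d1 [d2 [x [y [-> hx hy ->]]]]]|[e [_ -> //]]].
  have := mode_weight (-2) hx hy.
  have -> : d2%:R + (d1%:Z - -2 - 1)%:~R = (d1 + d2).+1%:R :> C.
    rewrite -[d2%:R]/((d2%:Z)%:~R) -rmorphD -[RHS]/(((d1 + d2).+1%:Z)%:~R).
    by congr (_%:~R); lia.
  by [].
have span v : lspan [set v | exists k, P k v] v.
  set T := lspan _; have TP : subspace T by exact: lspan_subspace.
  apply: (lspan_sub TP _ (s0P v)) => u [|us0].
    apply: (lspan_sub TP) => _ [x [y ->]].
    apply: (@lspan_image _ _ _ (fun a => mode (adjoint V) a (-2) y) (model _ _) _ T
      TP _ x (homogeneous_span x)) => b [d1 hb].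
    apply: (@lspan_image _ _ _ (fun c => mode (adjoint V) b (-2) c) (moder _ _) _ T
      TP _ y (homogeneous_span y)) => c [d2 hc].
    by apply: sub_lspan; exists (d1 + d2).+1%:R; left; exists d1, d2, b, c.
  apply: (lspan_sub TP _ (ss u us0)) => x /= xs; have [e eD he] := DP x xs.
  by apply: sub_lspan; exists e%:R; right; exists e.
have := weight_span (vir_linear (adjoint V) 0) PW ha (span a).
apply: lspan_mono => v [[d1 [d2 [x [y [kE hx hy ->]]]]]|[e [eD kE _]]].
  by exists d1, d2, x, y; split=> //; apply/eqP; rewrite -(eqr_nat C) kE.
by move/eqP: kE; rewrite eqr_nat => /eqP de; move: Dd; rewrite de ltnNge eD.
Qed.

(** The order of quantifiers matters: D comes first, so that H can be chosen afterwards from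
    finitely many spanning vectors of weight at most D. *)
Lemma finite_by_weights (W : voa_module V) : C2_finite (adjoint V) ->
  homogeneous V 0 = [set v : V | exists k : C, v = k *: vacuum V] ->
  B1_finite W -> exists D : nat, forall H : nat, exists X : seq W, forall w,
  lspan ([set u | exists d a n v, [/\ homogeneous V d a, (0 < d <= D)%N, (H <= n)%N
     & u = mode W a (- n%:Z) v]] `|` [set` X]) w.
Proof.
move=> VC2 V0 /quotient_finite[s0 s0P]; have [D C2D] := C2_large VC2.
have [es [ew esP]] := lspan_finite (us := s0) (fun u _ => lspan_setT (vm_grading W)
  (lspan_subspace _) (@sub_lspan _ _ _) u).
pose E (l : C) (e : W) := e \in es /\ weight_space W l e.
exists D => H; apply: (@finite_words R V W E V0 _ _ D C2D H es).
- by move=> l e [].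
- move=> w; set T := lspan _; have TP : subspace T by exact: lspan_subspace.
  apply: (lspan_sub TP _ (s0P w)) => u [|us0].
    by apply: lspan_mono => v [d [a [w' h]]]; left; exists d, a, w'.
  apply: (lspan_sub TP _ (esP u us0)) => x /= xs; have [l _ lx] := ew x xs.
  by apply: sub_lspan; right; exists l.
- by move=> l e [].
Qed.

Lemma conformal_homogeneous : homogeneous V 2 omega.
Proof.
have vE : YV omega 1 (YV omega (-1) (vacuum V)) - YV omega (-1) (YV omega 1 (vacuum
  V)) =
  2%:~R *: YV omega (-1) (vacuum V) + 0 := voa_virasoro V 0 (-2) (vacuum V).
have e0 : YV omega (-1) 0 = 0 := linear_0 (moder (W := adjoint V) omega (-1)).
move: vE; rewrite (voa_creation V omega 1 isT) e0.
by rewrite voa_creation1 subr0 addr0.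
Qed.

(** * From all vectors to primary vectors and omega *)

Section Closure.
Variables (W : weak_module V) (gen : V -> nat -> Prop).
Local Notation Y := (mode W).

Definition gen_span : set W := lspan [set u | exists a n v, gen a n /\ u = Y a (-
  n%:Z) v].

Let MP : subspace gen_span. Proof. exact: lspan_subspace. Qed.

(** All sufficiently negative modes of c map into the span reached by the available modes [gen]; the
    bound H may depend on c. *)
Definition absorbed (c : V) := exists H : nat, forall n, (H <= n)%N -> forall w,
  gen_span (Y c (- n%:Z) w).

Hypothesis V0 : homogeneous V 0 = [set v : V | exists k : C, v = k *: vacuum V].
Hypothesis gen_primary : forall d a, (0 < d)%N -> homogeneous V d a -> primary V a ->
  exists H : nat, forall n, (H <= n)%N -> gen a n.
Hypothesis gen_conformal : exists H : nat, forall n, (H <= n)%N -> gen omega n.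

Lemma absorbed_subspace : subspace absorbed.
Proof.
split; first by exists 0%N => n _ w; rewrite (linear_0 (model _ w)); exact: subspace0.
move=> k u v [H uH] [H' vH]; exists (maxn H H') => n; rewrite geq_max => /andP[nH
  nH'] w.
by rewrite (model _ w); apply: MP.2; [exact: uH|exact: vH].
Qed.

Lemma absorbed_bounded (f : nat -> V) T : (forall l, absorbed (f l)) ->
  exists H : nat, forall l n, (l < T)%N -> (H <= n)%N -> forall w, gen_span (Y (f l)
    (- n%:Z) w).
Proof.
move=> fa; elim: T => [|T [H HP]]; first by exists 0%N => l n.
have [H' H'P] := fa T; exists (maxn H H') => l n; rewrite ltnS leq_eqVlt geq_max.
by move=> /orP[/eqP ->|lT] /andP[nH nH'] w; [exact: H'P|exact: HP].
Qed.

Local Notation L j := (vir (adjoint V) j).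

(** The modes of omega(r)c are sums of products omega(r - i) c(-n + i) and c(..) omega(i). The
    latter start with a very negative mode of c. In the former omega(r - i) is available for large
    i; for small i it is commuted to the right, which produces modes of c and of the L_j c with j >=
    0, all with very negative index. *)
Lemma absorbed_vir c (r : int) : absorbed c -> (forall j : nat, absorbed (L j%:Z c)) ->
  absorbed (YV omega r c).
Proof.
move=> [Hc HcP] La; have [Hw HwP] := gen_conformal.
have [T TP] := @truncN R V (adjoint V) omega c.
have [HL HLP] := absorbed_bounded T La.
exists (Hc + Hw + HL + (absz r + absz r) + 2)%N => n nH w.
have absM d (k : int) v : (Hc%:Z <= - k) -> c = d -> gen_span (Y d k v).
  move=> kH <-; have kE : k = - (absz k)%:Z by lia.
  by have := HcP (absz k) _ v; rewrite -kE; apply; lia.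
apply: iter_mem => // i; last by apply: absM => //; lia.
have [ir|ir] := leP (Hw%:Z + r) i%:Z.
  have -> : r - i%:Z = - (absz (i%:Z - r)%R)%:Z by lia.
  apply: sub_lspan; exists omega, (absz (i%:Z - r)%R); eexists; split; last by [].
  by apply: HwP; lia.
set q := - n%:Z + i%:Z; rewrite -[X in gen_span X](subrK (Y c q (Y omega (r - i%:Z)
  w))).
apply: (subspaceD MP); last by apply: absM => //; rewrite /q; lia.
apply: comm_mem => // -[|l].
  rewrite mode_translation; apply: (subspaceZ _ MP); apply: absM => //; rewrite /q; lia.
have [lT|lT] := ltnP l.+1 T.
  have -> : YV omega l.+1%:Z c = L l%:Z c by rewrite /vir /= -PoszD addn1.
  have -> : r - i%:Z + q - l.+1%:Z = - (n%:Z - r + l.+1%:Z) by rewrite /q; lia.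
  have -> : n%:Z - r + l.+1%:Z = (absz (n%:Z - r + l.+1%:Z)%R)%:Z by lia.
  by apply: HLP; [exact: ltnW|lia].
have -> : YV omega l.+1%:Z c = 0 by apply: TP; lia.
by rewrite (linear_0 (model _ w)); exact: subspace0.
Qed.

(** The largest set of absorbed vectors stable under all L_j with j >= 0. [absorbed_vir] needs these
    images, so absorption alone would not propagate. *)
Definition strongly_absorbed (c : V) := forall js : seq nat,
  absorbed (foldr (fun j => L j%:Z) c js).

Lemma foldr_vir_linear (js : seq nat) : linear (foldr (fun j => L j%:Z) ^~ js).
Proof.
elim: js => [//|j js IH] k u v; pose g := foldr (fun j => L j%:Z) ^~ js.
have hg : g (k *: u + v) = k *: g u + g v := IH k u v.
by rewrite -[LHS]/(L j%:Z (g (k *: u + v))) hg; exact: (vir_linear (adjoint V) j%:Z k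
  (g u) (g v)).
Qed.

Lemma strongly_absorbed_subspace : subspace strongly_absorbed.
Proof.
split=> [js|k u v hu hv js].
  by rewrite (linear_0 (foldr_vir_linear js)); exact: subspace0 absorbed_subspace.
by rewrite (foldr_vir_linear js); apply: absorbed_subspace.2.
Qed.

Lemma strongly_absorbed_vir c (j : nat) : strongly_absorbed c -> strongly_absorbed (L
  j%:Z c).
Proof. by move=> hc js; have := hc (rcons js j); rewrite foldr_rcons. Qed.

Lemma strongly_absorbed_max (P : set V) : (forall c, P c -> absorbed c) ->
  (forall (j : nat) c, P c -> P (L j%:Z c)) -> forall c, P c -> strongly_absorbed c.
Proof.
move=> Pa PL c Pc js; apply: Pa; elim: js => [//|j js IH] /=; exact: PL.
Qed.

(** The span of strongly absorbed vectors and their images under all L_k is absorbed by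
    [absorbed_vir]. The Virasoro relations move L_j past L_k, so this span is stable under L_j for j
    >= 0 and thus strongly absorbed. *)
Lemma strongly_absorbed_submodule : vir_submodule (adjoint V) strongly_absorbed.
Proof.
split=> [|m c hc]; first exact: strongly_absorbed_subspace.
pose P : set V := lspan [set v | exists k c, strongly_absorbed c /\ v = L k c \/
  strongly_absorbed v].
have PP : subspace P by exact: lspan_subspace.
apply: (@strongly_absorbed_max P); last by apply: sub_lspan; exists m, c; left.
  apply: (lspan_sub absorbed_subspace) => v [k [d [[hd ->]|hv]]]; last exact: hv [::].
  by apply: absorbed_vir (hd [::]) _ => j; have := hd [:: j].
move=> j v; apply: (lspan_image (vir_linear (adjoint V) _) PP) => {}v [k [d [[hd
  ->]|hv]]]; last first.
  by apply: sub_lspan; exists 0, 0; right; exact: strongly_absorbed_vir.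
have := voa_virasoro V j%:Z k d => /= vE.
rewrite -[X in P X](subrK (L k (L j%:Z d))) /vir /= vE.
apply: (subspaceD PP); last first.
  by apply: sub_lspan; exists k, (L j%:Z d); left; split=> //; exact:
    strongly_absorbed_vir.
apply: (subspaceD PP).
  by apply: (subspaceZ _ PP); apply: sub_lspan; exists (j%:Z + k), d; left.
case: ifP => _; last exact: subspace0.
by apply: (subspaceZ _ PP); apply: sub_lspan; exists 0, 0; right.
Qed.

(** It suffices to treat highest weight vectors, as strongly absorbed vectors form a submodule. Such
    a vector is zero, a multiple of the vacuum, or a primary vector of positive weight; each L_j
    with j >= 0 only multiplies it by a scalar. *)
Lemma absorbed_all : sum_of_highest_weight V -> forall c, absorbed c.
Proof.
move=> [F [FH FT]] c; suff : strongly_absorbed c by move=> /(_ [::]).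
move: c; apply: (lspan_setT FT strongly_absorbed_subspace) => v [M FM Mv].
have [w [h [wn w0 ME]]] := FH M FM; rewrite ME in Mv.
apply: Mv; split; first exact: strongly_absorbed_submodule.
move=> _ ->.
have aw : absorbed w.
  have [[d hd]|no] := pselect (exists d : nat, h = d%:R); last first.
    rewrite (weight_neg w0); first exact: subspace0 absorbed_subspace.
    by move=> d; apply/eqP => hd; apply: no; exists d.
  have hw : homogeneous V d w by rewrite /homogeneous /weight_space -hd.
  case: d hw {hd} => [|d] hw.
    move: hw; rewrite V0 => -[k ->]; apply: (subspaceZ _ absorbed_subspace).
    exists 2%N => n n2 v'; rewrite (mode_vacuum (wm_axioms W)).
    by case: eqP => [|_]; [lia|exact: subspace0].
  have pw : primary V w by split; apply: wn.
  have [H HP] := gen_primary (ltn0Sn d) hw pw.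
  by exists H => n nH v'; apply: sub_lspan; exists w, n, v'; split=> //; exact: HP.
apply: (@strongly_absorbed_max [set u | exists k : C, u = k *: w]).
- by move=> _ [k ->]; exact: subspaceZ absorbed_subspace aw.
- move=> [|j] _ [k ->]; rewrite (linear_Z (vir_linear (adjoint V) _)).
    by exists (k * h); rewrite w0 scalerA.
  by exists 0; rewrite wn // scaler0 scale0r.
- by exists 1; rewrite scale1r.
Qed.

End Closure.

Lemma finite_by_generators (W : voa_module V) (gen : V -> nat -> Prop) :
  homogeneous V 0 = [set v : V | exists k : C, v = k *: vacuum V] ->
  C2_finite (adjoint V) -> sum_of_highest_weight V -> B1_finite W ->
  (forall d a, (0 < d)%N -> homogeneous V d a -> primary V a ->
    exists H : nat, forall n, (H <= n)%N -> gen a n) ->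
  (exists H : nat, forall n, (H <= n)%N -> gen omega n) ->
  exists X : seq W, (forall x, x \in X -> exists l, weight_space W l x) /\
    forall w, lspan ([set u | exists a n v, gen a n /\ u = mode W a (- n%:Z) v] `|`
      [set` X]) w.
Proof.
move=> V0 VC2 Vhw WB1 g1 g2; have [D DP] := finite_by_weights VC2 V0 WB1.
have ab c : absorbed W gen c by exact: absorbed_all.
have /choice[bs bsP] : forall d : nat, exists s : seq V, homogeneous V d `<=` lspan
  [set` s].
  exact: voa_fin_dim.
(* A common bound for the finitely many spanning vectors of weight at most D, although absorption
   has no uniform bound. *)
have [H HP] : exists H : nat, forall d, (d <= D)%N -> forall b, b \in bs d -> forall
  n, (H <= n)%N ->
    forall w, @gen_span W gen (mode W b (- n%:Z) w).
  have one (s : seq V) : exists H : nat, forall b, b \in s -> forall n, (H <= n)%N ->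
      forall w, @gen_span W gen (mode W b (- n%:Z) w).
    elim: s => [|b s [H HP]]; first by exists 0%N.
    have [H' H'P] := ab b; exists (maxn H H') => c + n; rewrite inE geq_max.
    by move=> /orP[/eqP ->|cs] /andP[h h'] w; [exact: H'P|exact: HP].
  elim: D {DP} => [|D [H HP]].
    have [H HP] := one (bs 0%N); exists H => d; rewrite leqn0 => /eqP ->; exact: HP.
  have [H' H'P] := one (bs D.+1); exists (maxn H H') => d dD b bb n.
  rewrite geq_max => /andP[h h'] w; move: dD bb; rewrite leq_eqVlt => /orP[/eqP
    ->|dD] bb.
    exact: H'P bb _ h' w.
  exact: HP dD _ bb _ h w.
have [X XP] := DP H.
have [X' [X'w X'P]] := lspan_finite (us := X) (fun u _ => lspan_setT (vm_grading W)
  (lspan_subspace _) (@sub_lspan _ _ _) u).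
exists X'; split=> [x /X'w[l _ lx]|w]; first by exists l.
set T := lspan _; have TP : subspace T by exact: lspan_subspace.
have gT : @gen_span W gen `<=` T by apply: lspan_mono => u; left.
apply: (lspan_sub TP _ (XP w)) => u [[d [a [n [v [ha /andP[d0 dD] nH ->]]]]]|uX].
  apply: (lspan_image (model _ v) TP _ (bsP d a ha)) => b bb; apply: gT; exact: HP bb
    _ nH v.
by move: (X'P u uX); apply: lspan_mono => x xX; right.
Qed.

End VOAFinite.

Lemma fsum_rest (K : fieldType) (U : lmodType K) (T : choiceType) (M : set U) (r :
  seq T)
    (F : T -> U) (k : T) : subspace M -> (forall i, i \notin r -> F i = 0) ->
  (forall i, i != k -> M (F i)) -> M (\sum_(i \in [set: T]) F i - F k).
Proof.
move=> MP Fr MF; pose s := undup (k :: r).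
have su : uniq s by exact: undup_uniq.
have ks : k \in s by rewrite mem_undup mem_head.
rewrite (@fsbigE _ _ _ _ setT s) //; last first.
  by move=> i _; rewrite mem_undup inE negb_or => /andP[_ /Fr].
rewrite (eq_bigl xpredT) => [|i]; last by rewrite in_setT.
rewrite (bigD1_seq k) //= addrAC subrr add0r.
by apply: subspace_sum => // i; exact: MF.
Qed.

(** * Conformal blocks *)

Section DualFinite.
Variables (K : fieldType) (X : Type).

(** Elimination over the test points: a function of M that does not vanish at the first one is split
    off, and the functions vanishing there form a subspace tested by the remaining points. *)
Lemma functions_fin_dim (T : eqType) (e : T -> X) (ts : seq T) (M : set (X -> K^o)) :
  subspace M ->
  (forall phi, M phi -> (forall t, t \in ts -> phi (e t) = 0) -> phi = 0) -> fin_dim M.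
Proof.
elim: ts M => [|t ts IH] M MP h.
  by exists [::] => phi Mphi; rewrite (h phi Mphi) //; exact: subspace0
    (lspan_subspace _).
pose M' : set (X -> K^o) := [set phi | M phi /\ phi (e t) = 0].
have M'P : subspace M'.
  split; first by split; [exact: MP.1|].
  move=> k u v [Mu u0] [Mv v0]; split; first exact: MP.2.
  by rewrite -[LHS]/(k * u (e t) + v (e t)) u0 v0 mulr0 addr0.
have [|s sP] := IH M' M'P.
  by move=> phi [Mphi p0] ht; apply: h => // t'; rewrite inE => /orP[/eqP ->|/ht].
have [[phi0 [M0 p0]]|no] := pselect (exists phi, M phi /\ phi (e t) != 0); last first.
  exists s => phi Mphi; apply: sP; split=> //; apply/eqP/negPn/negP => pt.
  by apply: no; exists phi.
exists (phi0 :: s) => phi Mphi.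
set T' := lspan _; have TP : subspace T' by exact: lspan_subspace.
rewrite -[phi](subrK ((phi (e t) / phi0 (e t)) *: phi0)); apply: (subspaceD TP).
  have M1 : M' (phi - (phi (e t) / phi0 (e t)) *: phi0).
    split; first by apply: (subspaceB MP) => //; exact: subspaceZ.
    by rewrite -[LHS]/(phi (e t) - phi (e t) / phi0 (e t) * phi0 (e t)) mulfVK ?subrr.
  by have := sP _ M1; apply: lspan_mono => x /= xs; rewrite inE xs orbT.
by apply: (subspaceZ _ TP); apply: sub_lspan; rewrite /= mem_head.
Qed.

End DualFinite.

(** * Pure tensors and their slots *)

Section TensorSpan.
Variables (K : fieldType) (I : finType) (W : I -> lmodType K).

Lemma free_mod_sum (X : choiceType) (r : seq X) (F : X -> free_mod K X) x :
  (\sum_(i <- r) F i) x = \sum_(i <- r) F i x.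
Proof. by elim/big_rec2: _ => [//|i y z _ <-]. Qed.

Lemma tensor_span (t : tensor W) : lspan [set u | exists w, u = pure w] t.
Proof.
rewrite -[t]lclass_repr; move: (repr t) => f.
have fA : finite_set [set w | f w != 0] by apply/asboolP; exact: free_coefP.
pose r : seq (vecs W) := finmap.enum_fset (fset_set [set w | f w != 0]).
have -> : f = \sum_(w <- r) (f w : K) *: free_delta w.
  set g := (X in _ = X); apply: val_inj; apply/funext => w; rewrite -[RHS]/(g w) /g.
  rewrite free_mod_sum -[LHS]/(f w).
  have dE w' : ((f w' : K) *: free_delta w') w = f w' * (w == w')%:R by [].
  under eq_bigr do rewrite dE.
  have [fw|fw] := eqVneq (f w) 0.
    rewrite fw big1_seq // => w' _; case: eqP => [<-|_]; last by rewrite mulr0.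
    by rewrite fw mul0r.
  have ru : uniq r by exact: finmap.fset_uniq.
  have wr : w \in r by apply: (etrans (in_fset_set fA w)); exact: mem_set fw.
  rewrite (bigD1_seq w wr ru) /= eqxx mulr1 big1 ?addr0 // => w' ww; by rewrite
    eq_sym (negPf ww) mulr0.
rewrite (linear_big (@lclass_linear _ _ _)); apply: subspace_sum => [|w _]; first
  exact: lspan_subspace.
rewrite (linear_Z (@lclass_linear _ _ _)); apply: (subspaceZ _ (lspan_subspace _)).
by apply: sub_lspan; exists w.
Qed.

Definition slot (w : vecs W) (i : I) (u : W i) : tensor W := pure (dfwith w i u).

Lemma slot_linear w i : linear (@slot w i).
Proof. by move=> k u v; exact: pure_multilinear. Qed.

Lemma slot_self w i : slot w (w i) = pure w.
Proof.
congr pure; apply/functional_extensionality_dep => j; have [->|ij] := eqVneq j i.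
  by rewrite dfwithin.
by rewrite dfwithout // eq_sym.
Qed.

Lemma slot_dfwith w i (u v : W i) : slot (dfwith w i u) v = slot w v.
Proof.
congr pure; apply/functional_extensionality_dep => j; have [->|ij] := eqVneq j i.
  by rewrite !dfwithin.
by rewrite !dfwithout // eq_sym.
Qed.

Lemma pure_zero (w : vecs W) i : w i = 0 -> pure w = 0.
Proof. by move=> wi; rewrite -(slot_self w i) wi (linear_0 (@slot_linear w i)). Qed.

Lemma finite_pure (X : forall i, seq (W i)) : exists s : seq (tensor W),
  forall w : vecs W, (forall i, w i \in X i) -> pure w \in s.
Proof.
exists [seq pure ((fun i => ssval (f i)) : vecs W) | f : {dffun forall i, seq_sub (X
  i)}].
move=> w wX; apply/mapP; exists ([ffun i => SeqSub (wX i)] : {dffun forall i, seq_sub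
  (X i)}).
  by rewrite mem_enum.
by congr pure; apply/functional_extensionality_dep => i; rewrite ffunE.
Qed.

End TensorSpan.

Section Final.
Variables (R : realType) (V : voa R) (N : nat) (S : labeled_surface V N).
Local Notation C := (Cplx R).
Local Notation omega := (conformal V).
Local Notation W := (label_space S).
Local Notation Y i := (mode (label S i)).
Hypothesis V0 : homogeneous V 0 = [set v : V | exists k : C, v = k *: vacuum V].
Hypothesis V_C2 : C2_finite (adjoint V).
Hypothesis V_hw : sum_of_highest_weight V.
Hypothesis W_B1 : forall i : 'I_N, B1_finite (label S i).

(* a(-n) is the leading term at the i-th point of an operator of G(S). *)
Definition leading (i : 'I_N) (a : V) (n : nat) : Prop := exists (d : nat) f,
  [/\ (0 < d)%N /\ (0 < n)%N, homogeneous V d a, GS S (section_op a f),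
    laurent_coef (f (coord S i)) (- n%:Z) != 0 &
    (forall k : int, k < - n%:Z -> laurent_coef (f (coord S i)) k = 0) /\
    (forall j, j != i -> forall k : int, k < 0 -> laurent_coef (f (coord S j)) k = 0)].

Lemma leading_primary i d a : (0 < d)%N -> homogeneous V d a -> primary V a ->
  exists H : nat, forall n, (H <= n)%N -> leading i a n.
Proof.
case: d => [//|e] _ ha pa; have [n0 n0P] := sections_with_pole S i e.
exists (maxn n0 1) => n; rewrite geq_max => /andP[/n0P[f [fs f1 f2 f3]] n1].
exists e.+1, f; split=> //; apply: sub_lspan; left.
by exists e.+1, a, f.
Qed.

Lemma leading_conformal i : exists H : nat, forall n, (H <= n)%N -> leading i omega n.
Proof.
have [n0 n0P] := sections_with_pole S i 1.
exists (maxn n0 1) => n; rewrite geq_max => /andP[/n0P[f [fs f1 f2 f3]] n1].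
exists 2%N, f; split=> //; first exact: conformal_homogeneous.
by apply: sub_lspan; right; exists f.
Qed.

Lemma mode_series_support (i : 'I_N) (a : V) f (w : W i) : exists r : seq int,
  forall k, k \notin r -> laurent_coef (f : C -> C) k *: Y i a k w = 0.
Proof.
have [lo loP] := laurent_coef_lower f.
have [hi hiP] := truncN (W := label S i) a w.
exists [seq lo + j%:Z | j <- iota 0 (absz (hi%:Z - lo))] => k kr.
have [klo|klo] := ltP k lo; first by rewrite loP ?scale0r.
rewrite hiP ?scaler0 // leNgt; apply/negP => khi; move/negP: kr; apply.
by apply/mapP; exists (absz (k - lo)%R); [rewrite mem_iota; lia|lia].
Qed.

(** The sum of the mode series over all points is an element of G(S) applied to a pure tensor. Its
    only term outside the stated ones is the leading one, whose coefficient is nonzero and can be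
    divided out. *)
Lemma leading_reduce (i : 'I_N) (a : V) (n : nat) (w : vecs W) : leading i a n ->
  lspan (GWA S `|` [set u | exists j (k : int), [/\ (j == i) -> - n%:Z < k, (j != i)
    -> 0 <= k
    & u = slot w (Y j a k (w j))]]) (slot w (Y i a (- n%:Z) (w i))).
Proof.
move=> [d [f [_ ha fG c0 [ci cj]]]].
set T := lspan _; have TP : subspace T by exact: lspan_subspace.
pose c j := laurent_coef (f (coord S j)).
pose ser j : W j := mode_series (label S j) a (c j) (w j).
have total : T (\sum_j slot w (ser j)).
  apply: sub_lspan; left; rewrite -[X in GWA S X]/(section_action a f w)
    -section_op_pure.
  by apply: sub_lspan; exists (section_op a f), (pure w).
have slotT j (k : int) : ((j == i) -> - n%:Z < k) -> ((j != i) -> 0 <= k) ->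
    T (slot w (c j k *: Y j a k (w j))).
  move=> h1 h2; rewrite (linear_Z (@slot_linear _ _ _ w j)); apply: (subspaceZ _ TP).
  by apply: sub_lspan; right; exists j, k.
have other j : j != i -> T (slot w (ser j)).
  move=> ji; have [r rP] := @mode_series_support j a (f (coord S j)) (w j).
  pose F k := c j k *: Y j a k (w j).
  have FT k : T (slot w (F k)).
    have [k0|k0] := ltP k 0; last by apply: slotT; rewrite ?(negPf ji).
    rewrite /F /c cj // scale0r (linear_0 (@slot_linear _ _ _ w j)); exact: subspace0.
  have := fsum_rest (k := 0) (preim_subspace (@slot_linear _ _ _ w j) TP) rP (fun k _
    => FT k).
  rewrite /preimage /mkset (linear_B (@slot_linear _ _ _ w j)) => h.
  by rewrite -[X in T X](subrK (slot w (F 0))); apply: (subspaceD TP) h (FT 0).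
have self : T (slot w (ser i) - slot w (c i (- n%:Z) *: Y i a (- n%:Z) (w i))).
  have [r rP] := @mode_series_support i a (f (coord S i)) (w i).
  have FT k : k != - n%:Z -> T (slot w (c i k *: Y i a k (w i))).
    move=> kn; have [k0|k0] := ltP (- n%:Z) k.
      by apply: slotT => //; rewrite eqxx.
    rewrite /c ci; last by rewrite lt_neqAle kn.
    rewrite scale0r (linear_0 (@slot_linear _ _ _ w i)); exact: subspace0.
  have := fsum_rest (preim_subspace (@slot_linear _ _ _ w i) TP) rP FT.
  by rewrite /preimage /mkset (linear_B (@slot_linear _ _ _ w i)).
have : T (slot w (c i (- n%:Z) *: Y i a (- n%:Z) (w i))).
  move: total; rewrite (bigD1 i) //= => total.
  set x := slot w (ser i) in total self; set y := slot w _ in self *.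
  rewrite -[X in T X](subKr x); apply: (subspaceB TP) self.
  rewrite -[X in T X](addrK (\sum_(j < N | j != i) slot w (ser j))).
  apply: (subspaceB TP) total _; exact: (@subspace_sum _ _ _ _ _ _ _ TP).
rewrite (linear_Z (@slot_linear _ _ _ w i)) => h.
by have := subspaceZ (c i (- n%:Z))^-1 TP h; rewrite scalerA mulVf // scale1r.
Qed.

(** The weights l are complex; the induction runs on the sum of the integer heights m. *)
Definition graded (l : 'I_N -> C) (m : 'I_N -> int) (w : vecs W) : Prop := forall i,
  weight_space (label S i) (l i) (w i) /\ lower (label S i) (m i) (l i).

Definition bump_at (j : 'I_N) (k : int) (i : 'I_N) : int := if i == j then k else 0.

Lemma graded_update l m w (j : 'I_N) (k : int) (u : W j) : graded l m w ->
  weight_space (label S j) (l j + k%:~R) u ->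
  graded (fun i => l i + (bump_at j k i)%:~R) (fun i => m i + bump_at j k i) (dfwith
    w j u).
Proof.
move=> g hu i; have [gw gl] := g i; rewrite /bump_at; case: (eqVneq i j) => [ij|ij].
  by subst j; rewrite dfwithin; split=> //; exact: lowerD.
by rewrite dfwithout 1?eq_sym // mulr0z !addr0.
Qed.

Lemma sum_bump (m : 'I_N -> int) j (k : int) : \sum_i (m i + bump_at j k i) = \sum_i
  m i + k.
Proof.
rewrite big_split /=; congr (_ + _); rewrite /bump_at -big_mkcond /=.
by rewrite big_pred1_eq.
Qed.

Lemma graded_exists (w : vecs W) : (forall i, exists l, weight_space (label S i) l (w
  i)) ->
  exists l m, graded l m w.
Proof.
move=> h; have /choice[lm lmP] : forall i, exists lm : C * int,
    weight_space (label S i) lm.1 (w i) /\ lower (label S i) lm.2 lm.1.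
  move=> i; have [l lw] := h i; have [m mP] := vm_lower (label S i) l.
  by exists (l, m); split=> // n mn; apply: mP; exact: ltW.
by exists (fun i => (lm i).1), (fun i => (lm i).2) => i; exact: lmP.
Qed.

Theorem finite_coinvariants : exists s : seq (WA S), forall t, lspan (GWA S `|` [set`
  s]) t.
Proof.
have XE i : exists X : seq (W i), (forall x, x \in X -> exists l, weight_space (label
  S i) l x) /\
    forall w, lspan ([set u | exists a n v, leading i a n /\ u = Y i a (- n%:Z) v]
      `|` [set` X]) w.
  apply: (finite_by_generators V0 V_C2 V_hw (W_B1 i)); first exact: leading_primary.
  exact: leading_conformal.
pose X i := sval (cid (XE i)); have XP i := svalP (cid (XE i)).
have {}XP i : (forall x, x \in X i -> exists l, weight_space (label S i) l x) /\
    forall w, lspan ([set u | exists a n v, leading i a n /\ u = Y i a (- n%:Z) v]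
      `|` [set` X i]) w := XP i.
have [s sP] := finite_pure X; exists s.
set T := lspan _; have TP : subspace T by exact: lspan_subspace.
(* Outer induction on a bound for the total height. If the total is negative, some height is
   negative and that factor is zero. *)
have graded_T (t : nat) : forall l m w, graded l m w -> \sum_i m i < t%:Z -> T (pure w).
  elim: t => [|t IH] l m w g mt.
    have [i mi] : exists i, m i < 0.
      apply: contrapT => /forallNP h; move: mt; rewrite ltNge => /negP; apply.
      by apply: sumr_ge0 => i _; rewrite leNgt; apply/negP => /(h i).
    have [gw gl] := g i; rewrite (@pure_zero _ _ _ w i); first exact: subspace0.
    exact: lower_neg gl mi gw.
  (* Inner induction at fixed total height: the first N - k factors already lie in the finite sets
     X, the last k are arbitrary. *)
  suff slots k : (k <= N)%N -> forall l m w, graded l m w -> \sum_i m i < t.+1%:Z ->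
      (forall i : 'I_N, (i < N - k)%N -> w i \in X i) -> T (pure w).
    by apply: (slots N (leqnn N) l m w g mt) => i; rewrite subnn.
  elim: k => [|k IHk] kN {}l {}m {}w {}g {}mt wX.
    by apply: sub_lspan; right; apply: sP => i; apply: wX; rewrite subn0.
  have jN : (N - k.+1 < N)%N by lia.
  pose j := Ordinal jN; have [gj lj] := g j.
  (* A homogeneous form of the generation of W j: the weight of v is the one for which a(-n) v has
     weight mu, so that the height of v is known. *)
  pose P (mu : C) (u : W j) := (exists a n d v, [/\ leading j a n, homogeneous V d a,
      weight_space (label S j) (mu - (d%:Z + n%:Z - 1)%:~R) v & u = Y j a (- n%:Z)
        v]) \/
    (u \in X j /\ weight_space (label S j) mu u).
  have PW mu u : P mu u -> weight_space (label S j) mu u.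
    move=> [[a [n [d [v [_ ha hv ->]]]]]|[]//].
    have := mode_weight (- n%:Z) ha hv.
    have -> : d%:Z - - n%:Z - 1 = d%:Z + n%:Z - 1 by lia.
    by rewrite subrK.
  have span : lspan [set u | exists mu, P mu u] (w j).
    set T' := lspan _; have TP' : subspace T' by exact: lspan_subspace.
    apply: (lspan_sub TP' _ ((XP j).2 (w j))) => u [[a [n [v [ln ->]]]]|uX]; last first.
      by have [mu hu] := (XP j).1 u uX; apply: sub_lspan; exists mu; right.
    have [d [_ [_ ha _ _ _]]] := ln.
    have lv : lspan (\bigcup_(l in [set: C]) weight_space (label S j) l) v by rewrite
      vm_grading.
    apply: (lspan_image (moder a _) TP' _ lv) => x [mu _ hx].
    apply: sub_lspan; exists (mu + (d%:Z + n%:Z - 1)%:~R); left.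
    by exists a, n, d, x; split=> //; rewrite addrK.
  have := weight_span (vir_linear (label S j) 0) PW gj span.
  rewrite -(slot_self w j); apply: (lspan_image (@slot_linear _ _ _ w j) TP) => u.
  move=> [[a [n [d [v [ln ha hv ->]]]]]|[uX hu]]; last first.
    have hu' : weight_space (label S j) (l j + 0%:~R) u by rewrite mulr0z addr0.
    apply: (IHk _ _ _ _ (graded_update g hu')); [exact: ltnW|by rewrite sum_bump
      addr0|].
    move=> i iN; have [ij|ij] := eqVneq i j; first by subst i; rewrite dfwithin.
    rewrite dfwithout 1?eq_sym //; apply: wX; move: ij; rewrite -val_eqE /=; lia.
  have [d' [_ [[d0 n0] _ _ _ _]]] := ln.
  have hv' : weight_space (label S j) (l j + (- (d%:Z + n%:Z - 1))%:~R) v by rewrite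
    rmorphN.
  have g' := graded_update g hv'.
  have := @leading_reduce j a n (dfwith w j v) ln; rewrite dfwithin slot_dfwith.
  apply: (lspan_sub TP) => x [xG|[i [k' [h1 h2 ->]]]]; first by apply: sub_lspan; left.
  have [gi li] := g' i.
  have hi := mode_weight k' ha gi.
  (* Replacing u by v changes the total height by -(d + n - 1) and a(k') by d - k' - 1, together by
     - n - k'. This is negative: k' > -n at j, and elsewhere k' >= 0 while n > 0. *)
  apply: (IH _ _ _ (graded_update g' hi)); rewrite !sum_bump.
  have [ij|ij] := boolP (i == j); [have := h1 ij|have := h2 ij]; lia.
move=> t; apply: (lspan_sub TP _ (tensor_span t)) => _ [w ->].
(* Arbitrary pure tensors are reduced to homogeneous ones by decomposing one factor at a time. *)
suff slots k : (k <= N)%N -> forall w : vecs W,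
    (forall i : 'I_N, (i < N - k)%N -> exists l, weight_space (label S i) l (w i)) ->
      T (pure w).
  by apply: (slots N (leqnn N)) => i; rewrite subnn.
elim: k => [|k IHk] kN {}w hw.
  have [|l [m g]] := @graded_exists w; first by move=> i; apply: hw; rewrite subn0.
  by apply: (graded_T (absz (\sum_i m i)).+1 l m w g); lia.
have jN : (N - k.+1 < N)%N by lia.
pose j := Ordinal jN; rewrite -(slot_self w j).
have lv : lspan (\bigcup_(l in [set: C]) weight_space (label S j) l) (w j) by rewrite
  vm_grading.
apply: (lspan_image (@slot_linear _ _ _ w j) TP _ lv) => u [l _ hu].
apply: IHk => [|i iN]; first exact: ltnW.
have [ij|ij] := eqVneq i j; first by subst i; rewrite dfwithin; exists l.
rewrite dfwithout 1?eq_sym //; apply: hw; move: ij; rewrite -val_eqE /=; lia.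
Qed.

Lemma conformal_block_finite : fin_dim (conformal_block S).
Proof.
have [s sP] := finite_coinvariants.
apply: (functions_fin_dim (e := lclass (GWA S)) (ts := s)).
  split=> [|k phi psi pl ql] u v w.
    by rewrite -[LHS]/(0 : C^o) -[RHS]/(u *: (0 : C^o) + 0) scaler0 addr0.
  rewrite -[LHS]/(k *: phi (u *: v + w) + psi (u *: v + w)) pl ql.
  rewrite -[RHS]/(u *: (k *: phi v + psi v) + (k *: phi w + psi w)).
  by rewrite !scalerDr !scalerA mulrC addrACA.
move=> phi pl p0; apply/funext => q; rewrite -[q]lclass_repr.
pose M : set (WA S) := [set u | phi (lclass (GWA S) u) = 0].
have MP : subspace M.
  split; first by rewrite /M /mkset (linear_0 (@lclass_linear _ _ (GWA S))) (linear_0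
    pl).
  by move=> k u v hu hv; rewrite /M /mkset lclass_linear pl hu hv scaler0 addr0.
apply: (lspan_sub MP _ (sP (repr q))) => u [uG|us]; last exact: p0.
rewrite /M /mkset; have -> : lclass (GWA S) u = 0; last exact: linear_0 pl.
rewrite -(linear_0 (@lclass_linear _ _ (GWA S))); apply/lclassP; rewrite subr0.
exact: sub_lspan.
Qed.

End Final.
Theorem theorem4p7 (R : realType) (V : voa R) (N : nat)
    (S : labeled_surface V N)
    (V0 : homogeneous V 0 = [set v : V | exists k : Cplx R, v = k *: vacuum V])
    (V_quasi_primary : quasi_primary_generated V)
    (V_C2 : C2_finite (adjoint V))
    (V_highest_weight : sum_of_highest_weight V)
    (S_projective : projective S)
    (W_B1 : forall i : 'I_N, B1_finite (label S i)) :
  fin_dim (conformal_block S).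
Proof. exact: conformal_block_finite. Qed.
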